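(* Let $k\ge0$ be an integer. If $k$ is odd, the space of modes of wavenumber $k$ of the Poincaré dodecahedral space $S^3/I^*$ is $\{0\}$. If $k$ is even, put $\tilde k=\lfloor\frac{k/2}{2}\rfloor+\lfloor\frac{k/2}{3}\rfloor+\lfloor\frac{k/2}{5}\rfloor-\frac k2$ (so $\tilde k\ge-1$). For $i=0,1,\dots,\tilde k$ let $$B_i=I_{12}^{\,5i+\mathrm{mod}(k/2,5)}\;I_{20}^{\,3(\tilde k-i)+\mathrm{mod}(k/2,3)}\;I_{30}^{\,\mathrm{mod}(k/2,2)},$$ a homogeneous polynomial of degree $k$ in $\alpha,\beta$. Then the $(\tilde k+1)(k+1)$ functions consisting of the siblings of $B_0,\dots,B_{\tilde k}$ (restricted to $S^3$) form a basis of the space of modes of wavenumber $k$ of $S^3/I^*$; in particular this space has dimension $(\tilde k+1)(k+1)$ (zero when $\tilde k=-1$).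
   Context: Identify $\mathbb R^4$ with $\mathbb C^2$ via $\alpha=x+iy$, $\beta=z+iw$, $S^3=\{|\alpha|^2+|\beta|^2=1\}$. Wirtinger derivatives $\frac{\partial}{\partial\alpha}=\frac12(\partial_x-i\partial_y)$, $\frac{\partial}{\partial\bar\alpha}=\frac12(\partial_x+i\partial_y)$, similarly for $\beta$ with $(z,w)$. $\mathrm{twist}_-=-\bar\beta\frac{\partial}{\partial\alpha}+\bar\alpha\frac{\partial}{\partial\beta}$. For a polynomial $f$ in $\alpha,\beta$ only, homogeneous of degree $k$, its siblings are $\mathrm{twist}_-^j f$, $j=0,\dots,k$. $\gamma\in SU(2)$ acts on $\mathbb C^2$ by $(\alpha,\beta)^T\mapsto\gamma(\alpha,\beta)^T$ and on functions by $(R_\gamma F)(x)=F(\gamma^{-1}x)$. For a finite subgroup $\Gamma\subset SU(2)$, the space of modes of wavenumber $k$ of $S^3/\Gamma$ is the complex vector space of $\Gamma$-invariant functions $F:S^3\to\mathbb C$ with $\Delta_{S^3}F=-k(k+2)F$. $\mathrm{mod}(m,n)$ is the remainder of $m$ upon division by $n$, $\lfloor\cdot\rfloor$ the floor. $I_{12}=\alpha^{11}\beta+11\alpha^6\beta^6-\alpha\beta^{11}$, $I_{20}=\alpha^{20}-228\alpha^{15}\beta^5+494\alpha^{10}\beta^{10}+228\alpha^5\beta^{15}+\beta^{20}$, $I_{30}=\alpha^{30}+522\alpha^{25}\beta^5-10005\alpha^{20}\beta^{10}-10005\alpha^{10}\beta^{20}-522\alpha^5\beta^{25}+\beta^{30}$.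 A matrix $\begin{pmatrix}a&b\\c&d\end{pmatrix}\in SU(2)$ induces the Möbius map $z\mapsto\frac{az+b}{cz+d}$ of $\mathbb C\cup\{\infty\}$. Let $V_I=\{0,\infty\}\cup\{z:z^{10}+11z^5-1=0\}$ (vertices of a regular icosahedron under stereographic projection), $I$ the order-60 group of such Möbius maps preserving $V_I$, and $I^*\subset SU(2)$ (order 120) the set of matrices inducing elements of $I$. *)

(* Defs.v *)
From Stdlib Require Import Reals ZArith Lia.
From Coquelicot Require Import Coquelicot.

Notation CC := Complex.C.
Local Open Scope R_scope.

Definition R4 : Type := (R * R * R * R)%type.

Definition alpha (p : R4) : CC := let '(x, y, z, w) := p in (x, y).
Definition beta  (p : R4) : CC := let '(x, y, z, w) := p in (z, w).

Definition sqnorm4 (p : R4) : R := let '(x, y, z, w) := p in x*x + y*y + z*z + w*w.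

Definition onS3 (p : R4) : Prop := sqnorm4 p = 1.

Definition coord (i : nat) (p : R4) : R :=
  let '(x, y, z, w) := p in
  match i with 0%nat => x | 1%nat => y | 2%nat => z | _ => w end.
Definition upd (i : nat) (p : R4) (t : R) : R4 :=
  let '(x, y, z, w) := p in
  match i with
  | 0%nat => (t, y, z, w) | 1%nat => (x, t, z, w)
  | 2%nat => (x, y, t, w) | _ => (x, y, z, t) end.

Definition partial (i : nat) (g : R4 -> R) (p : R4) : R :=
  Derive (fun t => g (upd i p t)) (coord i p).
Definition ex_partial (i : nat) (g : R4 -> R) (p : R4) : Prop :=
  ex_derive (fun t => g (upd i p t)) (coord i p).

Definition sub4 (p q : R4) : R4 :=
  let '(x, y, z, w) := p in let '(x', y', z', w') := q in
  (x - x', y - y', z - z', w - w').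
Definition cont4_at (g : R4 -> R) (p : R4) : Prop :=
  forall eps, 0 < eps -> exists delta, 0 < delta /\
    forall q, sqrt (sqnorm4 (sub4 q p)) < delta -> Rabs (g q - g p) < eps.

Definition nonzero4 (p : R4) : Prop := sqnorm4 p <> 0.

Definition C2_away0 (g : R4 -> R) : Prop :=
  forall p, nonzero4 p ->
    cont4_at g p /\
    forall i, (i < 4)%nat ->
      ex_partial i g p /\ cont4_at (partial i g) p /\
      forall j, (j < 4)%nat ->
        ex_partial j (partial i g) p /\ cont4_at (partial j (partial i g)) p.

Definition lap4 (g : R4 -> R) (p : R4) : R :=
  partial 0 (partial 0 g) p + partial 1 (partial 1 g) p +
  partial 2 (partial 2 g) p + partial 3 (partial 3 g) p.

(** Complex-valued functions.  A function on S^3 is represented by a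
    function R4 -> C of which only the values on S^3 matter. *)
Definition cfun := R4 -> CC.

Definition ext (F : cfun) : cfun := fun p =>
  let r := sqrt (sqnorm4 p) in
  let '(x, y, z, w) := p in F (x / r, y / r, z / r, w / r).

(** Laplace-Beltrami operator of S^3 (used at points of S^3):
    Delta_{S^3} F = (Euclidean Laplacian of the 0-homogeneous extension)|S^3 *)
Definition smooth_S3 (F : cfun) : Prop :=
  C2_away0 (fun p => Re (ext F p)) /\ C2_away0 (fun p => Im (ext F p)).
Definition lapS3 (F : cfun) (p : R4) : CC :=
  (lap4 (fun q => Re (ext F q)) p, lap4 (fun q => Im (ext F q)) p).

Definition mat2 : Type := (CC * CC * CC * CC)%type.  (* (a,b,c,d) = [[a,b],[c,d]] *)

Definition in_SU2 (g : mat2) : Prop :=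
  let '(a, b, c, d) := g in
  (a * Cconj a + b * Cconj b = 1 /\ c * Cconj c + d * Cconj d = 1 /\
   a * Cconj c + b * Cconj d = 0 /\ a * d - b * c = 1)%C.

(** inverse of a determinant-one matrix *)
Definition inv2 (g : mat2) : mat2 :=
  let '(a, b, c, d) := g in (d, (- b)%C, (- c)%C, a).

Definition act (g : mat2) (p : R4) : R4 :=
  let '(a, b, c, d) := g in
  let al := (a * alpha p + b * beta p)%C in
  let be := (c * alpha p + d * beta p)%C in
  (Re al, Im al, Re be, Im be).

(** Riemann sphere C u {oo}: None = oo *)
Definition Ceq_dec (u v : CC) : {u = v} + {u <> v}.
Proof.
  destruct u as [u1 u2], v as [v1 v2].
  destruct (Req_dec_T u1 v1) as [e1|n1]; [destruct (Req_dec_T u2 v2) as [e2|n2]|].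
  - left; subst; reflexivity.
  - right; intros H; inversion H; auto.
  - right; intros H; inversion H; auto.
Defined.

Definition mobius (g : mat2) (u : option CC) : option CC :=
  let '(a, b, c, d) := g in
  match u with
  | Some z => if Ceq_dec (c * z + d)%C 0%C then None
              else Some ((a * z + b) / (c * z + d))%C
  | None => if Ceq_dec c 0%C then None else Some (a / c)%C
  end.

Definition in_VI (u : option CC) : Prop :=
  match u with
  | None => True
  | Some z => z = 0%C \/ (z ^ 10 + 11 * z ^ 5 - 1)%C = 0%C
  end.

Definition in_Istar (g : mat2) : Prop :=
  in_SU2 g /\ forall u, in_VI u <-> in_VI (mobius g u).

Definition is_mode (Gamma : mat2 -> Prop) (k : nat) (F : cfun) : Prop :=
  smooth_S3 F /\
  (forall p, onS3 p -> lapS3 F p = (RtoC (- (INR k * (INR k + 2))) * F p)%C) /\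
  (forall g, Gamma g -> forall p, onS3 p -> F (act (inv2 g) p) = F p).

Definition cpartial (i : nat) (G : cfun) (p : R4) : CC :=
  (partial i (fun q => Re (G q)) p, partial i (fun q => Im (G q)) p).
Definition d_alpha (G : cfun) (p : R4) : CC :=
  (/ 2 * (cpartial 0 G p - Ci * cpartial 1 G p))%C.
Definition d_beta (G : cfun) (p : R4) : CC :=
  (/ 2 * (cpartial 2 G p - Ci * cpartial 3 G p))%C.
Definition twist_minus (G : cfun) : cfun := fun p =>
  (- Cconj (beta p) * d_alpha G p + Cconj (alpha p) * d_beta G p)%C.

Definition sibling (f : cfun) (j : nat) : cfun := Nat.iter j twist_minus f.

Definition I12 (a b : CC) : CC := (a ^ 11 * b + 11 * a ^ 6 * b ^ 6 - a * b ^ 11)%C.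
Definition I20 (a b : CC) : CC :=
  (a ^ 20 - 228 * a ^ 15 * b ^ 5 + 494 * a ^ 10 * b ^ 10
   + 228 * a ^ 5 * b ^ 15 + b ^ 20)%C.
Definition I30 (a b : CC) : CC :=
  (a ^ 30 + 522 * a ^ 25 * b ^ 5 - 10005 * a ^ 20 * b ^ 10
   - 10005 * a ^ 10 * b ^ 20 - 522 * a ^ 5 * b ^ 25 + b ^ 30)%C.

Definition ktilde (k : nat) : Z :=
  let h := Z.of_nat (k / 2) in (h / 2 + h / 3 + h / 5 - h)%Z.

Definition Bpoly (k i : nat) : cfun := fun p =>
  let h := (k / 2)%nat in
  (I12 (alpha p) (beta p) ^ (5 * i + h mod 5)
   * I20 (alpha p) (beta p) ^ (3 * Z.to_nat (ktilde k - Z.of_nat i) + h mod 3)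
   * I30 (alpha p) (beta p) ^ (h mod 2))%C.

Fixpoint csum (n : nat) (f : nat -> CC) : CC :=
  match n with O => 0%C | S m => (csum m f + f m)%C end.

(* Main.v *)
(* A mode is the restriction to the sphere of a polynomial: averaging an eigenfunction g against
   cos(nt), sin(nt) along the orbits of a one-parameter group of unit quaternions gives two
   eigenfunctions A, B which rotate into each other with speed n, so at a maximum of A^2 + B^2 the
   inequality n^2 (A^2 + B^2) <= |grad A|^2 + |grad B|^2 <= k (k + 2) (A^2 + B^2) forces them to
   vanish for n > k.  Hence g is a trigonometric polynomial of degree at most k on every great
   circle, and its homogeneous extension is separately polynomial.

   On polynomials the operators twist_- and twist_+ generate sl(2), and
   twist_- twist_+ = r^2 (d_alpha d_alphabar + d_beta d_betabar) - E Ebar - Ebar.  Raising a harmonic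
   polynomial of bidegree (k - j, j) to bidegree (k, 0) therefore exhibits it as the j-th sibling of
   a binary form of degree k, uniquely; since twist_- commutes with SU(2), the form inherits the
   invariance under the group.

   Up to constants I20 is the Hessian of I12 and I30 the Jacobian of I12 and I20, so a group element
   that multiplies I12 by chi multiplies them by chi^2 and chi^3, and I30^2 = 1728 I12^5 + I20^3
   yields chi = 1.  An invariant form of degree 2 h vanishes at the vertex 0 unless 5 divides h, and
   a form vanishing at 0 vanishes at all twelve vertices, hence is divisible by I12.  Subtracting
   a multiple of I20^m I30^e when 5 divides h and dividing by I12, one descends on h; only h = 5
   mod 6 escapes, where one first multiplies by I30. *)

Require Import Defs.
From Stdlib Require Import Reals ZArith ZifyNat Lra Lia Psatz List FinFun.
From Stdlib Require Import Classical ClassicalEpsilon FunctionalExtensionality.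
From Coquelicot Require Import Coquelicot.
Local Open Scope R_scope.

(** * Differential calculus on R^4 *)

(** An eigenfunction is only C^2, so polynomiality has to come out of elementary analysis:
    one-dimensional integrals, compactness of the sphere, the second-derivative test. The cut-off at
    frequency k is sharp because (k + 1)^2 = k (k + 2) + 1. Left multiplication by unit quaternions
    serves twice: its one-parameter groups move all points of S^3 at unit speed along great circles
    and commute with the Laplacian, and any two orthogonal unit vectors lie on a common orbit, so
    lines parallel to an axis project radially into orbits. Frequencies at most k do not yet make
    r^k g polynomial, since r^(k - j) is a polynomial only for k - j even; hence g is split by
    antipodal parity into a part of degree k and one of degree k + 1. The second part vanishes: a
    nonzero component would need 2 k + 3 = 4 b (a + 1), odd against even. Identities between forms
    are tested at the points (n + 3, 1), where I12, I20 and I30 do not vanish. The descent on h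
    loses the class 5 mod 6 because it would end at h = 5, where 5 divides h but there is no basis
    form to subtract; the factor I30 moves this class to 2 mod 6. *)

Definition inbox (d : R) (p q : R4) : Prop :=
  let '(x, y, z, w) := p in let '(x', y', z', w') := q in
  Rabs (x' - x) < d /\ Rabs (y' - y) < d /\ Rabs (z' - z) < d /\ Rabs (w' - w) < d.

(** Boxes instead of Euclidean balls: estimates can be made one coordinate at a time, and boxes are
    the balls of the product uniform spaces. *)
Lemma cont4_at_box (g : R4 -> R) (p : R4) :
  cont4_at g p <->
  forall eps, 0 < eps -> exists d, 0 < d /\ forall q, inbox d p q -> Rabs (g q - g p) < eps.
Proof.
  destruct p as [[[x y] z] w]; split; intros H eps He; destruct (H eps He) as [d [Hd Hq]].
  (* Four squares, each below d^2 / 4, sum to less than d^2. *)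
  - exists (d / 2); split; [lra|].
    intros [[[x' y'] z'] w'] (h1 & h2 & h3 & h4); apply Hq; cbn.
    rewrite <- (sqrt_square d) by lra; apply sqrt_lt_1_alt.
    assert (B : forall u, Rabs u < d / 2 -> 0 <= u * u < d * d / 4).
    { intros u Hu; apply Rabs_def2 in Hu; split; nra. }
    apply B in h1, h2, h3, h4; split; nra.
  - exists d; split; [exact Hd|].
    intros [[[x' y'] z'] w'] h; apply Hq; cbn in h.
    assert (B : forall u v, 0 <= v -> sqrt (u * u + v) < d -> Rabs u < d).
    { intros u v Hv Hs; apply Rle_lt_trans with (2 := Hs).
      rewrite <- (sqrt_Rsqr_abs u); apply sqrt_le_1_alt; unfold Rsqr; lra. }
    pose proof (Rle_0_sqr (x' - x)); pose proof (Rle_0_sqr (y' - y));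
    pose proof (Rle_0_sqr (z' - z)); pose proof (Rle_0_sqr (w' - w)); unfold Rsqr in *.
    cbn; repeat split.
    + apply B with ((y' - y) * (y' - y) + (z' - z) * (z' - z) + (w' - w) * (w' - w)); [lra|].
      replace (_ + _) with ((x' - x) * (x' - x) + (y' - y) * (y' - y) + (z' - z) * (z' - z) + (w' - w) * (w' - w)) by ring; exact h.
    + apply B with ((x' - x) * (x' - x) + (z' - z) * (z' - z) + (w' - w) * (w' - w)); [lra|].
      replace (_ + _) with ((x' - x) * (x' - x) + (y' - y) * (y' - y) + (z' - z) * (z' - z) + (w' - w) * (w' - w)) by ring; exact h.
    + apply B with ((x' - x) * (x' - x) + (y' - y) * (y' - y) + (w' - w) * (w' - w)); [lra|].
      replace (_ + _) with ((x' - x) * (x' - x) + (y' - y) * (y' - y) + (z' - z) * (z' - z) + (w' - w) * (w' - w)) by ring; exact h.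
    + apply B with ((x' - x) * (x' - x) + (y' - y) * (y' - y) + (z' - z) * (z' - z)); [lra|].
      replace (_ + _) with ((x' - x) * (x' - x) + (y' - y) * (y' - y) + (z' - z) * (z' - z) + (w' - w) * (w' - w)) by ring; exact h.
Qed.

Lemma nonzero4_coord (x y z w : R) :
  nonzero4 (x, y, z, w) <-> (x <> 0 \/ y <> 0 \/ z <> 0 \/ w <> 0).
Proof.
  unfold nonzero4; cbn; split.
  - intros H.
    destruct (Req_dec x 0); [|now auto]; destruct (Req_dec y 0); [|now auto];
    destruct (Req_dec z 0); [|now auto]; destruct (Req_dec w 0); [|now auto].
    subst; exfalso; apply H; ring.
  - intros H E.
    pose proof (Rle_0_sqr x); pose proof (Rle_0_sqr y);
    pose proof (Rle_0_sqr z); pose proof (Rle_0_sqr w); unfold Rsqr in *.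
    assert (forall t, t * t = 0 -> t = 0) by (intros t Ht; apply Rmult_integral in Ht; tauto).
    destruct H as [H|[H|[H|H]]]; apply H; apply H4; lra.
Qed.

Lemma nonzero4_open (p : R4) :
  nonzero4 p -> exists d, 0 < d /\ forall q, inbox d p q -> nonzero4 q.
Proof.
  destruct p as [[[x y] z] w]; rewrite nonzero4_coord; intros H.
  assert (B : forall u v, Rabs (v - u) < Rabs u -> v <> 0).
  { intros u v Hv ->; replace (0 - u) with (- u) in Hv by ring; rewrite Rabs_Ropp in Hv; lra. }
  destruct H as [H|[H|[H|H]]];
    (eexists; split; [apply Rabs_pos_lt; exact H|]);
    intros [[[x' y'] z'] w'] (h1 & h2 & h3 & h4); apply nonzero4_coord; eauto 6.
Qed.

(** The regularity that the chain rule consumes. The origin is excluded because 0-homogeneous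
    extensions are singular there. *)
Definition C1_away0 (h : R4 -> R) : Prop :=
  forall p, nonzero4 p -> cont4_at h p /\
    forall i, (i < 4)%nat -> ex_partial i h p /\ cont4_at (partial i h) p.

Lemma C2_C1 (g : R4 -> R) : C2_away0 g -> C1_away0 g.
Proof. intros H p Hp; destruct (H p Hp) as [H1 H2]; split; auto; intros i Hi; now destruct (H2 i Hi) as (? & ? & _). Qed.

Lemma C2_C1_partial (g : R4 -> R) (i : nat) : (i < 4)%nat -> C2_away0 g -> C1_away0 (partial i g).
Proof.
  intros Hi H p Hp; destruct (H p Hp) as [_ H2]; destruct (H2 i Hi) as (_ & Hc & Hj).
  now split.
Qed.

Lemma inbox_between (d x t : R) : Rabs (x - t) < d -> forall u, Rmin t x <= u <= Rmax t x -> Rabs (u - t) < d.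
Proof.
  intros H u Hu; apply Rabs_def2 in H; apply Rabs_def1;
  unfold Rmin, Rmax in Hu; destruct (Rle_dec t x); lra.
Qed.

Lemma ex_partial_is_derive (i : nat) (h : R4 -> R) (p : R4) (t : R) :
  (i < 4)%nat -> ex_partial i h (upd i p t) ->
  is_derive (fun s => h (upd i p s)) t (partial i h (upd i p t)).
Proof.
  destruct p as [[[x y] z] w]; intros Hi H.
  destruct i as [|[|[|[|i]]]]; try lia; apply Derive_correct; exact H.
Qed.

(** Continuous partial derivatives give differentiability: the increment is split along four
    segments parallel to the axes, and on each the mean value theorem produces a partial derivative
    within [eps] of its value at the base point. *)
Lemma C1_differentiable (h : R4 -> R) (x y z w : R) :
  C1_away0 h -> nonzero4 (x, y, z, w) ->
  forall eps, 0 < eps -> exists d, 0 < d /\ forall x' y' z' w', inbox d (x, y, z, w) (x', y', z', w') ->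
  Rabs (h (x', y', z', w') - h (x, y, z, w)
        - ((x' - x) * partial 0 h (x, y, z, w) + (y' - y) * partial 1 h (x, y, z, w)
           + (z' - z) * partial 2 h (x, y, z, w) + (w' - w) * partial 3 h (x, y, z, w)))
  <= eps * (Rabs (x' - x) + Rabs (y' - y) + Rabs (z' - z) + Rabs (w' - w)).
Proof.
  intros H Hp eps He.
  destruct (nonzero4_open _ Hp) as [d0 [Hd0 N]].
  assert (Hb : forall i, (i < 4)%nat -> exists d, 0 < d /\ forall q, inbox d (x, y, z, w) q ->
            Rabs (partial i h q - partial i h (x, y, z, w)) < eps).
  { intros i Hi; destruct (H _ Hp) as [_ H2]; destruct (H2 i Hi) as [_ Hc].
    now apply (proj1 (cont4_at_box _ _) Hc). }
  destruct (Hb 0%nat) as [d1 [Hd1 B1]]; [lia|].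
  destruct (Hb 1%nat) as [d2 [Hd2 B2]]; [lia|].
  destruct (Hb 2%nat) as [d3 [Hd3 B3]]; [lia|].
  destruct (Hb 3%nat) as [d4 [Hd4 B4]]; [lia|].
  set (d := Rmin d0 (Rmin (Rmin d1 d2) (Rmin d3 d4))).
  assert (Hd : 0 < d) by (unfold d; repeat apply Rmin_pos; assumption).
  assert (L : d <= d0 /\ d <= d1 /\ d <= d2 /\ d <= d3 /\ d <= d4).
  { unfold d, Rmin; repeat destruct Rle_dec; lra. }
  exists d; split; [exact Hd|].
  intros x' y' z' w' (h1 & h2 & h3 & h4).
  assert (Z : forall t, Rabs (t - t) < d) by (intros t; rewrite Rminus_diag, Rabs_R0; exact Hd).
  assert (I : forall d' q, d <= d' -> inbox d (x, y, z, w) q -> inbox d' (x, y, z, w) q).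
  { intros d' [[[q1 q2] q3] q4] Hdd (e1 & e2 & e3 & e4); repeat split; lra. }
  assert (M : forall i (q : R4) t t', (i < 4)%nat ->
     (forall u, Rmin t t' <= u <= Rmax t t' -> inbox d (x, y, z, w) (upd i q u)) ->
     (forall q', inbox d (x, y, z, w) q' -> Rabs (partial i h q' - partial i h (x, y, z, w)) < eps) ->
     Rabs (h (upd i q t') - h (upd i q t) - (t' - t) * partial i h (x, y, z, w)) <= eps * Rabs (t' - t)).
  { intros i q t t' Hi Hin Hc.
    destruct (MVT_gen (fun s => h (upd i q s)) t t' (fun s => partial i h (upd i q s))) as [c [Hc1 Hc2]].
    - intros u Hu; apply ex_partial_is_derive; [exact Hi|].
      apply H; [apply N, I; [tauto|]; apply Hin; lra|exact Hi].
    - intros u Hu; apply continuity_pt_filterlim; apply (ex_derive_continuous (fun s => h (upd i q s))).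
      eexists; apply ex_partial_is_derive; [exact Hi|].
      apply H; [apply N, I; [tauto|]; apply Hin; lra|exact Hi].
    - rewrite Hc2.
      replace (partial i h (upd i q c) * (t' - t) - (t' - t) * partial i h (x, y, z, w))
        with ((partial i h (upd i q c) - partial i h (x, y, z, w)) * (t' - t)) by ring.
      rewrite Rabs_mult; apply Rmult_le_compat_r; [apply Rabs_pos|].
      apply Rlt_le, Hc, Hin; exact Hc1. }
  (* The path moves w first and x last, so each segment keeps the coordinates still to be moved at
     their old values. *)
  assert (M0 := M 0%nat (x, y', z', w') x x' ltac:(lia)).
  assert (M1 := M 1%nat (x, y, z', w') y y' ltac:(lia)).
  assert (M2 := M 2%nat (x, y, z, w') z z' ltac:(lia)).
  assert (M3 := M 3%nat (x, y, z, w) w w' ltac:(lia)).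
  cbn [upd] in M0, M1, M2, M3.
  assert (K0 : Rabs (h (x', y', z', w') - h (x, y', z', w') - (x' - x) * partial 0 h (x, y, z, w)) <= eps * Rabs (x' - x)).
  { apply M0; [intros u Hu; repeat split; auto; eapply inbox_between; eauto|]. intros q Hq; apply B1, I; tauto. }
  assert (K1 : Rabs (h (x, y', z', w') - h (x, y, z', w') - (y' - y) * partial 1 h (x, y, z, w)) <= eps * Rabs (y' - y)).
  { apply M1; [intros u Hu; repeat split; auto; eapply inbox_between; eauto|]. intros q Hq; apply B2, I; tauto. }
  assert (K2 : Rabs (h (x, y, z', w') - h (x, y, z, w') - (z' - z) * partial 2 h (x, y, z, w)) <= eps * Rabs (z' - z)).
  { apply M2; [intros u Hu; repeat split; auto; eapply inbox_between; eauto|]. intros q Hq; apply B3, I; tauto. }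
  assert (K3 : Rabs (h (x, y, z, w') - h (x, y, z, w) - (w' - w) * partial 3 h (x, y, z, w)) <= eps * Rabs (w' - w)).
  { apply M3; [intros u Hu; repeat split; auto; eapply inbox_between; eauto|]. intros q Hq; apply B4, I; tauto. }
  clear - K0 K1 K2 K3.
  match goal with |- Rabs ?e <= _ => replace e with
    ((h (x', y', z', w') - h (x, y', z', w') - (x' - x) * partial 0 h (x, y, z, w))
    + ((h (x, y', z', w') - h (x, y, z', w') - (y' - y) * partial 1 h (x, y, z, w))
    + ((h (x, y, z', w') - h (x, y, z, w') - (z' - z) * partial 2 h (x, y, z, w))
    + (h (x, y, z, w') - h (x, y, z, w) - (w' - w) * partial 3 h (x, y, z, w))))) by ring end.
  eapply Rle_trans; [apply Rabs_triang|].
  eapply Rle_trans; [apply Rplus_le_compat; [exact K0|apply Rabs_triang]|].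
  eapply Rle_trans; [apply Rplus_le_compat_l, Rplus_le_compat; [exact K1|apply Rabs_triang]|].
  lra.
Qed.

Lemma is_derive_littleo (r : R -> R) (s : R) :
  r s = 0 ->
  (forall eps, 0 < eps -> exists d, 0 < d /\ forall s', Rabs (s' - s) < d -> Rabs (r s') <= eps * Rabs (s' - s)) ->
  is_derive r s 0.
Proof.
  intros H0 H; apply is_derive_Reals; intros eps He.
  destruct (H (eps / 2)) as [d [Hd B]]; [lra|].
  exists (mkposreal d Hd); intros t Ht Htd; cbn in Htd.
  rewrite H0, !Rminus_0_r; unfold Rdiv; rewrite Rabs_mult, Rabs_inv.
  assert (0 < Rabs t) by (apply Rabs_pos_lt; exact Ht).
  apply Rle_lt_trans with (eps / 2); [|lra].
  apply Rmult_le_reg_r with (Rabs t); [assumption|].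
  rewrite Rmult_assoc, Rinv_l, Rmult_1_r by lra.
  replace t with (s + t - s) at 2 by ring; apply B.
  replace (s + t - s) with t by ring; exact Htd.
Qed.

Lemma is_derive_lipschitz (c : R -> R) (s l : R) :
  is_derive c s l ->
  exists d, 0 < d /\ forall s', Rabs (s' - s) < d -> Rabs (c s' - c s) <= (Rabs l + 1) * Rabs (s' - s).
Proof.
  intros H; apply is_derive_Reals in H; destruct (H 1 Rlt_0_1) as [[d Hd] B]; cbn in B.
  exists d; split; [exact Hd|]; intros s' Hs'.
  destruct (Req_dec s' s) as [->|Hn].
  - rewrite !Rminus_diag, Rabs_R0; lra.
  - specialize (B (s' - s) ltac:(lra) Hs'); replace (s + (s' - s)) with s' in B by ring.
    assert (P : 0 < Rabs (s' - s)) by (apply Rabs_pos_lt; lra).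
    assert (E : Rabs ((c s' - c s) / (s' - s)) <= Rabs l + 1).
    { replace ((c s' - c s) / (s' - s)) with (l + ((c s' - c s) / (s' - s) - l)) by ring.
      eapply Rle_trans; [apply Rabs_triang|lra]. }
    replace (c s' - c s) with ((c s' - c s) / (s' - s) * (s' - s)) by (field; lra).
    rewrite Rabs_mult; apply Rmult_le_compat_r; lra.
Qed.

(** The remainder [r] of the linearisation along the curve is o(t - s): differentiability of [h]
    bounds it by a small multiple of the displacement, and the Lipschitz bounds of the four
    coordinates turn displacement into elapsed time. *)
Lemma is_derive_chain4 (h : R4 -> R) (c0 c1 c2 c3 : R -> R) (s l0 l1 l2 l3 : R) :
  C1_away0 h -> nonzero4 (c0 s, c1 s, c2 s, c3 s) ->
  is_derive c0 s l0 -> is_derive c1 s l1 -> is_derive c2 s l2 -> is_derive c3 s l3 ->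
  is_derive (fun t => h (c0 t, c1 t, c2 t, c3 t)) s
   (l0 * partial 0 h (c0 s, c1 s, c2 s, c3 s) + l1 * partial 1 h (c0 s, c1 s, c2 s, c3 s)
    + l2 * partial 2 h (c0 s, c1 s, c2 s, c3 s) + l3 * partial 3 h (c0 s, c1 s, c2 s, c3 s)).
Proof.
  intros H Hn D0 D1 D2 D3.
  set (p := (c0 s, c1 s, c2 s, c3 s)) in *.
  set (a0 := partial 0 h p); set (a1 := partial 1 h p); set (a2 := partial 2 h p); set (a3 := partial 3 h p).
  set (r := fun t => h (c0 t, c1 t, c2 t, c3 t) - h p
     - ((c0 t - c0 s) * a0 + (c1 t - c1 s) * a1 + (c2 t - c2 s) * a2 + (c3 t - c3 s) * a3)).
  assert (Hr : is_derive r s 0).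
  { apply is_derive_littleo; [unfold r, p; ring|].
    destruct (is_derive_lipschitz _ _ _ D0) as [e0 [He0 L0]].
    destruct (is_derive_lipschitz _ _ _ D1) as [e1 [He1 L1]].
    destruct (is_derive_lipschitz _ _ _ D2) as [e2 [He2 L2]].
    destruct (is_derive_lipschitz _ _ _ D3) as [e3 [He3 L3]].
    (* [K] bounds the l^1 speed of the curve near s, so the tolerance asked of [h] is eps / K. *)
    set (K := (Rabs l0 + 1) + (Rabs l1 + 1) + (Rabs l2 + 1) + (Rabs l3 + 1)).
    assert (Q : forall l, 0 < Rabs l + 1) by (intros l; pose proof (Rabs_pos l); lra).
    assert (HK : 0 < K) by (unfold K; pose proof (Q l0); pose proof (Q l1); pose proof (Q l2); pose proof (Q l3); lra).
    intros eps He.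
    destruct (C1_differentiable h (c0 s) (c1 s) (c2 s) (c3 s) H Hn (eps / K)) as [d [Hd B]].
    { apply Rdiv_lt_0_compat; assumption. }
    set (m := Rmin (Rmin (Rmin e0 e1) (Rmin e2 e3)) (d / K)).
    assert (Hm : 0 < m) by (unfold m; repeat apply Rmin_pos; auto; apply Rdiv_lt_0_compat; auto).
    assert (Hm' : m <= e0 /\ m <= e1 /\ m <= e2 /\ m <= e3 /\ m <= d / K)
      by (unfold m, Rmin; repeat destruct Rle_dec; lra).
    exists m; split; [exact Hm|]; intros t Ht.
    specialize (L0 t ltac:(lra)); specialize (L1 t ltac:(lra));
    specialize (L2 t ltac:(lra)); specialize (L3 t ltac:(lra)).
    assert (S : Rabs (c0 t - c0 s) + Rabs (c1 t - c1 s) + Rabs (c2 t - c2 s) + Rabs (c3 t - c3 s) <= K * Rabs (t - s))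
      by (unfold K; lra).
    assert (T : K * Rabs (t - s) < d).
    { apply Rlt_le_trans with (K * (d / K)); [|right; field; lra].
      apply Rmult_lt_compat_l; lra. }
    pose proof (Rabs_pos (c0 t - c0 s)); pose proof (Rabs_pos (c1 t - c1 s));
    pose proof (Rabs_pos (c2 t - c2 s)); pose proof (Rabs_pos (c3 t - c3 s)).
    eapply Rle_trans; [apply B; cbn; repeat split; lra|].
    apply Rle_trans with (eps / K * (K * Rabs (t - s))).
    - apply Rmult_le_compat_l; [apply Rlt_le, Rdiv_lt_0_compat; assumption|exact S].
    - right; field; lra. }
  assert (E : forall t, r t + (h p + ((c0 t - c0 s) * a0 + (c1 t - c1 s) * a1 + (c2 t - c2 s) * a2 + (c3 t - c3 s) * a3))
            = h (c0 t, c1 t, c2 t, c3 t)) by (intros t; unfold r; ring).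
  eapply is_derive_ext; [exact E|].
  clearbody a0 a1 a2 a3 p r.
  auto_derive; [repeat split; eexists; eassumption|].
  replace (Derive (fun x => r x) s) with 0 by (symmetry; apply is_derive_unique; exact Hr).
  replace (Derive (fun x => c0 x) s) with l0 by (symmetry; apply is_derive_unique; assumption).
  replace (Derive (fun x => c1 x) s) with l1 by (symmetry; apply is_derive_unique; assumption).
  replace (Derive (fun x => c2 x) s) with l2 by (symmetry; apply is_derive_unique; assumption).
  replace (Derive (fun x => c3 x) s) with l3 by (symmetry; apply is_derive_unique; assumption).
  ring.
Qed.

Lemma R4_eq (x y z w x' y' z' w' : R) :
  x = x' -> y = y' -> z = z' -> w = w' -> (x, y, z, w) = (x', y', z', w').
Proof. now intros -> -> -> ->. Qed.

Lemma coord_eta (p : R4) : (coord 0 p, coord 1 p, coord 2 p, coord 3 p) = p.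
Proof. now destruct p as [[[x y] z] w]. Qed.

Lemma is_derive_curve4 (h : R4 -> R) (c : R -> R4) (s l0 l1 l2 l3 : R) :
  C1_away0 h -> nonzero4 (c s) ->
  is_derive (fun t => coord 0 (c t)) s l0 -> is_derive (fun t => coord 1 (c t)) s l1 ->
  is_derive (fun t => coord 2 (c t)) s l2 -> is_derive (fun t => coord 3 (c t)) s l3 ->
  is_derive (fun t => h (c t)) s
   (l0 * partial 0 h (c s) + l1 * partial 1 h (c s) + l2 * partial 2 h (c s) + l3 * partial 3 h (c s)).
Proof.
  intros H Hn D0 D1 D2 D3.
  rewrite <- (coord_eta (c s)) in Hn.
  pose proof (is_derive_chain4 h _ _ _ _ s _ _ _ _ H Hn D0 D1 D2 D3) as D.
  cbv beta in D; rewrite coord_eta in D; eapply is_derive_ext; [|exact D].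
  intros t; cbv beta; now rewrite coord_eta.
Qed.

Lemma choice_fun (A B : Type) (P : A -> B -> Prop) :
  (forall x, exists y, P x y) -> exists f, forall x, P x (f x).
Proof.
  intros H; exists (fun x => proj1_sig (constructive_indefinite_description _ (H x))).
  intros x; apply proj2_sig.
Qed.

(** * Averages over one-parameter groups of rotations *)

(* Left multiplication by the unit quaternion [cos t + sin t (a i + b j + c k)]. *)
Definition rot (a b c t : R) (p : R4) : R4 :=
  let '(x, y, z, w) := p in
  (cos t * x - sin t * (a * y + b * z + c * w),
   cos t * y + sin t * (a * x + b * w - c * z),
   cos t * z + sin t * (b * x + c * y - a * w),
   cos t * w + sin t * (c * x + a * z - b * y)).

(** The matrix of [rot a b c t]: row [j] is the output coordinate, column [i] the input
    coordinate. *)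
Definition rotm (a b c : R) (j i : nat) (t : R) : R :=
  match j, i with
  | 0%nat, 0%nat | 1%nat, 1%nat | 2%nat, 2%nat | 3%nat, 3%nat => cos t
  | 0%nat, 1%nat => - (a * sin t) | 0%nat, 2%nat => - (b * sin t) | 0%nat, 3%nat => - (c * sin t)
  | 1%nat, 0%nat => a * sin t | 1%nat, 2%nat => - (c * sin t) | 1%nat, 3%nat => b * sin t
  | 2%nat, 0%nat => b * sin t | 2%nat, 1%nat => c * sin t | 2%nat, 3%nat => - (a * sin t)
  | 3%nat, 0%nat => c * sin t | 3%nat, 1%nat => - (b * sin t) | 3%nat, 2%nat => a * sin t
  | _, _ => 0
  end.

Lemma rot_sqnorm (a b c t : R) (p : R4) :
  a * a + b * b + c * c = 1 -> sqnorm4 (rot a b c t p) = sqnorm4 p.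
Proof.
  intros Hu; destruct p as [[[x y] z] w]; cbn.
  assert (Hs := sin2_cos2 t); unfold Rsqr in Hs.
  transitivity ((cos t * cos t + sin t * sin t * (a * a + b * b + c * c)) * (x * x + y * y + z * z + w * w)); [ring|].
  rewrite Hu; replace (cos t * cos t + sin t * sin t * 1) with 1 by lra; ring.
Qed.

Lemma rot_nonzero (a b c t : R) (p : R4) :
  a * a + b * b + c * c = 1 -> nonzero4 p -> nonzero4 (rot a b c t p).
Proof. intros Hu Hp; unfold nonzero4; now rewrite rot_sqnorm. Qed.

(** Differentiation under the integral sign asks for continuity of the derivative jointly in the
    moving coordinate and the angle. *)
Lemma continuity_2d_pt_comp4 (h : R4 -> R) (c0 c1 c2 c3 : R -> R -> R) (x y : R) :
  cont4_at h (c0 x y, c1 x y, c2 x y, c3 x y) ->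
  continuity_2d_pt c0 x y -> continuity_2d_pt c1 x y ->
  continuity_2d_pt c2 x y -> continuity_2d_pt c3 x y ->
  continuity_2d_pt (fun u v => h (c0 u v, c1 u v, c2 u v, c3 u v)) x y.
Proof.
  rewrite cont4_at_box; intros H H0 H1 H2 H3 eps.
  destruct (H eps (cond_pos eps)) as [d [Hd B]].
  specialize (H0 (mkposreal d Hd)); specialize (H1 (mkposreal d Hd));
  specialize (H2 (mkposreal d Hd)); specialize (H3 (mkposreal d Hd)).
  generalize (locally_2d_and _ _ _ _ (locally_2d_and _ _ _ _ H0 H1) (locally_2d_and _ _ _ _ H2 H3)).
  apply locally_2d_impl, locally_2d_forall; intros u v [[h0 h1] [h2 h3]]; apply B; cbn; auto.
Qed.

Lemma continuity_2d_pt_snd (f : R -> R) (x y : R) :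
  continuous f y -> continuity_2d_pt (fun _ v => f v) x y.
Proof.
  intros H; apply (continuity_1d_2d_pt_comp f (fun _ v => v)).
  - now apply continuity_pt_filterlim.
  - apply continuity_2d_pt_id2.
Qed.

Ltac cont2 :=
  lazymatch goal with
  | |- continuity_2d_pt (fun u v => @?f u v + @?g u v) _ _ => apply (continuity_2d_pt_plus f g); cont2
  | |- continuity_2d_pt (fun u v => @?f u v - @?g u v) _ _ => apply (continuity_2d_pt_minus f g); cont2
  | |- continuity_2d_pt (fun u v => @?f u v * @?g u v) _ _ => apply (continuity_2d_pt_mult f g); cont2
  | |- continuity_2d_pt (fun u v => cos v) _ _ => apply continuity_2d_pt_snd, continuous_cos
  | |- continuity_2d_pt (fun u v => sin v) _ _ => apply continuity_2d_pt_snd, continuous_sin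
  | |- continuity_2d_pt (fun u v => u) _ _ => apply continuity_2d_pt_id1
  | |- _ => apply continuity_2d_pt_const
  end.

Lemma continuity_2d_pt_rot (h : R4 -> R) (a b c : R) (i : nat) (p : R4) (u t : R) :
  cont4_at h (rot a b c t (upd i p u)) ->
  continuity_2d_pt (fun u t => h (rot a b c t (upd i p u))) u t.
Proof.
  intros H.
  apply continuity_2d_pt_ext with (fun u t => h (coord 0 (rot a b c t (upd i p u)),
    coord 1 (rot a b c t (upd i p u)), coord 2 (rot a b c t (upd i p u)), coord 3 (rot a b c t (upd i p u)))).
  { intros u' t'; now rewrite coord_eta. }
  apply (continuity_2d_pt_comp4 h (fun u t => coord 0 (rot a b c t (upd i p u)))
    (fun u t => coord 1 (rot a b c t (upd i p u))) (fun u t => coord 2 (rot a b c t (upd i p u)))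
    (fun u t => coord 3 (rot a b c t (upd i p u)))).
  { now rewrite coord_eta. }
  all: clear H; destruct p as [[[x y] z] w]; destruct i as [|[|[|i]]]; cbn; cont2.
Qed.

Lemma upd_coord (i : nat) (p : R4) : upd i p (coord i p) = p.
Proof. destruct p as [[[x y] z] w]; now destruct i as [|[|[|i]]]. Qed.
Lemma upd_upd (i : nat) (p : R4) (s t : R) : upd i (upd i p s) t = upd i p t.
Proof. destruct p as [[[x y] z] w]; now destruct i as [|[|[|i]]]. Qed.
Lemma coord_upd (i : nat) (p : R4) (s : R) : coord i (upd i p s) = s.
Proof. destruct p as [[[x y] z] w]; now destruct i as [|[|[|i]]]. Qed.

Lemma upd_nonzero (i : nat) (p : R4) : nonzero4 p ->
  exists d : posreal, forall s, Rabs (s - coord i p) < d -> nonzero4 (upd i p s).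
Proof.
  intros Hp; destruct (nonzero4_open p Hp) as [d [Hd B]]; exists (mkposreal d Hd); cbn; intros s Hs.
  assert (Z : forall t, Rabs (t - t) < d) by (intros t; rewrite Rminus_diag, Rabs_R0; exact Hd).
  apply B; destruct p as [[[x y] z] w]; destruct i as [|[|[|i]]]; cbn in *; auto.
Qed.

Lemma upd_nonzero_locally (i : nat) (p : R4) : nonzero4 p ->
  locally (coord i p) (fun s => nonzero4 (upd i p s)).
Proof. intros Hp; destruct (upd_nonzero i p Hp) as [d B]; exists d; intros s Hs; apply B, Hs. Qed.

Ltac asR := match goal with |- @eq _ ?x ?y => change (@eq R x y) end.

Lemma RInt_plus4 (f0 f1 f2 f3 : R -> R) (l r : R) :
  ex_RInt f0 l r -> ex_RInt f1 l r -> ex_RInt f2 l r -> ex_RInt f3 l r ->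
  RInt (fun t => f0 t + f1 t + f2 t + f3 t) l r = RInt f0 l r + RInt f1 l r + RInt f2 l r + RInt f3 l r.
Proof.
  intros H0 H1 H2 H3; apply is_RInt_unique.
  apply (is_RInt_plus (V := R_NormedModule) (fun t => f0 t + f1 t + f2 t) f3);
    [|now apply (RInt_correct (V := R_CompleteNormedModule))].
  apply (is_RInt_plus (V := R_NormedModule) (fun t => f0 t + f1 t) f2); [|now apply (RInt_correct (V := R_CompleteNormedModule))].
  apply (is_RInt_plus (V := R_NormedModule) f0 f1); now apply (RInt_correct (V := R_CompleteNormedModule)).
Qed.

Lemma ex_RInt_plus4 (f0 f1 f2 f3 : R -> R) (l r : R) :
  ex_RInt f0 l r -> ex_RInt f1 l r -> ex_RInt f2 l r -> ex_RInt f3 l r ->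
  ex_RInt (fun t => f0 t + f1 t + f2 t + f3 t) l r.
Proof.
  intros H0 H1 H2 H3.
  apply (ex_RInt_plus (V := R_NormedModule) (fun t => f0 t + f1 t + f2 t) f3); [|exact H3].
  apply (ex_RInt_plus (V := R_NormedModule) (fun t => f0 t + f1 t) f2); [|exact H2].
  now apply (ex_RInt_plus (V := R_NormedModule) f0 f1).
Qed.

Lemma continuous_plus4 (f0 f1 f2 f3 : R -> R) (t : R) :
  continuous f0 t -> continuous f1 t -> continuous f2 t -> continuous f3 t ->
  continuous (fun t => f0 t + f1 t + f2 t + f3 t) t.
Proof.
  intros H0 H1 H2 H3.
  apply (continuous_plus (fun t => f0 t + f1 t + f2 t) f3); [|exact H3].
  apply (continuous_plus (fun t => f0 t + f1 t) f2); [|exact H2].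
  now apply (continuous_plus f0 f1).
Qed.

(** With [w] a cosine or sine this is a Fourier coefficient of [h] along the orbit of [p]. The
    weight is arbitrary because differentiating in [p] multiplies it by matrix entries of the
    rotation, so the family is closed under partial derivatives. *)
Definition Av (a b c : R) (h : R4 -> R) (w : R -> R) (p : R4) : R :=
  RInt (fun t => h (rot a b c t p) * w t) 0 (2 * PI).

Section Average.
Context (a b c : R) (Hu : a * a + b * b + c * c = 1).

Lemma continuous_rot (h : R4 -> R) (p : R4) (t : R) :
  cont4_at h (rot a b c t p) -> continuous (fun t => h (rot a b c t p)) t.
Proof.
  intros H. apply continuity_pt_filterlim; intros eps He.
  pose proof (continuity_2d_pt_rot h a b c 0 p (coord 0 p) t) as C.
  rewrite upd_coord in C; destruct (C H (mkposreal eps He)) as [d B].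
  exists d; split; [apply cond_pos|]; intros s [_ Hs].
  specialize (B (coord 0 p) s); rewrite upd_coord in B; apply B; [|exact Hs].
  rewrite Rminus_diag, Rabs_R0; apply cond_pos.
Qed.

Lemma continuous_Av_integrand (h : R4 -> R) (w : R -> R) (p : R4) (t : R) :
  (forall q, nonzero4 q -> cont4_at h q) -> continuous w t -> nonzero4 p ->
  continuous (fun t => h (rot a b c t p) * w t) t.
Proof.
  intros H Hw Hp; apply (continuous_mult (fun t => h (rot a b c t p)) w); auto.
  apply continuous_rot, H, rot_nonzero; auto.
Qed.

Lemma ex_RInt_Av (h : R4 -> R) (w : R -> R) (p : R4) :
  (forall q, nonzero4 q -> cont4_at h q) -> (forall t, continuous w t) -> nonzero4 p ->
  ex_RInt (fun t => h (rot a b c t p) * w t) 0 (2 * PI).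
Proof.
  intros H Hw Hp; apply (ex_RInt_continuous (V := R_CompleteNormedModule)); intros t _.
  apply continuous_Av_integrand; auto.
Qed.

Lemma is_derive_rot (h : R4 -> R) (i : nat) (p : R4) (t s : R) :
  (i < 4)%nat -> C1_away0 h -> nonzero4 (upd i p s) ->
  is_derive (fun s => h (rot a b c t (upd i p s))) s
    (rotm a b c 0 i t * partial 0 h (rot a b c t (upd i p s))
     + rotm a b c 1 i t * partial 1 h (rot a b c t (upd i p s))
     + rotm a b c 2 i t * partial 2 h (rot a b c t (upd i p s))
     + rotm a b c 3 i t * partial 3 h (rot a b c t (upd i p s))).
Proof.
  intros Hi Hh Hp.
  apply (is_derive_curve4 h (fun s => rot a b c t (upd i p s))); auto;
    try (now apply rot_nonzero);
    destruct p as [[[x y] z] w]; destruct i as [|[|[|[|i]]]]; try lia; cbn; auto_derive; auto; ring.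
Qed.

(** Differentiation under the integral sign; the derivative of [rot] in the i-th coordinate is
    column i of its matrix, absorbed into the weights. *)
Lemma is_derive_Av (h : R4 -> R) (w : R -> R) (i : nat) (p : R4) :
  (i < 4)%nat -> C1_away0 h -> (forall t, continuous w t) -> nonzero4 p ->
  is_derive (fun s => Av a b c h w (upd i p s)) (coord i p)
    (Av a b c (partial 0 h) (fun t => rotm a b c 0 i t * w t) p
     + Av a b c (partial 1 h) (fun t => rotm a b c 1 i t * w t) p
     + Av a b c (partial 2 h) (fun t => rotm a b c 2 i t * w t) p
     + Av a b c (partial 3 h) (fun t => rotm a b c 3 i t * w t) p).
Proof.
  intros Hi Hh Hw Hp.
  set (D := fun u t => (rotm a b c 0 i t * partial 0 h (rot a b c t (upd i p u))
     + rotm a b c 1 i t * partial 1 h (rot a b c t (upd i p u))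
     + rotm a b c 2 i t * partial 2 h (rot a b c t (upd i p u))
     + rotm a b c 3 i t * partial 3 h (rot a b c t (upd i p u))) * w t).
  assert (HD : forall u t, nonzero4 (upd i p u) ->
     is_derive (fun s => h (rot a b c t (upd i p s)) * w t) u (D u t)).
  { intros u t Hn; unfold D.
    pose proof (is_derive_rot h i p t u Hi Hh Hn) as R.
    eapply is_derive_ext; [intros s; apply Rmult_comm|].
    rewrite Rmult_comm; apply (is_derive_scal (fun s => h (rot a b c t (upd i p s)))); exact R. }
  assert (Hrm : forall j t, continuous (rotm a b c j i) t).
  { intros j t; apply (ex_derive_continuous (rotm a b c j i)).
    destruct i as [|[|[|[|i']]]]; [..|lia]; destruct j as [|[|[|[|j']]]]; unfold rotm; auto_derive; auto. }
  assert (Hpc : forall j, (j < 4)%nat -> forall q, nonzero4 q -> cont4_at (partial j h) q).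
  { intros j Hj q Hq; now apply (Hh q Hq). }
  assert (Hwc : forall j t, continuous (fun t => rotm a b c j i t * w t) t).
  { intros j t; apply (continuous_mult (rotm a b c j i) w); auto. }
  pose proof (upd_nonzero_locally i p Hp) as HL.
  unfold Av at 1.
  replace (_ + Av a b c (partial 3 h) _ p)
    with (RInt (fun t => Derive (fun u => h (rot a b c t (upd i p u)) * w t) (coord i p)) 0 (2 * PI)).
  - apply (is_derive_RInt_param (fun u t => h (rot a b c t (upd i p u)) * w t)).
    + eapply filter_imp; [|exact HL]; intros u Hn t _; exists (D u t); now apply HD.
    + intros t _.
      apply continuity_2d_pt_ext_loc with D.
      * destruct (upd_nonzero i p Hp) as [d B]; exists d; intros u v Hu' _.
        symmetry; apply is_derive_unique, HD, B, Hu'.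
      * unfold D; apply continuity_2d_pt_mult; [|now apply continuity_2d_pt_snd].
        repeat apply continuity_2d_pt_plus; apply continuity_2d_pt_mult;
          try (apply continuity_2d_pt_snd, Hrm);
          apply continuity_2d_pt_rot; rewrite upd_coord; apply Hpc; try lia; now apply rot_nonzero.
    + eapply filter_imp; [|exact HL]; intros u Hn; apply ex_RInt_Av; auto.
      intros q Hq; apply (Hh q Hq).
  - unfold Av.
    rewrite <- RInt_plus4; try (apply ex_RInt_Av; auto; apply Hpc; lia).
    apply RInt_ext; intros t _.
    transitivity (D (coord i p) t); [apply is_derive_unique, HD; rewrite upd_coord; exact Hp|].
    unfold D; rewrite upd_coord; asR; ring.
Qed.

(** The integrand is continuous jointly in point and angle; compactness of [0, 2 PI] makes its
    variation in the point uniform in the angle. *)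
Lemma Av_cont (h : R4 -> R) (w : R -> R) (p : R4) :
  (forall q, nonzero4 q -> cont4_at h q) -> (forall t, continuous w t) -> nonzero4 p ->
  cont4_at (Av a b c h w) p.
Proof.
  intros Hh Hw Hp; apply cont4_at_box; intros eps He.
  set (H := fun q t => h (rot a b c t q) * w t).
  (* An error of 2 e in the integrand over an interval of length 2 PI costs eps / 2. *)
  set (e := eps / (8 * PI)).
  assert (HPI := PI_RGT_0).
  assert (He' : 0 < e) by (apply Rdiv_lt_0_compat; lra).
  assert (J : forall t, exists d : posreal, forall q s, inbox d p q -> Rabs (s - t) < d ->
              Rabs (H q s - H p t) < e).
  { intros t.
    assert (Hr := Hh _ (rot_nonzero a b c t p Hu Hp)); rewrite cont4_at_box in Hr.
    set (M := Rabs (h (rot a b c t p)) + 1 + Rabs (w t) + 1).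
    assert (HM : 1 <= M) by (unfold M; pose proof (Rabs_pos (h (rot a b c t p))); pose proof (Rabs_pos (w t)); lra).
    set (e1 := Rmin 1 (e / (2 * M))).
    assert (He1 : 0 < e1) by (apply Rmin_pos; [lra|apply Rdiv_lt_0_compat; lra]).
    destruct (Hr e1 He1) as [d1 [Hd1 B1]].
    assert (Hwt : continuity_pt w t) by (apply continuity_pt_filterlim, Hw).
    destruct (Hwt e1 He1) as [d2 [Hd2 B2]].
    assert (K : exists d3 : posreal, forall q s, inbox d3 p q -> Rabs (s - t) < d3 -> inbox d1 (rot a b c t p) (rot a b c s q)).
    { assert (Hc : continuity_pt cos t) by apply continuity_cos.
      assert (Hs : continuity_pt sin t) by apply continuity_sin.
      destruct p as [[[x y] z] v].
      (* [rot] is bilinear in (cos t, sin t) and the point. [L] bounds the coefficients on both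
         sides, and [e2] is scaled so that every image coordinate moves by less than [d1]. *)
      set (L := (1 + Rabs x + Rabs y + Rabs z + Rabs v) * (1 + Rabs a + Rabs b + Rabs c)).
      assert (HL : 1 <= L) by (unfold L; pose proof (Rabs_pos x); pose proof (Rabs_pos y);
        pose proof (Rabs_pos z); pose proof (Rabs_pos v); pose proof (Rabs_pos a); pose proof (Rabs_pos b);
        pose proof (Rabs_pos c); nra).
      set (e2 := Rmin 1 (d1 / (8 * L))).
      assert (He2 : 0 < e2) by (apply Rmin_pos; [lra|apply Rdiv_lt_0_compat; lra]).
      destruct (Hc e2 He2) as [d4 [Hd4 B4]]; destruct (Hs e2 He2) as [d5 [Hd5 B5]].
      assert (Hd : 0 < Rmin e2 (Rmin d4 d5)) by (apply Rmin_pos; [exact He2|apply Rmin_pos; lra]).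
      exists (mkposreal _ Hd); cbn; intros [[[x' y'] z'] v'] s (h1 & h2 & h3 & h4) h5.
      assert (Q : Rmin e2 (Rmin d4 d5) <= e2 /\ Rmin e2 (Rmin d4 d5) <= d4 /\ Rmin e2 (Rmin d4 d5) <= d5)
        by (unfold Rmin; repeat destruct Rle_dec; lra).
      assert (Ec : Rabs (cos s - cos t) < e2).
      { destruct (Req_dec s t) as [->|Hst]; [rewrite Rminus_diag, Rabs_R0; lra|].
        apply B4; split; [split; [exact I|auto]|]. cbn; unfold Rdist; lra. }
      assert (Es : Rabs (sin s - sin t) < e2).
      { destruct (Req_dec s t) as [->|Hst]; [rewrite Rminus_diag, Rabs_R0; lra|].
        apply B5; split; [split; [exact I|auto]|]. cbn; unfold Rdist; lra. }
      assert (Hce : e2 <= 1 /\ 8 * L * e2 <= d1).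
      { split; [apply Rmin_l|]. apply Rle_trans with (8 * L * (d1 / (8 * L))); [|right; field; lra].
        apply Rmult_le_compat_l; [lra|apply Rmin_r]. }
      assert (P : forall m n m' n' N, Rabs (m' - m) < e2 -> Rabs (n' - n) < e2 -> Rabs m <= 1 -> Rabs n <= N ->
               Rabs (m' * n' - m * n) <= e2 * (N + 2)).
      { intros m n m' n' N U V Hm Hn.
        replace (m' * n' - m * n) with ((m' - m) * n + m * (n' - n) + (m' - m) * (n' - n)) by ring.
        eapply Rle_trans; [apply Rabs_triang|]. eapply Rle_trans; [apply Rplus_le_compat_r, Rabs_triang|].
        rewrite !Rabs_mult.
        pose proof (Rabs_pos (m' - m)); pose proof (Rabs_pos (n' - n)); pose proof (Rabs_pos m); pose proof (Rabs_pos n); nra. }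
      assert (Cb : Rabs (cos t) <= 1) by (apply Rabs_le, COS_bound).
      assert (Sb : Rabs (sin t) <= 1) by (apply Rabs_le, SIN_bound).
      assert (P4 : forall x1 x2 x3 x4 y1 y2 y3 y4 f g k N, Rabs (y1 - x1) < e2 -> Rabs (y2 - x2) < e2 -> Rabs (y3 - x3) < e2 -> Rabs (y4 - x4) < e2 ->
         Rabs x1 <= N -> Rabs x2 <= N -> Rabs x3 <= N -> Rabs x4 <= N ->
         Rabs ((cos s * y1 + sin s * (f * y2 + g * y3 + k * y4)) - (cos t * x1 + sin t * (f * x2 + g * x3 + k * x4)))
         <= e2 * (N + 2) * (1 + Rabs f + Rabs g + Rabs k)).
      { intros x1 x2 x3 x4 y1 y2 y3 y4 f g k N q1 q2 q3 q4 n1 n2 n3 n4.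
        replace (_ - _) with ((cos s * y1 - cos t * x1) + (f * (sin s * y2 - sin t * x2) + (g * (sin s * y3 - sin t * x3) + k * (sin s * y4 - sin t * x4)))) by ring.
        eapply Rle_trans; [apply Rabs_triang|].
        eapply Rle_trans; [apply Rplus_le_compat_l, Rabs_triang|].
        eapply Rle_trans; [apply Rplus_le_compat_l, Rplus_le_compat_l, Rabs_triang|].
        rewrite !Rabs_mult.
        pose proof (P _ _ _ _ N Ec q1 Cb n1) as T1. pose proof (P _ _ _ _ N Es q2 Sb n2) as T2.
        pose proof (P _ _ _ _ N Es q3 Sb n3) as T3. pose proof (P _ _ _ _ N Es q4 Sb n4) as T4.
        apply (Rmult_le_compat_l (Rabs f)) in T2; [|apply Rabs_pos].
        apply (Rmult_le_compat_l (Rabs g)) in T3; [|apply Rabs_pos].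
        apply (Rmult_le_compat_l (Rabs k)) in T4; [|apply Rabs_pos].
        lra. }
      assert (Fin : forall f g k, Rabs f + Rabs g + Rabs k = Rabs a + Rabs b + Rabs c ->
        e2 * ((Rabs x + Rabs y + Rabs z + Rabs v) + 2) * (1 + Rabs f + Rabs g + Rabs k) < d1).
      { intros f g k E. replace (1 + Rabs f + Rabs g + Rabs k) with (1 + Rabs a + Rabs b + Rabs c) by lra.
        apply Rle_lt_trans with (2 * L * e2); [|nra].
        unfold L; pose proof (Rabs_pos x); pose proof (Rabs_pos y);
        pose proof (Rabs_pos z); pose proof (Rabs_pos v); pose proof (Rabs_pos a); pose proof (Rabs_pos b);
        pose proof (Rabs_pos c).
        replace (e2 * (Rabs x + Rabs y + Rabs z + Rabs v + 2) * (1 + Rabs a + Rabs b + Rabs c)) with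
          ((Rabs x + Rabs y + Rabs z + Rabs v + 2) * ((1 + Rabs a + Rabs b + Rabs c) * e2)) by ring.
        replace (2 * ((1 + Rabs x + Rabs y + Rabs z + Rabs v) * (1 + Rabs a + Rabs b + Rabs c)) * e2) with
          ((2 + 2 * (Rabs x + Rabs y + Rabs z + Rabs v)) * ((1 + Rabs a + Rabs b + Rabs c) * e2)) by ring.
        apply Rmult_le_compat_r; [|lra]. apply Rmult_le_pos; lra. }
      set (N := Rabs x + Rabs y + Rabs z + Rabs v) in *.
      assert (NN : Rabs x <= N /\ Rabs y <= N /\ Rabs z <= N /\ Rabs v <= N) by
        (unfold N; pose proof (Rabs_pos x); pose proof (Rabs_pos y);
        pose proof (Rabs_pos z); pose proof (Rabs_pos v); lra).
      destruct NN as (N1 & N2 & N3 & N4).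
      assert (F1 := Fin (-a) (-b) (-c) ltac:(rewrite !Rabs_Ropp; ring)).
      assert (F2 := Fin a b (-c) ltac:(rewrite !Rabs_Ropp; ring)).
      assert (F3 := Fin b c (-a) ltac:(rewrite !Rabs_Ropp; ring)).
      assert (F4 := Fin c a (-b) ltac:(rewrite !Rabs_Ropp; ring)).
      repeat split.
      - eapply Rle_lt_trans; [|exact F1].
        replace (_ - _) with ((cos s * x' + sin s * (- a * y' + - b * z' + - c * v')) - (cos t * x + sin t * (- a * y + - b * z + - c * v))) by ring.
        apply P4; auto; lra.
      - eapply Rle_lt_trans; [|exact F2].
        replace (_ - _) with ((cos s * y' + sin s * (a * x' + b * v' + - c * z')) - (cos t * y + sin t * (a * x + b * v + - c * z))) by ring.
        apply P4; auto; lra.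
      - eapply Rle_lt_trans; [|exact F3].
        replace (_ - _) with ((cos s * z' + sin s * (b * x' + c * y' + - a * v')) - (cos t * z + sin t * (b * x + c * y + - a * v))) by ring.
        apply P4; auto; lra.
      - eapply Rle_lt_trans; [|exact F4].
        replace (_ - _) with ((cos s * v' + sin s * (c * x' + a * z' + - b * y')) - (cos t * v + sin t * (c * x + a * z + - b * y))) by ring.
        apply P4; auto; lra. }
    destruct K as [d3 B3].
    assert (Hd : 0 < Rmin d2 d3) by (apply Rmin_pos; [lra|apply cond_pos]).
    exists (mkposreal _ Hd); cbn; intros q s Hq Hs.
    assert (Q : Rmin d2 d3 <= d2 /\ Rmin d2 d3 <= d3) by (split; [apply Rmin_l|apply Rmin_r]).
    assert (E1 : Rabs (h (rot a b c s q) - h (rot a b c t p)) < e1).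
    { apply B1, B3; [|lra]. destruct p as [[[x y] z] v], q as [[[x' y'] z'] v']; cbn in Hq |- *.
      destruct Hq as (? & ? & ? & ?); repeat split; lra. }
    assert (E2 : Rabs (w s - w t) < e1).
    { destruct (Req_dec s t) as [->|Hst]; [rewrite Rminus_diag, Rabs_R0; lra|].
      apply B2; split; [split; [exact I|auto]|]. cbn; unfold Rdist; lra. }
    assert (Ee : e1 <= 1 /\ e1 * M <= e / 2).
    { split; [apply Rmin_l|]. apply Rle_trans with (e / (2 * M) * M); [|right; field; lra].
      apply Rmult_le_compat_r; [lra|apply Rmin_r]. }
    unfold H.
    replace (_ - _) with ((h (rot a b c s q) - h (rot a b c t p)) * (w s - w t) + ((h (rot a b c s q) - h (rot a b c t p)) * w t + h (rot a b c t p) * (w s - w t))) by ring.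
    eapply Rle_lt_trans; [apply Rabs_triang|]. eapply Rle_lt_trans; [apply Rplus_le_compat_l, Rabs_triang|].
    rewrite !Rabs_mult. unfold M in *.
    pose proof (Rabs_pos (h (rot a b c s q) - h (rot a b c t p))); pose proof (Rabs_pos (w s - w t));
    pose proof (Rabs_pos (h (rot a b c t p))); pose proof (Rabs_pos (w t)). nra. }
  apply choice_fun in J; destruct J as [dl J].
  (* Every angle t lies within the gauge of some centre s whose gauge is at least [d]; [H q t] and
     [H p t] are both compared with [H p s]. *)
  destruct (compactness_value_1d 0 (2 * PI) dl) as [d Hd].
  destruct (nonzero4_open p Hp) as [d' [Hd' N]].
  exists (Rmin d d'); split; [apply Rmin_pos; [apply cond_pos|lra]|]; intros q Hq.
  assert (Q : Rmin d d' <= d /\ Rmin d d' <= d') by (split; [apply Rmin_l|apply Rmin_r]).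
  assert (Mono : forall e1 e2, e1 <= e2 -> inbox e1 p q -> inbox e2 p q).
  { intros e1 e2 Hle; destruct p as [[[x y] z] v], q as [[[x' y'] z'] v']; cbn; intros (? & ? & ? & ?); repeat split; lra. }
  assert (Hnq : nonzero4 q) by (apply N; eapply Mono; [|exact Hq]; tauto).
  assert (B : forall t, 0 <= t <= 2 * PI -> Rabs (H q t - H p t) <= 2 * e).
  { intros t Ht; destruct (NNPP _ (Hd t Ht)) as [s (Hs1 & Hs2 & Hs3)].
    assert (U1 := J s q t ltac:(eapply Mono; [|exact Hq]; lra) Hs2).
    assert (Z : inbox (dl s) p p).
    { pose proof (cond_pos (dl s)); destruct p as [[[x y] z] v]; cbn; rewrite !Rminus_diag, Rabs_R0; auto. }
    assert (U2 := J s p t Z Hs2).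
    replace (H q t - H p t) with ((H q t - H p s) + - (H p t - H p s)) by ring.
    eapply Rle_trans; [apply Rabs_triang|]; rewrite Rabs_Ropp; lra. }
  unfold Av.
  assert (E1 := ex_RInt_Av h w q Hh Hw Hnq); assert (E2 := ex_RInt_Av h w p Hh Hw Hp).
  change (Rabs (minus (RInt (fun t => h (rot a b c t q) * w t) 0 (2 * PI)) (RInt (fun t => h (rot a b c t p) * w t) 0 (2 * PI))) < eps).
  rewrite <- (RInt_minus (V := R_CompleteNormedModule)) by assumption.
  apply Rle_lt_trans with ((2 * PI - 0) * (2 * e)).
  - apply abs_RInt_le_const; [lra| |exact B].
    now apply (ex_RInt_minus (V := R_NormedModule)).
  - unfold e; replace ((2 * PI - 0) * (2 * (eps / (8 * PI)))) with (eps / 2) by (field; lra); lra.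
Qed.

End Average.

(** * Maxima on the sphere *)

Lemma cont4_at_continuous (g : R4 -> R) (p : R4) :
  cont4_at g p <-> @continuous (prod_UniformSpace (prod_UniformSpace (prod_UniformSpace R_UniformSpace R_UniformSpace) R_UniformSpace) R_UniformSpace) R_UniformSpace g p.
Proof.
  rewrite cont4_at_box; destruct p as [[[x y] z] w]; split.
  - intros H; apply filterlim_locally; intros [eps He]; destruct (H eps He) as [d [Hd B]].
    exists (mkposreal d Hd); intros [[[x' y'] z'] w'] [[[h1 h2] h3] h4]; apply B; cbn; auto.
  - intros H eps He; pose proof (proj1 (filterlim_locally _ _) H (mkposreal eps He)) as [d B].
    exists d; split; [apply cond_pos|]; intros [[[x' y'] z'] w'] (h1 & h2 & h3 & h4).
    apply B; repeat split; assumption.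
Qed.

Lemma cont4_at_const (k : R) (p : R4) : cont4_at (fun _ => k) p.
Proof. apply cont4_at_continuous, continuous_const. Qed.
Lemma cont4_at_coord (i : nat) (p : R4) : cont4_at (coord i) p.
Proof.
  apply cont4_at_box; intros eps He; exists eps; split; auto.
  intros q; destruct p as [[[x y] z] w], q as [[[x' y'] z'] w']; intros (h1 & h2 & h3 & h4).
  now destruct i as [|[|[|i]]].
Qed.
Lemma cont4_at_plus (f g : R4 -> R) (p : R4) :
  cont4_at f p -> cont4_at g p -> cont4_at (fun q => f q + g q) p.
Proof. rewrite !cont4_at_continuous; apply (continuous_plus f g). Qed.
Lemma cont4_at_mult (f g : R4 -> R) (p : R4) :
  cont4_at f p -> cont4_at g p -> cont4_at (fun q => f q * g q) p.
Proof. rewrite !cont4_at_continuous; apply (continuous_mult f g). Qed.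
Lemma cont4_at_comp (f : R4 -> R) (k : R -> R) (p : R4) :
  cont4_at f p -> continuous k (f p) -> cont4_at (fun q => k (f q)) p.
Proof. rewrite !cont4_at_continuous; apply (continuous_comp f k). Qed.
Lemma cont4_at_ext (f g : R4 -> R) (p : R4) :
  (forall q, f q = g q) -> cont4_at f p -> cont4_at g p.
Proof. intros E; now replace g with f by (apply functional_extensionality; exact E). Qed.

Lemma sqnorm4_coord (p : R4) :
  sqnorm4 p = coord 0 p * coord 0 p + coord 1 p * coord 1 p + coord 2 p * coord 2 p + coord 3 p * coord 3 p.
Proof. now destruct p as [[[x y] z] w]. Qed.

Lemma cont4_at_sqnorm (p : R4) : cont4_at sqnorm4 p.
Proof.
  eapply cont4_at_ext; [intros q; symmetry; apply sqnorm4_coord|].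
  repeat apply cont4_at_plus; apply cont4_at_mult; apply cont4_at_coord.
Qed.

Lemma onS3_nonzero (p : R4) : onS3 p -> nonzero4 p.
Proof. unfold onS3, nonzero4; intros ->; lra. Qed.

(** Without a maximum, every point of the cube [-1, 1]^4 has a box on whose sphere points [phi]
    stays below its value at some witness on the sphere; a finite subcover then contradicts itself
    at the best witness. *)
Lemma S3_max (phi : R4 -> R) :
  (forall p, nonzero4 p -> cont4_at phi p) ->
  exists p, onS3 p /\ forall q, onS3 q -> phi q <= phi p.
Proof.
  intros Hc; apply NNPP; intros Hno.
  assert (Hex : forall p, onS3 p -> exists q, onS3 q /\ phi p < phi q).
  { intros p Hp; apply NNPP; intros H; apply Hno; exists p; split; [exact Hp|].
    intros q Hq; apply Rnot_lt_le; intros Hlt; apply H; now exists q. }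
  assert (H0 : onS3 (1, 0, 0, 0)) by (unfold onS3; cbn; ring).
  assert (G : forall p, exists dq : posreal * R4, onS3 (snd dq) /\
     forall p', inbox (fst dq) p p' -> onS3 p' -> phi p' < phi (snd dq)).
  { intros p; destruct (classic (onS3 p)) as [Hp|Hp].
    - destruct (Hex p Hp) as [q [Hq Hlt]].
      destruct (proj1 (cont4_at_box _ _) (Hc p (onS3_nonzero p Hp)) (phi q - phi p) ltac:(lra)) as [d [Hd B]].
      exists (mkposreal d Hd, q); split; [exact Hq|]; cbn; intros p' Hin _.
      apply B, Rabs_def2 in Hin; lra.
    (* Off the sphere the box is chosen to miss S^3, and the witness (1, 0, 0, 0) is arbitrary. *)
    - destruct (proj1 (cont4_at_box _ _) (cont4_at_sqnorm p) (Rabs (sqnorm4 p - 1))) as [d [Hd B]].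
      { apply Rabs_pos_lt; unfold onS3 in Hp; lra. }
      exists (mkposreal d Hd, (1, 0, 0, 0)); split; [exact H0|]; cbn; intros p' Hin Hp'; exfalso.
      apply B in Hin; unfold onS3 in Hp'; rewrite Hp', Rabs_minus_sym in Hin; lra. }
  apply choice_fun in G; destruct G as [f G].
  set (toR4 := fun t : Compactness.Tn 4 R => let '(x, (y, (z, (w, _)))) := t in (x, y, z, w) : R4).
  set (m := (-1, (-1, (-1, (-1, tt)))) : Compactness.Tn 4 R).
  set (M := (1, (1, (1, (1, tt)))) : Compactness.Tn 4 R).
  apply (compactness_list 4 m M (fun t => fst (f (toR4 t)))); intros [l Hl].
  (* Take q at least as high as all the finitely many witnesses: the box that covers q gives phi q <
     phi q. *)
  assert (L : exists q, onS3 q /\ forall t, In t l -> phi (snd (f (toR4 t))) <= phi q).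
  { clear Hl; induction l as [|t l [q [Hq IH]]].
    - exists (1, 0, 0, 0); split; [exact H0|intros t []].
    - destruct (Rle_dec (phi q) (phi (snd (f (toR4 t))))) as [Hle|Hle].
      + exists (snd (f (toR4 t))); split; [apply G|].
        intros s [<-|Hs]; [lra|]. specialize (IH s Hs); lra.
      + exists q; split; [exact Hq|]. intros s [<-|Hs]; [lra|auto]. }
  destruct L as [[[[x y] z] w] [Hq L]].
  assert (B : -1 <= x <= 1 /\ -1 <= y <= 1 /\ -1 <= z <= 1 /\ -1 <= w <= 1).
  { unfold onS3 in Hq; cbn in Hq.
    assert (K : forall t r, 0 <= r -> t * t + r = 1 -> -1 <= t <= 1) by (intros; split; nra).
    pose proof (Rle_0_sqr x); pose proof (Rle_0_sqr y); pose proof (Rle_0_sqr z); pose proof (Rle_0_sqr w).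
    unfold Rsqr in *; repeat apply conj.
    all: first [eapply (K x (y*y+z*z+w*w)); lra | eapply (K y (x*x+z*z+w*w)); lra | eapply (K z (x*x+y*y+w*w)); lra | eapply (K w (x*x+y*y+z*z)); lra]. }
  destruct (Hl (x, (y, (z, (w, tt))))) as [[x' [y' [z' [w' []]]]] (Hin & _ & Hcl)].
  { cbn; tauto. }
  specialize (L _ Hin); cbn in Hcl.
  apply (Rlt_irrefl (phi (x, y, z, w))); apply Rlt_le_trans with (2 := L); apply G; [|exact Hq].
  cbn; tauto.
Qed.

(** A positive [l] would make [f'] pass through x with slope at least l / 2, and the mean value
    theorem then finds a value above [f x] on one side. *)
Lemma local_max_second_derivative (f f' : R -> R) (x l : R) :
  locally x (fun s => is_derive f s (f' s)) -> is_derive f' x l ->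
  locally x (fun s => f s <= f x) -> l <= 0.
Proof.
  intros [d1 H1] H2 [d2 H3]; apply Rnot_lt_le; intros Hl.
  assert (Hb : forall s, Rabs (s - x) < d1 -> is_derive f s (f' s)) by (intros s Hs; apply H1, Hs).
  assert (Hm : forall s, Rabs (s - x) < d2 -> f s <= f x) by (intros s Hs; apply H3, Hs).
  assert (P1 := cond_pos d1); assert (P2 := cond_pos d2).
  apply is_derive_Reals in H2; destruct (H2 (l / 2) ltac:(lra)) as [d3 B3].
  assert (P3 := cond_pos d3).
  set (e := Rmin d1 (Rmin d2 d3) / 2).
  assert (He : 0 < e /\ e < d1 /\ e < d2 /\ e < d3) by (unfold e, Rmin; repeat destruct Rle_dec; lra).
  assert (Hf' : forall t, t <> 0 -> Rabs t <= e -> (f' (x + t) - f' x) / t > l / 2).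
  { intros t Ht Hte; specialize (B3 t Ht ltac:(lra)); apply Rabs_def2 in B3; lra. }
  assert (S : forall t, 0 < t <= e -> f' (x + t) > f' x + l / 2 * t).
  { intros t Ht; specialize (Hf' t ltac:(lra) ltac:(rewrite Rabs_pos_eq; lra)).
    apply (Rmult_gt_compat_r t) in Hf'; [|lra]. unfold Rdiv in Hf' at 1; rewrite Rmult_assoc, Rinv_l, Rmult_1_r in Hf'; lra. }
  assert (S' : forall t, 0 < t <= e -> f' (x - t) < f' x - l / 2 * t).
  { intros t Ht; specialize (Hf' (- t) ltac:(lra) ltac:(rewrite Rabs_Ropp, Rabs_pos_eq; lra)).
    apply (Rmult_gt_compat_r t) in Hf'; [|lra].
    replace ((f' (x + - t) - f' x) / - t * t) with (f' x - f' (x - t)) in Hf' by (unfold Rminus; field; lra); lra. }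
  (* If f' x is nonnegative, f' is positive just to the right; otherwise it is negative just to the
     left. *)
  destruct (Rle_dec 0 (f' x)) as [Hp|Hp].
  - destruct (MVT_cor2 f f' x (x + e)) as [c [Hc1 Hc2]]; [lra| |].
    { intros s Hs; apply is_derive_Reals, Hb, Rabs_def1; lra. }
    assert (f (x + e) <= f x) by (apply Hm, Rabs_def1; lra).
    specialize (S (c - x) ltac:(lra)); replace (x + (c - x)) with c in S by ring.
    assert (0 < f' c) by nra. nra.
  - destruct (MVT_cor2 f f' (x - e) x) as [c [Hc1 Hc2]]; [lra| |].
    { intros s Hs; apply is_derive_Reals, Hb, Rabs_def1; lra. }
    assert (f (x - e) <= f x) by (apply Hm, Rabs_def1; lra).
    specialize (S' (x - c) ltac:(lra)); replace (x - (x - c)) with c in S' by ring.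
    assert (f' c < 0) by nra. nra.
Qed.

(** * Fourier coefficients of eigenfunctions *)

Definition scale4 (s : R) (p : R4) : R4 := let '(x, y, z, w) := p in (s * x, s * y, s * z, s * w).

Definition homog0 (g : R4 -> R) : Prop := forall s p, 0 < s -> g (scale4 s p) = g p.

Lemma rot_scale (a b c t s : R) (p : R4) : rot a b c t (scale4 s p) = scale4 s (rot a b c t p).
Proof. destruct p as [[[x y] z] w]; cbn; apply R4_eq; ring. Qed.

Lemma sqnorm4_pos (p : R4) : nonzero4 p -> 0 < sqnorm4 p.
Proof.
  intros H; unfold nonzero4 in H; assert (0 <= sqnorm4 p); [|lra].
  destruct p as [[[x y] z] w]; cbn; pose proof (Rle_0_sqr x); pose proof (Rle_0_sqr y);
  pose proof (Rle_0_sqr z); pose proof (Rle_0_sqr w); unfold Rsqr in *; lra.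
Qed.

Lemma sqnorm4_scale (s : R) (p : R4) : sqnorm4 (scale4 s p) = s * s * sqnorm4 p.
Proof. destruct p as [[[x y] z] w]; cbn; ring. Qed.

Lemma normalize_onS3 (p : R4) : nonzero4 p -> onS3 (scale4 (/ sqrt (sqnorm4 p)) p).
Proof.
  intros H; apply sqnorm4_pos in H; unfold onS3; rewrite sqnorm4_scale.
  rewrite <- Rinv_mult, sqrt_sqrt by lra; apply Rinv_l; lra.
Qed.

Section Fourier.
Context (a b c : R) (Hu : a * a + b * b + c * c = 1).

Lemma is_derive_rot_t (h : R4 -> R) (p : R4) (t : R) :
  C1_away0 h -> nonzero4 p ->
  is_derive (fun t => h (rot a b c t p)) t
   (let '(x, y, z, w) := p in
    (- sin t * x - cos t * (a * y + b * z + c * w)) * partial 0 h (rot a b c t p)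
    + (- sin t * y + cos t * (a * x + b * w - c * z)) * partial 1 h (rot a b c t p)
    + (- sin t * z + cos t * (b * x + c * y - a * w)) * partial 2 h (rot a b c t p)
    + (- sin t * w + cos t * (c * x + a * z - b * y)) * partial 3 h (rot a b c t p)).
Proof.
  destruct p as [[[x y] z] w]; intros Hh Hp.
  apply (is_derive_curve4 h (fun t => rot a b c t (x, y, z, w))); auto; try (now apply rot_nonzero);
    cbn; auto_derive; auto; ring.
Qed.

Lemma Av_plus4 (h : R4 -> R) (w0 w1 w2 w3 : R -> R) (p : R4) :
  (forall q, nonzero4 q -> cont4_at h q) ->
  (forall t, continuous w0 t) -> (forall t, continuous w1 t) ->
  (forall t, continuous w2 t) -> (forall t, continuous w3 t) -> nonzero4 p ->
  Av a b c h w0 p + Av a b c h w1 p + Av a b c h w2 p + Av a b c h w3 p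
  = Av a b c h (fun t => w0 t + w1 t + w2 t + w3 t) p.
Proof.
  intros Hh H0 H1 H2 H3 Hp; unfold Av.
  rewrite <- RInt_plus4 by (apply ex_RInt_Av; auto).
  apply RInt_ext; intros t _; asR; ring.
Qed.

Lemma Av_ext (h : R4 -> R) (w w' : R -> R) (p : R4) :
  (forall t, w t = w' t) -> Av a b c h w p = Av a b c h w' p.
Proof. intros E; apply RInt_ext; intros t _; now rewrite E. Qed.

Lemma Av_0 (h : R4 -> R) (p : R4) : Av a b c h (fun _ => 0) p = 0.
Proof.
  unfold Av; transitivity (RInt (fun _ => 0) 0 (2 * PI)).
  - apply RInt_ext; intros t _; asR; ring.
  - rewrite RInt_const; unfold scal; cbn; unfold mult; cbn; ring.
Qed.

Lemma continuous_rotm (j i : nat) (t : R) : continuous (rotm a b c j i) t.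
Proof.
  apply (ex_derive_continuous (rotm a b c j i)).
  destruct i as [|[|[|[|i]]]]; destruct j as [|[|[|[|j]]]]; unfold rotm; auto_derive; auto.
Qed.

Lemma continuous_rotm_mult (j i : nat) (w : R -> R) :
  (forall t, continuous w t) -> forall t, continuous (fun t => rotm a b c j i t * w t) t.
Proof. intros Hw t; apply (continuous_mult (rotm a b c j i) w); auto; apply continuous_rotm. Qed.

(** The matrix is cos t + sin t J with J skew, and J^2 = -1 because (a, b, c) is a unit vector;
    hence it is orthogonal. *)
Lemma rotm_orth (j k : nat) (t : R) : (j < 4)%nat -> (k < 4)%nat ->
  rotm a b c k 0 t * rotm a b c j 0 t + rotm a b c k 1 t * rotm a b c j 1 t
  + rotm a b c k 2 t * rotm a b c j 2 t + rotm a b c k 3 t * rotm a b c j 3 t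
  = if Nat.eqb j k then 1 else 0.
Proof.
  intros Hj Hk.
  assert (Hs := sin2_cos2 t); unfold Rsqr in Hs.
  assert (Hd : cos t * cos t + (a * a + b * b + c * c) * (sin t * sin t) = 1) by (rewrite Hu; lra).
  destruct j as [|[|[|[|j]]]]; [..|lia]; destruct k as [|[|[|[|k]]]]; [..|lia]; cbn; nra.
Qed.

Lemma Av_orth (h : R4 -> R) (w : R -> R) (j k : nat) (p : R4) :
  (j < 4)%nat -> (k < 4)%nat ->
  (forall q, nonzero4 q -> cont4_at h q) -> (forall t, continuous w t) -> nonzero4 p ->
  Av a b c h (fun t => rotm a b c k 0 t * (rotm a b c j 0 t * w t)) p
  + Av a b c h (fun t => rotm a b c k 1 t * (rotm a b c j 1 t * w t)) p
  + Av a b c h (fun t => rotm a b c k 2 t * (rotm a b c j 2 t * w t)) p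
  + Av a b c h (fun t => rotm a b c k 3 t * (rotm a b c j 3 t * w t)) p
  = if Nat.eqb j k then Av a b c h w p else 0.
Proof.
  intros Hj Hk Hh Hw Hp.
  rewrite Av_plus4; auto; try (now apply continuous_rotm_mult, continuous_rotm_mult).
  transitivity (Av a b c h (fun t => (if Nat.eqb j k then 1 else 0) * w t) p).
  - apply Av_ext; intros t; rewrite <- (rotm_orth j k t Hj Hk); ring.
  - destruct (Nat.eqb j k).
    + apply Av_ext; intros t; ring.
    + transitivity (Av a b c h (fun _ => 0) p); [apply Av_ext; intros t; ring|apply Av_0].
Qed.

(** The i-th partial derivative of [Av] in closed form, again a sum of averages, so that it can be
    differentiated once more. *)
Definition Avd (h : R4 -> R) (w : R -> R) (i : nat) (p : R4) : R :=
  Av a b c (partial 0 h) (fun t => rotm a b c 0 i t * w t) p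
  + Av a b c (partial 1 h) (fun t => rotm a b c 1 i t * w t) p
  + Av a b c (partial 2 h) (fun t => rotm a b c 2 i t * w t) p
  + Av a b c (partial 3 h) (fun t => rotm a b c 3 i t * w t) p.

Lemma is_derive_Av_upd (h : R4 -> R) (w : R -> R) (i : nat) (p : R4) (s : R) :
  (i < 4)%nat -> C1_away0 h -> (forall t, continuous w t) -> nonzero4 (upd i p s) ->
  is_derive (fun s => Av a b c h w (upd i p s)) s (Avd h w i (upd i p s)).
Proof.
  intros Hi Hh Hw Hp.
  pose proof (is_derive_Av a b c Hu h w i _ Hi Hh Hw Hp) as D.
  rewrite coord_upd in D; eapply is_derive_ext; [|exact D].
  intros s'; cbv beta; now rewrite upd_upd.
Qed.

Definition Avdd (g : R4 -> R) (w : R -> R) (i : nat) (p : R4) : R :=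
  Avd (partial 0 g) (fun t => rotm a b c 0 i t * w t) i p
  + Avd (partial 1 g) (fun t => rotm a b c 1 i t * w t) i p
  + Avd (partial 2 g) (fun t => rotm a b c 2 i t * w t) i p
  + Avd (partial 3 g) (fun t => rotm a b c 3 i t * w t) i p.

Lemma is_derive_Avd (g : R4 -> R) (w : R -> R) (i : nat) (p : R4) :
  (i < 4)%nat -> C2_away0 g -> (forall t, continuous w t) -> nonzero4 p ->
  is_derive (fun s => Avd g w i (upd i p s)) (coord i p) (Avdd g w i p).
Proof.
  intros Hi Hg Hw Hp; unfold Avdd, Avd at 1.
  assert (D : forall j, (j < 4)%nat ->
    is_derive (fun s => Av a b c (partial j g) (fun t => rotm a b c j i t * w t) (upd i p s)) (coord i p)
      (Avd (partial j g) (fun t => rotm a b c j i t * w t) i p)).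
  { intros j Hj; apply (is_derive_Av a b c Hu); auto.
    - now apply C2_C1_partial.
    - now apply continuous_rotm_mult. }
  apply @is_derive_plus; [apply @is_derive_plus; [apply @is_derive_plus|]|]; apply D; lia.
Qed.

(** The Laplacian commutes with rotations: summed over the direction i, products of matrix entries
    become Kronecker deltas and the mixed second derivatives drop out. *)
Lemma Avdd_sum (g : R4 -> R) (w : R -> R) (p : R4) :
  C2_away0 g -> (forall t, continuous w t) -> nonzero4 p ->
  Avdd g w 0 p + Avdd g w 1 p + Avdd g w 2 p + Avdd g w 3 p = Av a b c (lap4 g) w p.
Proof.
  intros Hg Hw Hp.
  assert (Hc : forall j k, (j < 4)%nat -> (k < 4)%nat -> forall q, nonzero4 q -> cont4_at (partial k (partial j g)) q).
  { intros j k Hj Hk q Hq; destruct (Hg q Hq) as [_ H]; destruct (H j Hj) as (_ & _ & H2); now apply H2. }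
  assert (O := fun j k Hj Hk => Av_orth (partial k (partial j g)) w j k p Hj Hk (Hc j k Hj Hk) Hw Hp).
  assert (L : Av a b c (lap4 g) w p = Av a b c (partial 0 (partial 0 g)) w p + Av a b c (partial 1 (partial 1 g)) w p
       + Av a b c (partial 2 (partial 2 g)) w p + Av a b c (partial 3 (partial 3 g)) w p).
  { unfold Av; rewrite <- RInt_plus4 by (apply ex_RInt_Av; auto; apply Hc; lia).
    apply RInt_ext; intros t _; unfold lap4; asR; ring. }
  rewrite L; unfold Avdd, Avd.
  pose proof (O 0 0 ltac:(lia) ltac:(lia))%nat as O00; pose proof (O 0 1 ltac:(lia) ltac:(lia))%nat as O01;
  pose proof (O 0 2 ltac:(lia) ltac:(lia))%nat as O02; pose proof (O 0 3 ltac:(lia) ltac:(lia))%nat as O03;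
  pose proof (O 1 0 ltac:(lia) ltac:(lia))%nat as O10; pose proof (O 1 1 ltac:(lia) ltac:(lia))%nat as O11;
  pose proof (O 1 2 ltac:(lia) ltac:(lia))%nat as O12; pose proof (O 1 3 ltac:(lia) ltac:(lia))%nat as O13;
  pose proof (O 2 0 ltac:(lia) ltac:(lia))%nat as O20; pose proof (O 2 1 ltac:(lia) ltac:(lia))%nat as O21;
  pose proof (O 2 2 ltac:(lia) ltac:(lia))%nat as O22; pose proof (O 2 3 ltac:(lia) ltac:(lia))%nat as O23;
  pose proof (O 3 0 ltac:(lia) ltac:(lia))%nat as O30; pose proof (O 3 1 ltac:(lia) ltac:(lia))%nat as O31;
  pose proof (O 3 2 ltac:(lia) ltac:(lia))%nat as O32; pose proof (O 3 3 ltac:(lia) ltac:(lia))%nat as O33.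
  clear O L; cbn [Nat.eqb] in *; lra.
Qed.

(* Integration by parts along the closed orbit of the rotation. *)
Lemma Avd_orbit (g : R4 -> R) (w w' : R -> R) (x y z v : R) :
  C1_away0 g -> (forall t, is_derive w t (w' t)) -> (forall t, continuous w' t) ->
  w (2 * PI) = w 0 -> nonzero4 (x, y, z, v) ->
  - (a * y + b * z + c * v) * Avd g w 0 (x, y, z, v) + (a * x + b * v - c * z) * Avd g w 1 (x, y, z, v)
  + (b * x + c * y - a * v) * Avd g w 2 (x, y, z, v) + (c * x + a * z - b * y) * Avd g w 3 (x, y, z, v)
  = - Av a b c g w' (x, y, z, v).
Proof.
  intros Hg Hw Hw' Hper Hp; set (p := (x, y, z, v)) in *.
  assert (Hwc : forall t, continuous w t) by (intros t; apply (ex_derive_continuous w); eexists; apply Hw).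
  assert (Hpc : forall j, (j < 4)%nat -> forall q, nonzero4 q -> cont4_at (partial j g) q).
  { intros j Hj q Hq; now apply (Hg q Hq). }
  (* [d0], ..., [d3] are the components of the velocity of the orbit at time t. *)
  set (d0 := fun t => - sin t * x - cos t * (a * y + b * z + c * v)).
  set (d1 := fun t => - sin t * y + cos t * (a * x + b * v - c * z)).
  set (d2 := fun t => - sin t * z + cos t * (b * x + c * y - a * v)).
  set (d3 := fun t => - sin t * v + cos t * (c * x + a * z - b * y)).
  assert (Hdc : forall t, continuous d0 t /\ continuous d1 t /\ continuous d2 t /\ continuous d3 t).
  { intros t; repeat split; unfold d0, d1, d2, d3.
    - apply (ex_derive_continuous (fun t => - sin t * x - cos t * (a * y + b * z + c * v))); auto_derive; auto.
    - apply (ex_derive_continuous (fun t => - sin t * y + cos t * (a * x + b * v - c * z))); auto_derive; auto.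
    - apply (ex_derive_continuous (fun t => - sin t * z + cos t * (b * x + c * y - a * v))); auto_derive; auto.
    - apply (ex_derive_continuous (fun t => - sin t * v + cos t * (c * x + a * z - b * y))); auto_derive; auto. }
  assert (Hdw : (forall t, continuous (fun t => d0 t * w t) t) /\ (forall t, continuous (fun t => d1 t * w t) t)
     /\ (forall t, continuous (fun t => d2 t * w t) t) /\ (forall t, continuous (fun t => d3 t * w t) t)).
  { repeat split; intros t; destruct (Hdc t) as (? & ? & ? & ?).
    - apply (continuous_mult d0 w); auto.
    - apply (continuous_mult d1 w); auto.
    - apply (continuous_mult d2 w); auto.
    - apply (continuous_mult d3 w); auto. }
  destruct Hdw as (W0 & W1 & W2 & W3).
  (* The coefficients in the goal form J p, the velocity at time 0. Applying the rotation to it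
     gives cos t J p + sin t J^2 p, the velocity at time t, since J^2 = -1. *)
  assert (Lin : forall h j, (forall q, nonzero4 q -> cont4_at h q) -> (j < 4)%nat ->
     - (a * y + b * z + c * v) * Av a b c h (fun t => rotm a b c j 0 t * w t) p
     + (a * x + b * v - c * z) * Av a b c h (fun t => rotm a b c j 1 t * w t) p
     + (b * x + c * y - a * v) * Av a b c h (fun t => rotm a b c j 2 t * w t) p
     + (c * x + a * z - b * y) * Av a b c h (fun t => rotm a b c j 3 t * w t) p
     = Av a b c h (fun t => (match j with 0%nat => d0 t | 1%nat => d1 t | 2%nat => d2 t | _ => d3 t end) * w t) p).
  { intros h j Hh Hj.
    assert (Sc : forall k i, k * Av a b c h (fun t => rotm a b c j i t * w t) p
                 = Av a b c h (fun t => k * (rotm a b c j i t * w t)) p).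
    { intros k i; unfold Av.
      rewrite <- (RInt_scal (V := R_CompleteNormedModule) (fun t => h (rot a b c t p) * (rotm a b c j i t * w t))).
      - apply RInt_ext; intros t _; unfold scal; cbn; unfold mult; cbn; asR; ring.
      - apply ex_RInt_Av; auto; now apply continuous_rotm_mult. }
    assert (Cc : forall k i t, continuous (fun t => k * (rotm a b c j i t * w t)) t).
    { intros k i t; apply (continuous_scal_r k (fun t => rotm a b c j i t * w t)).
      now apply continuous_rotm_mult. }
    rewrite !Sc, Av_plus4 by auto.
    apply Av_ext; intros t.
    assert (Q : a * a + b * b + c * c - 1 = 0) by lra.
    destruct j as [|[|[|[|j]]]]; [..|lia]; unfold d0, d1, d2, d3, rotm.
    - transitivity ((- sin t * x - cos t * (a * y + b * z + c * v)) * w t - sin t * x * (a * a + b * b + c * c - 1) * w t); [ring|rewrite Q; ring].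
    - transitivity ((- sin t * y + cos t * (a * x + b * v - c * z)) * w t - sin t * y * (a * a + b * b + c * c - 1) * w t); [ring|rewrite Q; ring].
    - transitivity ((- sin t * z + cos t * (b * x + c * y - a * v)) * w t - sin t * z * (a * a + b * b + c * c - 1) * w t); [ring|rewrite Q; ring].
    - transitivity ((- sin t * v + cos t * (c * x + a * z - b * y)) * w t - sin t * v * (a * a + b * b + c * c - 1) * w t); [ring|rewrite Q; ring]. }
  assert (L0 := Lin (partial 0 g) 0%nat (Hpc 0%nat ltac:(lia)) ltac:(lia)).
  assert (L1 := Lin (partial 1 g) 1%nat (Hpc 1%nat ltac:(lia)) ltac:(lia)).
  assert (L2 := Lin (partial 2 g) 2%nat (Hpc 2%nat ltac:(lia)) ltac:(lia)).
  assert (L3 := Lin (partial 3 g) 3%nat (Hpc 3%nat ltac:(lia)) ltac:(lia)).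
  assert (I : Av a b c (partial 0 g) (fun t => d0 t * w t) p + Av a b c (partial 1 g) (fun t => d1 t * w t) p
      + Av a b c (partial 2 g) (fun t => d2 t * w t) p + Av a b c (partial 3 g) (fun t => d3 t * w t) p
      = - Av a b c g w' p).
  { assert (X0 := ex_RInt_Av a b c Hu (partial 0 g) _ p (Hpc 0%nat ltac:(lia)) W0 Hp).
    assert (X1 := ex_RInt_Av a b c Hu (partial 1 g) _ p (Hpc 1%nat ltac:(lia)) W1 Hp).
    assert (X2 := ex_RInt_Av a b c Hu (partial 2 g) _ p (Hpc 2%nat ltac:(lia)) W2 Hp).
    assert (X3 := ex_RInt_Av a b c Hu (partial 3 g) _ p (Hpc 3%nat ltac:(lia)) W3 Hp).
    assert (Xg := ex_RInt_Av a b c Hu g w' p (fun q Hq => proj1 (Hg q Hq)) Hw' Hp).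
    set (S := fun t => partial 0 g (rot a b c t p) * (d0 t * w t) + partial 1 g (rot a b c t p) * (d1 t * w t)
        + partial 2 g (rot a b c t p) * (d2 t * w t) + partial 3 g (rot a b c t p) * (d3 t * w t)).
    assert (ES : ex_RInt S 0 (2 * PI)).
    { now apply ex_RInt_plus4. }
    (* The integrand is the derivative of g w along the orbit; the boundary terms agree because the
       orbit closes up after 2 PI and w takes equal values at both ends. *)
    assert (Z : is_RInt (fun t => S t + g (rot a b c t p) * w' t) 0 (2 * PI) 0).
    { replace 0 with (minus (g (rot a b c (2 * PI) p) * w (2 * PI)) (g (rot a b c 0 p) * w 0)) at 2.
      - apply (is_RInt_derive (V := R_CompleteNormedModule) (fun t => g (rot a b c t p) * w t)).
        + intros t _.
          assert (D := is_derive_rot_t g p t Hg Hp). cbn [p] in D.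
          pose proof (is_derive_mult (fun t => g (rot a b c t p)) w t _ _ D (Hw t) Rmult_comm) as D'.
          replace (S t + g (rot a b c t p) * w' t) with
            (plus (mult ((- sin t * x - cos t * (a * y + b * z + c * v)) * partial 0 g (rot a b c t p)
               + (- sin t * y + cos t * (a * x + b * v - c * z)) * partial 1 g (rot a b c t p)
               + (- sin t * z + cos t * (b * x + c * y - a * v)) * partial 2 g (rot a b c t p)
               + (- sin t * v + cos t * (c * x + a * z - b * y)) * partial 3 g (rot a b c t p)) (w t))
              (mult (g (rot a b c t p)) (w' t))); [exact D'|].
          unfold S, d0, d1, d2, d3, plus, mult; cbn; ring.
        + intros t _.
          apply (continuous_plus S (fun t => g (rot a b c t p) * w' t)).
          * apply continuous_plus4; apply continuous_Av_integrand; auto; apply Hpc; lia.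
          * apply continuous_Av_integrand; auto; intros q Hq; apply (Hg q Hq).
      - rewrite Hper; replace (rot a b c (2 * PI) p) with (rot a b c 0 p);
          [unfold minus, plus, opp; cbn; ring|].
        unfold rot, p; now rewrite sin_2PI, cos_2PI, sin_0, cos_0. }
    assert (R1 := is_RInt_plus (V := R_NormedModule) _ _ _ _ _ _ (RInt_correct (V := R_CompleteNormedModule) _ _ _ ES)
       (RInt_correct (V := R_CompleteNormedModule) _ _ _ Xg)).
    assert (R2 : RInt (fun t => S t + g (rot a b c t p) * w' t) 0 (2 * PI)
       = RInt S 0 (2 * PI) + RInt (fun t => g (rot a b c t p) * w' t) 0 (2 * PI))
      by exact (is_RInt_unique (V := R_CompleteNormedModule) _ _ _ _ R1).
    rewrite (is_RInt_unique (V := R_CompleteNormedModule) _ _ _ _ Z) in R2.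
    unfold S in R2; rewrite RInt_plus4 in R2 by assumption.
    unfold Av; cbn in R2 |- *; lra. }
  unfold Avd; lra.
Qed.

Lemma Av_homog0 (g : R4 -> R) (w : R -> R) : homog0 g -> homog0 (Av a b c g w).
Proof. intros Hg s p Hs; apply RInt_ext; intros t _; now rewrite rot_scale, Hg. Qed.

(** By the identity of Lagrange the defect is the sum of the squared 2 by 2 minors. *)
Lemma cauchy_schwarz4 (u0 u1 u2 u3 v0 v1 v2 v3 : R) :
  u0 * u0 + u1 * u1 + u2 * u2 + u3 * u3 = 1 ->
  (u0 * v0 + u1 * v1 + u2 * v2 + u3 * v3) ^ 2 <= v0 ^ 2 + v1 ^ 2 + v2 ^ 2 + v3 ^ 2.
Proof.
  intros H.
  assert (E : v0 ^ 2 + v1 ^ 2 + v2 ^ 2 + v3 ^ 2 - (u0 * v0 + u1 * v1 + u2 * v2 + u3 * v3) ^ 2 =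
    (u0 * v1 - u1 * v0) ^ 2 + (u0 * v2 - u2 * v0) ^ 2 + (u0 * v3 - u3 * v0) ^ 2
    + (u1 * v2 - u2 * v1) ^ 2 + (u1 * v3 - u3 * v1) ^ 2 + (u2 * v3 - u3 * v2) ^ 2
    - (u0 * u0 + u1 * u1 + u2 * u2 + u3 * u3 - 1) * (v0 ^ 2 + v1 ^ 2 + v2 ^ 2 + v3 ^ 2)) by ring.
  rewrite H in E.
  pose proof (pow2_ge_0 (u0 * v1 - u1 * v0)); pose proof (pow2_ge_0 (u0 * v2 - u2 * v0));
  pose proof (pow2_ge_0 (u0 * v3 - u3 * v0)); pose proof (pow2_ge_0 (u1 * v2 - u2 * v1));
  pose proof (pow2_ge_0 (u1 * v3 - u3 * v1)); pose proof (pow2_ge_0 (u2 * v3 - u3 * v2)); lra.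
Qed.

(* Maximum principle: at a maximum of A^2 + B^2 on the sphere the Laplacian is nonpositive, while
   the derivative n along the orbit forces it to be at least 2 (n^2 - lam) (A^2 + B^2). *)
Lemma fourier_coefficients_vanish (g : R4 -> R) (lam n : R) :
  C2_away0 g -> homog0 g -> (forall p, onS3 p -> lap4 g p = - lam * g p) ->
  lam < n * n -> cos (n * (2 * PI)) = 1 -> sin (n * (2 * PI)) = 0 ->
  forall p, onS3 p ->
    Av a b c g (fun t => cos (n * t)) p = 0 /\ Av a b c g (fun t => sin (n * t)) p = 0.
Proof.
  intros Hg Hhom Hlap Hn Hc2 Hs2.
  set (wc := fun t => cos (n * t)); set (ws := fun t => sin (n * t)).
  assert (Dc : forall t, is_derive wc t (- n * ws t)) by (intros t; unfold wc, ws; auto_derive; auto; ring).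
  assert (Ds : forall t, is_derive ws t (n * wc t)) by (intros t; unfold wc, ws; auto_derive; auto; ring).
  assert (Cc : forall t, continuous wc t) by (intros t; apply (ex_derive_continuous wc); eexists; apply Dc).
  assert (Cs : forall t, continuous ws t) by (intros t; apply (ex_derive_continuous ws); eexists; apply Ds).
  set (A := Av a b c g wc); set (B := Av a b c g ws).
  assert (Hgc : forall q, nonzero4 q -> cont4_at g q) by (intros q Hq; apply (Hg q Hq)).
  set (phi := fun p => A p * A p + B p * B p).
  destruct (S3_max phi) as [p [Hp Hmax]].
  { intros q Hq; unfold phi; apply cont4_at_plus; apply cont4_at_mult; apply Av_cont; auto. }
  assert (Hnz := onS3_nonzero p Hp).
  (* [phi] is constant on rays, so its maximum on S^3 is a maximum on R^4 minus the origin, and the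
     second-derivative test applies along the coordinate axes. *)
  assert (Hphi : homog0 phi).
  { intros s q Hs; unfold phi, A, B; now rewrite !Av_homog0. }
  assert (Hgl : forall q, nonzero4 q -> phi q <= phi p).
  { intros q Hq; rewrite <- (Hphi (/ sqrt (sqnorm4 q))).
    - now apply Hmax, normalize_onS3.
    - apply Rinv_0_lt_compat, sqrt_lt_R0, sqnorm4_pos, Hq. }
  assert (H2 : forall i, (i < 4)%nat ->
     Avd g wc i p ^ 2 + A p * Avdd g wc i p + (Avd g ws i p ^ 2 + B p * Avdd g ws i p) <= 0).
  { intros i Hi.
    pose proof (upd_nonzero_locally i p Hnz) as HL.
    assert (D1 : forall w, (forall t, continuous w t) -> is_derive (fun s => Av a b c g w (upd i p s)) (coord i p) (Avd g w i p)).
    { intros w Hw; apply (is_derive_Av a b c Hu); auto; now apply C2_C1. }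
    assert (X : 2 * (Avd g wc i p ^ 2 + A p * Avdd g wc i p + (Avd g ws i p ^ 2 + B p * Avdd g ws i p)) <= 0); [|lra].
    apply (local_max_second_derivative (fun s => phi (upd i p s))
      (fun s => 2 * (A (upd i p s) * Avd g wc i (upd i p s) + B (upd i p s) * Avd g ws i (upd i p s))) (coord i p)).
    - eapply filter_imp; [|exact HL]; intros s Hs; unfold phi.
      assert (DA := is_derive_Av_upd g wc i p s Hi (C2_C1 g Hg) Cc Hs).
      assert (DB := is_derive_Av_upd g ws i p s Hi (C2_C1 g Hg) Cs Hs).
      pose proof (is_derive_plus _ _ _ _ _ (is_derive_mult _ _ _ _ _ DA DA Rmult_comm) (is_derive_mult _ _ _ _ _ DB DB Rmult_comm)) as D.
      match type of D with is_derive _ _ ?l => replace (2 * (A (upd i p s) * Avd g wc i (upd i p s) + B (upd i p s) * Avd g ws i (upd i p s))) with l end.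
      + exact D.
      + unfold plus, mult; cbn; unfold A, B; ring.
    - assert (DA := D1 wc Cc); assert (DB := D1 ws Cs).
      assert (EA := is_derive_Avd g wc i p Hi Hg Cc Hnz); assert (EB := is_derive_Avd g ws i p Hi Hg Cs Hnz).
      pose proof (is_derive_scal _ _ 2 _ (is_derive_plus _ _ _ _ _ (is_derive_mult _ _ _ _ _ DA EA Rmult_comm) (is_derive_mult _ _ _ _ _ DB EB Rmult_comm))) as D.
      match type of D with is_derive _ _ ?l => match goal with |- is_derive _ _ ?l' => replace l' with l end end.
      + exact D.
      + unfold plus, mult, scal; cbn; unfold mult; cbn; rewrite upd_coord; unfold A, B; ring.
    - eapply filter_imp; [|exact HL]; intros s Hs; rewrite upd_coord; now apply Hgl. }
  assert (La : forall w, (forall t, continuous w t) ->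
     Avdd g w 0 p + Avdd g w 1 p + Avdd g w 2 p + Avdd g w 3 p = - lam * Av a b c g w p).
  { intros w Hw; rewrite Avdd_sum by auto; unfold Av.
    rewrite <- (RInt_scal (V := R_CompleteNormedModule) (fun t => g (rot a b c t p) * w t)) by (apply ex_RInt_Av; auto).
    apply RInt_ext; intros t _; rewrite Hlap by (unfold onS3; rewrite rot_sqnorm; auto).
    unfold scal; cbn; unfold mult; cbn; asR; ring. }
  assert (LA := La wc Cc); assert (LB := La ws Cs); fold A in LA; fold B in LB.
  assert (H20 := H2 0%nat ltac:(lia)); assert (H21 := H2 1%nat ltac:(lia));
  assert (H22 := H2 2%nat ltac:(lia)); assert (H23 := H2 3%nat ltac:(lia)).
  destruct p as [[[x y] z] v].
  assert (OA := Avd_orbit g wc (fun t => - n * ws t) x y z v (C2_C1 g Hg) Dc).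
  assert (OB := Avd_orbit g ws (fun t => n * wc t) x y z v (C2_C1 g Hg) Ds).
  assert (Sc : forall k w, (forall t, continuous w t) -> Av a b c g (fun t => k * w t) (x, y, z, v) = k * Av a b c g w (x, y, z, v)).
  { intros k w Hw; unfold Av.
    rewrite <- (RInt_scal (V := R_CompleteNormedModule) (fun t => g (rot a b c t (x, y, z, v)) * w t)) by (apply ex_RInt_Av; auto).
    apply RInt_ext; intros t _; unfold scal; cbn; unfold mult; cbn; asR; ring. }
  rewrite Sc in OA, OB by assumption; fold A B in OA, OB.
  specialize (OA (fun t => continuous_scal_r (- n) ws t (Cs t))).
  specialize (OB (fun t => continuous_scal_r n wc t (Cc t))).
  unfold wc at 1 2 in OA; rewrite Hc2, Rmult_0_r, cos_0 in OA; specialize (OA eq_refl Hnz).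
  unfold ws at 1 2 in OB; rewrite Hs2, Rmult_0_r, sin_0 in OB; specialize (OB eq_refl Hnz).
  (* The orbit has unit speed. With [OA] and [OB] this yields n^2 B^2 <= |grad A|^2 and n^2 A^2 <=
     |grad B|^2. *)
  assert (U : (- (a * y + b * z + c * v)) * (- (a * y + b * z + c * v)) + (a * x + b * v - c * z) * (a * x + b * v - c * z)
    + (b * x + c * y - a * v) * (b * x + c * y - a * v) + (c * x + a * z - b * y) * (c * x + a * z - b * y) = 1).
  { unfold onS3 in Hp; cbn in Hp.
    transitivity ((a * a + b * b + c * c) * (x * x + y * y + z * z + v * v)); [ring|rewrite Hu, Hp; ring]. }
  assert (KA := cauchy_schwarz4 _ _ _ _ (Avd g wc 0 (x, y, z, v)) (Avd g wc 1 (x, y, z, v)) (Avd g wc 2 (x, y, z, v)) (Avd g wc 3 (x, y, z, v)) U).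
  assert (KB := cauchy_schwarz4 _ _ _ _ (Avd g ws 0 (x, y, z, v)) (Avd g ws 1 (x, y, z, v)) (Avd g ws 2 (x, y, z, v)) (Avd g ws 3 (x, y, z, v)) U).
  rewrite OA in KA; rewrite OB in KB.
  set (p := (x, y, z, v)) in *.
  (* The four inequalities [H2] add up to |grad A|^2 + |grad B|^2 <= lam phi at the maximum, against
     the lower bound n^2 phi. *)
  assert (F : (n * n - lam) * phi p <= 0).
  { apply (Rmult_eq_compat_l (A p)) in LA; apply (Rmult_eq_compat_l (B p)) in LB.
    unfold phi; nra. }
  assert (P0 : phi p <= 0).
  { apply Rnot_lt_le; intros Hlt; assert (0 < (n * n - lam) * phi p) by (apply Rmult_lt_0_compat; lra); lra. }
  intros q Hq; assert (Hq0 := Hmax q Hq).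
  assert (Z : A q * A q + B q * B q <= 0) by (unfold phi in *; lra).
  pose proof (Rle_0_sqr (A q)); pose proof (Rle_0_sqr (B q)); unfold Rsqr in *.
  split; apply Rsqr_0_uniq; unfold Rsqr; fold A B; lra.
Qed.

End Fourier.

(** * Uniqueness of Fourier coefficients *)

Lemma ex_RInt_cont (f : R -> R) (l r : R) : (forall t, continuous f t) -> ex_RInt f l r.
Proof. intros H; apply (ex_RInt_continuous (V := R_CompleteNormedModule)); auto. Qed.

Lemma RInt_plusR (f g : R -> R) (l r : R) :
  ex_RInt f l r -> ex_RInt g l r -> RInt (fun t => f t + g t) l r = RInt f l r + RInt g l r.
Proof. intros Hf Hg; exact (RInt_plus (V := R_CompleteNormedModule) f g l r Hf Hg). Qed.

Lemma RInt_scalR (f : R -> R) (k l r : R) :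
  ex_RInt f l r -> RInt (fun t => k * f t) l r = k * RInt f l r.
Proof. intros Hf; exact (RInt_scal (V := R_CompleteNormedModule) f l r k Hf). Qed.

Lemma RInt_ChaslesR (f : R -> R) (l m r : R) :
  (forall t, continuous f t) -> RInt f l r = RInt f l m + RInt f m r.
Proof.
  intros H; symmetry; exact (RInt_Chasles (V := R_CompleteNormedModule) f l m r (ex_RInt_cont f l m H) (ex_RInt_cont f m r H)).
Qed.

Ltac cont1 :=
  match goal with
  | |- continuous ?f ?t => apply (ex_derive_continuous f); auto_derive; auto
  end.

Lemma continuous_multR (f g : R -> R) (t : R) :
  continuous f t -> continuous g t -> continuous (fun t => f t * g t) t.
Proof. apply (continuous_mult f g). Qed.
Lemma continuous_plusR (f g : R -> R) (t : R) :
  continuous f t -> continuous g t -> continuous (fun t => f t + g t) t.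
Proof. apply (continuous_plus f g). Qed.
Lemma continuous_minusR (f g : R -> R) (t : R) :
  continuous f t -> continuous g t -> continuous (fun t => f t - g t) t.
Proof. apply (continuous_minus f g). Qed.

Lemma RInt_periodic (f : R -> R) (T s : R) :
  (forall t, continuous f t) -> (forall t, f (t + T) = f t) -> RInt f s (s + T) = RInt f 0 T.
Proof.
  intros Hc Hp.
  rewrite (RInt_ChaslesR f s 0 (s + T)), (RInt_ChaslesR f 0 T (s + T)) by auto.
  assert (E : RInt f T (s + T) = RInt f 0 s).
  { transitivity (RInt (fun t => 1 * f (1 * t + T)) 0 s).
    - replace T with (1 * 0 + T) at 1 by ring; replace (s + T) with (1 * s + T) by ring.
      symmetry; apply (RInt_comp_lin (V := R_CompleteNormedModule) f 1 T 0 s), ex_RInt_cont, Hc.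
    - apply RInt_ext; intros t _; asR; rewrite !Rmult_1_l; apply Hp. }
  rewrite E.
  assert (E2 : RInt f s 0 = - RInt f 0 s).
  { symmetry; exact (opp_RInt_swap (V := R_CompleteNormedModule) f 0 s (ex_RInt_cont f 0 s Hc)). }
  lra.
Qed.

Lemma RInt_shift (f : R -> R) (T s : R) :
  (forall t, continuous f t) -> RInt (fun t => f (t + s)) 0 T = RInt f s (s + T).
Proof.
  intros Hc.
  pose proof (RInt_comp_lin (V := R_CompleteNormedModule) f 1 s 0 T (ex_RInt_cont f _ _ Hc)) as E.
  replace (1 * 0 + s) with s in E by ring; replace (1 * T + s) with (s + T) in E by ring.
  rewrite <- E; apply RInt_ext; intros t _; unfold scal; cbn; unfold mult; cbn; asR; now rewrite !Rmult_1_l.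
Qed.

(** Integer frequencies, so that multiplication by cos t, which shifts n by 1 both ways, stays
    within the family. *)
Definition no_fourier (f : R -> R) : Prop := forall n : Z,
  RInt (fun t => f t * cos (IZR n * t)) 0 (2 * PI) = 0 /\ RInt (fun t => f t * sin (IZR n * t)) 0 (2 * PI) = 0.

Lemma continuous_cosn (n : Z) (t : R) : continuous (fun t => cos (IZR n * t)) t.
Proof. cont1. Qed.
Lemma continuous_sinn (n : Z) (t : R) : continuous (fun t => sin (IZR n * t)) t.
Proof. cont1. Qed.

Lemma no_fourier_mult (f : R -> R) (k : R) :
  (forall t, continuous f t) -> no_fourier f -> no_fourier (fun t => f t * (k - cos t)).
Proof.
  intros Hc Hf n.
  assert (X : forall m, ex_RInt (fun t => f t * cos (IZR m * t)) 0 (2 * PI)).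
  { intros m; apply ex_RInt_cont; intros t; apply continuous_multR; auto using continuous_cosn. }
  assert (Y : forall m, ex_RInt (fun t => f t * sin (IZR m * t)) 0 (2 * PI)).
  { intros m; apply ex_RInt_cont; intros t; apply continuous_multR; auto using continuous_sinn. }
  assert (SX : forall k m, ex_RInt (fun t => k * (f t * cos (IZR m * t))) 0 (2 * PI)).
  { intros k' m; apply (ex_RInt_scal (V := R_NormedModule) (fun t => f t * cos (IZR m * t))), X. }
  assert (SY : forall k m, ex_RInt (fun t => k * (f t * sin (IZR m * t))) 0 (2 * PI)).
  { intros k' m; apply (ex_RInt_scal (V := R_NormedModule) (fun t => f t * sin (IZR m * t))), Y. }
  destruct (Hf n) as [C0 S0]; destruct (Hf (n + 1)%Z) as [C1 S1]; destruct (Hf (n - 1)%Z) as [C2 S2].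
  split.
  - transitivity (RInt (fun t => (k * (f t * cos (IZR n * t)) + - / 2 * (f t * cos (IZR (n + 1) * t)))
       + - / 2 * (f t * cos (IZR (n - 1) * t))) 0 (2 * PI)).
    + apply RInt_ext; intros t _; asR; rewrite plus_IZR, minus_IZR, Rmult_plus_distr_r, Rmult_minus_distr_r, Rmult_1_l, cos_plus, cos_minus; field.
    + rewrite RInt_plusR, RInt_plusR, !RInt_scalR, C0, C1, C2; auto; try (asR; ring).
      apply (ex_RInt_plus (V := R_NormedModule) (fun t => k * (f t * cos (IZR n * t)))); auto.
  - transitivity (RInt (fun t => (k * (f t * sin (IZR n * t)) + - / 2 * (f t * sin (IZR (n + 1) * t)))
       + - / 2 * (f t * sin (IZR (n - 1) * t))) 0 (2 * PI)).
    + apply RInt_ext; intros t _; asR; rewrite plus_IZR, minus_IZR, Rmult_plus_distr_r, Rmult_minus_distr_r, Rmult_1_l, sin_plus, sin_minus; field.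
    + rewrite RInt_plusR, RInt_plusR, !RInt_scalR, S0, S1, S2; auto; try (asR; ring).
      apply (ex_RInt_plus (V := R_NormedModule) (fun t => k * (f t * sin (IZR n * t)))); auto.
Qed.

(** If f were positive at PI, multiplying by a high power of a trigonometric polynomial peaked there
    would make the integral of the product large, although all these integrals vanish. PI is chosen
    as the midpoint of the interval of integration. *)
Lemma no_fourier_PI (f : R -> R) :
  (forall t, continuous f t) -> no_fourier f -> f PI <= 0.
Proof.
  intros Hc Hf; apply Rnot_lt_le; intros Hpos.
  assert (HPI := PI_RGT_0); assert (HPI4 := PI_4); assert (HP3 := PI2_3_2).
  set (eta := f PI / 2).
  assert (Heta : 0 < eta) by (unfold eta; lra).
  assert (Hc' : continuity_pt f PI) by apply continuity_pt_filterlim, Hc.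
  destruct (Hc' eta Heta) as [d0 [Hd0 B0]].
  set (d := Rmin d0 1 / 2).
  assert (Hd : 0 < d /\ d < d0 /\ d < 1) by (unfold d, Rmin; destruct Rle_dec; lra).
  assert (Hf1 : forall t, Rabs (t - PI) <= d -> eta <= f t).
  { intros t Ht; destruct (Req_dec t PI) as [->|Hn]; [unfold eta; lra|].
    assert (E : Rabs (f t - f PI) < eta).
    { apply B0; split; [split; [exact I|auto]|]; cbn; unfold Rdist; lra. }
    apply Rabs_def2 in E; unfold eta in *; lra. }
  assert (HM : exists M, 0 < M /\ forall t, 0 <= t <= 2 * PI -> Rabs (f t) <= M).
  { destruct (continuity_ab_maj (fun t => Rabs (f t)) 0 (2 * PI)) as [m [Hm _]]; [lra| |].
    - intros t _; apply (continuity_pt_comp f Rabs); [apply continuity_pt_filterlim, Hc|apply Rcontinuity_abs].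
    - exists (Rabs (f m) + 1); split; [pose proof (Rabs_pos (f m)); lra|].
      intros t Ht; specialize (Hm t Ht); lra. }
  destruct HM as [M [HM0 HM]].
  (* The peaked factor: at least 1 within d of PI, at least 1 + rho within d / 2, and at most 1 in
     absolute value on the rest of the period. *)
  set (kap := fun t => (1 - cos d) - cos t).
  set (rho := cos (d / 2) - cos d).
  assert (Hrho : 0 < rho) by (unfold rho; apply Rlt_0_minus, cos_decreasing_1; lra).
  assert (Hcosd : 0 < cos d) by (apply cos_gt_0; lra).
  assert (HcosPI : forall t, cos t = - cos (Rabs (t - PI))).
  { intros t; replace (cos (Rabs (t - PI))) with (cos (t - PI)).
    - rewrite cos_minus, cos_PI, sin_PI; ring.
    - unfold Rabs; destruct Rcase_abs; [now rewrite <- cos_neg|reflexivity]. }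
  assert (Kin : forall t, Rabs (t - PI) <= d -> 1 <= kap t).
  { intros t Ht; unfold kap; rewrite (HcosPI t).
    assert (cos d <= cos (Rabs (t - PI))) by (apply cos_decr_1; pose proof (Rabs_pos (t - PI)); lra). lra. }
  assert (Kin2 : forall t, Rabs (t - PI) <= d / 2 -> 1 + rho <= kap t).
  { intros t Ht; unfold kap, rho; rewrite (HcosPI t).
    assert (cos (d / 2) <= cos (Rabs (t - PI))) by (apply cos_decr_1; pose proof (Rabs_pos (t - PI)); lra). lra. }
  assert (Kout : forall t, 0 <= t <= 2 * PI -> d <= Rabs (t - PI) -> Rabs (kap t) <= 1).
  { intros t Ht Hdt; unfold kap; rewrite (HcosPI t).
    assert (HA : Rabs (t - PI) <= PI) by (apply Rabs_le; lra).
    assert (cos (Rabs (t - PI)) <= cos d) by (apply cos_decr_1; lra).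
    pose proof (COS_bound (Rabs (t - PI))); pose proof (COS_bound d). apply Rabs_le; lra. }
  set (K := fun N t => f t * kap t ^ N).
  assert (KC : forall N, forall t, continuous (K N) t).
  { intros N t; apply continuous_multR; auto. unfold kap; cont1. }
  assert (KF : forall N, no_fourier (K N)).
  { induction N as [|N IH].
    - replace (K 0%nat) with f; [exact Hf|]. apply functional_extensionality; intros t; unfold K; cbn; ring.
    - replace (K (S N)) with (fun t => K N t * ((1 - cos d) - cos t)); [now apply no_fourier_mult|].
      apply functional_extensionality; intros t; unfold K, kap; cbn; ring. }
  assert (KI : forall N, RInt (K N) 0 (2 * PI) = 0).
  { intros N; destruct (KF N 0%Z) as [E _]; etransitivity; [|exact E]; apply RInt_ext; intros t _; asR.
    rewrite Rmult_0_l, cos_0; ring. }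
  (* Adding M makes the function nonnegative on the whole period, with integral 2 PI M for every N,
     so the contribution near PI cannot exceed this. *)
  assert (Main : forall N, d * (eta * (1 + rho) ^ N) <= 2 * PI * M).
  { intros N; set (G := fun t => K N t + M).
    assert (GC : forall t, continuous G t).
    { intros t; apply continuous_plusR; auto; apply continuous_const. }
    assert (GI : RInt G 0 (2 * PI) = 2 * PI * M).
    { unfold G; rewrite RInt_plusR, KI, RInt_const by (apply ex_RInt_cont; auto; intros; apply continuous_const).
      unfold scal; cbn; unfold mult; cbn; ring. }
    assert (Gin : forall t, Rabs (t - PI) <= d -> 0 <= K N t).
    { intros t Ht; unfold K; specialize (Hf1 t Ht); specialize (Kin t Ht).
      apply Rmult_le_pos; [lra|apply pow_le; lra]. }
    assert (Gpos : forall t, 0 <= t <= 2 * PI -> 0 <= G t).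
    { intros t Ht; unfold G; destruct (Rle_dec (Rabs (t - PI)) d) as [Hle|Hle].
      - specialize (Gin t Hle); lra.
      - assert (E : Rabs (K N t) <= M).
        { unfold K; rewrite Rabs_mult, <- RPow_abs, <- (Rmult_1_r M).
          apply Rmult_le_compat; auto using Rabs_pos; [apply pow_le, Rabs_pos|].
          rewrite <- (pow1 N); apply pow_incr; split; [apply Rabs_pos|apply Kout; lra]. }
        apply Rabs_le_between in E; lra. }
    rewrite (RInt_ChaslesR G 0 (PI - d / 2) (2 * PI)), (RInt_ChaslesR G (PI - d / 2) (PI + d / 2) (2 * PI)) in GI by auto.
    assert (I1 : 0 <= RInt G 0 (PI - d / 2)).
    { apply RInt_ge_0; [lra|now apply ex_RInt_cont|]. intros t Ht; apply Gpos; lra. }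
    assert (I3 : 0 <= RInt G (PI + d / 2) (2 * PI)).
    { apply RInt_ge_0; [lra|now apply ex_RInt_cont|]. intros t Ht; apply Gpos; lra. }
    assert (I2 : d * (eta * (1 + rho) ^ N) <= RInt G (PI - d / 2) (PI + d / 2)).
    { replace (d * (eta * (1 + rho) ^ N)) with (RInt (fun _ => eta * (1 + rho) ^ N) (PI - d / 2) (PI + d / 2)).
      - apply RInt_le; [lra|apply ex_RInt_cont; intros; apply continuous_const|now apply ex_RInt_cont|].
        intros t Ht; unfold G, K.
        assert (Ht' : Rabs (t - PI) <= d / 2) by (apply Rabs_le; lra).
        assert (eta <= f t) by (apply Hf1; lra). specialize (Kin2 t Ht').
        assert ((1 + rho) ^ N <= kap t ^ N) by (apply pow_incr; lra).
        assert (0 <= (1 + rho) ^ N) by (apply pow_le; lra).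
        assert (eta * (1 + rho) ^ N <= f t * kap t ^ N) by (apply Rmult_le_compat; lra). lra.
      - rewrite RInt_const; unfold scal; cbn; unfold mult; cbn; field. }
    lra. }
  destruct (Pow_x_infinity (1 + rho)) with (b := 2 * PI * M / (d * eta) + 1) as [N HN].
  { rewrite Rabs_pos_eq; lra. }
  specialize (HN N (Nat.le_refl N)); rewrite Rabs_pos_eq in HN by (apply pow_le; lra).
  specialize (Main N).
  assert (Hde : 0 < d * eta) by (apply Rmult_lt_0_compat; lra).
  assert (d * eta * (2 * PI * M / (d * eta) + 1) <= d * eta * (1 + rho) ^ N) by (apply Rmult_le_compat_l; lra).
  replace (d * eta * (2 * PI * M / (d * eta) + 1)) with (2 * PI * M + d * eta) in H by (field; lra).
  lra.
Qed.

(** Translation preserves the vanishing of all coefficients, so any point can be moved to PI; the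
    one-sided bound for f and for -f gives equality. *)
Lemma fourier_unique (f : R -> R) :
  (forall t, continuous f t) -> (forall t, f (t + 2 * PI) = f t) -> no_fourier f -> forall t, f t = 0.
Proof.
  intros Hc Hp Hf t0.
  assert (G : forall h, (forall t, continuous h t) -> (forall t, h (t + 2 * PI) = h t) -> no_fourier h -> h t0 <= 0).
  { clear f Hc Hp Hf; intros f Hc Hp Hf.
    set (s := t0 - PI); replace (f t0) with ((fun t => f (t + s)) PI) by (unfold s; f_equal; ring).
    apply (no_fourier_PI (fun t => f (t + s))).
    - intros t; apply (continuous_comp (fun t => t + s) f); auto. cont1.
    - intros n.
      assert (P : forall t, cos (IZR n * (t + 2 * PI)) = cos (IZR n * t) /\ sin (IZR n * (t + 2 * PI)) = sin (IZR n * t)).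
      { intros t; rewrite Rmult_plus_distr_l; replace (IZR n * (2 * PI)) with (2 * IZR n * PI) by ring.
        rewrite cos_plus, sin_plus.
        replace (2 * IZR n * PI) with (IZR n * PI + IZR n * PI) by ring.
        rewrite cos_plus, sin_plus.
        assert (S0 : sin (IZR n * PI) = 0) by (apply sin_eq_0_1; now exists n).
        assert (C1 := sin2_cos2 (IZR n * PI)); unfold Rsqr in C1; rewrite S0 in *.
        replace (cos (IZR n * PI) * cos (IZR n * PI)) with 1 by lra. split; ring. }
      destruct (Hf n) as [C S].
      assert (FC : forall t, continuous (fun t => f t * cos (IZR n * t)) t) by (intros; apply continuous_multR; auto using continuous_cosn).
      assert (FS : forall t, continuous (fun t => f t * sin (IZR n * t)) t) by (intros; apply continuous_multR; auto using continuous_sinn).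
      rewrite <- (RInt_periodic _ _ s FC) in C by (intros t; now rewrite Hp, (proj1 (P t))).
      rewrite <- (RInt_periodic _ _ s FS) in S by (intros t; now rewrite Hp, (proj2 (P t))).
      rewrite <- RInt_shift in C, S by assumption.
      assert (FC' : ex_RInt (fun t => f (t + s) * cos (IZR n * (t + s))) 0 (2 * PI)).
      { apply ex_RInt_cont; intros t; apply (continuous_comp (fun t => t + s) (fun t => f t * cos (IZR n * t))); auto. cont1. }
      assert (FS' : ex_RInt (fun t => f (t + s) * sin (IZR n * (t + s))) 0 (2 * PI)).
      { apply ex_RInt_cont; intros t; apply (continuous_comp (fun t => t + s) (fun t => f t * sin (IZR n * t))); auto. cont1. }
      assert (Sc : forall (F : R -> R) k, ex_RInt F 0 (2 * PI) -> ex_RInt (fun t => k * F t) 0 (2 * PI)).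
      { intros F k; apply (ex_RInt_scal (V := R_NormedModule) F). }
      split.
      + transitivity (RInt (fun t => cos (IZR n * s) * (f (t + s) * cos (IZR n * (t + s))) + sin (IZR n * s) * (f (t + s) * sin (IZR n * (t + s)))) 0 (2 * PI)).
        * apply RInt_ext; intros t _; asR. replace (IZR n * t) with (IZR n * (t + s) - IZR n * s) by ring.
          rewrite cos_minus; ring.
        * rewrite RInt_plusR, !RInt_scalR, C, S; auto; asR; ring.
      + transitivity (RInt (fun t => cos (IZR n * s) * (f (t + s) * sin (IZR n * (t + s))) + - sin (IZR n * s) * (f (t + s) * cos (IZR n * (t + s)))) 0 (2 * PI)).
        * apply RInt_ext; intros t _; asR. replace (IZR n * t) with (IZR n * (t + s) - IZR n * s) by ring.
          rewrite sin_minus; ring.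
        * rewrite RInt_plusR, !RInt_scalR, C, S; auto; asR; ring. }
  apply Rle_antisym; [now apply G|].
  assert (- f t0 <= 0); [|lra].
  apply (G (fun t => - f t)).
  - intros t; apply (continuous_opp f), Hc.
  - intros t; now rewrite Hp.
  - intros n; destruct (Hf n) as [C S]; split.
    + transitivity (RInt (fun t => -1 * (f t * cos (IZR n * t))) 0 (2 * PI)); [apply RInt_ext; intros; asR; ring|].
      rewrite RInt_scalR, C; [asR; ring|]. apply ex_RInt_cont; intros; apply continuous_multR; auto using continuous_cosn.
    + transitivity (RInt (fun t => -1 * (f t * sin (IZR n * t))) 0 (2 * PI)); [apply RInt_ext; intros; asR; ring|].
      rewrite RInt_scalR, S; [asR; ring|]. apply ex_RInt_cont; intros; apply continuous_multR; auto using continuous_sinn.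
Qed.

Fixpoint trig (k : nat) (a b : nat -> R) (t : R) : R :=
  match k with
  | O => a O
  | S m => trig m a b t + (a (S m) * cos (INR (S m) * t) + b (S m) * sin (INR (S m) * t))
  end.

Lemma continuous_trig (k : nat) (a b : nat -> R) (t : R) : continuous (trig k a b) t.
Proof.
  induction k as [|k IH].
  - apply continuous_const.
  - apply (continuous_plusR (trig k a b)); [exact IH|]. cont1.
Qed.

Lemma sin_cos_period (n : Z) : cos (IZR n * (2 * PI)) = 1 /\ sin (IZR n * (2 * PI)) = 0.
Proof.
  replace (IZR n * (2 * PI)) with (2 * (IZR n * PI)) by ring.
  assert (S0 : sin (IZR n * PI) = 0) by (apply sin_eq_0_1; now exists n).
  rewrite cos_2a_sin, sin_2a, S0; split; ring.
Qed.

Lemma RInt_cosn (n : Z) : RInt (fun t => cos (IZR n * t)) 0 (2 * PI) = if Z.eqb n 0 then 2 * PI else 0.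
Proof.
  destruct (Z.eqb_spec n 0) as [->|Hn].
  - transitivity (RInt (fun _ => 1) 0 (2 * PI)).
    + apply RInt_ext; intros t _; asR; now rewrite Rmult_0_l, cos_0.
    + rewrite RInt_const; unfold scal; cbn; unfold mult; cbn; asR; ring.
  - assert (Hn' : IZR n <> 0) by (now apply not_0_IZR).
    apply is_RInt_unique.
    replace 0 with (minus (/ IZR n * sin (IZR n * (2 * PI))) (/ IZR n * sin (IZR n * 0))) at 2.
    + apply (is_RInt_derive (V := R_CompleteNormedModule) (fun t => / IZR n * sin (IZR n * t))).
      * intros t _; auto_derive; auto. field; auto.
      * intros t _; apply continuous_cosn.
    + rewrite (proj2 (sin_cos_period n)), !Rmult_0_r, sin_0; unfold minus, plus, opp; cbn; ring.
Qed.

Lemma RInt_sinn (n : Z) : RInt (fun t => sin (IZR n * t)) 0 (2 * PI) = 0.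
Proof.
  destruct (Z.eq_dec n 0) as [->|Hn].
  - transitivity (RInt (fun _ => 0) 0 (2 * PI)).
    + apply RInt_ext; intros t _; asR; now rewrite Rmult_0_l, sin_0.
    + rewrite RInt_const; unfold scal; cbn; unfold mult; cbn; asR; ring.
  - assert (Hn' : IZR n <> 0) by (now apply not_0_IZR).
    apply is_RInt_unique.
    replace 0 with (minus (- / IZR n * cos (IZR n * (2 * PI))) (- / IZR n * cos (IZR n * 0))) at 2.
    + apply (is_RInt_derive (V := R_CompleteNormedModule) (fun t => - / IZR n * cos (IZR n * t))).
      * intros t _; auto_derive; auto. field; auto.
      * intros t _; apply continuous_sinn.
    + rewrite (proj1 (sin_cos_period n)), Rmult_0_r, cos_0; unfold minus, plus, opp; cbn; ring.
Qed.

Lemma RInt_comb2 (f g h : R -> R) (x y : R) :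
  (forall t, h t = x * f t + y * g t) -> (forall t, continuous f t) -> (forall t, continuous g t) ->
  RInt h 0 (2 * PI) = x * RInt f 0 (2 * PI) + y * RInt g 0 (2 * PI).
Proof.
  intros E Hf Hg.
  transitivity (RInt (fun t => x * f t + y * g t) 0 (2 * PI)); [apply RInt_ext; intros t _; apply E|].
  assert (Sc : forall (F : R -> R) k, (forall t, continuous F t) -> ex_RInt (fun t => k * F t) 0 (2 * PI)).
  { intros F k HF; apply (ex_RInt_scal (V := R_NormedModule) F), ex_RInt_cont, HF. }
  rewrite RInt_plusR, !RInt_scalR by auto using ex_RInt_cont; reflexivity.
Qed.

Lemma RInt_trig (k : nat) (a b : nat -> R) (m : nat) :
  RInt (fun t => trig k a b t * cos (IZR (Z.of_nat m) * t)) 0 (2 * PI)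
    = (if Nat.leb m k then (if Nat.eqb m 0 then 2 * PI * a m else PI * a m) else 0) /\
  RInt (fun t => trig k a b t * sin (IZR (Z.of_nat m) * t)) 0 (2 * PI)
    = (if Nat.leb m k then (if Nat.eqb m 0 then 0 else PI * b m) else 0).
Proof.
  assert (Cm : forall t, continuous (fun t => cos (IZR (Z.of_nat m) * t)) t) by (intros; apply continuous_cosn).
  assert (Sm : forall t, continuous (fun t => sin (IZR (Z.of_nat m) * t)) t) by (intros; apply continuous_sinn).
  induction k as [|k [IHc IHs]].
  - cbn [trig]; rewrite !RInt_scalR, RInt_cosn, RInt_sinn by auto using ex_RInt_cont.
    destruct m as [|m]; cbn; split; asR; ring.
  - set (n := S k) in *; set (zn := Z.of_nat n); set (zm := Z.of_nat m).
    assert (P1 : forall t, continuous (fun t => cos (IZR (zn - zm) * t)) t) by (intros; apply continuous_cosn).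
    assert (P2 : forall t, continuous (fun t => cos (IZR (zn + zm) * t)) t) by (intros; apply continuous_cosn).
    assert (P3 : forall t, continuous (fun t => sin (IZR (zn - zm) * t)) t) by (intros; apply continuous_sinn).
    assert (P4 : forall t, continuous (fun t => sin (IZR (zn + zm) * t)) t) by (intros; apply continuous_sinn).
    assert (Cn : forall t, continuous (fun t => a n * cos (INR n * t) + b n * sin (INR n * t)) t) by (intros; cont1).
    assert (CC : RInt (fun t => cos (INR n * t) * cos (IZR zm * t)) 0 (2 * PI) = if Nat.eqb m n then PI else 0).
    { rewrite (RInt_comb2 (fun t => cos (IZR (zn - zm) * t)) (fun t => cos (IZR (zn + zm) * t)) _ (/ 2) (/ 2)); auto.
      - rewrite !RInt_cosn.
        replace (Z.eqb (zn + zm) 0) with false by (symmetry; apply Z.eqb_neq; unfold zn, zm; lia).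
        destruct (Nat.eqb_spec m n) as [->|Hmn].
        + replace (Z.eqb (zn - zm) 0) with true by (symmetry; apply Z.eqb_eq; unfold zn, zm; lia). asR; field.
        + replace (Z.eqb (zn - zm) 0) with false by (symmetry; apply Z.eqb_neq; unfold zn, zm; lia). asR; ring.
      - intros t; rewrite INR_IZR_INZ; fold zn; rewrite minus_IZR, plus_IZR, Rmult_minus_distr_r, Rmult_plus_distr_r, cos_minus, cos_plus; field. }
    assert (SS : RInt (fun t => sin (INR n * t) * sin (IZR zm * t)) 0 (2 * PI) = if Nat.eqb m n then PI else 0).
    { rewrite (RInt_comb2 (fun t => cos (IZR (zn - zm) * t)) (fun t => cos (IZR (zn + zm) * t)) _ (/ 2) (- / 2)); auto.
      - rewrite !RInt_cosn.
        replace (Z.eqb (zn + zm) 0) with false by (symmetry; apply Z.eqb_neq; unfold zn, zm; lia).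
        destruct (Nat.eqb_spec m n) as [->|Hmn].
        + replace (Z.eqb (zn - zm) 0) with true by (symmetry; apply Z.eqb_eq; unfold zn, zm; lia). asR; field.
        + replace (Z.eqb (zn - zm) 0) with false by (symmetry; apply Z.eqb_neq; unfold zn, zm; lia). asR; ring.
      - intros t; rewrite INR_IZR_INZ; fold zn; rewrite minus_IZR, plus_IZR, Rmult_minus_distr_r, Rmult_plus_distr_r, cos_minus, cos_plus; field. }
    assert (SC : RInt (fun t => sin (INR n * t) * cos (IZR zm * t)) 0 (2 * PI) = 0).
    { rewrite (RInt_comb2 (fun t => sin (IZR (zn - zm) * t)) (fun t => sin (IZR (zn + zm) * t)) _ (/ 2) (/ 2)); auto.
      - rewrite !RInt_sinn; asR; ring.
      - intros t; rewrite INR_IZR_INZ; fold zn; rewrite minus_IZR, plus_IZR, Rmult_minus_distr_r, Rmult_plus_distr_r, sin_minus, sin_plus; field. }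
    assert (CS : RInt (fun t => cos (INR n * t) * sin (IZR zm * t)) 0 (2 * PI) = 0).
    { rewrite (RInt_comb2 (fun t => sin (IZR (zn - zm) * t)) (fun t => sin (IZR (zn + zm) * t)) _ (- / 2) (/ 2)); auto.
      - rewrite !RInt_sinn; asR; ring.
      - intros t; rewrite INR_IZR_INZ; fold zn; rewrite minus_IZR, plus_IZR, Rmult_minus_distr_r, Rmult_plus_distr_r, sin_minus, sin_plus; field. }
    assert (T1 : forall F : R -> R, (forall t, continuous F t) -> RInt (fun t => trig n a b t * F t) 0 (2 * PI) =
        RInt (fun t => trig k a b t * F t) 0 (2 * PI) + (a n * RInt (fun t => cos (INR n * t) * F t) 0 (2 * PI)
          + b n * RInt (fun t => sin (INR n * t) * F t) 0 (2 * PI))).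
    { intros F HF.
      rewrite (RInt_comb2 (fun t => trig k a b t * F t) (fun t => (a n * cos (INR n * t) + b n * sin (INR n * t)) * F t) _ 1 1).
      - rewrite (RInt_comb2 (fun t => cos (INR n * t) * F t) (fun t => sin (INR n * t) * F t) (fun t => (a n * cos (INR n * t) + b n * sin (INR n * t)) * F t) (a n) (b n)).
        + asR; ring.
        + intros t; ring.
        + intros t; apply continuous_multR; auto; cont1.
        + intros t; apply continuous_multR; auto; cont1.
      - intros t; cbn [trig n]; fold n; ring.
      - intros t; apply continuous_multR; auto using continuous_trig.
      - intros t; apply continuous_multR; auto. }
    rewrite (T1 (fun t => cos (IZR zm * t))), (T1 (fun t => sin (IZR zm * t))), CC, SS, SC, CS by auto.
    fold zm in IHc, IHs; rewrite IHc, IHs.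
    destruct (Nat.leb_spec m k), (Nat.leb_spec m n), (Nat.eqb_spec m n), (Nat.eqb_spec m 0); try (unfold n in *; lia);
      subst; split; asR; ring.
Qed.

(** Subtracting the Fourier sum of order k leaves a function with no Fourier coefficient at all, to
    which uniqueness applies. *)
Lemma trig_of_fourier (f : R -> R) (k : nat) :
  (forall t, continuous f t) -> (forall t, f (t + 2 * PI) = f t) ->
  (forall n : nat, (k < n)%nat -> RInt (fun t => f t * cos (INR n * t)) 0 (2 * PI) = 0 /\
      RInt (fun t => f t * sin (INR n * t)) 0 (2 * PI) = 0) ->
  exists a b, forall t, f t = trig k a b t.
Proof.
  intros Hc Hp Hf.
  set (A := fun n : nat => RInt (fun t => f t * cos (IZR (Z.of_nat n) * t)) 0 (2 * PI)).
  set (B := fun n : nat => RInt (fun t => f t * sin (IZR (Z.of_nat n) * t)) 0 (2 * PI)).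
  (* The constant function has square integral 2 PI over the period, all other cosines and sines
     PI. *)
  set (a := fun n : nat => A n / (if Nat.eqb n 0 then 2 * PI else PI)); set (b := fun n => B n / PI).
  exists a, b.
  assert (HPI := PI_neq0).
  assert (Pt : forall t, trig k a b (t + 2 * PI) = trig k a b t).
  { intros t; clearbody a b; clear -a b; induction k as [|k IH]; [reflexivity|]; cbn [trig]; rewrite IH.
    destruct (sin_cos_period (Z.of_nat (S k))) as [c s]; rewrite <- INR_IZR_INZ in c, s.
    rewrite Rmult_plus_distr_l, cos_plus, sin_plus, c, s; ring. }
  assert (Z : forall t, f t - trig k a b t = 0).
  { apply (fourier_unique (fun t => f t - trig k a b t)).
    - intros t; apply continuous_minusR; auto using continuous_trig.
    - intros t; now rewrite Hp, Pt.
    - assert (N : forall n : nat, RInt (fun t => (f t - trig k a b t) * cos (IZR (Z.of_nat n) * t)) 0 (2 * PI) = 0 /\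
         RInt (fun t => (f t - trig k a b t) * sin (IZR (Z.of_nat n) * t)) 0 (2 * PI) = 0).
      { intros n.
        rewrite (RInt_comb2 (fun t => f t * cos (IZR (Z.of_nat n) * t)) (fun t => trig k a b t * cos (IZR (Z.of_nat n) * t))
            (fun t => (f t - trig k a b t) * cos (IZR (Z.of_nat n) * t)) 1 (-1));
          [|intros t; ring|intros t; apply continuous_multR; auto using continuous_cosn|intros t; apply continuous_multR; auto using continuous_cosn, continuous_trig].
        rewrite (RInt_comb2 (fun t => f t * sin (IZR (Z.of_nat n) * t)) (fun t => trig k a b t * sin (IZR (Z.of_nat n) * t))
            (fun t => (f t - trig k a b t) * sin (IZR (Z.of_nat n) * t)) 1 (-1));
          [|intros t; ring|intros t; apply continuous_multR; auto using continuous_sinn|intros t; apply continuous_multR; auto using continuous_sinn, continuous_trig].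
        destruct (RInt_trig k a b n) as [-> ->]; fold (A n) (B n).
        destruct (Nat.leb_spec n k) as [Hle|Hlt].
        - unfold a, b; destruct (Nat.eqb_spec n 0) as [->|_].
          + assert (B0 : B 0%nat = 0).
            { unfold B; transitivity (RInt (fun _ => 0) 0 (2 * PI)).
              - apply RInt_ext; intros t _; asR; cbn; rewrite Rmult_0_l, sin_0; ring.
              - rewrite RInt_const; unfold scal; cbn; unfold mult; cbn; asR; ring. }
            rewrite B0; split; asR; [field; auto|ring].
          + split; asR; field; auto.
        - destruct (Hf n Hlt) as [HA HB]; rewrite INR_IZR_INZ in HA, HB.
          fold (A n) in HA; fold (B n) in HB; rewrite HA, HB; split; asR; ring. }
      (* Negative frequencies reduce to positive ones by the parity of cosine and sine. *)
      intros n; destruct (Z_le_gt_dec 0 n) as [Hn|Hn].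
      + rewrite <- (Z2Nat.id n Hn); apply N.
      + destruct (N (Z.to_nat (- n))) as [N1 N2]; rewrite Z2Nat.id, opp_IZR in N1, N2 by lia.
        split.
        * etransitivity; [|exact N1]; apply RInt_ext; intros t _; asR; now rewrite Ropp_mult_distr_l_reverse, cos_neg.
        * transitivity (-1 * RInt (fun t => (f t - trig k a b t) * sin (- IZR n * t)) 0 (2 * PI)); [|rewrite N2; asR; ring].
          rewrite <- RInt_scalR.
          -- apply RInt_ext; intros t _; asR; rewrite Ropp_mult_distr_l_reverse, sin_neg; ring.
          -- apply ex_RInt_cont; intros t; apply continuous_multR; [|cont1].
             apply continuous_minusR; auto using continuous_trig. }
  intros t; specialize (Z t); lra.
Qed.

(** * Separately polynomial functions *)

(** Polynomial functions of degree at most d, with the top coefficient peeled off so that induction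
    lowers the bound. *)
Fixpoint polyfun (d : nat) (f : R -> R) : Prop :=
  match d with
  | O => exists c, forall s, f s = c
  | S d' => exists c f1, polyfun d' f1 /\ forall s, f s = c * s ^ (S d') + f1 s
  end.

Lemma polyfun_ext (d : nat) (f g : R -> R) : (forall s, f s = g s) -> polyfun d f -> polyfun d g.
Proof. intros E; replace g with f; auto; now apply functional_extensionality. Qed.

Lemma polyfun_const (d : nat) (k : R) : polyfun d (fun _ => k).
Proof.
  induction d as [|d IH]; [now exists k|].
  exists 0, (fun _ => k); split; [exact IH|intros s; ring].
Qed.

Lemma polyfun_plus (d : nat) : forall f g, polyfun d f -> polyfun d g -> polyfun d (fun s => f s + g s).
Proof.
  induction d as [|d IH]; intros f g.
  - intros [c Hc] [e He]; exists (c + e); intros s; now rewrite Hc, He.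
  - intros (c & f1 & Hf & Ec) (e & g1 & Hg & Ee); exists (c + e), (fun s => f1 s + g1 s).
    split; [now apply IH|]. intros s; rewrite Ec, Ee; ring.
Qed.

Lemma polyfun_scal (d : nat) (k : R) : forall f, polyfun d f -> polyfun d (fun s => k * f s).
Proof.
  induction d as [|d IH]; intros f.
  - intros [c Hc]; exists (k * c); intros s; now rewrite Hc.
  - intros (c & f1 & Hf & Ec); exists (k * c), (fun s => k * f1 s).
    split; [now apply IH|]. intros s; rewrite Ec; ring.
Qed.

Lemma polyfun_S (d : nat) (f : R -> R) : polyfun d f -> polyfun (S d) f.
Proof. intros H; exists 0, f; split; [exact H|intros s; ring]. Qed.

Lemma polyfun_id_mult (d : nat) : forall f, polyfun d f -> polyfun (S d) (fun s => s * f s).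
Proof.
  induction d as [|d IH]; intros f.
  - intros [c Hc]; exists c, (fun _ => 0); split; [now exists 0|]. intros s; rewrite Hc; cbn; ring.
  - intros (c & f1 & Hf & Ec); exists c, (fun s => s * f1 s).
    split; [now apply IH|]. intros s; rewrite Ec; cbn; ring.
Qed.

Lemma polyfun_pow (d : nat) : polyfun d (fun s => s ^ d).
Proof.
  induction d as [|d IH]; [now exists 1|].
  now apply (polyfun_id_mult d (fun s => s ^ d)).
Qed.

(** The product of s - j over the interpolation nodes j = 0, ..., d. *)
Fixpoint nodal (d : nat) (s : R) : R :=
  match d with O => s | S d' => (s - INR (S d')) * nodal d' s end.

Lemma nodal_monic (d : nat) : polyfun d (fun s => nodal d s - s ^ S d).
Proof.
  induction d as [|d IH].
  - exists 0; intros s; cbn; ring.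
  - apply polyfun_ext with (fun s => s * (nodal d s - s ^ S d) + (- INR (S d)) * ((nodal d s - s ^ S d) + s ^ S d)).
    { intros s; cbn [nodal pow]; ring. }
    apply polyfun_plus; [now apply (polyfun_id_mult d (fun s => nodal d s - s ^ S d))|].
    apply (polyfun_scal (S d)), (polyfun_plus (S d)); [now apply polyfun_S|apply polyfun_pow].
Qed.

Lemma nodal_root (d j : nat) : (j <= d)%nat -> nodal d (INR j) = 0.
Proof.
  induction d as [|d IH]; intros Hj.
  - replace j with 0%nat by lia; reflexivity.
  - cbn [nodal]; destruct (Nat.eq_dec j (S d)) as [->|Hn]; [rewrite Rminus_diag; ring|].
    rewrite IH by lia; ring.
Qed.

Lemma nodal_nonroot (d : nat) (s : R) : INR d < s -> 0 < nodal d s.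
Proof.
  revert s; induction d as [|d IH]; intros s Hs; [exact Hs|].
  cbn [nodal]; apply Rmult_lt_0_compat; [lra|apply IH]. rewrite S_INR in Hs; lra.
Qed.

Lemma sum_f_R0_ext (f g : nat -> R) (n : nat) :
  (forall j, (j <= n)%nat -> f j = g j) -> sum_f_R0 f n = sum_f_R0 g n.
Proof. intros H; apply sum_eq; exact H. Qed.

(** The point is that the [L j] do not depend on f, so the formula can be applied with parameters. A
    new node is added as in Newton interpolation: a multiple of [nodal d] is fitted without
    disturbing the old nodes. *)
Lemma lagrange (d : nat) : exists L : nat -> R -> R,
  (forall j, polyfun d (L j)) /\
  forall f, polyfun d f -> forall s, f s = sum_f_R0 (fun j => L j s * f (INR j)) d.
Proof.
  induction d as [|d (L & HL & HI)].
  - exists (fun _ _ => 1); split; [intros j; now exists 1|].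
    intros f [c Hc] s; cbn; rewrite !Hc; ring.
  - set (m := nodal d (INR (S d))).
    assert (Hm : m <> 0).
    { apply Rgt_not_eq, nodal_nonroot; rewrite S_INR; lra. }
    assert (HN : polyfun (S d) (nodal d)).
    { apply polyfun_ext with (fun s => (nodal d s - s ^ S d) + s ^ S d); [intros s; ring|].
      apply (polyfun_plus (S d)); [apply polyfun_S, nodal_monic|apply polyfun_pow]. }
    exists (fun j s => if Nat.eqb j (S d) then nodal d s / m else L j s + - L j (INR (S d)) * (nodal d s / m)).
    assert (HN' : polyfun (S d) (fun s => nodal d s / m)).
    { apply polyfun_ext with (fun s => / m * nodal d s); [intros s; unfold Rdiv; ring|]. now apply polyfun_scal. }
    split.
    + intros j; destruct (Nat.eqb j (S d)); [exact HN'|].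
      apply (polyfun_plus (S d)); [apply polyfun_S, HL|now apply polyfun_scal].
    + intros f (c & f1 & Hf1 & Ef) s.
      (* [f2] is f minus c times [nodal d]: its degree is at most d and it agrees with f at the
         nodes 0, ..., d. *)
      set (f2 := fun s => f1 s + - c * (nodal d s - s ^ S d)).
      assert (Hf2 : polyfun d f2).
      { apply polyfun_plus; [exact Hf1|]. apply (polyfun_scal d (- c)), nodal_monic. }
      assert (E2 : forall s, f s = c * nodal d s + f2 s) by (intros t; rewrite Ef; unfold f2; ring).
      assert (E3 : forall s, f2 s = sum_f_R0 (fun j => L j s * f (INR j)) d).
      { intros t; rewrite (HI f2 Hf2 t); apply sum_f_R0_ext; intros j Hj.
        rewrite (E2 (INR j)), (nodal_root d j Hj); ring. }
      assert (Ec : c = (f (INR (S d)) - f2 (INR (S d))) / m).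
      { rewrite E2; fold m; field; exact Hm. }
      cbn [sum_f_R0]; rewrite Nat.eqb_refl.
      rewrite (sum_f_R0_ext _ (fun j => L j s * f (INR j) + - (nodal d s / m) * (L j (INR (S d)) * f (INR j)))).
      * rewrite sum_plus, <- E3.
        rewrite (sum_f_R0_ext (fun l => - (nodal d s / m) * (L l (INR (S d)) * f (INR l))) (fun l => (L l (INR (S d)) * f (INR l)) * - (nodal d s / m)))
          by (intros; ring).
        rewrite <- scal_sum, <- E3, E2, Ec. field; exact Hm.
      * intros j Hj; replace (Nat.eqb j (S d)) with false by (symmetry; apply Nat.eqb_neq; lia). ring.
Qed.

Inductive RPol : (R4 -> R) -> Prop :=
| RPol_const k : RPol (fun _ => k)
| RPol_coord i : (i < 4)%nat -> RPol (coord i)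
| RPol_plus f g : RPol f -> RPol g -> RPol (fun p => f p + g p)
| RPol_mult f g : RPol f -> RPol g -> RPol (fun p => f p * g p).

Lemma RPol_ext (f g : R4 -> R) : (forall p, f p = g p) -> RPol f -> RPol g.
Proof. intros E; replace g with f; auto; now apply functional_extensionality. Qed.

Lemma RPol_pow (f : R4 -> R) (n : nat) : RPol f -> RPol (fun p => f p ^ n).
Proof. intros H; induction n as [|n IH]; [apply (RPol_const 1)|]. now apply (RPol_mult f (fun p => f p ^ n)). Qed.

Lemma RPol_polyfun (d i : nat) : (i < 4)%nat -> forall f, polyfun d f -> RPol (fun p => f (coord i p)).
Proof.
  intros Hi; induction d as [|d IH]; intros f.
  - intros [c Hc]; apply RPol_ext with (fun _ => c); [intros; now rewrite Hc|apply RPol_const].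
  - intros (c & f1 & Hf & Ec); apply RPol_ext with (fun p => c * coord i p ^ S d + f1 (coord i p)); [intros; now rewrite Ec|].
    apply (RPol_plus (fun p => c * coord i p ^ S d)); [|now apply IH].
    apply (RPol_mult (fun _ => c)); [apply RPol_const|]. now apply RPol_pow, RPol_coord.
Qed.

Lemma RPol_sum (F : nat -> R4 -> R) (n : nat) :
  (forall j, RPol (F j)) -> RPol (fun p => sum_f_R0 (fun j => F j p) n).
Proof.
  intros H; induction n as [|n IH]; [apply H|]. cbn. now apply (RPol_plus (fun p => sum_f_R0 (fun j => F j p) n)).
Qed.

(** Interpolating in one variable after another leaves only the values of [u] on the finite grid {0,
    ..., d}^4, with polynomial coefficients; the uniform degree bound makes the grid independent of
    the point. *)
Lemma separately_polynomial (d : nat) (u : R4 -> R) :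
  (forall p i, (i < 4)%nat -> polyfun d (fun s => u (upd i p s))) -> RPol u.
Proof.
  intros H; destruct (lagrange d) as (L & HL & HI).
  assert (Step : forall i p, (i < 4)%nat -> u p = sum_f_R0 (fun j => L j (coord i p) * u (upd i p (INR j))) d).
  { intros i p Hi; rewrite <- (upd_coord i p) at 1; apply (HI _ (H p i Hi)). }
  apply RPol_ext with (fun p => sum_f_R0 (fun j => L j (coord 0 p) * sum_f_R0 (fun k => L k (coord 1 p) *
     sum_f_R0 (fun l => L l (coord 2 p) * sum_f_R0 (fun m => L m (coord 3 p) * u (INR j, INR k, INR l, INR m)) d) d) d) d).
  { intros [[[x y] z] w]; symmetry; rewrite (Step 0%nat) by lia; apply sum_f_R0_ext; intros j _; f_equal; cbn [upd coord].
    rewrite (Step 1%nat) by lia; apply sum_f_R0_ext; intros k _; f_equal; cbn [upd coord].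
    rewrite (Step 2%nat) by lia; apply sum_f_R0_ext; intros l _; f_equal; cbn [upd coord].
    rewrite (Step 3%nat) by lia; apply sum_f_R0_ext; intros m _; f_equal; cbn [upd coord]. }
  assert (HC : forall i j, (i < 4)%nat -> RPol (fun p => L j (coord i p))).
  { intros i j Hi; exact (RPol_polyfun d i Hi _ (HL j)). }
  apply RPol_sum; intros j; apply RPol_mult; [apply HC; lia|].
  apply RPol_sum; intros k; apply RPol_mult; [apply HC; lia|].
  apply RPol_sum; intros l; apply RPol_mult; [apply HC; lia|].
  apply RPol_sum; intros m; apply RPol_mult; [apply HC; lia|]. apply RPol_const.
Qed.

(* Real and imaginary part of [(s + i rho)^n]. *)
Fixpoint pcs (rho : R) (n : nat) (s : R) : R * R :=
  match n with
  | O => (1, 0)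
  | S m => (s * fst (pcs rho m s) - rho * snd (pcs rho m s), s * snd (pcs rho m s) + rho * fst (pcs rho m s))
  end.

Lemma polyfun_pcs (rho : R) (n : nat) :
  polyfun n (fun s => fst (pcs rho n s)) /\ polyfun n (fun s => snd (pcs rho n s)).
Proof.
  induction n as [|n [IHc IHs]]; [split; cbn; eexists; reflexivity|]; cbn [pcs fst snd]; split.
  - apply polyfun_ext with (fun s => s * fst (pcs rho n s) + - rho * snd (pcs rho n s)); [intros; ring|].
    apply (polyfun_plus (S n)); [now apply (polyfun_id_mult n (fun s => fst (pcs rho n s)))|].
    now apply polyfun_S, polyfun_scal.
  - apply (polyfun_plus (S n)); [now apply (polyfun_id_mult n (fun s => snd (pcs rho n s)))|].
    now apply polyfun_S, polyfun_scal.
Qed.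

Lemma pcs_trig (rho r s t : R) (n : nat) : s = r * cos t -> rho = r * sin t ->
  pcs rho n s = (r ^ n * cos (INR n * t), r ^ n * sin (INR n * t)).
Proof.
  intros -> ->; induction n as [|n IH].
  - cbn; rewrite Rmult_0_l, cos_0, sin_0; f_equal; ring.
  - cbn [pcs]; rewrite IH; cbn [fst snd]; rewrite S_INR, Rmult_plus_distr_r, Rmult_1_l, cos_plus, sin_plus.
    cbn [pow]; f_equal; ring.
Qed.

Lemma polyfun_radial (rho : R) (m n : nat) (f : R -> R) :
  polyfun n f -> polyfun (2 * m + n) (fun s => (s * s + rho * rho) ^ m * f s).
Proof.
  intros H; induction m as [|m IH].
  - apply polyfun_ext with f; [intros; cbn; ring|exact H].
  - replace (2 * S m + n)%nat with (S (S (2 * m + n))) by lia.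
    apply polyfun_ext with (fun s => s * (s * ((s * s + rho * rho) ^ m * f s)) + rho * rho * ((s * s + rho * rho) ^ m * f s)).
    { intros s; cbn; ring. }
    apply (polyfun_plus (S (S (2 * m + n)))).
    + apply (polyfun_id_mult _ (fun s => s * ((s * s + rho * rho) ^ m * f s))).
      now apply (polyfun_id_mult _ (fun s => (s * s + rho * rho) ^ m * f s)).
    + now apply polyfun_S, polyfun_S, polyfun_scal.
Qed.

(** * Eigenfunctions are polynomials *)

Lemma rot_PI (a b c t : R) (p : R4) : rot a b c (t + PI) p = scale4 (-1) (rot a b c t p).
Proof.
  destruct p as [[[x y] z] w]; unfold rot, scale4; rewrite neg_cos, neg_sin.
  apply R4_eq; ring.
Qed.

Lemma scale4_scale4 (s t : R) (p : R4) : scale4 s (scale4 t p) = scale4 (s * t) p.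
Proof. destruct p as [[[x y] z] w]; cbn; apply R4_eq; ring. Qed.
Lemma scale4_1 (p : R4) : scale4 1 p = p.
Proof. destruct p as [[[x y] z] w]; cbn; apply R4_eq; ring. Qed.

Definition unit4 (i : nat) : R4 := upd i (0, 0, 0, 0) 1.

(** The part of g that the antipodal map multiplies by (-1)^d. *)
Definition parity_part (g : R4 -> R) (d : nat) (p : R4) : R := (g p + (-1) ^ d * g (scale4 (-1) p)) / 2.

(* The value at the origin is that of the constant when d = 0 and vanishes when d > 0. *)
Definition homog_ext (g : R4 -> R) (d : nat) (p : R4) : R :=
  sqrt (sqnorm4 p) ^ d * parity_part g d (if Req_dec_T (sqnorm4 p) 0 then unit4 0 else p).

Section Polynomial.
Context (g : R4 -> R) (k : nat) (Hg : C2_away0 g) (Hhom : homog0 g)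
  (Hlap : forall p, onS3 p -> lap4 g p = - (INR k * (INR k + 2)) * g p).

Lemma circle_trig (a b c : R) (p : R4) : a * a + b * b + c * c = 1 -> onS3 p ->
  exists u v, forall t, g (rot a b c t p) = trig k u v t.
Proof.
  intros Hu Hp; apply trig_of_fourier.
  - intros t; apply continuous_rot; auto. apply Hg, rot_nonzero, onS3_nonzero; auto.
  - intros t; replace (t + 2 * PI) with (t + PI + PI) by ring.
    rewrite !rot_PI, scale4_scale4; replace (-1 * -1) with 1 by ring; now rewrite scale4_1.
  - intros n Hn; destruct (sin_cos_period (Z.of_nat n)) as [E1 E2]; rewrite <- INR_IZR_INZ in E1, E2.
    apply (fourier_coefficients_vanish a b c Hu g (INR k * (INR k + 2)) (INR n)); auto.
    (* For n >= k + 1 one has n^2 >= k (k + 2) + 1, so the strict inequality holds. *)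
    apply le_INR in Hn; rewrite S_INR in Hn; pose proof (pos_INR k); nra.
Qed.

Lemma trig_PI (n : nat) (u v : nat -> R) (t : R) :
  trig n u v (t + PI) = trig n (fun j => (-1) ^ j * u j) (fun j => (-1) ^ j * v j) t.
Proof.
  induction n as [|n IH]; [cbn; ring|]; cbn [trig]; rewrite IH.
  assert (E : cos (INR (S n) * PI) = (-1) ^ S n /\ sin (INR (S n) * PI) = 0).
  { generalize (S n); induction n0 as [|m [Ec Es]]; [cbn; rewrite Rmult_0_l, cos_0, sin_0; auto|].
    rewrite S_INR, Rmult_plus_distr_r, Rmult_1_l, neg_cos, neg_sin, Ec, Es; cbn; split; ring. }
  destruct E as [Ec Es]; rewrite Rmult_plus_distr_l, cos_plus, sin_plus, Ec, Es; ring.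
Qed.

(** Half a period leads to the antipode and multiplies frequency j by (-1)^j, so only frequencies
    congruent to d mod 2 survive. *)
Lemma parity_trig (a b c : R) (p : R4) (d : nat) : a * a + b * b + c * c = 1 -> onS3 p ->
  exists u v, (forall j, Nat.even (d + j) = false -> u j = 0 /\ v j = 0) /\
    forall t, parity_part g d (rot a b c t p) = trig k u v t.
Proof.
  intros Hu Hp; destruct (circle_trig a b c p Hu Hp) as (u & v & E).
  exists (fun j => (1 + (-1) ^ (d + j)) / 2 * u j), (fun j => (1 + (-1) ^ (d + j)) / 2 * v j); split.
  - intros j Hj; assert (Od : Nat.odd (d + j) = true) by (unfold Nat.odd; now rewrite Hj).
    apply Nat.odd_spec in Od; destruct Od as [m ->].
    rewrite pow_add, pow_1_even; split; cbn; field.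
  - intros t; unfold parity_part; rewrite <- rot_PI, !E, trig_PI.
    clear E; generalize k; intros n; induction n as [|n IH].
    + cbn; rewrite pow_add; cbn; field.
    + cbn [trig]; replace (_ / 2) with ((trig n u v t + (-1) ^ d * trig n (fun j => (-1) ^ j * u j) (fun j => (-1) ^ j * v j) t) / 2
        + (u (S n) * cos (INR (S n) * t) + v (S n) * sin (INR (S n) * t) + (-1) ^ d * ((-1) ^ S n * u (S n) * cos (INR (S n) * t) + (-1) ^ S n * v (S n) * sin (INR (S n) * t))) / 2) by field.
      rewrite IH, pow_add; field.
Qed.

Lemma parity_homog0 (d : nat) : homog0 (parity_part g d).
Proof.
  intros s p Hs; unfold parity_part; rewrite Hhom by exact Hs.
  rewrite scale4_scale4, (Rmult_comm (-1) s), <- scale4_scale4, (Hhom s) by exact Hs; reflexivity.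
Qed.

Lemma parity_neg (d : nat) (p : R4) : parity_part g d (scale4 (-1) p) = (-1) ^ d * parity_part g d p.
Proof.
  unfold parity_part; rewrite scale4_scale4; replace (-1 * -1) with 1 by ring; rewrite scale4_1.
  assert ((-1) ^ d * (-1) ^ d = 1) by (rewrite <- Rpow_mult_distr; replace (-1 * -1) with 1 by ring; apply pow1).
  transitivity ((-1) ^ d * g p / 2 + ((-1) ^ d * (-1) ^ d) * g (scale4 (-1) p) / 2); [|field].
  rewrite H; field.
Qed.

Lemma unit4_onS3 (i : nat) : onS3 (unit4 i).
Proof. unfold onS3; destruct i as [|[|[|i]]]; cbn; ring. Qed.

(** For k = 0 trigonometric polynomials of degree 0 are constant on great circles, and a quarter
    turn leads from the first basis vector to each other one. This makes the value of [homog_ext] at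
    the origin consistent along all axes. *)
Lemma parity_unit (i : nat) : k = 0%nat -> (i < 4)%nat -> parity_part g 0 (unit4 0) = parity_part g 0 (unit4 i).
Proof.
  intros Hk Hi.
  assert (C : forall a b c, a * a + b * b + c * c = 1 -> parity_part g 0 (rot a b c (PI / 2) (unit4 0)) = parity_part g 0 (unit4 0)).
  { intros a b c Hu; destruct (parity_trig a b c (unit4 0) 0 Hu (unit4_onS3 0)) as (u & v & _ & E).
    assert (E0 : rot a b c 0 (unit4 0) = unit4 0).
    { unfold rot, unit4; cbn; rewrite cos_0, sin_0; apply R4_eq; ring. }
    rewrite <- E0 at 2; rewrite !E, Hk; reflexivity. }
  assert (X : forall a b c, rot a b c (PI / 2) (unit4 0) = (0, a, b, c)).
  { intros a b c; unfold rot, unit4; cbn; rewrite cos_PI2, sin_PI2; apply R4_eq; ring. }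
  destruct i as [|[|[|[|i]]]]; [reflexivity| | | |lia].
  - rewrite <- (C 1 0 0) by ring; now rewrite X.
  - rewrite <- (C 0 1 0) by ring; now rewrite X.
  - rewrite <- (C 0 0 1) by ring; now rewrite X.
Qed.

(** r^j cos(j t) and r^j sin(j t) are the real and imaginary parts of (s + i rho)^j. The leftover
    factor r^(d - j) is a power of s^2 + rho^2 exactly because d - j is even. *)
Lemma polyfun_trig_terms (rho : R) (d n : nat) (u v : nat -> R) : (n <= d)%nat ->
  (forall j, Nat.even (d + j) = false -> u j = 0 /\ v j = 0) ->
  exists f, polyfun d f /\ forall r s t, s = r * cos t -> rho = r * sin t -> r ^ d * trig n u v t = f s.
Proof.
  intros Hn Huv.
  assert (T : forall j, (j <= d)%nat -> exists f, polyfun d f /\ forall r s t, s = r * cos t -> rho = r * sin t ->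
     r ^ d * (u j * cos (INR j * t) + v j * sin (INR j * t)) = f s).
  { intros j Hj; destruct (Nat.even (d + j)) eqn:Ev.
    - assert (M : exists m, d = (2 * m + j)%nat).
      { apply Nat.even_spec in Ev; destruct Ev as [m Em]; exists (m - j)%nat; lia. }
      destruct M as [m ->]; destruct (polyfun_pcs rho j) as [Pc Ps].
      exists (fun s => (s * s + rho * rho) ^ m * (u j * fst (pcs rho j s) + v j * snd (pcs rho j s))); split.
      + apply (polyfun_radial rho m j (fun s => u j * fst (pcs rho j s) + v j * snd (pcs rho j s))).
        apply polyfun_plus; now apply polyfun_scal.
      + intros r s t Es Er; rewrite (pcs_trig rho r s t j Es Er); cbn [fst snd].
        replace (s * s + rho * rho) with (r ^ 2).
        * rewrite <- pow_mult, pow_add; ring.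
        * rewrite Es, Er; assert (Q := sin2_cos2 t); unfold Rsqr in Q.
          transitivity (r * r * (sin t * sin t + cos t * cos t)); [rewrite Q; ring|ring].
    - destruct (Huv j Ev) as [-> ->]; exists (fun _ => 0); split; [apply polyfun_const|intros; ring]. }
  induction n as [|n IH].
  - destruct (T 0%nat Hn) as (f & Hf & E); exists f; split; [exact Hf|].
    intros r s t Es Er; rewrite <- (E r s t Es Er); cbn; rewrite Rmult_0_l, cos_0, sin_0; ring.
  - destruct IH as (f1 & Hf1 & E1); [lia|]. destruct (T (S n) Hn) as (f2 & Hf2 & E2).
    exists (fun s => f1 s + f2 s); split; [now apply polyfun_plus|].
    intros r s t Es Er; rewrite <- (E1 r s t Es Er), <- (E2 r s t Es Er); cbn [trig]; ring.
Qed.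

Lemma homog_ext_nonzero (d : nat) (p : R4) : nonzero4 p ->
  homog_ext g d p = sqrt (sqnorm4 p) ^ d * parity_part g d p.
Proof. unfold homog_ext, nonzero4; intros H; destruct Req_dec_T; [contradiction|reflexivity]. Qed.

(** The line lies in the plane spanned by the i-th unit vector and its own foot q, whose unit circle
    is an orbit. In polar coordinates of that plane rho = r sin t is fixed on the line and s = r cos
    t runs. *)
Lemma homog_ext_line (d : nat) (p : R4) (i : nat) : (k <= d)%nat -> (i < 4)%nat ->
  polyfun d (fun s => homog_ext g d (upd i p s)).
Proof.
  intros Hd Hi; set (q := upd i p 0).
  assert (Hq : forall s, sqnorm4 (upd i p s) = s * s + sqnorm4 q).
  { intros s; unfold q; destruct p as [[[x y] z] w]; destruct i as [|[|[|[|i]]]]; cbn; ring. }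
  assert (Hq0 : 0 <= sqnorm4 q).
  { destruct q as [[[x y] z] w]; cbn; pose proof (Rle_0_sqr x); pose proof (Rle_0_sqr y);
    pose proof (Rle_0_sqr z); pose proof (Rle_0_sqr w); unfold Rsqr in *; lra. }
  destruct (Req_dec (sqnorm4 q) 0) as [Z|NZ].
  (* Here the line is an axis through the origin: homogeneity handles s > 0, antipodal parity s < 0,
     and s = 0 is the chosen value at the origin. *)
  - assert (U : forall s, upd i p s = scale4 s (unit4 i)).
    { intros s.
      assert (q = (0, 0, 0, 0)).
      { destruct q as [[[x y] z] w] eqn:Eq; apply NNPP; intros Hne.
        assert (nonzero4 (x, y, z, w)); [|unfold nonzero4 in *; contradiction].
        apply nonzero4_coord; destruct (Req_dec x 0), (Req_dec y 0), (Req_dec z 0), (Req_dec w 0); auto.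
        subst; now elim Hne. }
      rewrite <- (upd_upd i p 0 s); fold q; rewrite H.
      destruct i as [|[|[|[|i]]]]; cbn; apply R4_eq; ring. }
    apply polyfun_ext with (fun s => parity_part g d (unit4 i) * s ^ d).
    + intros s; destruct (Req_dec s 0) as [->|Hs].
      * unfold homog_ext; rewrite Hq, Z, Rmult_0_l, Rplus_0_l, sqrt_0.
        destruct Req_dec_T as [_|C]; [|now elim C].
        destruct d as [|d]; [|cbn; ring]. replace k with 0%nat by lia.
        rewrite <- (parity_unit i ltac:(lia) Hi); cbn; ring.
      * assert (Hn : nonzero4 (upd i p s)) by (unfold nonzero4; rewrite Hq, Z; nra).
        rewrite homog_ext_nonzero, Hq, Z, Rplus_0_r by exact Hn; rewrite U.
        replace (s * s) with (Rsqr s) by reflexivity; rewrite sqrt_Rsqr_abs.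
        destruct (Rlt_dec 0 s) as [Hp|Hp].
        -- rewrite (parity_homog0 d s _ Hp), Rabs_pos_eq by lra; ring.
        -- replace s with (- s * -1) at 3 by ring; rewrite <- scale4_scale4, (parity_homog0 d (- s)) by lra.
           rewrite parity_neg, Rabs_left by lra.
           replace (- s) with (-1 * s) by ring; rewrite Rpow_mult_distr.
           transitivity (((-1) ^ d * (-1) ^ d) * (s ^ d * parity_part g d (unit4 i))); [|ring].
           rewrite <- Rpow_mult_distr; replace (-1 * -1) with 1 by ring; rewrite pow1; ring.
    + apply polyfun_scal, polyfun_pow.
  - set (rho := sqrt (sqnorm4 q)).
    assert (Hrho : 0 < rho) by (apply sqrt_lt_R0; lra).
    assert (Hr2 : rho * rho = sqnorm4 q) by (apply sqrt_sqrt; lra).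
    (* the complex structure sending the i-th unit vector to q / rho *)
    assert (O : exists a b c, a * a + b * b + c * c = 1 /\
       forall t, rot a b c t (unit4 i) = upd i (scale4 (sin t / rho) q) (cos t)).
    (* In each case a i + b j + c k is the quaternion q e^(-1) / rho with e the i-th unit
       quaternion; it is imaginary because q is orthogonal to e. *)
    { unfold q in *; destruct p as [[[x y] z] w]; destruct i as [|[|[|[|i]]]]; [..|lia]; cbn in Hr2.
      - exists (y / rho), (z / rho), (w / rho); split.
        + transitivity ((rho * rho) / (rho * rho)); [rewrite Hr2 at 1; field; lra|field; lra].
        + intros t; unfold rot, unit4; cbn; apply R4_eq; field; lra.
      - exists (- x / rho), (- w / rho), (z / rho); split.
        + transitivity ((rho * rho) / (rho * rho)); [rewrite Hr2 at 1; field; lra|field; lra].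
        + intros t; unfold rot, unit4; cbn; apply R4_eq; field; lra.
      - exists (w / rho), (- x / rho), (- y / rho); split.
        + transitivity ((rho * rho) / (rho * rho)); [rewrite Hr2 at 1; field; lra|field; lra].
        + intros t; unfold rot, unit4; cbn; apply R4_eq; field; lra.
      - exists (- z / rho), (y / rho), (- x / rho); split.
        + transitivity ((rho * rho) / (rho * rho)); [rewrite Hr2 at 1; field; lra|field; lra].
        + intros t; unfold rot, unit4; cbn; apply R4_eq; field; lra. }
    destruct O as (a & b & c & Hu & Hrot).
    destruct (parity_trig a b c (unit4 i) d Hu (unit4_onS3 i)) as (u & v & Huv & E).
    destruct (polyfun_trig_terms rho d k u v Hd Huv) as (f & Hf & Ef).
    apply polyfun_ext with f; [|exact Hf]; intros s.
    set (r := sqrt (sqnorm4 (upd i p s))).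
    assert (Hrr : r * r = s * s + rho * rho) by (unfold r; rewrite sqrt_sqrt, Hq, Hr2; [reflexivity|rewrite Hq; nra]).
    assert (Hr : 0 < r) by (apply sqrt_lt_R0; rewrite Hq; nra).
    assert (Hb : -1 <= s / r <= 1).
    { assert (Rabs s <= r) by (apply Rabs_le; split; nra).
      apply Rabs_le_between. unfold Rdiv; rewrite Rabs_mult, Rabs_inv, (Rabs_pos_eq r) by lra.
      apply Rmult_le_reg_r with r; [exact Hr|]. rewrite Rmult_assoc, Rinv_l by lra; lra. }
    (* [acos] takes values with nonnegative sine, in agreement with rho > 0. *)
    set (t := acos (s / r)).
    assert (Hc : cos t = s / r) by (apply cos_acos; exact Hb).
    assert (Hs : sin t = rho / r).
    { unfold t; rewrite sin_acos by exact Hb.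
      replace (1 - (s / r)²) with (Rsqr (rho / r)).
      - apply sqrt_Rsqr, Rlt_le, Rdiv_lt_0_compat; assumption.
      - unfold Rsqr; transitivity ((r * r - s * s) / (r * r)); [rewrite Hrr at 1; field; lra|field; lra]. }
    symmetry; rewrite <- (Ef r s t) by (rewrite ?Hc, ?Hs; field; lra).
    rewrite homog_ext_nonzero by (unfold nonzero4; rewrite Hq; nra); fold r; f_equal.
    rewrite <- E, <- (parity_homog0 d r (rot a b c t (unit4 i)) Hr), Hrot; f_equal.
    unfold q; destruct p as [[[x y] z] w]; destruct i as [|[|[|[|i]]]]; [..|lia]; cbn; rewrite Hc, Hs;
      apply R4_eq; field; lra.
Qed.

(** The two antipodal parts of g are extended with degrees k and k + 1, the smallest degrees at
    least k of the two parities. Homogeneity is recorded for the factor 2 only, which suffices to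
    tell degrees apart. *)
Lemma eigenfunction_polynomial :
  exists u v, RPol u /\ RPol v /\
    (forall p, u (scale4 2 p) = 2 ^ k * u p) /\ (forall p, v (scale4 2 p) = 2 ^ S k * v p) /\
    forall p, onS3 p -> g p = u p + v p.
Proof.
  exists (homog_ext g k), (homog_ext g (S k)).
  assert (H2 : forall d p, homog_ext g d (scale4 2 p) = 2 ^ d * homog_ext g d p).
  { intros d p; unfold homog_ext; rewrite sqnorm4_scale, sqrt_mult_alt, sqrt_square, Rpow_mult_distr by lra.
    destruct (Req_dec_T (2 * 2 * sqnorm4 p) 0), (Req_dec_T (sqnorm4 p) 0); try (exfalso; lra); [ring|].
    rewrite (parity_homog0 d 2) by lra; ring. }
  repeat split; auto.
  - apply (separately_polynomial k); intros; now apply homog_ext_line.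
  - apply (separately_polynomial (S k)); intros; apply homog_ext_line; auto.
  - intros p Hp; rewrite !homog_ext_nonzero by (now apply onS3_nonzero).
    rewrite Hp, sqrt_1, !pow1; unfold parity_part; cbn [pow]; field.
Qed.

End Polynomial.

(** * Polynomials in alpha, beta and their conjugates *)

Definition alphab (p : R4) : CC := Cconj (alpha p).
Definition betab (p : R4) : CC := Cconj (beta p).

Lemma Ceq_ri (z w : CC) : fst z = fst w -> snd z = snd w -> z = w.
Proof. destruct z, w; cbn; now intros -> ->. Qed.

Inductive Pol : cfun -> Prop :=
| Pol_const c : Pol (fun _ => c)
| Pol_alpha : Pol alpha
| Pol_beta : Pol beta
| Pol_alphab : Pol alphab
| Pol_betab : Pol betab
| Pol_plus F G : Pol F -> Pol G -> Pol (fun p => F p + G p)%C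
| Pol_mult F G : Pol F -> Pol G -> Pol (fun p => F p * G p)%C.

Lemma Pol_ext (F G : cfun) : (forall p, F p = G p) -> Pol F -> Pol G.
Proof. intros E; replace G with F; auto; now apply functional_extensionality. Qed.

Lemma Pol_scal (c : CC) (F : cfun) : Pol F -> Pol (fun p => c * F p)%C.
Proof. apply (Pol_mult (fun _ => c)), Pol_const. Qed.

Lemma Pol_opp (F : cfun) : Pol F -> Pol (fun p => - F p)%C.
Proof. intros H; apply Pol_ext with (fun p => RtoC (-1) * F p)%C; [intros; ring|now apply Pol_scal]. Qed.

Lemma Pol_minus (F G : cfun) : Pol F -> Pol G -> Pol (fun p => F p - G p)%C.
Proof. intros HF HG; apply (Pol_plus F (fun p => - G p)%C HF), Pol_opp, HG. Qed.

Lemma Pol_pow (F : cfun) (n : nat) : Pol F -> Pol (fun p => F p ^ n)%C.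
Proof. intros H; induction n as [|n IH]; [apply (Pol_const 1)|]. now apply (Pol_mult F (fun p => F p ^ n)%C). Qed.

Lemma Pol_csum (n : nat) (F : nat -> cfun) : (forall j, (j < n)%nat -> Pol (F j)) -> Pol (fun p => csum n (fun j => F j p)).
Proof.
  induction n as [|n IH]; intros H; [apply (Pol_const 0)|].
  apply (Pol_plus (fun p => csum n (fun j => F j p)) (F n)); auto.
Qed.

(** [cpartial] is built on the total operator [Derive]; this relation carries the differentiability
    that makes its values meaningful. *)
Definition cderiv (i : nat) (F F' : cfun) : Prop := forall p,
  is_derive (fun t => Re (F (upd i p t))) (coord i p) (Re (F' p)) /\
  is_derive (fun t => Im (F (upd i p t))) (coord i p) (Im (F' p)).

Lemma cderiv_cpartial (i : nat) (F F' : cfun) : cderiv i F F' -> cpartial i F = F'.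
Proof.
  intros H; apply functional_extensionality; intros p; destruct (H p) as [H1 H2].
  apply Ceq_ri; now apply is_derive_unique.
Qed.

Lemma cderiv_const (i : nat) (c : CC) : cderiv i (fun _ => c) (fun _ => 0%C).
Proof. intros p; split; apply (is_derive_const (V := R_NormedModule)). Qed.

Lemma cderiv_plus (i : nat) (F G F' G' : cfun) :
  cderiv i F F' -> cderiv i G G' -> cderiv i (fun p => F p + G p)%C (fun p => F' p + G' p)%C.
Proof.
  intros HF HG p; destruct (HF p) as [F1 F2], (HG p) as [G1 G2]; split.
  - exact (is_derive_plus _ _ _ _ _ F1 G1).
  - exact (is_derive_plus _ _ _ _ _ F2 G2).
Qed.

Lemma cderiv_mult (i : nat) (F G F' G' : cfun) :
  cderiv i F F' -> cderiv i G G' ->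
  cderiv i (fun p => F p * G p)%C (fun p => F' p * G p + F p * G' p)%C.
Proof.
  intros HF HG p; destruct (HF p) as [F1 F2], (HG p) as [G1 G2].
  pose proof (is_derive_mult _ _ _ _ _ F1 G1 Rmult_comm) as D1.
  pose proof (is_derive_mult _ _ _ _ _ F2 G2 Rmult_comm) as D2.
  pose proof (is_derive_mult _ _ _ _ _ F1 G2 Rmult_comm) as D3.
  pose proof (is_derive_mult _ _ _ _ _ F2 G1 Rmult_comm) as D4.
  cbv beta in D1, D2, D3, D4; rewrite upd_coord in D1, D2, D3, D4; split.
  - pose proof (is_derive_minus _ _ _ _ _ D1 D2) as D.
    match type of D with is_derive _ _ ?l => replace (Re (F' p * G p + F p * G' p)%C) with l end; [exact D|].
    unfold minus, plus, opp, mult; cbn; unfold Re, Im; ring.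
  - pose proof (is_derive_plus _ _ _ _ _ D3 D4) as D.
    match type of D with is_derive _ _ ?l => replace (Im (F' p * G p + F p * G' p)%C) with l end; [exact D|].
    unfold plus, mult; cbn; unfold Re, Im; ring.
Qed.

Definition cd_alpha (i : nat) : CC := match i with 0%nat => 1%C | 1%nat => Ci | _ => 0%C end.
Definition cd_beta (i : nat) : CC := match i with 2%nat => 1%C | 3%nat => Ci | _ => 0%C end.

Lemma cderiv_alpha (i : nat) : (i < 4)%nat -> cderiv i alpha (fun _ => cd_alpha i).
Proof.
  intros Hi [[[x y] z] w]; destruct i as [|[|[|[|i]]]]; [..|lia]; cbn; split; auto_derive; auto.
Qed.
Lemma cderiv_beta (i : nat) : (i < 4)%nat -> cderiv i beta (fun _ => cd_beta i).
Proof.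
  intros Hi [[[x y] z] w]; destruct i as [|[|[|[|i]]]]; [..|lia]; cbn; split; auto_derive; auto.
Qed.
Lemma cderiv_conj (i : nat) (F F' : cfun) :
  cderiv i F F' -> cderiv i (fun p => Cconj (F p)) (fun p => Cconj (F' p)).
Proof.
  intros H p; destruct (H p) as [H1 H2]; split; cbn.
  - exact H1.
  - exact (is_derive_opp _ _ _ H2).
Qed.

Lemma Pol_cderiv (i : nat) (F : cfun) : (i < 4)%nat -> Pol F -> exists F', Pol F' /\ cderiv i F F'.
Proof.
  intros Hi; induction 1 as [c| | | | |F G _ (F' & PF & DF) _ (G' & PG & DG)|F G HF (F' & PF & DF) HG (G' & PG & DG)].
  - eexists; split; [|apply cderiv_const]; apply Pol_const.
  - eexists; split; [|now apply cderiv_alpha]; apply Pol_const.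
  - eexists; split; [|now apply cderiv_beta]; apply Pol_const.
  - eexists; split; [|now apply cderiv_conj, cderiv_alpha]; apply (Pol_const (Cconj (cd_alpha i))).
  - eexists; split; [|now apply cderiv_conj, cderiv_beta]; apply (Pol_const (Cconj (cd_beta i))).
  - eexists; split; [|apply cderiv_plus; eassumption]; now apply Pol_plus.
  - eexists; split; [|apply cderiv_mult; eassumption].
    apply (Pol_plus (fun p => F' p * G p)%C (fun p => F p * G' p)%C); now apply Pol_mult.
Qed.

Lemma cpartial_cderiv (i : nat) (F : cfun) : (i < 4)%nat -> Pol F -> cderiv i F (cpartial i F).
Proof. intros Hi HF; destruct (Pol_cderiv i F Hi HF) as (F' & _ & D); now rewrite (cderiv_cpartial _ _ _ D). Qed.

Lemma cpartial_Pol (i : nat) (F : cfun) : (i < 4)%nat -> Pol F -> Pol (cpartial i F).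
Proof. intros Hi HF; destruct (Pol_cderiv i F Hi HF) as (F' & P & D); now rewrite (cderiv_cpartial _ _ _ D). Qed.

(** The sum and product rules are asked on [Pol] only, since [Derive] returns arbitrary values where
    no derivative exists. *)
Record derivation (D : cfun -> cfun) : Prop := {
  der_pol : forall F, Pol F -> Pol (D F);
  der_const : forall c p, D (fun _ => c) p = 0%C;
  der_plus : forall F G p, Pol F -> Pol G -> D (fun q => F q + G q)%C p = (D F p + D G p)%C;
  der_mult : forall F G p, Pol F -> Pol G -> D (fun q => F q * G q)%C p = (D F p * G p + F p * D G p)%C }.

Lemma der_scal (D : cfun -> cfun) (c : CC) (F : cfun) (p : R4) :
  derivation D -> Pol F -> D (fun q => c * F q)%C p = (c * D F p)%C.
Proof.
  intros HD HF; rewrite (der_mult D HD (fun _ => c) F p (Pol_const c) HF), (der_const D HD); ring.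
Qed.

Lemma der_opp (D : cfun -> cfun) (F : cfun) (p : R4) :
  derivation D -> Pol F -> D (fun q => - F q)%C p = (- D F p)%C.
Proof.
  intros HD HF; replace (fun q => - F q)%C with (fun q => RtoC (-1) * F q)%C
    by (apply functional_extensionality; intros; ring).
  rewrite der_scal by assumption; ring.
Qed.

Lemma der_csum (D : cfun -> cfun) (n : nat) (F : nat -> cfun) (p : R4) :
  derivation D -> (forall j, (j < n)%nat -> Pol (F j)) ->
  D (fun q => csum n (fun j => F j q)) p = csum n (fun j => D (F j) p).
Proof.
  intros HD; induction n as [|n IH]; intros H; [apply (der_const D HD 0%C)|].
  cbn [csum]; rewrite (der_plus D HD (fun q => csum n (fun j => F j q)) (F n)), IH; auto using Pol_csum.
Qed.

Lemma derivation_cpartial (i : nat) : (i < 4)%nat -> derivation (cpartial i).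
Proof.
  intros Hi; constructor.
  - intros F; now apply cpartial_Pol.
  - intros c p; now rewrite (cderiv_cpartial _ _ _ (cderiv_const i c)).
  - intros F G p HF HG; now rewrite (cderiv_cpartial _ _ _ (cderiv_plus _ _ _ _ _ (cpartial_cderiv i F Hi HF) (cpartial_cderiv i G Hi HG))).
  - intros F G p HF HG; now rewrite (cderiv_cpartial _ _ _ (cderiv_mult _ _ _ _ _ (cpartial_cderiv i F Hi HF) (cpartial_cderiv i G Hi HG))).
Qed.

Definition der_comb (U V : cfun) (D1 D2 : cfun -> cfun) : cfun -> cfun :=
  fun F p => (U p * D1 F p + V p * D2 F p)%C.

Lemma derivation_comb (U V : cfun) (D1 D2 : cfun -> cfun) :
  Pol U -> Pol V -> derivation D1 -> derivation D2 -> derivation (der_comb U V D1 D2).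
Proof.
  intros HU HV H1 H2; constructor; unfold der_comb.
  - intros F HF; apply (Pol_plus (fun p => U p * D1 F p)%C (fun p => V p * D2 F p)%C);
      apply Pol_mult; auto; now apply der_pol.
  - intros c p; rewrite (der_const D1 H1), (der_const D2 H2); ring.
  - intros F G p HF HG; rewrite (der_plus D1 H1), (der_plus D2 H2) by assumption; ring.
  - intros F G p HF HG; rewrite (der_mult D1 H1), (der_mult D2 H2) by assumption; ring.
Qed.

Lemma derivation_ext (D D' : cfun -> cfun) :
  (forall F p, D F p = D' F p) -> derivation D -> derivation D'.
Proof.
  intros E HD; replace D' with D; auto.
  apply functional_extensionality; intros F; apply functional_extensionality; auto.
Qed.

Definition der_comm (D1 D2 : cfun -> cfun) : cfun -> cfun := fun F p => (D1 (D2 F) p - D2 (D1 F) p)%C.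

(** The cross terms of the two compositions cancel, so a commutator again obeys the product rule and
    is determined by the generators. *)
Lemma derivation_comm (D1 D2 : cfun -> cfun) :
  derivation D1 -> derivation D2 -> derivation (der_comm D1 D2).
Proof.
  intros H1 H2.
  assert (EP1 : forall F G, Pol F -> Pol G -> D1 (fun q => F q + G q)%C = (fun q => D1 F q + D1 G q)%C)
    by (intros; apply functional_extensionality; intros; now apply der_plus).
  assert (EP2 : forall F G, Pol F -> Pol G -> D2 (fun q => F q + G q)%C = (fun q => D2 F q + D2 G q)%C)
    by (intros; apply functional_extensionality; intros; now apply der_plus).
  assert (EM1 : forall F G, Pol F -> Pol G -> D1 (fun q => F q * G q)%C = (fun q => D1 F q * G q + F q * D1 G q)%C)
    by (intros; apply functional_extensionality; intros; now apply der_mult).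
  assert (EM2 : forall F G, Pol F -> Pol G -> D2 (fun q => F q * G q)%C = (fun q => D2 F q * G q + F q * D2 G q)%C)
    by (intros; apply functional_extensionality; intros; now apply der_mult).
  assert (EC1 : forall c, D1 (fun _ => c) = fun _ => 0%C) by (intros; apply functional_extensionality; intros; now apply der_const).
  assert (EC2 : forall c, D2 (fun _ => c) = fun _ => 0%C) by (intros; apply functional_extensionality; intros; now apply der_const).
  assert (P1 := der_pol D1 H1); assert (P2 := der_pol D2 H2).
  assert (PM := Pol_mult).
  constructor; unfold der_comm.
  - intros F HF; apply (Pol_minus (D1 (D2 F)) (D2 (D1 F))); auto.
  - intros c p; rewrite EC1, EC2, EC1, EC2; ring.
  - intros F G p HF HG; rewrite EP1, EP2, EP1, EP2 by auto; ring.
  - intros F G p HF HG; rewrite EM1, EM2 by auto.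
    rewrite EP1, EP2, !EM1, !EM2 by auto; ring.
Qed.

(** The tool for operator identities: it is enough to compare values on the four coordinate
    functions. *)
Lemma derivation_unique (D D' : cfun -> cfun) :
  derivation D -> derivation D' ->
  (forall p, D alpha p = D' alpha p) -> (forall p, D beta p = D' beta p) ->
  (forall p, D alphab p = D' alphab p) -> (forall p, D betab p = D' betab p) ->
  forall F, Pol F -> forall p, D F p = D' F p.
Proof.
  intros HD HD' Ha Hb Hab Hbb; induction 1 as [c| | | | |F G HF IF HG IG|F G HF IF HG IG]; auto; intros p.
  - now rewrite (der_const D HD), (der_const D' HD').
  - now rewrite (der_plus D HD), (der_plus D' HD'), IF, IG.
  - now rewrite (der_mult D HD), (der_mult D' HD'), IF, IG.
Qed.

Definition d_alphab (G : cfun) (p : R4) : CC := (/ 2 * (cpartial 0 G p + Ci * cpartial 1 G p))%C.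
Definition d_betab (G : cfun) (p : R4) : CC := (/ 2 * (cpartial 2 G p + Ci * cpartial 3 G p))%C.

Lemma derivation_wirt (i j : nat) (s : CC) (D : cfun -> cfun) : (i < 4)%nat -> (j < 4)%nat ->
  (forall F p, D F p = (/ 2 * (cpartial i F p + s * cpartial j F p))%C) -> derivation D.
Proof.
  intros Hi Hj E; apply derivation_ext with (der_comb (fun _ => / 2)%C (fun _ => / 2 * s)%C (cpartial i) (cpartial j)).
  - intros F p; rewrite E; unfold der_comb; ring.
  - apply derivation_comb; auto using Pol_const, derivation_cpartial.
Qed.

Lemma derivation_d_alpha : derivation d_alpha.
Proof. apply (derivation_wirt 0 1 (- Ci)%C); [lia|lia|]; intros; unfold d_alpha; ring. Qed.
Lemma derivation_d_beta : derivation d_beta.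
Proof. apply (derivation_wirt 2 3 (- Ci)%C); [lia|lia|]; intros; unfold d_beta; ring. Qed.
Lemma derivation_d_alphab : derivation d_alphab.
Proof. apply (derivation_wirt 0 1 Ci); [lia|lia|]; intros; unfold d_alphab; ring. Qed.
Lemma derivation_d_betab : derivation d_betab.
Proof. apply (derivation_wirt 2 3 Ci); [lia|lia|]; intros; unfold d_betab; ring. Qed.

Lemma cpartial_gens (i : nat) (p : R4) : (i < 4)%nat ->
  cpartial i alpha p = cd_alpha i /\ cpartial i beta p = cd_beta i /\
  cpartial i alphab p = Cconj (cd_alpha i) /\ cpartial i betab p = Cconj (cd_beta i).
Proof.
  intros Hi; repeat split.
  - now rewrite (cderiv_cpartial _ _ _ (cderiv_alpha i Hi)).
  - now rewrite (cderiv_cpartial _ _ _ (cderiv_beta i Hi)).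
  - change alphab with (fun p => Cconj (alpha p)).
    now rewrite (cderiv_cpartial _ _ _ (cderiv_conj _ _ _ (cderiv_alpha i Hi))).
  - change betab with (fun p => Cconj (beta p)).
    now rewrite (cderiv_cpartial _ _ _ (cderiv_conj _ _ _ (cderiv_beta i Hi))).
Qed.

Lemma wirtinger_gens (p : R4) :
  (d_alpha alpha p = 1 /\ d_alpha beta p = 0 /\ d_alpha alphab p = 0 /\ d_alpha betab p = 0 /\
   d_beta alpha p = 0 /\ d_beta beta p = 1 /\ d_beta alphab p = 0 /\ d_beta betab p = 0 /\
   d_alphab alpha p = 0 /\ d_alphab beta p = 0 /\ d_alphab alphab p = 1 /\ d_alphab betab p = 0 /\
   d_betab alpha p = 0 /\ d_betab beta p = 0 /\ d_betab alphab p = 0 /\ d_betab betab p = 1)%C.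
Proof.
  destruct (cpartial_gens 0 p ltac:(lia)) as (A0 & B0 & AB0 & BB0).
  destruct (cpartial_gens 1 p ltac:(lia)) as (A1 & B1 & AB1 & BB1).
  destruct (cpartial_gens 2 p ltac:(lia)) as (A2 & B2 & AB2 & BB2).
  destruct (cpartial_gens 3 p ltac:(lia)) as (A3 & B3 & AB3 & BB3).
  unfold d_alpha, d_beta, d_alphab, d_betab.
  rewrite A0, B0, AB0, BB0, A1, B1, AB1, BB1, A2, B2, AB2, BB2, A3, B3, AB3, BB3.
  repeat split; apply Ceq_ri; cbn; field.
Qed.

(** * Twist operators and bidegree *)

(** The complex conjugate of [twist_minus]; it trades a conjugated variable for an unconjugated
    one. *)
Definition twist_plus (G : cfun) : cfun := fun p => (- beta p * d_alphab G p + alpha p * d_betab G p)%C.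
Definition euler (G : cfun) : cfun := fun p => (alpha p * d_alpha G p + beta p * d_beta G p)%C.
Definition eulerb (G : cfun) : cfun := fun p => (alphab p * d_alphab G p + betab p * d_betab G p)%C.
(** One quarter of the Euclidean Laplacian of R^4. *)
Definition lapC (G : cfun) : cfun := fun p => (d_alpha (d_alphab G) p + d_beta (d_betab G) p)%C.

#[local] Hint Resolve derivation_d_alpha derivation_d_beta derivation_d_alphab derivation_d_betab
  Pol_const Pol_alpha Pol_beta Pol_alphab Pol_betab Pol_plus Pol_mult Pol_opp Pol_minus Pol_scal : pol.

Lemma derivation_twist_minus : derivation twist_minus.
Proof.
  apply derivation_ext with (der_comb (fun p => - betab p)%C alphab d_alpha d_beta).
  - intros F p; reflexivity.
  - apply derivation_comb; auto with pol.
Qed.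
Lemma derivation_twist_plus : derivation twist_plus.
Proof.
  apply derivation_ext with (der_comb (fun p => - beta p)%C alpha d_alphab d_betab).
  - intros F p; reflexivity.
  - apply derivation_comb; auto with pol.
Qed.
Lemma derivation_euler : derivation euler.
Proof. apply (derivation_comb alpha beta d_alpha d_beta); auto with pol. Qed.
Lemma derivation_eulerb : derivation eulerb.
Proof. apply (derivation_comb alphab betab d_alphab d_betab); auto with pol. Qed.

#[local] Hint Resolve derivation_twist_minus derivation_twist_plus derivation_euler derivation_eulerb : pol.

Lemma Pol_der (D : cfun -> cfun) (F : cfun) : derivation D -> Pol F -> Pol (D F).
Proof. intros HD; apply der_pol, HD. Qed.
#[local] Hint Resolve Pol_der : pol.

Ltac gens p := destruct (wirtinger_gens p) as
  (?Gaa & ?Gab & ?Gac & ?Gad & ?Gba & ?Gbb & ?Gbc & ?Gbd & ?Gca & ?Gcb & ?Gcc & ?Gcd & ?Gda & ?Gdb & ?Gdc & ?Gdd).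

Lemma twist_minus_gens (p : R4) :
  twist_minus alpha p = (- betab p)%C /\ twist_minus beta p = alphab p /\
  twist_minus alphab p = 0%C /\ twist_minus betab p = 0%C.
Proof.
  gens p; unfold twist_minus; rewrite Gaa, Gab, Gac, Gad, Gba, Gbb, Gbc, Gbd; unfold alphab, betab; repeat split; ring.
Qed.
Lemma twist_plus_gens (p : R4) :
  twist_plus alpha p = 0%C /\ twist_plus beta p = 0%C /\
  twist_plus alphab p = (- beta p)%C /\ twist_plus betab p = alpha p.
Proof.
  gens p; unfold twist_plus; rewrite Gca, Gcb, Gcc, Gcd, Gda, Gdb, Gdc, Gdd; repeat split; ring.
Qed.
Lemma euler_gens (p : R4) :
  euler alpha p = alpha p /\ euler beta p = beta p /\ euler alphab p = 0%C /\ euler betab p = 0%C.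
Proof.
  gens p; unfold euler; rewrite Gaa, Gab, Gac, Gad, Gba, Gbb, Gbc, Gbd; repeat split; ring.
Qed.
Lemma eulerb_gens (p : R4) :
  eulerb alpha p = 0%C /\ eulerb beta p = 0%C /\ eulerb alphab p = alphab p /\ eulerb betab p = betab p.
Proof.
  gens p; unfold eulerb; rewrite Gca, Gcb, Gcc, Gcd, Gda, Gdb, Gdc, Gdd; repeat split; ring.
Qed.

Ltac fext := apply functional_extensionality; intros.

(** The sl(2) relation [twist_+, twist_-] = Ebar - E. Both sides are derivations, so the four
    generators decide. *)
Lemma twist_comm (F : cfun) (p : R4) : Pol F ->
  twist_plus (twist_minus F) p = (twist_minus (twist_plus F) p + eulerb F p - euler F p)%C.
Proof.
  intros HF.
  assert (E : der_comm twist_plus twist_minus F p = der_comb (fun _ => 1%C) (fun _ => (- 1)%C) eulerb euler F p).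
  { apply derivation_unique; auto using derivation_comm, derivation_comb with pol; clear; intros p;
    unfold der_comm, der_comb;
    destruct (euler_gens p) as (Ea & Eb & Eab & Ebb), (eulerb_gens p) as (Fa & Fb & Fab & Fbb).
    - replace (twist_minus alpha) with (fun q => - betab q)%C by (fext; now rewrite (proj1 (twist_minus_gens _))).
      replace (twist_plus alpha) with (fun _ : R4 => RtoC 0) by (fext; now rewrite (proj1 (twist_plus_gens _))).
      rewrite der_opp, (der_const twist_minus), Ea, Fa by auto with pol.
      destruct (twist_plus_gens p) as (_ & _ & _ & ->); ring.
    - replace (twist_minus beta) with alphab by (fext; now destruct (twist_minus_gens x) as (_ & -> & _)).
      replace (twist_plus beta) with (fun _ : R4 => RtoC 0) by (fext; now destruct (twist_plus_gens x) as (_ & -> & _)).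
      rewrite (der_const twist_minus), Eb, Fb by auto with pol.
      destruct (twist_plus_gens p) as (_ & _ & -> & _); ring.
    - replace (twist_minus alphab) with (fun _ : R4 => RtoC 0) by (fext; now destruct (twist_minus_gens x) as (_ & _ & -> & _)).
      replace (twist_plus alphab) with (fun q => - beta q)%C by (fext; now destruct (twist_plus_gens x) as (_ & _ & -> & _)).
      rewrite der_opp, (der_const twist_plus), Eab, Fab by auto with pol.
      destruct (twist_minus_gens p) as (_ & -> & _); ring.
    - replace (twist_minus betab) with (fun _ : R4 => RtoC 0) by (fext; now destruct (twist_minus_gens x) as (_ & _ & _ & ->)).
      replace (twist_plus betab) with alpha by (fext; now destruct (twist_plus_gens x) as (_ & _ & _ & ->)).
      rewrite (der_const twist_plus), Ebb, Fbb by auto with pol.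
      destruct (twist_minus_gens p) as (-> & _); ring. }
  unfold der_comm, der_comb in E.
  replace (twist_plus (twist_minus F) p) with (twist_plus (twist_minus F) p - twist_minus (twist_plus F) p + twist_minus (twist_plus F) p)%C by ring.
  rewrite E; ring.
Qed.

Lemma d_comm (D1 D2 : cfun -> cfun) (F : cfun) (p : R4) :
  derivation D1 -> derivation D2 ->
  (forall H, In H (alpha :: beta :: alphab :: betab :: nil) -> exists c1 c2, D1 H = (fun _ => c1) /\ D2 H = (fun _ => c2)) ->
  Pol F -> D1 (D2 F) p = D2 (D1 F) p.
Proof.
  intros H1 H2 Hc HF.
  assert (E : der_comm D1 D2 F p = der_comb (fun _ => 0%C) (fun _ => 0%C) D1 D2 F p).
  { apply derivation_unique; auto using derivation_comm, derivation_comb with pol; clear p; intros p;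
    unfold der_comm, der_comb;
    [destruct (Hc alpha) as (c1 & c2 & -> & ->)|destruct (Hc beta) as (c1 & c2 & -> & ->)
    |destruct (Hc alphab) as (c1 & c2 & -> & ->)|destruct (Hc betab) as (c1 & c2 & -> & ->)];
    cbn; auto; rewrite (der_const D1 H1), (der_const D2 H2); ring. }
  unfold der_comm, der_comb in E.
  replace (D1 (D2 F) p) with (D1 (D2 F) p - D2 (D1 F) p + D2 (D1 F) p)%C by ring.
  rewrite E; ring.
Qed.

Lemma wirtinger_const (D : cfun -> cfun) (H : cfun) :
  In D (d_alpha :: d_beta :: d_alphab :: d_betab :: nil) ->
  In H (alpha :: beta :: alphab :: betab :: nil) -> exists c, D H = fun _ => c.
Proof.
  intros HD HH; cbn in HD, HH.
  destruct HD as [<-|[<-|[<-|[<-|[]]]]]; destruct HH as [<-|[<-|[<-|[<-|[]]]]];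
    first [exists 0%C; fext; gens x; assumption | exists 1%C; fext; gens x; assumption].
Qed.

Lemma wirtinger_comm (D1 D2 : cfun -> cfun) (F : cfun) (p : R4) :
  In D1 (d_alpha :: d_beta :: d_alphab :: d_betab :: nil) ->
  In D2 (d_alpha :: d_beta :: d_alphab :: d_betab :: nil) ->
  Pol F -> D1 (D2 F) p = D2 (D1 F) p.
Proof.
  intros H1 H2 HF.
  assert (W : forall D, In D (d_alpha :: d_beta :: d_alphab :: d_betab :: nil) -> derivation D).
  { intros D HD; cbn in HD; destruct HD as [<-|[<-|[<-|[<-|[]]]]]; auto with pol. }
  apply d_comm; auto.
  intros H HH; destruct (wirtinger_const D1 H H1 HH) as [c1 E1], (wirtinger_const D2 H H2 HH) as [c2 E2]; eauto.
Qed.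

(** The first-order terms of the product give - Ebar. In second order E Ebar removes from r^2 times
    the Laplacian its uncrossed terms, such as |alpha|^2 d_alpha d_alphab, and leaves those that the
    twists produce. *)
Lemma twist_minus_plus (F : cfun) (p : R4) : Pol F ->
  twist_minus (twist_plus F) p =
  ((alpha p * alphab p + beta p * betab p) * lapC F p - euler (eulerb F) p - eulerb F p)%C.
Proof.
  intros HF; gens p.
  assert (P1 := Pol_der d_alphab F derivation_d_alphab HF); assert (P2 := Pol_der d_betab F derivation_d_betab HF).
  assert (X : forall D, derivation D -> D (twist_plus F) p =
     (- (D beta p * d_alphab F p + beta p * D (d_alphab F) p) + (D alpha p * d_betab F p + alpha p * D (d_betab F) p))%C).
  { intros D HD; unfold twist_plus.
    rewrite (der_plus D HD (fun p => - beta p * d_alphab F p)%C (fun p => alpha p * d_betab F p)%C) by auto with pol.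
    rewrite (der_mult D HD (fun p => - beta p)%C), (der_mult D HD alpha), (der_opp D) by auto with pol; ring. }
  assert (Y : forall D, derivation D -> D (eulerb F) p =
     (D alphab p * d_alphab F p + alphab p * D (d_alphab F) p + (D betab p * d_betab F p + betab p * D (d_betab F) p))%C).
  { intros D HD; unfold eulerb.
    rewrite (der_plus D HD (fun p => alphab p * d_alphab F p)%C (fun p => betab p * d_betab F p)%C) by auto with pol.
    rewrite (der_mult D HD alphab), (der_mult D HD betab) by auto with pol; ring. }
  unfold twist_minus, euler; rewrite !X, !Y by auto with pol.
  rewrite Gaa, Gab, Gac, Gad, Gba, Gbb, Gbc, Gbd.
  unfold lapC, eulerb; fold (alphab p) (betab p); ring.
Qed.

(** Bihomogeneous polynomials of bidegree (a, b). Zero is put into every bidegree, so that an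
    operator may kill its argument without leaving the family. *)
Inductive BPol : nat -> nat -> cfun -> Prop :=
| BPol_0 a b : BPol a b (fun _ => 0%C)
| BPol_const c : BPol 0 0 (fun _ => c)
| BPol_alpha : BPol 1 0 alpha
| BPol_beta : BPol 1 0 beta
| BPol_alphab : BPol 0 1 alphab
| BPol_betab : BPol 0 1 betab
| BPol_plus a b F G : BPol a b F -> BPol a b G -> BPol a b (fun p => F p + G p)%C
| BPol_mult a b a' b' F G : BPol a b F -> BPol a' b' G -> BPol (a + a') (b + b') (fun p => F p * G p)%C.

Lemma BPol_Pol (a b : nat) (F : cfun) : BPol a b F -> Pol F.
Proof. induction 1; auto with pol. Qed.
#[local] Hint Resolve BPol_Pol : pol.

Lemma BPol_ext (a b : nat) (F G : cfun) : (forall p, F p = G p) -> BPol a b F -> BPol a b G.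
Proof. intros E; replace G with F; auto; now apply functional_extensionality. Qed.

Lemma BPol_eq (a b a' b' : nat) (F : cfun) : a = a' -> b = b' -> BPol a b F -> BPol a' b' F.
Proof. now intros -> ->. Qed.

Lemma BPol_scal (a b : nat) (c : CC) (F : cfun) : BPol a b F -> BPol a b (fun p => c * F p)%C.
Proof. exact (BPol_mult 0 0 a b (fun _ => c) F (BPol_const c)). Qed.

Lemma BPol_opp (a b : nat) (F : cfun) : BPol a b F -> BPol a b (fun p => - F p)%C.
Proof. intros H; apply BPol_ext with (fun p => RtoC (-1) * F p)%C; [intros; ring|now apply BPol_scal]. Qed.

Lemma BPol_minus (a b : nat) (F G : cfun) : BPol a b F -> BPol a b G -> BPol a b (fun p => F p - G p)%C.
Proof. intros HF HG; apply (BPol_plus a b F (fun p => - G p)%C HF), BPol_opp, HG. Qed.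

Lemma BPol_csum (a b n : nat) (F : nat -> cfun) :
  (forall j, (j < n)%nat -> BPol a b (F j)) -> BPol a b (fun p => csum n (fun j => F j p)).
Proof.
  induction n as [|n IH]; intros H; [apply BPol_0|].
  apply (BPol_plus a b (fun p => csum n (fun j => F j p)) (F n)); auto.
Qed.

Lemma BPol_pow (a b : nat) (F : cfun) (n : nat) : BPol a b F -> BPol (n * a) (n * b) (fun p => F p ^ n)%C.
Proof. intros H; induction n as [|n IH]; [apply (BPol_const 1)|]. now apply (BPol_mult a b (n * a) (n * b) F (fun p => F p ^ n)%C). Qed.

Definition INC (n : nat) : CC := RtoC (INR n).
Lemma INC_plus (m n : nat) : INC (m + n) = (INC m + INC n)%C.
Proof. unfold INC; now rewrite plus_INR, RtoC_plus. Qed.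
Lemma INC_S (n : nat) : INC (S n) = (INC n + 1)%C.
Proof. unfold INC; now rewrite S_INR, RtoC_plus. Qed.
Lemma INC_0 : INC 0 = 0%C.
Proof. reflexivity. Qed.
Lemma INC_inj (m n : nat) : INC m = INC n -> m = n.
Proof. unfold INC; intros E; apply INR_eq; now injection E. Qed.

Lemma BPol_euler (a b : nat) (F : cfun) : BPol a b F -> forall p,
  euler F p = (INC a * F p)%C /\ eulerb F p = (INC b * F p)%C.
Proof.
  induction 1 as [a b|c| | | | |a b F G HF IF HG IG|a b a' b' F G HF IF HG IG]; intros p.
  - rewrite (der_const euler), (der_const eulerb) by auto with pol; split; ring.
  - rewrite (der_const euler), (der_const eulerb), INC_0 by auto with pol; split; ring.
  - destruct (euler_gens p) as (-> & _), (eulerb_gens p) as (-> & _); unfold INC; cbn; split; ring.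
  - destruct (euler_gens p) as (_ & -> & _), (eulerb_gens p) as (_ & -> & _); unfold INC; cbn; split; ring.
  - destruct (euler_gens p) as (_ & _ & -> & _), (eulerb_gens p) as (_ & _ & -> & _); unfold INC; cbn; split; ring.
  - destruct (euler_gens p) as (_ & _ & _ & ->), (eulerb_gens p) as (_ & _ & _ & ->); unfold INC; cbn; split; ring.
  - rewrite (der_plus euler), (der_plus eulerb) by eauto with pol.
    destruct (IF p) as [-> ->], (IG p) as [-> ->]; split; ring.
  - rewrite (der_mult euler), (der_mult eulerb) by eauto with pol.
    destruct (IF p) as [-> ->], (IG p) as [-> ->]; rewrite !INC_plus; split; ring.
Qed.

(** Two clauses in place of truncated subtraction: bidegree (a, b + 1) goes to (a + 1, b), and
    polynomials without conjugated variables are killed. *)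
Lemma BPol_twist_plus (a b : nat) (F : cfun) : BPol a b F ->
  (b = 0%nat -> forall p, twist_plus F p = 0%C) /\
  (forall b', b = S b' -> BPol (S a) b' (twist_plus F)).
Proof.
  induction 1 as [a b|c| | | | |a b F G HF [IF0 IF] HG [IG0 IG]|a b a' b' F G HF [IF0 IF] HG [IG0 IG]].
  - split; [intros _ p; now apply (der_const twist_plus); auto with pol|].
    intros b' _; apply BPol_ext with (fun _ => 0%C); [|apply BPol_0].
    intros p; symmetry; apply (der_const twist_plus); auto with pol.
  - split; [intros _ p; apply (der_const twist_plus); auto with pol|discriminate].
  - split; [intros _ p; now destruct (twist_plus_gens p) as (-> & _)|discriminate].
  - split; [intros _ p; now destruct (twist_plus_gens p) as (_ & -> & _)|discriminate].
  - split; [discriminate|]. intros b' [= <-].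
    apply BPol_ext with (fun p => - beta p)%C; [intros p; now destruct (twist_plus_gens p) as (_ & _ & -> & _)|].
    apply BPol_opp, BPol_beta.
  - split; [discriminate|]. intros b' [= <-].
    apply BPol_ext with alpha; [intros p; now destruct (twist_plus_gens p) as (_ & _ & _ & ->)|apply BPol_alpha].
  - split.
    + intros Hb p; rewrite (der_plus twist_plus) by eauto with pol; rewrite IF0, IG0 by assumption; ring.
    + intros b' Hb; apply BPol_ext with (fun p => twist_plus F p + twist_plus G p)%C.
      * intros p; symmetry; apply (der_plus twist_plus); eauto with pol.
      * apply BPol_plus; auto.
  - split.
    + intros Hb p; rewrite (der_mult twist_plus) by eauto with pol; rewrite IF0, IG0 by lia; ring.
    + intros m Hb; apply BPol_ext with (fun p => twist_plus F p * G p + F p * twist_plus G p)%C.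
      * intros p; symmetry; apply (der_mult twist_plus); eauto with pol.
      * apply (BPol_plus (S (a + a')) m (fun p => twist_plus F p * G p)%C (fun p => F p * twist_plus G p)%C).
        (* A factor of degree 0 in the conjugated variables contributes a vanishing term, which
           counts as zero of the required bidegree. *)
        -- destruct b as [|b].
           ++ apply BPol_ext with (fun _ => 0%C); [intros p; rewrite IF0 by reflexivity; ring|apply BPol_0].
           ++ apply BPol_eq with (S a + a')%nat (b + b')%nat; [lia|lia|]. apply BPol_mult; auto.
        -- destruct b' as [|b'].
           ++ apply BPol_ext with (fun _ => 0%C); [intros p; rewrite IG0 by reflexivity; ring|apply BPol_0].
           ++ apply BPol_eq with (a + S a')%nat (b + b')%nat; [lia|lia|]. apply BPol_mult; auto.
Qed.

Lemma BPol_twist_minus (a b : nat) (F : cfun) : BPol a b F ->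
  (a = 0%nat -> forall p, twist_minus F p = 0%C) /\
  (forall a', a = S a' -> BPol a' (S b) (twist_minus F)).
Proof.
  induction 1 as [a b|c| | | | |a b F G HF [IF0 IF] HG [IG0 IG]|a b a' b' F G HF [IF0 IF] HG [IG0 IG]].
  - split; [intros _ p; now apply (der_const twist_minus); auto with pol|].
    intros b' _; apply BPol_ext with (fun _ => 0%C); [|apply BPol_0].
    intros p; symmetry; apply (der_const twist_minus); auto with pol.
  - split; [intros _ p; apply (der_const twist_minus); auto with pol|discriminate].
  - split; [discriminate|]. intros b' [= <-].
    apply BPol_ext with (fun p => - betab p)%C; [intros p; now destruct (twist_minus_gens p) as (-> & _)|].
    apply BPol_opp, BPol_betab.
  - split; [discriminate|]. intros b' [= <-].
    apply BPol_ext with alphab; [intros p; now destruct (twist_minus_gens p) as (_ & -> & _)|apply BPol_alphab].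
  - split; [intros _ p; now destruct (twist_minus_gens p) as (_ & _ & -> & _)|discriminate].
  - split; [intros _ p; now destruct (twist_minus_gens p) as (_ & _ & _ & ->)|discriminate].
  - split.
    + intros Hb p; rewrite (der_plus twist_minus) by eauto with pol; rewrite IF0, IG0 by assumption; ring.
    + intros m Hb; apply BPol_ext with (fun p => twist_minus F p + twist_minus G p)%C.
      * intros p; symmetry; apply (der_plus twist_minus); eauto with pol.
      * apply BPol_plus; auto.
  - split.
    + intros Hb p; rewrite (der_mult twist_minus) by eauto with pol; rewrite IF0, IG0 by lia; ring.
    + intros m Hb; apply BPol_ext with (fun p => twist_minus F p * G p + F p * twist_minus G p)%C.
      * intros p; symmetry; apply (der_mult twist_minus); eauto with pol.
      * apply (BPol_plus m (S (b + b')) (fun p => twist_minus F p * G p)%C (fun p => F p * twist_minus G p)%C).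
        -- destruct a as [|a].
           ++ apply BPol_ext with (fun _ => 0%C); [intros p; rewrite IF0 by reflexivity; ring|apply BPol_0].
           ++ apply BPol_eq with (a + a')%nat (S b + b')%nat; [lia|lia|]. apply BPol_mult; auto.
        -- destruct a' as [|a'].
           ++ apply BPol_ext with (fun _ => 0%C); [intros p; rewrite IG0 by reflexivity; ring|apply BPol_0].
           ++ apply BPol_eq with (a + a')%nat (b + S b')%nat; [lia|lia|]. apply BPol_mult; auto.
Qed.

Lemma BPol_scale (a b : nat) (F : cfun) : BPol a b F -> forall s p, F (scale4 s p) = (RtoC (s ^ (a + b)) * F p)%C.
Proof.
  assert (Sc : forall s p, alpha (scale4 s p) = (RtoC s * alpha p)%C /\ beta (scale4 s p) = (RtoC s * beta p)%C
     /\ alphab (scale4 s p) = (RtoC s * alphab p)%C /\ betab (scale4 s p) = (RtoC s * betab p)%C).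
  { intros s [[[x y] z] w]; repeat split; apply Ceq_ri; cbn; ring. }
  induction 1 as [a b|c| | | | |a b F G HF IF HG IG|a b a' b' F G HF IF HG IG]; intros s p;
    try destruct (Sc s p) as (Sa & Sb & Sab & Sbb).
  - ring.
  - cbn; ring.
  - rewrite Sa; cbn; rewrite Rmult_1_r; ring.
  - rewrite Sb; cbn; rewrite Rmult_1_r; ring.
  - rewrite Sab; cbn; rewrite Rmult_1_r; ring.
  - rewrite Sbb; cbn; rewrite Rmult_1_r; ring.
  - rewrite IF, IG; ring.
  - rewrite IF, IG. replace (a + a' + (b + b'))%nat with ((a + b) + (a' + b'))%nat by lia.
    rewrite (pow_add s (a + b)), RtoC_mult; ring.
Qed.

(** * Representation theory of the twist operators *)

Lemma csum_ext (n : nat) (f g : nat -> CC) : (forall j, (j < n)%nat -> f j = g j) -> csum n f = csum n g.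
Proof. induction n as [|n IH]; intros H; cbn; [reflexivity|]. rewrite IH, H; auto. Qed.
Lemma csum_0 (n : nat) : csum n (fun _ => 0%C) = 0%C.
Proof. induction n as [|n IH]; cbn; [reflexivity|]. rewrite IH; ring. Qed.
Lemma csum_plus (n : nat) (f g : nat -> CC) : csum n (fun j => f j + g j)%C = (csum n f + csum n g)%C.
Proof. induction n as [|n IH]; cbn; [ring|]. rewrite IH; ring. Qed.
Lemma csum_scal (n : nat) (c : CC) (f : nat -> CC) : csum n (fun j => c * f j)%C = (c * csum n f)%C.
Proof. induction n as [|n IH]; cbn; [ring|]. rewrite IH; ring. Qed.
Lemma csum_zero (n : nat) (f : nat -> CC) : (forall j, (j < n)%nat -> f j = 0%C) -> csum n f = 0%C.
Proof. intros H; rewrite (csum_ext n f (fun _ => 0%C) H); apply csum_0. Qed.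
Lemma csum_single (n b : nat) (x : CC) :
  csum n (fun j => if Nat.eqb j b then x else 0%C) = if Nat.ltb b n then x else 0%C.
Proof.
  induction n as [|n IH]; [reflexivity|]; cbn [csum]; rewrite IH.
  destruct (Nat.eqb_spec n b), (Nat.ltb_spec b n), (Nat.ltb_spec b (S n)); try lia; ring.
Qed.
Lemma csum_extend (n m : nat) (f : nat -> CC) : (n <= m)%nat ->
  (forall j, (n <= j)%nat -> f j = 0%C) -> csum m f = csum n f.
Proof. intros Hle H; induction Hle as [|m Hle IH]; [reflexivity|]. cbn; rewrite IH, H by exact Hle; ring. Qed.

Lemma Cmult_eq_0 (a b : CC) : (a * b = 0 -> a <> 0 -> b = 0)%C.
Proof.
  intros E Ha; replace b with (/ a * (a * b))%C by (field; exact Ha). rewrite E; ring.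
Qed.

Lemma RtoC_neq_0 (x : R) : x <> 0 -> RtoC x <> 0%C.
Proof. intros H E; apply H; now injection E. Qed.

(** Eigenvectors with distinct eigenvalues are independent. [L] is kept general because two
    instances occur: scaling by 2, which separates total degrees, and [eulerb], which separates
    bidegrees. *)
Lemma eigen_separate (L : cfun -> cfun) (mu : nat -> CC) (v : nat -> cfun) (n : nat) :
  (forall i j, (i < n)%nat -> (j < n)%nat -> mu i = mu j -> i = j) ->
  (forall c m p, (m <= n)%nat -> L (fun q => csum m (fun j => c j * v j q)%C) p = csum m (fun j => c j * L (v j) p)%C) ->
  (forall j p, (j < n)%nat -> L (v j) p = (mu j * v j p)%C) ->
  (forall p, csum n (fun j => v j p) = 0%C) -> forall j p, (j < n)%nat -> v j p = 0%C.
Proof.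
  intros Hinj HL Hv H0.
  assert (G : forall m, (m <= n)%nat -> forall c, (forall p, csum m (fun j => c j * v j p)%C = 0%C) ->
            forall j p, (j < m)%nat -> (c j * v j p = 0)%C).
  { induction m as [|m IH]; intros Hm c Hc j p Hj; [lia|].
    assert (H1 : forall p, csum (S m) (fun j => c j * mu j * v j p)%C = 0%C).
    { intros q.
      rewrite (csum_ext (S m) _ (fun j => c j * L (v j) q)%C) by (intros i Hi; rewrite Hv by lia; ring).
      rewrite <- HL by exact Hm.
      transitivity (L (fun q0 => csum (S m) (fun j0 => RtoC 0 * v j0 q0)%C) q).
      - f_equal; fext; rewrite Hc, csum_zero; auto; intros; ring.
      - rewrite HL by exact Hm; apply csum_zero; intros; ring. }
    assert (IHm : forall j p, (j < m)%nat -> (c j * v j p = 0)%C).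
    { intros i q Hi.
      assert (E : (c i * (mu i - mu m) * v i q = 0)%C).
      (* Applying L - mu m to the relation removes its last term. *)
      { apply (IH ltac:(lia) (fun i => c i * (mu i - mu m))%C); [|exact Hi]; intros r.
        transitivity (csum (S m) (fun j => c j * mu j * v j r)%C - mu m * csum (S m) (fun j => c j * v j r)%C)%C.
        - cbn [csum]; rewrite (csum_ext m _ (fun j => c j * mu j * v j r + - mu m * (c j * v j r))%C) by (intros; ring).
          rewrite csum_plus, csum_scal; ring.
        - rewrite H1, Hc; ring. }
      apply (Cmult_eq_0 (mu i - mu m)).
      - rewrite <- E; ring.
      - intros Z; assert (X : mu i = mu m) by (replace (mu i) with (mu i - mu m + mu m)%C by ring; rewrite Z; ring).
        apply Hinj in X; lia. }
    destruct (Nat.eq_dec j m) as [->|Hn]; [|apply IHm; lia].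
    specialize (Hc p); cbn in Hc; rewrite csum_zero in Hc by (intros i Hi; now apply IHm).
    rewrite <- Hc; ring. }
  intros j p Hj; transitivity (1 * v j p)%C; [ring|].
  apply (G n (Nat.le_refl n) (fun _ => 1%C)); [|exact Hj].
  intros q; rewrite <- (H0 q); apply csum_ext; intros; ring.
Qed.

Lemma der_iter_Pol (D : cfun -> cfun) (F : cfun) (j : nat) : derivation D -> Pol F -> Pol (Nat.iter j D F).
Proof. intros HD HF; induction j as [|j IH]; cbn; auto; now apply der_pol. Qed.
#[local] Hint Resolve der_iter_Pol : pol.

Lemma der_iter_scal (D : cfun -> cfun) (c : CC) (F : cfun) (j : nat) : derivation D -> Pol F ->
  Nat.iter j D (fun p => c * F p)%C = (fun p => c * Nat.iter j D F p)%C.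
Proof.
  intros HD HF; induction j as [|j IH]; [reflexivity|]; cbn [Nat.iter nat_rect]; fold (Nat.iter j D).
  change (D (Nat.iter j D (fun p => c * F p)%C) = (fun p => c * D (Nat.iter j D F) p)%C).
  rewrite IH; fext; apply der_scal; auto with pol.
Qed.

Lemma der_iter_csum (D : cfun -> cfun) (n : nat) (F : nat -> cfun) (j : nat) : derivation D ->
  (forall i, (i < n)%nat -> Pol (F i)) ->
  Nat.iter j D (fun p => csum n (fun i => F i p)) = (fun p => csum n (fun i => Nat.iter j D (F i) p)).
Proof.
  intros HD HF; induction j as [|j IH]; [reflexivity|].
  change (D (Nat.iter j D (fun p => csum n (fun i => F i p))) = (fun p => csum n (fun i => D (Nat.iter j D (F i)) p))).
  rewrite IH; fext; apply (der_csum D n (fun i => Nat.iter j D (F i))); auto with pol.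
Qed.

Lemma der_zero (D : cfun -> cfun) (F : cfun) : derivation D -> (forall p, F p = 0%C) -> forall p, D F p = 0%C.
Proof.
  intros HD H p; replace F with (fun _ : R4 => RtoC 0) by (fext; now rewrite H). apply (der_const D HD).
Qed.

Lemma der_iter_zero (D : cfun -> cfun) (F : cfun) (j : nat) : derivation D -> (forall p, F p = 0%C) ->
  forall p, Nat.iter j D F p = 0%C.
Proof. intros HD H; induction j as [|j IH]; auto; intros p. apply (der_zero D); auto. Qed.

Lemma sibling_S (f : cfun) (j : nat) : sibling f (S j) = twist_minus (sibling f j).
Proof. reflexivity. Qed.

Lemma sibling_BPol (k : nat) (f : cfun) (j : nat) : BPol k 0 f -> (j <= k)%nat -> BPol (k - j) j (sibling f j).
Proof.
  intros Hf; induction j as [|j IH]; intros Hj.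
  - apply BPol_eq with k 0%nat; [lia|reflexivity|exact Hf].
  - rewrite sibling_S; apply (proj2 (BPol_twist_minus _ _ _ (IH ltac:(lia)))); lia.
Qed.

(** The highest-weight computation: moving [twist_plus] past each [twist_minus] costs a commutator 2
    i - k, and the sum over i = 0, ..., j is - (j + 1)(k - j). *)
Lemma sibling_raise (k : nat) (f : cfun) (j : nat) : BPol k 0 f -> (S j <= k)%nat ->
  twist_plus (sibling f (S j)) = (fun p => - (INC (S j) * INC (k - j)) * sibling f j p)%C.
Proof.
  intros Hf; induction j as [|j IH]; intros Hj; fext.
  - assert (HB := sibling_BPol k f 0 Hf ltac:(lia)).
    rewrite sibling_S, twist_comm by eauto with pol.
    destruct (BPol_euler _ _ _ HB x) as [-> ->].
    rewrite (der_zero twist_minus); auto with pol.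
    + rewrite INC_S, INC_0; ring.
    + intros p; now apply (proj1 (BPol_twist_plus _ _ _ HB)).
  - assert (HB := sibling_BPol k f (S j) Hf ltac:(lia)).
    assert (HB0 := sibling_BPol k f j Hf ltac:(lia)).
    rewrite sibling_S, twist_comm by eauto with pol.
    destruct (BPol_euler _ _ _ HB x) as [-> ->].
    rewrite IH by lia. rewrite (der_scal twist_minus) by eauto with pol; rewrite <- sibling_S.
    replace (INC (k - j)) with (INC (k - S j) + 1)%C by (rewrite <- INC_S; f_equal; lia).
    rewrite !INC_S; ring.
Qed.

Lemma INC_neq_0 (n : nat) : (0 < n)%nat -> INC n <> 0%C.
Proof. intros Hn E; change (RtoC 0) with (INC 0) in E; apply INC_inj in E; lia. Qed.

Lemma sibling_raise_iter (k : nat) (f : cfun) (j : nat) : BPol k 0 f -> (j <= k)%nat ->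
  exists c : CC, c <> 0%C /\ Nat.iter j twist_plus (sibling f j) = (fun p => c * f p)%C.
Proof.
  intros Hf; induction j as [|j IH]; intros Hj.
  - exists 1%C; split; [apply RtoC_neq_0; lra|]. fext; cbn; ring.
  - destruct (IH ltac:(lia)) as (c & Hc & E).
    exists (- (INC (S j) * INC (k - j)) * c)%C; split.
    + intros Z; apply Hc, (Cmult_eq_0 _ _ Z); intros Z'.
      apply (INC_neq_0 (k - j)); [lia|]. apply (Cmult_eq_0 (- INC (S j))%C).
      * rewrite <- Z'; ring.
      * intros Z2; apply (INC_neq_0 (S j)); [lia|]. replace (INC (S j)) with (- - INC (S j))%C by ring; rewrite Z2; ring.
    + rewrite Nat.iter_succ_r, (sibling_raise k) by assumption.
      assert (HB := sibling_BPol k f j Hf ltac:(lia)).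
      rewrite der_iter_scal, E by eauto with pol. fext; ring.
Qed.

(** [twist_plus] iterated as often as the highest sibling index kills all lower siblings and returns
    a nonzero multiple of the top form, which therefore vanishes; then one descends. *)
Lemma siblings_independent (k : nat) (f : nat -> cfun) (m : nat) : (m <= S k)%nat ->
  (forall j, (j < m)%nat -> BPol k 0 (f j)) ->
  (forall p, csum m (fun j => sibling (f j) j p) = 0%C) -> forall j p, (j < m)%nat -> f j p = 0%C.
Proof.
  induction m as [|m IH]; intros Hm Hf H0 j p Hj; [lia|].
  assert (HP : forall i, (i < S m)%nat -> Pol (sibling (f i) i)).
  { intros i Hi; assert (HB := sibling_BPol k (f i) i (Hf i Hi) ltac:(lia)); eauto with pol. }
  assert (Top : forall q, f m q = 0%C).
  { intros q.
    assert (E := der_iter_zero twist_plus (fun p => csum (S m) (fun i => sibling (f i) i p)) m derivation_twist_plus H0 q).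
    rewrite (der_iter_csum twist_plus (S m) (fun i => sibling (f i) i)) in E by auto with pol.
    cbn [csum] in E; rewrite csum_zero in E.
    - destruct (sibling_raise_iter k (f m) m (Hf m ltac:(lia)) ltac:(lia)) as (c & Hc & Ec).
      rewrite Ec in E; apply (Cmult_eq_0 c); [rewrite <- E; ring|exact Hc].
    - intros i Hi; destruct (sibling_raise_iter k (f i) i (Hf i ltac:(lia)) ltac:(lia)) as (c & Hc & Ec).
      (* After i raisings the i-th sibling is a multiple of the form itself, and one more raising
         kills it. *)
      replace (Nat.iter m twist_plus (sibling (f i) i))
        with (Nat.iter (m - S i) twist_plus (Nat.iter (S i) twist_plus (sibling (f i) i)))
        by (rewrite <- Nat.iter_add; f_equal; lia).
      apply der_iter_zero; auto with pol. intros r.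
      change (twist_plus (Nat.iter i twist_plus (sibling (f i) i)) r = 0%C).
      assert (Hfi := Hf i ltac:(lia)).
      rewrite Ec, der_scal by eauto with pol.
      rewrite (proj1 (BPol_twist_plus _ _ _ Hfi) eq_refl); ring. }
  destruct (Nat.eq_dec j m) as [->|Hn]; [apply Top|].
  apply (IH ltac:(lia)); [intros i Hi; apply Hf; lia| |lia].
  intros q; specialize (H0 q); cbn [csum] in H0; unfold sibling at 2 in H0.
  rewrite (der_iter_zero twist_minus (f m)) in H0 by auto with pol. rewrite <- H0; ring.
Qed.

(** Commuting once changes the eigenvalue by E - Ebar, which on [twist_plus v] of bidegree (a + 1,
    b) is a + 1 - b. *)
Lemma raise_eigen (a b : nat) (v : cfun) (mu : R) : BPol a (S b) v ->
  (forall p, twist_minus (twist_plus v) p = (RtoC mu * v p)%C) ->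
  forall p, twist_minus (twist_plus (twist_plus v)) p = (RtoC (mu + INR a + 1 - INR b) * twist_plus v p)%C.
Proof.
  intros Hv Hmu p.
  assert (HB := proj2 (BPol_twist_plus _ _ _ Hv) b eq_refl).
  assert (E := twist_comm (twist_plus v) p ltac:(eauto with pol)).
  replace (twist_minus (twist_plus v)) with (fun q => RtoC mu * v q)%C in E by (fext; now rewrite Hmu).
  rewrite (der_scal twist_plus) in E by eauto with pol.
  destruct (BPol_euler _ _ _ HB p) as [E1 E2]; rewrite E1, E2 in E.
  rewrite RtoC_minus, !RtoC_plus; unfold INC in *; rewrite S_INR, RtoC_plus in E.
  replace (twist_minus (twist_plus (twist_plus v)) p) with
    ((twist_minus (twist_plus (twist_plus v)) p + RtoC (INR b) * twist_plus v p - (RtoC (INR a) + 1) * twist_plus v p)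
     - RtoC (INR b) * twist_plus v p + (RtoC (INR a) + 1) * twist_plus v p)%C by ring.
  rewrite <- E; ring.
Qed.

(** The eigenvalue - b (a + 1) is the harmonic one, and raising preserves its shape. For b > 0 it is
    nonzero, so v is recovered by lowering [twist_plus v] and dividing. *)
Lemma raise_to_form (b : nat) : forall a v, BPol a b v ->
  (forall p, twist_minus (twist_plus v) p = (RtoC (- (INR b * (INR a + 1))) * v p)%C) ->
  exists f, BPol (a + b) 0 f /\ v = sibling f b.
Proof.
  induction b as [|b IH]; intros a v Hv Hmu.
  - exists v; split; [now rewrite Nat.add_0_r|reflexivity].
  - assert (HB := proj2 (BPol_twist_plus _ _ _ Hv) b eq_refl).
    destruct (IH (S a) (twist_plus v) HB) as (f & Hf & Ef).
    { intros p; rewrite (raise_eigen a b v _ Hv Hmu p); f_equal; f_equal; rewrite !S_INR; ring. }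
    set (mu := RtoC (- (INR (S b) * (INR a + 1)))) in *.
    assert (Hmu0 : mu <> 0%C).
    { apply RtoC_neq_0; pose proof (pos_INR a); pose proof (pos_INR b); rewrite S_INR; nra. }
    exists (fun p => / mu * f p)%C; split.
    + apply BPol_scal; apply BPol_eq with (S a + b)%nat 0%nat; [lia|reflexivity|exact Hf].
    + unfold sibling; rewrite der_iter_scal by eauto with pol; fold (sibling f (S b)).
      rewrite sibling_S, <- Ef; fext; rewrite Hmu; field; exact Hmu0.
Qed.

(** The eigenvalue is never 0 because 2 k + 3 is odd, so v is recovered from [twist_plus v]. Raising
    until no conjugated variable is left ends in 0, and this propagates back down. *)
Lemma raise_to_zero (k b : nat) : forall a v, BPol a b v ->
  (forall p, twist_minus (twist_plus v) p = (RtoC ((2 * INR k + 3) / 4 - INR b * (INR a + 1)) * v p)%C) ->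
  forall p, v p = 0%C.
Proof.
  assert (NZ : forall a b, (2 * INR k + 3) / 4 - INR b * (INR a + 1) <> 0).
  { intros a b' E.
    assert (X : INR (2 * k + 3) = INR (4 * (b' * (a + 1)))).
    { rewrite plus_INR, !mult_INR, plus_INR; cbn; lra. }
    apply INR_eq in X; lia. }
  induction b as [|b IH]; intros a v Hv Hmu p.
  - assert (E := Hmu p); rewrite (der_zero twist_minus) in E; auto with pol.
    + apply (Cmult_eq_0 _ _ (eq_sym E)), RtoC_neq_0, NZ.
    + now apply (proj1 (BPol_twist_plus _ _ _ Hv)).
  - assert (HB := proj2 (BPol_twist_plus _ _ _ Hv) b eq_refl).
    assert (Z : forall p, twist_plus v p = 0%C).
    { apply (IH (S a) (twist_plus v) HB); intros q; rewrite (raise_eigen a b v _ Hv Hmu q); f_equal; f_equal; rewrite !S_INR; field. }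
    assert (E := Hmu p); rewrite (der_zero twist_minus) in E; auto with pol.
    apply (Cmult_eq_0 _ _ (eq_sym E)), RtoC_neq_0, NZ.
Qed.

(** * Splitting polynomials into homogeneous and bihomogeneous components *)

Inductive BSum : cfun -> Prop :=
| BSum_0 : BSum (fun _ => 0%C)
| BSum_add a b F G : BSum F -> BPol a b G -> BSum (fun p => F p + G p)%C.

Lemma BSum_ext (F G : cfun) : (forall p, F p = G p) -> BSum F -> BSum G.
Proof. intros E; replace G with F; auto; now apply functional_extensionality. Qed.

Lemma BSum_plus (F G : cfun) : BSum F -> BSum G -> BSum (fun p => F p + G p)%C.
Proof.
  intros HF; induction 1 as [|a b H G HH IH HG].
  - apply BSum_ext with F; [intros; ring|exact HF].
  - apply BSum_ext with (fun p => F p + H p + G p)%C; [intros; ring|]. now apply (BSum_add a b (fun p => F p + H p)%C).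
Qed.

Lemma BSum_BPol (a b : nat) (F : cfun) : BPol a b F -> BSum F.
Proof.
  intros H; apply BSum_ext with (fun p => RtoC 0 + F p)%C; [intros; ring|].
  apply (BSum_add a b (fun _ => RtoC 0)); [apply BSum_0|exact H].
Qed.

Lemma BSum_mult (F G : cfun) : BSum F -> BSum G -> BSum (fun p => F p * G p)%C.
Proof.
  intros HF HG; induction HF as [|a b F H HF IH HH].
  - apply BSum_ext with (fun _ => 0%C); [intros; ring|apply BSum_0].
  - apply BSum_ext with (fun p => F p * G p + H p * G p)%C; [intros; ring|].
    apply BSum_plus; [exact IH|]. clear IH HF; induction HG as [|a' b' G K HG IH HK].
    + apply BSum_ext with (fun _ => 0%C); [intros; ring|apply BSum_0].
    + apply BSum_ext with (fun p => H p * G p + H p * K p)%C; [intros; ring|].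
      apply BSum_plus; [exact IH|]. eapply BSum_BPol, BPol_mult; eassumption.
Qed.

Lemma Pol_BSum (F : cfun) : Pol F -> BSum F.
Proof.
  induction 1; auto using BSum_plus, BSum_mult; eapply BSum_BPol;
    [apply BPol_const|apply BPol_alpha|apply BPol_beta|apply BPol_alphab|apply BPol_betab].
Qed.

Definition HPol (e : nat) (W : cfun) : Prop := exists v : nat -> cfun,
  (forall b, (b <= e)%nat -> BPol (e - b) b (v b)) /\ forall p, W p = csum (S e) (fun b => v b p).

Lemma HPol_0 (e : nat) : HPol e (fun _ => 0%C).
Proof. exists (fun _ _ => 0%C); split; [intros; apply BPol_0|intros; now rewrite csum_0]. Qed.

Lemma HPol_add (a b : nat) (W G : cfun) : HPol (a + b) W -> BPol a b G -> HPol (a + b) (fun p => W p + G p)%C.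
Proof.
  intros (v & Hv & E) HG; exists (fun j p => v j p + (if Nat.eqb j b then G p else 0))%C; split.
  - intros j Hj; destruct (Nat.eqb_spec j b) as [->|Hn].
    + apply BPol_plus; auto. apply BPol_eq with a b; [lia|reflexivity|exact HG].
    + apply BPol_ext with (v j); [intros; ring|auto].
  - intros p; rewrite csum_plus, <- E, csum_single.
    destruct (Nat.ltb_spec b (S (a + b))); [reflexivity|lia].
Qed.

Lemma HPol_scale (e : nat) (W : cfun) : HPol e W -> forall s p, W (scale4 s p) = (RtoC (s ^ e) * W p)%C.
Proof.
  intros (v & Hv & E) s p; rewrite !E, <- csum_scal; apply csum_ext; intros b Hb.
  rewrite (BPol_scale _ _ _ (Hv b ltac:(lia))). do 3 f_equal; lia.
Qed.

Lemma BSum_HPol (F : cfun) : BSum F -> exists N (w : nat -> cfun), (forall e, HPol e (w e)) /\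
  (forall e p, (N <= e)%nat -> w e p = 0%C) /\ forall p, F p = csum N (fun e => w e p).
Proof.
  induction 1 as [|a b F G HF (N & w & Hw & Hz & E) HG].
  - exists 0%nat, (fun _ _ => 0%C); repeat split; auto; intros; apply HPol_0.
  - exists (Nat.max N (S (a + b))), (fun e p => w e p + (if Nat.eqb e (a + b) then G p else 0))%C; repeat split.
    + intros e; destruct (Nat.eqb_spec e (a + b)) as [->|Hn]; [now apply HPol_add|].
      replace (fun p => w e p + 0)%C with (w e) by (fext; ring). apply Hw.
    + intros e p He; rewrite Hz by lia; destruct (Nat.eqb_spec e (a + b)); [lia|ring].
    + intros p; rewrite csum_plus, csum_single, E.
      destruct (Nat.ltb_spec (a + b) (Nat.max N (S (a + b)))); [|lia].
      f_equal; symmetry; apply csum_extend; [lia|auto].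
Qed.

(** Scaling by 2 acts on the component of degree e by 2^e, and these eigenvalues are distinct, so
    all components but the d-th vanish. *)
Lemma homogeneous_HPol (F : cfun) (d : nat) : Pol F ->
  (forall p, F (scale4 2 p) = (RtoC (2 ^ d) * F p)%C) -> HPol d F.
Proof.
  intros HF H2; destruct (BSum_HPol F (Pol_BSum F HF)) as (N & w & Hw & Hz & E).
  set (M := Nat.max N (S d)).
  (* Subtracting F from the d-th component turns the decomposition of F into a relation with sum 0;
     the bound [M] keeps the index d in range. *)
  set (v := fun e p => (w e p + (if Nat.eqb e d then - F p else 0))%C).
  assert (Z : forall j p, (j < M)%nat -> v j p = 0%C).
  { apply (eigen_separate (fun G p => G (scale4 2 p)) (fun e => RtoC (2 ^ e))).
    - intros i j _ _ Eij; injection Eij; intros Eij'.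
      destruct (Nat.lt_trichotomy i j) as [Hlt|[->|Hlt]]; auto;
        apply (Rlt_pow 2) in Hlt; lra.
    - intros; reflexivity.
    - intros j p _; unfold v; rewrite (HPol_scale _ _ (Hw j)).
      destruct (Nat.eqb_spec j d) as [->|_]; [rewrite H2|]; ring.
    - intros p; unfold v; rewrite csum_plus, csum_single.
      destruct (Nat.ltb_spec d M); [|unfold M in *; lia].
      rewrite (csum_extend N M) by (auto; unfold M; lia). rewrite <- E; ring. }
  replace F with (w d); [apply Hw|]. fext. specialize (Z d x ltac:(unfold M; lia)); unfold v in Z.
  rewrite Nat.eqb_refl in Z. replace (w d x) with (w d x + - F x + F x)%C by ring. rewrite Z; ring.
Qed.

Lemma lapC_csum (n : nat) (v : nat -> cfun) (p : R4) : (forall j, (j < n)%nat -> Pol (v j)) ->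
  lapC (fun q => csum n (fun j => v j q)) p = csum n (fun j => lapC (v j) p).
Proof.
  intros H; unfold lapC; rewrite csum_plus; f_equal.
  - replace (d_alphab (fun q => csum n (fun j => v j q))) with (fun q => csum n (fun j => d_alphab (v j) q))
      by (fext; now rewrite der_csum by auto with pol).
    apply (der_csum d_alpha n (fun j => d_alphab (v j))); auto with pol.
  - replace (d_betab (fun q => csum n (fun j => v j q))) with (fun q => csum n (fun j => d_betab (v j) q))
      by (fext; now rewrite der_csum by auto with pol).
    apply (der_csum d_beta n (fun j => d_betab (v j))); auto with pol.
Qed.

Lemma alpha_beta_norm (p : R4) : (alpha p * alphab p + beta p * betab p)%C = RtoC (sqnorm4 p).
Proof. destruct p as [[[x y] z] w]; apply Ceq_ri; cbn; ring. Qed.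

Lemma BPol_lapC (a b : nat) (v : cfun) (p : R4) : BPol a b v ->
  (RtoC (sqnorm4 p) * lapC v p)%C = (twist_minus (twist_plus v) p + RtoC (INR b * (INR a + 1)) * v p)%C.
Proof.
  intros Hv; rewrite twist_minus_plus, alpha_beta_norm by eauto with pol.
  replace (eulerb v) with (fun q => INC b * v q)%C by (fext; now rewrite (proj2 (BPol_euler _ _ _ Hv _))).
  rewrite (der_scal euler) by eauto with pol; rewrite (proj1 (BPol_euler _ _ _ Hv _)).
  unfold INC; rewrite RtoC_mult, RtoC_plus; ring.
Qed.

Lemma BPol_twist_minus_plus (a b : nat) (v : cfun) : BPol a b v -> BPol a b (twist_minus (twist_plus v)).
Proof.
  intros Hv; destruct b as [|b].
  - apply BPol_ext with (fun _ => 0%C); [|apply BPol_0].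
    intros p; symmetry; apply der_zero; auto with pol. now apply (proj1 (BPol_twist_plus _ _ _ Hv)).
  - apply (proj2 (BPol_twist_minus (S a) b (twist_plus v) (proj2 (BPol_twist_plus _ _ _ Hv) b eq_refl))); reflexivity.
Qed.

Lemma HPol_vanish (d : nat) (Z : cfun) : HPol d Z -> (forall p, onS3 p -> Z p = 0%C) -> forall p, Z p = 0%C.
Proof.
  intros HZ ZS p; destruct (Req_dec (sqnorm4 p) 0) as [E|E].
  (* The origin is a sphere point scaled by 0; this covers degree 0 as well, since 0^0 = 1. *)
  - replace p with (scale4 0 (1, 0, 0, 0)).
    + rewrite (HPol_scale d Z HZ), ZS by (unfold onS3; cbn; ring); ring.
    + destruct p as [[[x y] w] t].
      assert (N : ~ (x <> 0 \/ y <> 0 \/ w <> 0 \/ t <> 0)) by (rewrite <- nonzero4_coord; unfold nonzero4; tauto).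
      cbn; apply R4_eq; rewrite ?Rmult_0_l; apply NNPP; intros X; apply N; auto 10.
  - assert (Hr : 0 < sqrt (sqnorm4 p)) by (apply sqrt_lt_R0, sqnorm4_pos, E).
    replace p with (scale4 (sqrt (sqnorm4 p)) (scale4 (/ sqrt (sqnorm4 p)) p)).
    + rewrite (HPol_scale d Z HZ), ZS by (now apply normalize_onS3); ring.
    + rewrite scale4_scale4, Rinv_r, scale4_1; [reflexivity|lra].
Qed.

(** The equation is known on S^3 only. Multiplying the Laplacian by r^2 makes both sides homogeneous
    of degree d, so the equation spreads to R^4, where [eulerb] separates the bidegrees. *)
Lemma HPol_eigen_components (d : nat) (U : cfun) (c : R) (v : nat -> cfun) :
  (forall b, (b <= d)%nat -> BPol (d - b) b (v b)) -> (forall p, U p = csum (S d) (fun b => v b p)) ->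
  (forall p, onS3 p -> (4 * lapC U p = RtoC c * U p)%C) ->
  forall b, (b <= d)%nat -> forall p,
    twist_minus (twist_plus (v b)) p = (RtoC (c / 4 - INR b * (INR (d - b) + 1)) * v b p)%C.
Proof.
  intros Hv EU Hc.
  assert (HP : forall b, (b < S d)%nat -> Pol (v b)) by (intros b Hb; assert (X := Hv b ltac:(lia)); eauto with pol).
  set (z := fun b p => (twist_minus (twist_plus (v b)) p - RtoC (c / 4 - INR b * (INR (d - b) + 1)) * v b p)%C).
  assert (Hz : forall b, (b <= d)%nat -> BPol (d - b) b (z b)).
  { intros b Hb; apply BPol_minus; [apply BPol_twist_minus_plus|apply BPol_scal]; auto. }
  set (Z := fun p => csum (S d) (fun b => z b p)).
  assert (HZ : HPol d Z) by (exists z; split; auto).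
  assert (ZS : forall p, onS3 p -> Z p = 0%C).
  { intros p Hp; unfold Z.
    rewrite (csum_ext (S d) _ (fun b => lapC (v b) p + - RtoC (c / 4) * v b p)%C).
    - rewrite csum_plus, csum_scal, <- EU, <- lapC_csum by exact HP.
      replace (fun q => csum (S d) (fun j => v j q)) with U by (fext; auto).
      specialize (Hc p Hp); unfold Rdiv; rewrite RtoC_mult, RtoC_inv by lra.
      replace (lapC U p) with (/ RtoC 4 * (4 * lapC U p))%C by (field; apply RtoC_neq_0; lra).
      rewrite Hc; ring.
    - intros b Hb; unfold z. assert (E := BPol_lapC _ _ (v b) p (Hv b ltac:(lia))).
      unfold onS3 in Hp; rewrite Hp in E.
      replace (lapC (v b) p) with (1 * lapC (v b) p)%C by ring; rewrite E, RtoC_minus; ring. }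
  assert (Z0 := HPol_vanish d Z HZ ZS).
  assert (Sep : forall j p, (j < S d)%nat -> z j p = 0%C).
  { assert (Pz : forall j, (j < S d)%nat -> Pol (z j)) by (intros j Hj; assert (X := Hz j ltac:(lia)); eauto with pol).
    apply (eigen_separate eulerb INC); auto.
    - intros i j _ _; apply INC_inj.
    - intros c' m p Hm. rewrite (der_csum eulerb m (fun j q => c' j * z j q)%C).
      + apply csum_ext; intros j Hj; apply der_scal; auto with pol. apply Pz; lia.
      + auto with pol.
      + intros j Hj; apply Pol_scal, Pz; lia.
    - intros j p Hj; apply (BPol_euler _ _ _ (Hz j ltac:(lia))). }
  intros b Hb p; specialize (Sep b p ltac:(lia)); unfold z in Sep.
  replace (twist_minus (twist_plus (v b)) p) with
    (twist_minus (twist_plus (v b)) p - RtoC (c / 4 - INR b * (INR (d - b) + 1)) * v b p + RtoC (c / 4 - INR b * (INR (d - b) + 1)) * v b p)%C by ring.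
  rewrite Sep; ring.
Qed.

Lemma harmonic_siblings (k : nat) (U : cfun) : HPol k U ->
  (forall p, onS3 p -> (4 * lapC U p = RtoC 0 * U p)%C) ->
  exists f : nat -> cfun, (forall j, (j <= k)%nat -> BPol k 0 (f j)) /\
    forall p, U p = csum (S k) (fun j => sibling (f j) j p).
Proof.
  intros (v & Hv & EU) Hc.
  assert (H := HPol_eigen_components k U 0 v Hv EU Hc).
  assert (G : forall b, exists f, (b <= k)%nat -> BPol k 0 f /\ v b = sibling f b).
  { intros b; destruct (le_dec b k) as [Hb|Hb]; [|exists (fun _ => 0%C); lia].
    destruct (raise_to_form b (k - b) (v b) (Hv b Hb)) as (f & Hf & E).
    - intros p; rewrite (H b Hb p); f_equal; f_equal; field.
    - exists f; intros _; split; [|exact E]. apply BPol_eq with (k - b + b)%nat 0%nat; [lia|reflexivity|exact Hf]. }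
  apply choice_fun in G; destruct G as [f G].
  exists f; split; [intros j Hj; now apply G|].
  intros p; rewrite EU; apply csum_ext; intros j Hj; now rewrite <- (proj2 (G j ltac:(lia))).
Qed.

(** The constant 2 k + 3 is (k + 1)(k + 3) - k (k + 2), the gap between the eigenvalues belonging to
    degrees k + 1 and k. *)
Lemma wrong_parity_zero (k : nat) (U : cfun) : HPol (S k) U ->
  (forall p, onS3 p -> (4 * lapC U p = RtoC (2 * INR k + 3) * U p)%C) -> forall p, U p = 0%C.
Proof.
  intros (v & Hv & EU) Hc.
  assert (H := HPol_eigen_components (S k) U _ v Hv EU Hc).
  intros p; rewrite EU; apply csum_zero; intros b Hb.
  apply (raise_to_zero k b (S k - b) (v b) (Hv b ltac:(lia))), H; lia.
Qed.

(** * The Laplacian of homogeneous polynomials *)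

Definition rho (p : R4) : R := / sqrt (sqnorm4 p).

(** Polynomials in the coordinates and 1 / r form a class closed under partial derivatives, since
    the i-th one of 1 / r is - x_i / r^3; smoothness away from the origin follows. *)
Inductive Sm : (R4 -> R) -> Prop :=
| Sm_const k : Sm (fun _ => k)
| Sm_coord i : (i < 4)%nat -> Sm (coord i)
| Sm_rho : Sm rho
| Sm_plus f g : Sm f -> Sm g -> Sm (fun p => f p + g p)
| Sm_mult f g : Sm f -> Sm g -> Sm (fun p => f p * g p).

Lemma Sm_ext (f g : R4 -> R) : (forall p, f p = g p) -> Sm f -> Sm g.
Proof. intros E; replace g with f; auto; now apply functional_extensionality. Qed.

Lemma Sm_pow (f : R4 -> R) (n : nat) : Sm f -> Sm (fun p => f p ^ n).
Proof. intros H; induction n as [|n IH]; [apply (Sm_const 1)|]. now apply (Sm_mult f (fun p => f p ^ n)). Qed.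

Lemma is_derive_coord (i j : nat) (p : R4) : (i < 4)%nat -> (j < 4)%nat ->
  is_derive (fun t => coord j (upd i p t)) (coord i p) (if Nat.eqb i j then 1 else 0).
Proof.
  intros Hi Hj; destruct p as [[[x y] z] w].
  destruct i as [|[|[|[|i]]]]; [..|lia]; destruct j as [|[|[|[|j]]]]; [..|lia]; cbn; auto_derive; auto.
Qed.

Lemma is_derive_rho (i : nat) (p : R4) : (i < 4)%nat -> nonzero4 p ->
  is_derive (fun t => rho (upd i p t)) (coord i p) (- (coord i p) * rho p ^ 3).
Proof.
  intros Hi Hp; assert (Hpos := sqnorm4_pos p Hp).
  assert (Hs : is_derive (fun t => sqnorm4 (upd i p t)) (coord i p) (2 * coord i p)).
  { destruct p as [[[x y] z] w]; destruct i as [|[|[|[|i]]]]; [..|lia]; cbn; auto_derive; auto; ring. }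
  assert (Hr : 0 < sqrt (sqnorm4 p)) by (now apply sqrt_lt_R0).
  pose proof (is_derive_sqrt _ _ _ Hs) as D; cbv beta in D; rewrite upd_coord in D; specialize (D Hpos).
  pose proof (is_derive_inv _ _ _ D) as D'; cbv beta in D'; rewrite upd_coord in D'.
  specialize (D' ltac:(lra)).
  replace (- coord i p * rho p ^ 3) with (- (2 * coord i p / (2 * sqrt (sqnorm4 p))) / sqrt (sqnorm4 p) ^ 2); [exact D'|].
  unfold rho; field; lra.
Qed.

Lemma is_derive_plusR (f g : R -> R) (x a b : R) :
  is_derive f x a -> is_derive g x b -> is_derive (fun t => f t + g t) x (a + b).
Proof. intros Hf Hg; exact (is_derive_plus f g x a b Hf Hg). Qed.

Lemma is_derive_multR (f g : R -> R) (x a b : R) :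
  is_derive f x a -> is_derive g x b -> is_derive (fun t => f t * g t) x (a * g x + f x * b).
Proof. intros Hf Hg; exact (is_derive_mult f g x a b Hf Hg Rmult_comm). Qed.

Lemma Sm_deriv (i : nat) (g : R4 -> R) : (i < 4)%nat -> Sm g -> exists g', Sm g' /\
  forall p, nonzero4 p -> is_derive (fun t => g (upd i p t)) (coord i p) (g' p).
Proof.
  intros Hi; induction 1 as [k|j Hj| |f g Hf (f' & Sf & Df) Hg (g' & Sg & Dg)|f g Hf (f' & Sf & Df) Hg (g' & Sg & Dg)].
  - exists (fun _ => 0); split; [apply Sm_const|intros; apply (is_derive_const (V := R_NormedModule))].
  - exists (fun _ => if Nat.eqb i j then 1 else 0); split; [apply Sm_const|intros; now apply is_derive_coord].
  - exists (fun p => (-1 * coord i p) * rho p ^ 3); split.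
    + apply (Sm_mult (fun p => -1 * coord i p)); [apply (Sm_mult (fun _ => -1)); [apply Sm_const|now apply Sm_coord]|].
      apply Sm_pow, Sm_rho.
    + intros p Hp; replace (-1 * coord i p * rho p ^ 3) with (- (coord i p) * rho p ^ 3) by ring; now apply is_derive_rho.
  - exists (fun p => f' p + g' p); split; [now apply Sm_plus|].
    intros p Hp; apply is_derive_plusR; auto.
  - exists (fun p => f' p * g p + f p * g' p); split; [apply (Sm_plus (fun p => f' p * g p)); now apply Sm_mult|].
    intros p Hp; pose proof (is_derive_multR _ _ _ _ _ (Df p Hp) (Dg p Hp)) as D.
    cbv beta in D; rewrite upd_coord in D; exact D.
Qed.

Lemma Sm_cont (g : R4 -> R) (p : R4) : Sm g -> nonzero4 p -> cont4_at g p.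
Proof.
  intros H Hp; induction H.
  - apply cont4_at_const.
  - apply cont4_at_coord.
  - assert (Hpos := sqnorm4_pos p Hp).
    apply (cont4_at_comp sqnorm4 (fun s => / sqrt s)); [apply cont4_at_sqnorm|].
    apply (ex_derive_continuous (fun s => / sqrt s)); auto_derive; split; auto.
    split; auto; apply Rgt_not_eq, sqrt_lt_R0; auto.
  - now apply cont4_at_plus.
  - now apply cont4_at_mult.
Qed.

Lemma cont4_at_loc (g h : R4 -> R) (p : R4) : (forall q, nonzero4 q -> g q = h q) -> nonzero4 p ->
  cont4_at h p -> cont4_at g p.
Proof.
  rewrite !cont4_at_box; intros E Hp H eps He; destruct (H eps He) as [d [Hd B]].
  destruct (nonzero4_open p Hp) as [d' [Hd' N]].
  exists (Rmin d d'); split; [now apply Rmin_pos|]; intros q Hq.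
  assert (Q : Rmin d d' <= d /\ Rmin d d' <= d') by (split; [apply Rmin_l|apply Rmin_r]).
  rewrite !E by (auto; apply N; destruct p as [[[x y] z] w], q as [[[x' y'] z'] w']; cbn in *; destruct Hq as (? & ? & ? & ?); repeat split; lra).
  apply B; destruct p as [[[x y] z] w], q as [[[x' y'] z'] w']; cbn in *; destruct Hq as (? & ? & ? & ?); repeat split; lra.
Qed.

Lemma is_derive_loc (i : nat) (g h : R4 -> R) (p : R4) (l : R) : (forall q, nonzero4 q -> g q = h q) -> nonzero4 p ->
  is_derive (fun t => h (upd i p t)) (coord i p) l -> is_derive (fun t => g (upd i p t)) (coord i p) l.
Proof.
  intros E Hp; apply is_derive_ext_loc. eapply filter_imp; [|apply (upd_nonzero_locally i p Hp)].
  intros t Ht; symmetry; now apply E.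
Qed.

Lemma partial_loc (i : nat) (g h : R4 -> R) : (forall q, nonzero4 q -> g q = h q) ->
  forall q, nonzero4 q -> partial i g q = partial i h q.
Proof.
  intros E q Hq; unfold partial; apply Derive_ext_loc.
  eapply filter_imp; [|apply (upd_nonzero_locally i q Hq)]. intros t Ht; now apply E.
Qed.

Lemma Sm_C2 (g h : R4 -> R) : (forall q, nonzero4 q -> g q = h q) -> Sm h -> C2_away0 g.
Proof.
  intros E Hh p Hp; split; [eapply cont4_at_loc; eauto using Sm_cont|].
  intros i Hi; destruct (Sm_deriv i h Hi Hh) as (h' & Sh' & Dh').
  assert (Ei : forall q, nonzero4 q -> partial i g q = h' q).
  { intros q Hq; apply is_derive_unique; eapply is_derive_loc; eauto. }
  split; [eexists; eapply is_derive_loc; eauto|].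
  split; [eapply cont4_at_loc; eauto using Sm_cont|].
  intros j Hj; destruct (Sm_deriv j h' Hj Sh') as (h'' & Sh'' & Dh'').
  assert (Eij : forall q, nonzero4 q -> partial j (partial i g) q = h'' q).
  { intros q Hq; apply is_derive_unique; eapply is_derive_loc; eauto. }
  split; [eexists; eapply is_derive_loc; eauto|].
  eapply cont4_at_loc; eauto using Sm_cont.
Qed.

Lemma Pol_Sm (F : cfun) : Pol F -> Sm (fun p => Re (F p)) /\ Sm (fun p => Im (F p)).
Proof.
  assert (N : forall f, Sm f -> Sm (fun p => -1 * f p)) by (intros f; apply (Sm_mult (fun _ => -1)), Sm_const).
  induction 1 as [c| | | | |F G _ [F1 F2] _ [G1 G2]|F G _ [F1 F2] _ [G1 G2]].
  - split; apply Sm_const.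
  - split; [apply Sm_ext with (coord 0)|apply Sm_ext with (coord 1)];
      try (intros [[[x y] z] w]; reflexivity); apply Sm_coord; lia.
  - split; [apply Sm_ext with (coord 2)|apply Sm_ext with (coord 3)];
      try (intros [[[x y] z] w]; reflexivity); apply Sm_coord; lia.
  - split; [apply Sm_ext with (coord 0)|apply Sm_ext with (fun p => -1 * coord 1 p)];
      try (intros [[[x y] z] w]; cbn; ring); [|apply N]; apply Sm_coord; lia.
  - split; [apply Sm_ext with (coord 2)|apply Sm_ext with (fun p => -1 * coord 3 p)];
      try (intros [[[x y] z] w]; cbn; ring); [|apply N]; apply Sm_coord; lia.
  - split; now apply Sm_plus.
  - split.
    + apply Sm_ext with (fun p => Re (F p) * Re (G p) + -1 * (Im (F p) * Im (G p))).
      * intros p; cbn; unfold Re, Im; ring.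
      * apply (Sm_plus (fun p => Re (F p) * Re (G p))); [now apply Sm_mult|]. apply N; now apply Sm_mult.
    + apply (Sm_plus (fun p => Re (F p) * Im (G p)) (fun p => Im (F p) * Re (G p))); now apply Sm_mult.
Qed.

Lemma HPol_Pol (d : nat) (P : cfun) : HPol d P -> Pol P.
Proof.
  intros (v & Hv & E); apply Pol_ext with (fun p => csum (S d) (fun b => v b p)); [auto|].
  apply Pol_csum; intros j Hj; assert (X := Hv j ltac:(lia)); eauto with pol.
Qed.

Lemma ext_scale (F : cfun) (p : R4) : ext F p = F (scale4 (rho p) p).
Proof.
  destruct p as [[[x y] z] w]; unfold ext, scale4, rho; f_equal; apply R4_eq; unfold Rdiv; ring.
Qed.

Lemma HPol_ext (d : nat) (P : cfun) (p : R4) : HPol d P -> ext P p = (RtoC (rho p ^ d) * P p)%C.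
Proof. intros H; rewrite ext_scale; now apply HPol_scale. Qed.

Lemma Re_scal (x : R) (z : CC) : Re (RtoC x * z)%C = x * Re z.
Proof. cbn; unfold Re; ring. Qed.
Lemma Im_scal (x : R) (z : CC) : Im (RtoC x * z)%C = x * Im z.
Proof. cbn; unfold Im; ring. Qed.

Lemma HPol_smooth (d : nat) (P : cfun) : HPol d P -> smooth_S3 P.
Proof.
  intros H; destruct (Pol_Sm P (HPol_Pol d P H)) as [S1 S2]; split.
  - apply Sm_C2 with (fun p => rho p ^ d * Re (P p)).
    + intros q _; rewrite (HPol_ext d) by exact H; apply Re_scal.
    + apply (Sm_mult (fun p => rho p ^ d)); auto; apply Sm_pow, Sm_rho.
  - apply Sm_C2 with (fun p => rho p ^ d * Im (P p)).
    + intros q _; rewrite (HPol_ext d) by exact H; apply Im_scal.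
    + apply (Sm_mult (fun p => rho p ^ d)); auto; apply Sm_pow, Sm_rho.
Qed.

Lemma is_derive_rho_pow (i n : nat) (p : R4) : (i < 4)%nat -> nonzero4 p ->
  is_derive (fun t => rho (upd i p t) ^ n) (coord i p) (- INR n * coord i p * rho p ^ (n + 2)).
Proof.
  intros Hi Hp; pose proof (is_derive_pow _ n _ _ (is_derive_rho i p Hi Hp)) as D.
  cbv beta in D; rewrite upd_coord in D.
  replace (- INR n * coord i p * rho p ^ (n + 2)) with (INR n * (- coord i p * rho p ^ 3) * rho p ^ Nat.pred n); [exact D|].
  destruct n as [|n]; [cbn; ring|]. cbn [Nat.pred]; replace (S n + 2)%nat with (n + 3)%nat by lia.
  rewrite pow_add; ring.
Qed.

(** On S^3 in R^4 the Laplacian of r^(-d) is d (d - 2), and the cross term is - 2 d^2 u by the Euler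
    relation; together they give - d (d + 2) u. *)
Lemma lap_radial (d : nat) (u : R4 -> R) (u1 u2 : nat -> R4 -> R) :
  (forall i p, (i < 4)%nat -> is_derive (fun t => u (upd i p t)) (coord i p) (u1 i p)) ->
  (forall i p, (i < 4)%nat -> is_derive (fun t => u1 i (upd i p t)) (coord i p) (u2 i p)) ->
  (forall p, coord 0 p * u1 0%nat p + coord 1 p * u1 1%nat p + coord 2 p * u1 2%nat p + coord 3 p * u1 3%nat p = INR d * u p) ->
  forall p, onS3 p -> lap4 (fun q => rho q ^ d * u q) p =
    u2 0%nat p + u2 1%nat p + u2 2%nat p + u2 3%nat p - INR d * (INR d + 2) * u p.
Proof.
  intros H1 H2 HE p Hp.
  set (g1 := fun i q => - INR d * coord i q * rho q ^ (d + 2) * u q + rho q ^ d * u1 i q).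
  assert (E1 : forall i q, (i < 4)%nat -> nonzero4 q -> partial i (fun q => rho q ^ d * u q) q = g1 i q).
  { intros i q Hi Hq; apply is_derive_unique.
    pose proof (is_derive_multR _ _ _ _ _ (is_derive_rho_pow i d q Hi Hq) (H1 i q Hi)) as D.
    cbv beta in D; rewrite upd_coord in D; exact D. }
  assert (Hnz := onS3_nonzero p Hp).
  assert (R1 : rho p = 1) by (unfold rho; rewrite Hp, sqrt_1; field).
  assert (E2 : forall i, (i < 4)%nat -> partial i (partial i (fun q => rho q ^ d * u q)) p =
     - INR d * u p + INR d * (INR d + 2) * (coord i p * coord i p) * u p - 2 * INR d * (coord i p * u1 i p) + u2 i p).
  { intros i Hi; rewrite (partial_loc i _ (g1 i)) by auto. apply is_derive_unique.
    pose proof (is_derive_coord i i p Hi Hi) as Dc; rewrite Nat.eqb_refl in Dc.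
    pose proof (is_derive_scal _ _ (- INR d) _ Dc) as Dc'.
    pose proof (is_derive_multR _ _ _ _ _ Dc' (is_derive_rho_pow i (d + 2) p Hi Hnz)) as Da.
    pose proof (is_derive_multR _ _ _ _ _ Da (H1 i p Hi)) as Db.
    pose proof (is_derive_multR _ _ _ _ _ (is_derive_rho_pow i d p Hi Hnz) (H2 i p Hi)) as De.
    pose proof (is_derive_plusR _ _ _ _ _ Db De) as D.
    cbv beta in D; rewrite upd_coord, R1, !pow1, plus_INR in D.
    match goal with |- is_derive _ _ ?l => match type of D with is_derive _ _ ?l' => replace l with l' end end; [exact D|].
    cbn; ring. }
  unfold lap4; rewrite !E2 by lia.
  specialize (HE p); unfold onS3 in Hp; rewrite sqnorm4_coord in Hp.
  apply (Rmult_eq_compat_l (2 * INR d)) in HE.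
  apply (Rmult_eq_compat_l (INR d * (INR d + 2) * u p)) in Hp.
  lra.
Qed.

Lemma d_parts (F : cfun) (p : R4) :
  cpartial 0 F p = (d_alpha F p + d_alphab F p)%C /\ cpartial 1 F p = (Ci * (d_alpha F p - d_alphab F p))%C /\
  cpartial 2 F p = (d_beta F p + d_betab F p)%C /\ cpartial 3 F p = (Ci * (d_beta F p - d_betab F p))%C.
Proof. unfold d_alpha, d_alphab, d_beta, d_betab; repeat split; apply Ceq_ri; cbn; field. Qed.

Lemma lapC_cpartial (F : cfun) (p : R4) : Pol F ->
  (cpartial 0 (cpartial 0 F) p + cpartial 1 (cpartial 1 F) p + cpartial 2 (cpartial 2 F) p + cpartial 3 (cpartial 3 F) p
   = 4 * lapC F p)%C.
Proof.
  intros HF.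
  assert (P1 := Pol_der _ F derivation_d_alpha HF); assert (P2 := Pol_der _ F derivation_d_alphab HF).
  assert (P3 := Pol_der _ F derivation_d_beta HF); assert (P4 := Pol_der _ F derivation_d_betab HF).
  assert (Q : forall D, derivation D -> D (cpartial 0 F) p = (D (d_alpha F) p + D (d_alphab F) p)%C
     /\ D (cpartial 1 F) p = (Ci * (D (d_alpha F) p - D (d_alphab F) p))%C
     /\ D (cpartial 2 F) p = (D (d_beta F) p + D (d_betab F) p)%C
     /\ D (cpartial 3 F) p = (Ci * (D (d_beta F) p - D (d_betab F) p))%C).
  { intros D HD.
    replace (cpartial 0 F) with (fun q => d_alpha F q + d_alphab F q)%C by (fext; now destruct (d_parts F x)).
    replace (cpartial 1 F) with (fun q => Ci * (d_alpha F q + - d_alphab F q))%C by (fext; now destruct (d_parts F x) as (_ & -> & _)).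
    replace (cpartial 2 F) with (fun q => d_beta F q + d_betab F q)%C by (fext; now destruct (d_parts F x) as (_ & _ & -> & _)).
    replace (cpartial 3 F) with (fun q => Ci * (d_beta F q + - d_betab F q))%C by (fext; now destruct (d_parts F x) as (_ & _ & _ & ->)).
    rewrite !(der_scal D), !(der_plus D), !(der_opp D) by auto with pol. repeat split; ring. }
  rewrite (proj1 (Q _ (derivation_cpartial 0 ltac:(lia)))), (proj1 (proj2 (Q _ (derivation_cpartial 1 ltac:(lia))))),
    (proj1 (proj2 (proj2 (Q _ (derivation_cpartial 2 ltac:(lia)))))), (proj2 (proj2 (proj2 (Q _ (derivation_cpartial 3 ltac:(lia)))))).
  destruct (d_parts (d_alpha F) p) as (-> & -> & _); destruct (d_parts (d_alphab F) p) as (-> & -> & _).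
  destruct (d_parts (d_beta F) p) as (_ & _ & -> & ->); destruct (d_parts (d_betab F) p) as (_ & _ & -> & ->).
  rewrite (wirtinger_comm d_alphab d_alpha), (wirtinger_comm d_betab d_beta) by (cbn; auto 6).
  assert (I2 : (Ci * Ci = - 1)%C) by (apply Ceq_ri; cbn; ring).
  unfold lapC.
  match goal with |- ?l = ?r => replace l with
    (d_alpha (d_alpha F) p * (1 + Ci * Ci) + d_alphab (d_alphab F) p * (1 + Ci * Ci) + 2 * (1 - Ci * Ci) * d_alpha (d_alphab F) p
    + (d_beta (d_beta F) p * (1 + Ci * Ci) + d_betab (d_betab F) p * (1 + Ci * Ci) + 2 * (1 - Ci * Ci) * d_beta (d_betab F) p))%C by ring end.
  rewrite I2; ring.
Qed.

Lemma HPol_euler (d : nat) (P : cfun) (p : R4) : HPol d P -> (euler P p + eulerb P p = INC d * P p)%C.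
Proof.
  intros (v & Hv & E).
  assert (HP : forall j, (j < S d)%nat -> Pol (v j)) by (intros j Hj; assert (X := Hv j ltac:(lia)); eauto with pol).
  replace P with (fun q => csum (S d) (fun b => v b q)) by (fext; auto).
  rewrite !der_csum by auto with pol. rewrite <- csum_plus, <- csum_scal; apply csum_ext; intros j Hj.
  destruct (BPol_euler _ _ _ (Hv j ltac:(lia)) p) as [-> ->].
  replace (INC d) with (INC (d - j) + INC j)%C by (rewrite <- INC_plus; f_equal; lia). ring.
Qed.

Lemma HPol_lap (d : nat) (P : cfun) (p : R4) : HPol d P -> onS3 p ->
  lapS3 P p = (4 * lapC P p - RtoC (INR d * (INR d + 2)) * P p)%C.
Proof.
  intros H Hp; assert (HP := HPol_Pol d P H).
  assert (D1 := fun i Hi => cpartial_cderiv i P Hi HP).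
  assert (D2 := fun i Hi => cpartial_cderiv i (cpartial i P) Hi (cpartial_Pol i P Hi HP)).
  assert (HEu : forall q, (RtoC (coord 0 q) * cpartial 0 P q + RtoC (coord 1 q) * cpartial 1 P q
      + RtoC (coord 2 q) * cpartial 2 P q + RtoC (coord 3 q) * cpartial 3 P q = RtoC (INR d) * P q)%C).
  { intros q; change (RtoC (INR d)) with (INC d); rewrite <- (HPol_euler d P q H); unfold euler, eulerb.
    destruct (d_parts P q) as (-> & -> & -> & ->).
    destruct q as [[[x y] z] w]; unfold alphab, betab; cbn [alpha beta coord].
    apply Ceq_ri; cbn; ring. }
  rewrite <- (lapC_cpartial P p HP).
  apply Ceq_ri.
  - transitivity (lap4 (fun q => rho q ^ d * Re (P q)) p).
    + unfold lapS3; cbn [fst]; f_equal; fext; rewrite (HPol_ext d) by exact H; apply Re_scal.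
    + rewrite (lap_radial d (fun q => Re (P q)) (fun i q => Re (cpartial i P q)) (fun i q => Re (cpartial i (cpartial i P) q))); auto.
      * unfold Re; cbn; ring.
      * intros i q Hi; apply (D1 i Hi q).
      * intros i q Hi; apply (D2 i Hi q).
      * intros q; specialize (HEu q); apply (f_equal Re) in HEu; rewrite Re_scal in HEu; rewrite <- HEu.
        rewrite <- !Re_scal; reflexivity.
  - transitivity (lap4 (fun q => rho q ^ d * Im (P q)) p).
    + unfold lapS3; cbn [snd]; f_equal; fext; rewrite (HPol_ext d) by exact H; apply Im_scal.
    + rewrite (lap_radial d (fun q => Im (P q)) (fun i q => Im (cpartial i P q)) (fun i q => Im (cpartial i (cpartial i P) q))); auto.
      * unfold Im; cbn; ring.
      * intros i q Hi; apply (D1 i Hi q).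
      * intros i q Hi; apply (D2 i Hi q).
      * intros q; specialize (HEu q); apply (f_equal Im) in HEu; rewrite Im_scal in HEu; rewrite <- HEu.
        rewrite <- !Im_scal; reflexivity.
Qed.

(** * Eigenfunctions as sums of siblings *)

Lemma RPol_Pol (u : R4 -> R) : RPol u -> Pol (fun p => RtoC (u p)).
Proof.
  induction 1 as [k|i Hi|f g _ IF _ IG|f g _ IF _ IG].
  - apply Pol_const.
  - assert (N2 : RtoC 2 <> 0%C) by (apply RtoC_neq_0; lra).
    destruct i as [|[|[|[|i]]]]; [..|lia].
    + apply Pol_ext with (fun p => / 2 * (alpha p + alphab p))%C; [|auto with pol].
      intros [[[x y] z] w]; apply Ceq_ri; cbn; field.
    + apply Pol_ext with (fun p => - (Ci * / 2) * (alpha p - alphab p))%C; [|auto with pol].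
      intros [[[x y] z] w]; apply Ceq_ri; cbn; field.
    + apply Pol_ext with (fun p => / 2 * (beta p + betab p))%C; [|auto with pol].
      intros [[[x y] z] w]; apply Ceq_ri; cbn; field.
    + apply Pol_ext with (fun p => - (Ci * / 2) * (beta p - betab p))%C; [|auto with pol].
      intros [[[x y] z] w]; apply Ceq_ri; cbn; field.
  - apply Pol_ext with (fun p => RtoC (f p) + RtoC (g p))%C; [intros; now rewrite RtoC_plus|auto with pol].
  - apply Pol_ext with (fun p => RtoC (f p) * RtoC (g p))%C; [intros; now rewrite RtoC_mult|auto with pol].
Qed.

Lemma rho_scale (s : R) (p : R4) : 0 < s -> rho (scale4 s p) * s = rho p.
Proof.
  intros Hs; unfold rho; rewrite sqnorm4_scale, sqrt_mult_alt, sqrt_square by nra.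
  rewrite Rinv_mult; transitivity ((/ s * s) * / sqrt (sqnorm4 p)); [ring|].
  rewrite Rinv_l by lra; ring.
Qed.

Lemma ext_homog0 (F : cfun) (s : R) (p : R4) : 0 < s -> ext F (scale4 s p) = ext F p.
Proof. intros Hs; now rewrite !ext_scale, scale4_scale4, rho_scale. Qed.

Lemma ext_onS3 (F : cfun) (p : R4) : onS3 p -> ext F p = F p.
Proof.
  intros Hp; rewrite ext_scale; unfold rho; rewrite Hp, sqrt_1, Rinv_1, scale4_1; reflexivity.
Qed.

Lemma ext_congr (F G : cfun) (p : R4) : (forall q, onS3 q -> F q = G q) -> nonzero4 p -> ext F p = ext G p.
Proof. intros E Hp; rewrite !ext_scale; apply E, normalize_onS3, Hp. Qed.

Lemma lap4_plus (f g : R4 -> R) (p : R4) : C2_away0 f -> C2_away0 g -> nonzero4 p ->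
  lap4 (fun q => f q + g q) p = lap4 f p + lap4 g p.
Proof.
  intros Hf Hg Hp.
  assert (E : forall i, (i < 4)%nat -> forall q, nonzero4 q -> partial i (fun q => f q + g q) q = partial i f q + partial i g q).
  { intros i Hi q Hq; apply (Derive_plus (fun t => f (upd i q t)) (fun t => g (upd i q t))); 
      [exact (proj1 (proj2 (Hf q Hq) i Hi))|exact (proj1 (proj2 (Hg q Hq) i Hi))]. }
  assert (E2 : forall i, (i < 4)%nat -> partial i (partial i (fun q => f q + g q)) p = partial i (partial i f) p + partial i (partial i g) p).
  { intros i Hi; rewrite (partial_loc i _ _ (E i Hi) p Hp); apply (Derive_plus (fun t => partial i f (upd i p t)) (fun t => partial i g (upd i p t))).
    - exact (proj1 (proj2 (proj2 (proj2 (Hf p Hp) i Hi)) i Hi)).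
    - exact (proj1 (proj2 (proj2 (proj2 (Hg p Hp) i Hi)) i Hi)). }
  unfold lap4; rewrite !E2 by lia; ring.
Qed.

Lemma lap4_loc (f g : R4 -> R) (p : R4) : (forall q, nonzero4 q -> f q = g q) -> nonzero4 p -> lap4 f p = lap4 g p.
Proof.
  intros E Hp.
  assert (E2 : forall i, partial i (partial i f) p = partial i (partial i g) p).
  { intros i; apply partial_loc; auto; now apply partial_loc. }
  unfold lap4; now rewrite !E2.
Qed.

Lemma lapS3_plus (F U V : cfun) (p : R4) : smooth_S3 U -> smooth_S3 V ->
  (forall q, onS3 q -> F q = U q + V q)%C -> onS3 p -> lapS3 F p = (lapS3 U p + lapS3 V p)%C.
Proof.
  intros [U1 U2] [V1 V2] E Hp; assert (Hn := onS3_nonzero p Hp).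
  assert (Ex : forall q, nonzero4 q -> ext F q = (ext U q + ext V q)%C).
  { intros q Hq; rewrite (ext_congr F (fun q => U q + V q)%C q E Hq), !ext_scale; reflexivity. }
  unfold lapS3; apply Ceq_ri; cbn [fst snd Cplus].
  - rewrite <- lap4_plus by auto; apply lap4_loc; auto; intros q Hq; now rewrite Ex.
  - rewrite <- lap4_plus by auto; apply lap4_loc; auto; intros q Hq; now rewrite Ex.
Qed.

Lemma HPol_lapC (d : nat) (U : cfun) : HPol d U -> HPol d (fun p => RtoC (sqnorm4 p) * lapC U p)%C.
Proof.
  intros (v & Hv & E).
  exists (fun b p => twist_minus (twist_plus (v b)) p + RtoC (INR b * (INR (d - b) + 1)) * v b p)%C; split.
  - intros b Hb; apply BPol_plus; [apply BPol_twist_minus_plus|apply BPol_scal]; auto.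
  - intros p; replace U with (fun q => csum (S d) (fun b => v b q)) by (fext; auto).
    rewrite lapC_csum by (intros j Hj; assert (X := Hv j ltac:(lia)); eauto with pol).
    rewrite <- csum_scal; apply csum_ext; intros j Hj; now apply BPol_lapC, Hv; lia.
Qed.

Lemma eigenfunction_siblings (k : nat) (F : cfun) : smooth_S3 F ->
  (forall p, onS3 p -> lapS3 F p = (RtoC (- (INR k * (INR k + 2))) * F p)%C) ->
  exists f : nat -> cfun, (forall j, (j <= k)%nat -> BPol k 0 (f j)) /\
    forall p, onS3 p -> F p = csum (S k) (fun j => sibling (f j) j p).
Proof.
  intros [HR HI] Hl.
  destruct (eigenfunction_polynomial (fun p => Re (ext F p)) k HR) as (u1 & v1 & Pu1 & Pv1 & Du1 & Dv1 & E1).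
  { intros s p Hs; now rewrite ext_homog0. }
  { intros p Hp; specialize (Hl p Hp); apply (f_equal fst) in Hl; unfold lapS3 in Hl; cbn [fst] in Hl.
    rewrite Hl, ext_onS3 by exact Hp; apply Re_scal. }
  destruct (eigenfunction_polynomial (fun p => Im (ext F p)) k HI) as (u2 & v2 & Pu2 & Pv2 & Du2 & Dv2 & E2).
  { intros s p Hs; now rewrite ext_homog0. }
  { intros p Hp; specialize (Hl p Hp); apply (f_equal snd) in Hl; unfold lapS3 in Hl; cbn [snd] in Hl.
    rewrite Hl, ext_onS3 by exact Hp; apply Im_scal. }
  (* Real and imaginary parts are recombined by degree: U has degree k, V degree k + 1. *)
  set (U := fun p => (RtoC (u1 p) + Ci * RtoC (u2 p))%C); set (V := fun p => (RtoC (v1 p) + Ci * RtoC (v2 p))%C).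
  assert (HU : HPol k U).
  { apply homogeneous_HPol.
    - unfold U; auto using RPol_Pol with pol.
    - intros p; unfold U; rewrite Du1, Du2, !RtoC_mult; ring. }
  assert (HV : HPol (S k) V).
  { apply homogeneous_HPol.
    - unfold V; auto using RPol_Pol with pol.
    - intros p; unfold V; rewrite Dv1, Dv2, !RtoC_mult; ring. }
  assert (EF : forall p, onS3 p -> F p = (U p + V p)%C).
  { intros p Hp; rewrite <- (ext_onS3 F p Hp); apply Ceq_ri.
    - change (fst (ext F p)) with (Re (ext F p)); rewrite E1 by exact Hp; unfold U, V; cbn; ring.
    - change (snd (ext F p)) with (Im (ext F p)); rewrite E2 by exact Hp; unfold U, V; cbn; ring. }
  assert (EL : forall p, onS3 p -> (4 * lapC U p + (4 * lapC V p - RtoC (2 * INR k + 3) * V p) = 0)%C).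
  { intros p Hp; assert (X := Hl p Hp).
    rewrite (lapS3_plus F U V p (HPol_smooth _ _ HU) (HPol_smooth _ _ HV) EF Hp), (HPol_lap k U), (HPol_lap (S k) V), EF in X by assumption.
    replace (INR k * (INR k + 2)) with (INR (S k) * (INR (S k) + 2) - (2 * INR k + 3)) in X by (rewrite S_INR; ring).
    rewrite RtoC_opp, RtoC_minus in X.
    match type of X with ?l = ?r => transitivity (l - r)%C; [ring|rewrite X; ring] end. }
  (* U and V have opposite antipodal parity and the Laplacian respects it, so the equation at -p
     separates what the equation at p mixes. *)
  assert (Neg : forall d W p, HPol d W -> onS3 p -> lapC W (scale4 (-1) p) = (RtoC ((-1) ^ d) * lapC W p)%C).
  { intros d W p HW Hp; assert (X := HPol_scale d _ (HPol_lapC d W HW) (-1) p).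
    cbv beta in X; rewrite sqnorm4_scale, Hp in X. replace (-1 * -1 * 1) with 1 in X by ring.
    transitivity (1 * lapC W (scale4 (-1) p))%C; [ring|rewrite X; ring]. }
  assert (On : forall p, onS3 p -> onS3 (scale4 (-1) p)).
  { intros p Hp; unfold onS3; rewrite sqnorm4_scale, Hp; ring. }
  assert (EA : forall p, onS3 p -> (4 * lapC U p = 0 /\ 4 * lapC V p - RtoC (2 * INR k + 3) * V p = 0)%C).
  { intros p Hp; assert (X := EL p Hp); assert (Y := EL _ (On p Hp)).
    rewrite (Neg k U p HU Hp), (Neg (S k) V p HV Hp), (HPol_scale (S k) V HV) in Y.
    assert (Sq : (RtoC ((-1) ^ k) * RtoC ((-1) ^ k) = 1)%C).
    { rewrite <- RtoC_mult, <- Rpow_mult_distr; replace (-1 * -1) with 1 by ring; now rewrite pow1. }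
    apply (f_equal (Cmult (RtoC ((-1) ^ k)))) in Y.
    assert (Y' : (4 * lapC U p - (4 * lapC V p - RtoC (2 * INR k + 3) * V p) = 0)%C).
    { transitivity ((RtoC ((-1) ^ k) * RtoC ((-1) ^ k)) * (4 * lapC U p - (4 * lapC V p - RtoC (2 * INR k + 3) * V p)))%C; [rewrite Sq; ring|].
      transitivity (RtoC ((-1) ^ k) * RtoC 0)%C; [rewrite <- Y|ring].
      cbn [pow]; rewrite RtoC_mult; ring. }
    assert (N2 : RtoC 2 <> 0%C) by (apply RtoC_neq_0; lra).
    set (A := (4 * lapC U p)%C) in *; set (B := (4 * lapC V p - RtoC (2 * INR k + 3) * V p)%C) in *.
    split.
    - apply (Cmult_eq_0 2%C); auto. transitivity ((A + B) + (A - B))%C; [ring|rewrite X, Y'; ring].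
    - apply (Cmult_eq_0 2%C); auto. transitivity ((A + B) - (A - B))%C; [ring|rewrite X, Y'; ring]. }
  destruct (harmonic_siblings k U HU) as (f & Hf & Ef).
  { intros p Hp; rewrite (proj1 (EA p Hp)); ring. }
  exists f; split; [exact Hf|]; intros p Hp.
  rewrite EF, (wrong_parity_zero k V HV), <- Ef; [ring| |exact Hp].
  intros q Hq; destruct (EA q Hq) as [_ X].
  transitivity ((4 * lapC V q - RtoC (2 * INR k + 3) * V q) + RtoC (2 * INR k + 3) * V q)%C; [ring|rewrite X; ring].
Qed.

(** * The action of SU(2) *)

(** Orthogonality to the first row and determinant 1 are two linear equations for (c, d), solved by
    means of |a|^2 + |b|^2 = 1. *)
Lemma SU2_entries (a b c d : CC) : in_SU2 (a, b, c, d) -> d = Cconj a /\ c = (- Cconj b)%C.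
Proof.
  intros (H1 & H2 & H3 & H4).
  assert (H5 : (Cconj a * c + Cconj b * d = 0)%C).
  { apply (f_equal Cconj) in H3. rewrite Cplus_conj, !Cmult_conj, !Cconj_conj in H3. rewrite H3; apply Ceq_ri; cbn; ring. }
  split.
  - transitivity (d * (a * Cconj a + b * Cconj b))%C; [rewrite H1; ring|].
    transitivity (Cconj a * (a * d - b * c) + b * (Cconj a * c + Cconj b * d))%C; [ring|rewrite H4, H5; ring].
  - transitivity (c * (a * Cconj a + b * Cconj b))%C; [rewrite H1; ring|].
    transitivity (a * (Cconj a * c + Cconj b * d) - Cconj b * (a * d - b * c))%C; [ring|rewrite H4, H5; ring].
Qed.

Lemma act_alpha (a b c d : CC) (p : R4) : alpha (act (a, b, c, d) p) = (a * alpha p + b * beta p)%C.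
Proof. apply Ceq_ri; reflexivity. Qed.
Lemma act_beta (a b c d : CC) (p : R4) : beta (act (a, b, c, d) p) = (c * alpha p + d * beta p)%C.
Proof. apply Ceq_ri; reflexivity. Qed.
Lemma act_alphab (a b c d : CC) (p : R4) : alphab (act (a, b, c, d) p) = (Cconj a * alphab p + Cconj b * betab p)%C.
Proof. unfold alphab, betab; now rewrite act_alpha, Cplus_conj, !Cmult_conj. Qed.
Lemma act_betab (a b c d : CC) (p : R4) : betab (act (a, b, c, d) p) = (Cconj c * alphab p + Cconj d * betab p)%C.
Proof. unfold alphab, betab; now rewrite act_beta, Cplus_conj, !Cmult_conj. Qed.

Lemma R4_of_alpha_beta (p q : R4) : alpha p = alpha q -> beta p = beta q -> p = q.
Proof. destruct p as [[[x y] z] w], q as [[[x' y'] z'] w']; cbn; intros [= -> ->] [= -> ->]; reflexivity. Qed.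

Definition pt (u v : CC) : R4 := (fst u, snd u, fst v, snd v).
Lemma alpha_pt (u v : CC) : alpha (pt u v) = u.
Proof. now destruct u. Qed.
Lemma beta_pt (u v : CC) : beta (pt u v) = v.
Proof. now destruct v. Qed.

Lemma act_inv2 (g : mat2) (p : R4) : in_SU2 g -> act (inv2 g) (act g p) = p.
Proof.
  destruct g as [[[a b] c] d]; intros (_ & _ & _ & H4); unfold inv2.
  apply R4_of_alpha_beta.
  - rewrite act_alpha, act_alpha, act_beta.
    transitivity ((a * d - b * c) * alpha p)%C; [ring|rewrite H4; ring].
  - rewrite act_beta, act_alpha, act_beta.
    transitivity ((a * d - b * c) * beta p)%C; [ring|rewrite H4; ring].
Qed.

Lemma in_SU2_inv2 (g : mat2) : in_SU2 g -> in_SU2 (inv2 g).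
Proof.
  destruct g as [[[a b] c] d]; intros H; destruct (SU2_entries a b c d H) as [-> ->].
  destruct H as (H1 & _ & _ & H4); unfold inv2, in_SU2.
  rewrite !Copp_conj, !Cconj_conj; repeat split.
  - rewrite <- H1; ring.
  - rewrite <- H1; ring.
  - ring.
  - rewrite <- H4; ring.
Qed.

Lemma onS3_act (g : mat2) (p : R4) : in_SU2 g -> onS3 p -> onS3 (act g p).
Proof.
  destruct g as [[[a b] c] d]; intros H Hp; destruct (SU2_entries a b c d H) as [-> ->].
  destruct H as (H1 & _).
  assert (E : RtoC (sqnorm4 (act (a, b, (- Cconj b)%C, Cconj a) p)) = RtoC 1).
  { rewrite <- alpha_beta_norm, act_alpha, act_beta, act_alphab, act_betab.
    rewrite !Copp_conj, !Cconj_conj.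
    transitivity ((a * Cconj a + b * Cconj b) * (alpha p * alphab p + beta p * betab p))%C; [ring|].
    rewrite H1, alpha_beta_norm, Hp; ring. }
  unfold onS3; now injection E.
Qed.

Lemma BPol_act (g : mat2) (a b : nat) (F : cfun) : BPol a b F -> BPol a b (fun p => F (act g p)).
Proof.
  destruct g as [[[ga gb] gc] gd]; induction 1.
  - apply BPol_0.
  - apply BPol_const.
  - apply BPol_ext with (fun p => ga * alpha p + gb * beta p)%C; [intros; now rewrite act_alpha|].
    apply BPol_plus; apply BPol_scal; [apply BPol_alpha|apply BPol_beta].
  - apply BPol_ext with (fun p => gc * alpha p + gd * beta p)%C; [intros; now rewrite act_beta|].
    apply BPol_plus; apply BPol_scal; [apply BPol_alpha|apply BPol_beta].
  - apply BPol_ext with (fun p => Cconj ga * alphab p + Cconj gb * betab p)%C; [intros; now rewrite act_alphab|].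
    apply BPol_plus; apply BPol_scal; [apply BPol_alphab|apply BPol_betab].
  - apply BPol_ext with (fun p => Cconj gc * alphab p + Cconj gd * betab p)%C; [intros; now rewrite act_betab|].
    apply BPol_plus; apply BPol_scal; [apply BPol_alphab|apply BPol_betab].
  - now apply BPol_plus.
  - now apply BPol_mult.
Qed.

Lemma Pol_act (g : mat2) (F : cfun) : Pol F -> Pol (fun p => F (act g p)).
Proof.
  destruct g as [[[ga gb] gc] gd]; induction 1.
  - apply Pol_const.
  - apply Pol_ext with (fun p => ga * alpha p + gb * beta p)%C; [intros; now rewrite act_alpha|auto with pol].
  - apply Pol_ext with (fun p => gc * alpha p + gd * beta p)%C; [intros; now rewrite act_beta|auto with pol].
  - apply Pol_ext with (fun p => Cconj ga * alphab p + Cconj gb * betab p)%C; [intros; now rewrite act_alphab|auto with pol].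
  - apply Pol_ext with (fun p => Cconj gc * alphab p + Cconj gd * betab p)%C; [intros; now rewrite act_betab|auto with pol].
  - now apply Pol_plus.
  - now apply Pol_mult.
Qed.

(* The pair (-conj beta, conj alpha) transforms under SU(2) like (alpha, beta). *)
Lemma twist_minus_act (g : mat2) (F : cfun) : in_SU2 g -> Pol F ->
  forall p, twist_minus (fun q => F (act g q)) p = twist_minus F (act g p).
Proof.
  destruct g as [[[ga gb] gc] gd]; intros Hg; destruct (SU2_entries _ _ _ _ Hg) as [-> ->].
  assert (L : forall u v (X Y : cfun) p, Pol X -> Pol Y -> twist_minus (fun q => u * X q + v * Y q)%C p = (u * twist_minus X p + v * twist_minus Y p)%C).
  { intros u v X Y p HX HY; rewrite (der_plus twist_minus) by auto with pol. rewrite !(der_scal twist_minus) by auto with pol; reflexivity. }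
  induction 1 as [c| | | | |F G HF IF HG IG|F G HF IF HG IG]; intros p.
  - now rewrite !(der_const twist_minus) by auto with pol.
  - rewrite (proj1 (twist_minus_gens _)).
    replace (fun q => alpha (act (ga, gb, (- Cconj gb)%C, Cconj ga) q)) with (fun q => ga * alpha q + gb * beta q)%C by (fext; now rewrite act_alpha).
    rewrite L, act_betab by auto with pol; destruct (twist_minus_gens p) as (-> & -> & _).
    rewrite Copp_conj, !Cconj_conj; ring.
  - rewrite (proj1 (proj2 (twist_minus_gens _))).
    replace (fun q => beta (act (ga, gb, (- Cconj gb)%C, Cconj ga) q)) with (fun q => - Cconj gb * alpha q + Cconj ga * beta q)%C by (fext; now rewrite act_beta).
    rewrite L, act_alphab by auto with pol; destruct (twist_minus_gens p) as (-> & -> & _). ring.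
  - rewrite (proj1 (proj2 (proj2 (twist_minus_gens _)))).
    replace (fun q => alphab (act (ga, gb, (- Cconj gb)%C, Cconj ga) q)) with (fun q => Cconj ga * alphab q + Cconj gb * betab q)%C by (fext; now rewrite act_alphab).
    rewrite L by auto with pol; destruct (twist_minus_gens p) as (_ & _ & -> & ->); ring.
  - rewrite (proj2 (proj2 (proj2 (twist_minus_gens _)))).
    replace (fun q => betab (act (ga, gb, (- Cconj gb)%C, Cconj ga) q)) with (fun q => Cconj (- Cconj gb) * alphab q + Cconj (Cconj ga) * betab q)%C by (fext; now rewrite act_betab).
    rewrite L by auto with pol; destruct (twist_minus_gens p) as (_ & _ & -> & ->); ring.
  - rewrite (der_plus twist_minus derivation_twist_minus (fun q => F (act _ q)) (fun q => G (act _ q))) by auto using Pol_act.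
    rewrite (der_plus twist_minus), IF, IG by auto with pol; reflexivity.
  - rewrite (der_mult twist_minus derivation_twist_minus (fun q => F (act _ q)) (fun q => G (act _ q))) by auto using Pol_act.
    rewrite (der_mult twist_minus), IF, IG by auto with pol; reflexivity.
Qed.

Lemma sibling_act (g : mat2) (F : cfun) (j : nat) : in_SU2 g -> Pol F ->
  sibling (fun q => F (act g q)) j = (fun p => sibling F j (act g p)).
Proof.
  intros Hg HF; induction j as [|j IH]; [reflexivity|].
  rewrite !sibling_S, IH; fext. apply (twist_minus_act g (sibling F j)); auto.
  apply der_iter_Pol; auto with pol.
Qed.

(** The chain rule for a complex linear substitution; conjugated variables do not contribute to
    unconjugated derivatives. Both sides obey the product rule, so induction starts from the
    generators. *)
Lemma d_alpha_act (a b c d : CC) (F : cfun) : Pol F -> forall p,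
  d_alpha (fun q => F (act (a, b, c, d) q)) p
    = (a * d_alpha F (act (a, b, c, d) p) + c * d_beta F (act (a, b, c, d) p))%C /\
  d_beta (fun q => F (act (a, b, c, d) q)) p
    = (b * d_alpha F (act (a, b, c, d) p) + d * d_beta F (act (a, b, c, d) p))%C.
Proof.
  assert (L : forall D u v (X Y : cfun) p, derivation D -> Pol X -> Pol Y -> D (fun q => u * X q + v * Y q)%C p = (u * D X p + v * D Y p)%C).
  { intros D u v X Y p HD HX HY; rewrite (der_plus D) by auto with pol. rewrite !(der_scal D) by auto with pol; reflexivity. }
  set (g := (a, b, c, d)).
  induction 1 as [k| | | | |F G HF IF HG IG|F G HF IF HG IG]; intros p.
  - rewrite !(der_const d_alpha), !(der_const d_beta) by auto with pol; split; ring.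
  - replace (fun q => alpha (act g q)) with (fun q => a * alpha q + b * beta q)%C by (fext; unfold g; now rewrite act_alpha).
    rewrite !L by auto with pol; gens p; rewrite Gaa, Gab, Gba, Gbb; clear; gens (act g p); rewrite Gaa, Gba; split; ring.
  - replace (fun q => beta (act g q)) with (fun q => c * alpha q + d * beta q)%C by (fext; unfold g; now rewrite act_beta).
    rewrite !L by auto with pol; gens p; rewrite Gaa, Gab, Gba, Gbb; clear; gens (act g p); rewrite Gab, Gbb; split; ring.
  - replace (fun q => alphab (act g q)) with (fun q => Cconj a * alphab q + Cconj b * betab q)%C by (fext; unfold g; now rewrite act_alphab).
    rewrite !L by auto with pol; gens p; rewrite Gac, Gad, Gbc, Gbd; clear; gens (act g p); rewrite Gac, Gbc; split; ring.
  - replace (fun q => betab (act g q)) with (fun q => Cconj c * alphab q + Cconj d * betab q)%C by (fext; unfold g; now rewrite act_betab).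
    rewrite !L by auto with pol; gens p; rewrite Gac, Gad, Gbc, Gbd; clear; gens (act g p); rewrite Gad, Gbd; split; ring.
  - rewrite (der_plus d_alpha derivation_d_alpha (fun q => F (act g q)) (fun q => G (act g q))),
      (der_plus d_beta derivation_d_beta (fun q => F (act g q)) (fun q => G (act g q))) by auto using Pol_act.
    rewrite (der_plus d_alpha), (der_plus d_beta) by auto with pol.
    destruct (IF p) as [-> ->], (IG p) as [-> ->]; split; ring.
  - rewrite (der_mult d_alpha derivation_d_alpha (fun q => F (act g q)) (fun q => G (act g q))),
      (der_mult d_beta derivation_d_beta (fun q => F (act g q)) (fun q => G (act g q))) by auto using Pol_act.
    rewrite (der_mult d_alpha), (der_mult d_beta) by auto with pol.
    destruct (IF p) as [-> ->], (IG p) as [-> ->]; split; ring.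
Qed.

Lemma siblings_HPol (k : nat) (f : nat -> cfun) : (forall j, (j <= k)%nat -> BPol k 0 (f j)) ->
  HPol k (fun p => csum (S k) (fun j => sibling (f j) j p)).
Proof.
  intros Hf; exists (fun j => sibling (f j) j); split; [|reflexivity].
  intros b Hb; apply sibling_BPol; auto.
Qed.

Lemma siblings_independent_S3 (k : nat) (f : nat -> cfun) : (forall j, (j <= k)%nat -> BPol k 0 (f j)) ->
  (forall p, onS3 p -> csum (S k) (fun j => sibling (f j) j p) = 0%C) ->
  forall j p, (j <= k)%nat -> f j p = 0%C.
Proof.
  intros Hf H0 j p Hj; apply (siblings_independent k f (S k)); [lia| | |lia].
  - intros i Hi; apply Hf; lia.
  - apply (HPol_vanish k); [now apply siblings_HPol|exact H0].
Qed.

Lemma sibling_minus (f h : cfun) (j : nat) : Pol f -> Pol h ->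
  sibling (fun p => f p - h p)%C j = (fun p => sibling f j p - sibling h j p)%C.
Proof.
  intros Hf Hh; induction j as [|j IH]; [reflexivity|].
  rewrite !sibling_S, IH; fext.
  assert (P1 : Pol (sibling f j)) by (apply der_iter_Pol; auto with pol).
  assert (P2 : Pol (sibling h j)) by (apply der_iter_Pol; auto with pol).
  rewrite (der_plus twist_minus derivation_twist_minus (sibling f j) (fun q => - sibling h j q)%C) by auto with pol.
  rewrite (der_opp twist_minus) by auto with pol; reflexivity.
Qed.

(** [twist_minus] commutes with the action, so F moved by g has the moved forms as components;
    uniqueness of components identifies them with the old ones. *)
Lemma components_invariant (k : nat) (F : cfun) (f : nat -> cfun) (g : mat2) :
  (forall j, (j <= k)%nat -> BPol k 0 (f j)) ->
  (forall p, onS3 p -> F p = csum (S k) (fun j => sibling (f j) j p)) ->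
  in_SU2 g -> (forall p, onS3 p -> F (act (inv2 g) p) = F p) ->
  forall j p, (j <= k)%nat -> f j (act g p) = f j p.
Proof.
  intros Hf EF Hg Hinv.
  assert (Hh := in_SU2_inv2 g Hg).
  assert (H : forall j p, (j <= k)%nat -> (f j (act (inv2 g) p) - f j p = 0)%C).
  { apply (siblings_independent_S3 k (fun j p => f j (act (inv2 g) p) - f j p)%C).
    - intros j Hj; apply BPol_minus; [apply BPol_act|]; auto.
    - intros p Hp.
      transitivity (F (act (inv2 g) p) - F p)%C.
      + rewrite !EF by auto using onS3_act.
        transitivity (csum (S k) (fun j => sibling (f j) j (act (inv2 g) p) + - (1) * sibling (f j) j p)%C).
        * apply csum_ext; intros j Hj; assert (X := Hf j ltac:(lia)).
          assert (PX : Pol (f j)) by eauto with pol.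
          rewrite (sibling_minus (fun q => f j (act (inv2 g) q)) (f j)), sibling_act by auto using Pol_act; ring.
        * rewrite csum_plus, csum_scal; ring.
      + rewrite Hinv by exact Hp; ring. }
  intros j p Hj; specialize (H j (act g p) Hj); rewrite act_inv2 in H by exact Hg.
  replace (f j (act g p)) with (f j p - (f j p - f j (act g p)))%C by ring. rewrite H; ring.
Qed.

(** * Binary forms *)

(** Binary forms of degree k as functions on C^2, with the pure power of the first variable split
    off and the rest divisible by the second. This makes the zero at infinity visible and suits
    synthetic division. *)
Fixpoint Form (k : nat) (f : CC -> CC -> CC) : Prop :=
  match k with
  | O => exists c : CC, forall a b, f a b = c
  | S k' => exists (c : CC) (f1 : CC -> CC -> CC), Form k' f1 /\ forall a b, f a b = (c * a ^ S k' + b * f1 a b)%C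
  end.

Lemma Form_ext (k : nat) (f g : CC -> CC -> CC) : (forall a b, f a b = g a b) -> Form k f -> Form k g.
Proof.
  intros E; replace g with f; auto. apply functional_extensionality; intros a; now apply functional_extensionality.
Qed.

Lemma Form_deg (k m : nat) (f : CC -> CC -> CC) : k = m -> Form k f -> Form m f.
Proof. now intros ->. Qed.

Lemma Form_0 (k : nat) : Form k (fun _ _ => 0%C).
Proof.
  induction k as [|k IH]; [now exists 0%C|]. exists 0%C, (fun _ _ => 0%C); split; [exact IH|]. intros; ring.
Qed.

Lemma Form_plus (k : nat) : forall f g, Form k f -> Form k g -> Form k (fun a b => f a b + g a b)%C.
Proof.
  induction k as [|k IH]; intros f g.
  - intros [c Hc] [e He]; exists (c + e)%C; intros; now rewrite Hc, He.
  - intros (c & f1 & Hf & Ec) (e & g1 & Hg & Ee); exists (c + e)%C, (fun a b => f1 a b + g1 a b)%C.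
    split; [now apply IH|]. intros; rewrite Ec, Ee; ring.
Qed.

Lemma Form_scal (k : nat) (x : CC) : forall f, Form k f -> Form k (fun a b => x * f a b)%C.
Proof.
  induction k as [|k IH]; intros f.
  - intros [c Hc]; exists (x * c)%C; intros; now rewrite Hc.
  - intros (c & f1 & Hf & Ec); exists (x * c)%C, (fun a b => x * f1 a b)%C.
    split; [now apply IH|]. intros; rewrite Ec; ring.
Qed.

Lemma Form_minus (k : nat) (f g : CC -> CC -> CC) : Form k f -> Form k g -> Form k (fun a b => f a b - g a b)%C.
Proof.
  intros Hf Hg; apply Form_ext with (fun a b => f a b + - (1) * g a b)%C; [intros; ring|].
  now apply Form_plus, Form_scal.
Qed.

Lemma Form_fst (k : nat) : forall f, Form k f -> Form (S k) (fun a b => a * f a b)%C.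
Proof.
  induction k as [|k IH]; intros f.
  - intros [c Hc]; exists c, (fun _ _ => 0%C); split; [now exists 0%C|]. intros; rewrite Hc; cbn; ring.
  - intros (c & f1 & Hf & Ec); exists c, (fun a b => a * f1 a b)%C.
    split; [now apply IH|]. intros; rewrite Ec, !Cpow_S; ring.
Qed.

Lemma Form_snd (k : nat) (f : CC -> CC -> CC) : Form k f -> Form (S k) (fun a b => b * f a b)%C.
Proof. intros H; exists 0%C, f; split; [exact H|]. intros; ring. Qed.

Lemma Form_fst_pow (m k : nat) (f : CC -> CC -> CC) : Form k f -> Form (m + k) (fun a b => a ^ m * f a b)%C.
Proof.
  intros H; induction m as [|m IH].
  - apply Form_ext with f; [intros; cbn; ring|exact H].
  - apply Form_ext with (fun a b => a * (a ^ m * f a b))%C; [intros; rewrite Cpow_S; ring|].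
    now apply (Form_fst (m + k) (fun a b => a ^ m * f a b)%C).
Qed.

Lemma Form_mult (m k : nat) : forall f g, Form m f -> Form k g -> Form (m + k) (fun a b => f a b * g a b)%C.
Proof.
  induction m as [|m IH]; intros f g.
  - intros [c Hc] Hg; apply Form_ext with (fun a b => c * g a b)%C; [intros; now rewrite Hc|now apply Form_scal].
  - intros (c & f1 & Hf & Ec) Hg.
    apply Form_ext with (fun a b => c * (a ^ S m * g a b) + b * (f1 a b * g a b))%C; [intros; rewrite Ec; ring|].
    apply (Form_plus (S m + k)).
    + now apply (Form_scal (S m + k)), Form_fst_pow.
    + now apply (Form_snd (m + k) (fun a b => f1 a b * g a b)%C), IH.
Qed.

Lemma Form_pow (m n : nat) (f : CC -> CC -> CC) : Form m f -> Form (n * m) (fun a b => f a b ^ n)%C.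
Proof.
  intros H; induction n as [|n IH]; [now exists 1%C|].
  now apply (Form_mult m (n * m) f (fun a b => f a b ^ n)%C).
Qed.

Lemma Form_mono (m n : nat) (c : CC) : Form (m + n) (fun a b => c * a ^ m * b ^ n)%C.
Proof.
  apply Form_ext with (fun a b => a ^ m * (c * b ^ n))%C; [intros; ring|].
  apply (Form_fst_pow m n (fun a b => c * b ^ n)%C), Form_scal.
  induction n as [|n IH]; [now exists 1%C|]. now apply (Form_snd n (fun a b => b ^ n)%C).
Qed.

Lemma Form_csum (k n : nat) (F : nat -> CC -> CC -> CC) : (forall i, (i < n)%nat -> Form k (F i)) ->
  Form k (fun a b => csum n (fun i => F i a b)).
Proof.
  induction n as [|n IH]; intros H; [apply Form_0|].
  apply (Form_plus k (fun a b => csum n (fun i => F i a b)) (F n)); auto.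
Qed.

Lemma Form_homog (k : nat) : forall f, Form k f -> forall s a b, f (s * a)%C (s * b)%C = (s ^ k * f a b)%C.
Proof.
  induction k as [|k IH]; intros f.
  - intros [c Hc] s a b; rewrite !Hc; cbn; ring.
  - intros (c & f1 & Hf & Ec) s a b; rewrite !Ec, (IH f1 Hf), Cpow_mult_l, !Cpow_S; ring.
Qed.

Lemma Form_subst (k : nat) (x y z w : CC) : forall f, Form k f ->
  Form k (fun a b => f (x * a + y * b) (z * a + w * b))%C.
Proof.
  assert (L : forall x y, Form 1 (fun a b => x * a + y * b)%C).
  { intros x' y'; exists x', (fun _ _ => y'); split; [now exists y'|]. intros; cbn; ring. }
  induction k as [|k IH]; intros f.
  - intros [c Hc]; exists c; intros; apply Hc.
  - intros (c & f1 & Hf & Ec).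
    apply Form_ext with (fun a b => c * (x * a + y * b) ^ S k + (z * a + w * b) * f1 (x * a + y * b) (z * a + w * b))%C; [intros; now rewrite Ec|].
    apply (Form_plus (S k)).
    + apply (Form_scal (S k)). apply Form_deg with (S k * 1)%nat; [lia|]. apply (Form_pow 1 (S k)), L.
    + apply (Form_mult 1 k (fun a b => z * a + w * b)%C); [apply L|now apply IH].
Qed.

Lemma Form_root (k : nat) (z : CC) : forall f, Form (S k) f -> f z 1%C = 0%C ->
  exists g, Form k g /\ forall a b, f a b = ((a - z * b) * g a b)%C.
Proof.
  induction k as [|k IH]; intros f (c & f1 & Hf & Ec) H0.
  - destruct Hf as [e He]. exists (fun _ _ => c); split; [now exists c|]. intros a b.
    rewrite Ec, He in *.
    assert (X : e = (- c * z)%C) by (transitivity ((c * z ^ 1 + 1 * e) - c * z)%C; [ring|rewrite H0; ring]).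
    rewrite X; ring.
  (* Synthetic division: subtracting (a - z b) c a^(k + 1) from f leaves b times [f2], which again
     vanishes at (z, 1). *)
  - set (f2 := fun a b => (f1 a b + z * c * a ^ S k)%C).
    assert (H2 : Form (S k) f2).
    { apply (Form_plus (S k)); [exact Hf|]. apply Form_ext with (fun a b => z * c * a ^ S k * b ^ 0)%C; [intros; cbn; ring|].
      apply Form_deg with (S k + 0)%nat; [lia|apply Form_mono]. }
    destruct (IH f2 H2) as (g & Hg & Eg).
    { unfold f2; rewrite <- H0, Ec, !Cpow_S; ring. }
    exists (fun a b => c * a ^ S k + b * g a b)%C; split.
    + exists c, g; split; [exact Hg|reflexivity].
    + intros a b.
      transitivity ((a - z * b) * c * a ^ S k + b * f2 a b)%C; [unfold f2; rewrite Ec, !Cpow_S; ring|rewrite Eg; ring].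
Qed.

Lemma Form_coeffs (k : nat) : forall f, Form k f ->
  exists c : nat -> CC, forall a b, f a b = csum (S k) (fun i => c i * a ^ i * b ^ (k - i))%C.
Proof.
  induction k as [|k IH]; intros f.
  - intros [c Hc]; exists (fun _ => c); intros; rewrite Hc; cbn; ring.
  - intros (c & f1 & Hf & Ec); destruct (IH f1 Hf) as [c1 E1].
    exists (fun i => if Nat.eqb i (S k) then c else c1 i); intros a b.
    rewrite Ec, E1, <- csum_scal.
    change (csum (S (S k)) ?F) with (csum (S k) F + F (S k))%C; cbv beta.
    rewrite Nat.eqb_refl, Nat.sub_diag.
    rewrite (csum_ext (S k) (fun i => (if Nat.eqb i (S k) then c else c1 i) * a ^ i * b ^ (S k - i))%C (fun j => b * (c1 j * a ^ j * b ^ (k - j)))%C).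
    + cbn [Cpow]; ring.
    + intros j Hj; replace (Nat.eqb j (S k)) with false by (symmetry; apply Nat.eqb_neq; lia).
      replace (S k - j)%nat with (S (k - j)) by lia; rewrite Cpow_S; ring.
Qed.

Fixpoint linprod (l : list CC) (a b : CC) : CC :=
  match l with nil => 1%C | z :: l' => ((a - z * b) * linprod l' a b)%C end.

Lemma Form_roots (l : list CC) : forall k f, NoDup l -> Form k f -> (forall z, In z l -> f z 1%C = 0%C) ->
  (forall a b, f a b = 0%C) \/
  exists m g, k = (length l + m)%nat /\ Form m g /\ forall a b, f a b = (linprod l a b * g a b)%C.
Proof.
  induction l as [|z l IH]; intros k f Hnd Hf H0.
  - right; exists k, f; repeat split; auto. intros; cbn; ring.
  - inversion Hnd as [|z' l' Hz Hl]; subst.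
    destruct k as [|k].
    + left; destruct Hf as [c Hc]; intros a b; rewrite Hc, <- (Hc z 1%C); apply H0; now left.
    + destruct (Form_root k z f Hf (H0 z (or_introl eq_refl))) as (g & Hg & Eg).
      destruct (IH k g Hl Hg) as [Hz0|(m & h & Hm & Hh & Eh)].
      * intros w Hw; assert (X := H0 w (or_intror Hw)); rewrite Eg in X.
        apply (Cmult_eq_0 _ _ X); intros E; apply Hz; replace z with w; [exact Hw|].
        transitivity ((w - z * 1) + z)%C; [ring|rewrite E; ring].
      * left; intros; rewrite Eg, Hz0; ring.
      * right; exists m, h; repeat split; [cbn; lia|exact Hh|]. intros; cbn; rewrite Eg, Eh; ring.
Qed.

(** The sample points start at 3 because there the three icosahedral forms are nonzero and may be
    cancelled. *)
Lemma Form_many_roots (k : nat) (f : CC -> CC -> CC) : Form k f ->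
  (forall n : nat, f (INC (n + 3)) 1%C = 0%C) -> forall a b, f a b = 0%C.
Proof.
  intros Hf H0.
  destruct (Form_roots (map (fun n => INC (n + 3)) (seq 0 (S k))) k f) as [Z|(m & g & Hm & _)]; auto.
  - apply FinFun.Injective_map_NoDup; [|apply seq_NoDup]. intros i j E; apply INC_inj in E; lia.
  - intros z Hz; apply in_map_iff in Hz; destruct Hz as (n & <- & _); apply H0.
  - rewrite length_map, length_seq in Hm; lia.
Qed.

Lemma Form_eq_points (k : nat) (f g : CC -> CC -> CC) : Form k f -> Form k g ->
  (forall n : nat, f (INC (n + 3)) 1%C = g (INC (n + 3)) 1%C) -> forall a b, f a b = g a b.
Proof.
  intros Hf Hg E a b.
  assert (Z := Form_many_roots k _ (Form_minus k f g Hf Hg)); cbv beta in Z.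
  transitivity ((f a b - g a b) + g a b)%C; [ring|rewrite Z; [ring|]]. intros n; rewrite E; ring.
Qed.

Lemma BPol_Form (a b : nat) (F : cfun) : BPol a b F -> b = 0%nat ->
  exists f, Form a f /\ forall p, F p = f (alpha p) (beta p).
Proof.
  induction 1 as [a b|c| | | | |a b F G HF IF HG IG|a b a' b' F G HF IF HG IG]; intros Hb; try discriminate.
  - exists (fun _ _ => 0%C); split; [apply Form_0|reflexivity].
  - exists (fun _ _ => c); split; [now exists c|reflexivity].
  - exists (fun u _ => u); split; [|reflexivity]. exists 1%C, (fun _ _ => 0%C); split; [now exists 0%C|]. intros; cbn; ring.
  - exists (fun _ v => v); split; [|reflexivity]. exists 0%C, (fun _ _ => 1%C); split; [now exists 1%C|]. intros; cbn; ring.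
  - destruct (IF Hb) as (f & Hf & Ef), (IG Hb) as (g & Hg & Eg).
    exists (fun u v => f u v + g u v)%C; split; [now apply Form_plus|]. intros; now rewrite Ef, Eg.
  - destruct (IF ltac:(lia)) as (f & Hf & Ef), (IG ltac:(lia)) as (g & Hg & Eg).
    exists (fun u v => f u v * g u v)%C; split; [now apply Form_mult|]. intros; now rewrite Ef, Eg.
Qed.

Lemma Form_BPol (k : nat) : forall f, Form k f -> BPol k 0 (fun p => f (alpha p) (beta p)).
Proof.
  induction k as [|k IH]; intros f.
  - intros [c Hc]; apply BPol_ext with (fun _ => c); [intros; now rewrite Hc|apply BPol_const].
  - intros (c & f1 & Hf & Ec).
    apply BPol_ext with (fun p => c * alpha p ^ S k + beta p * f1 (alpha p) (beta p))%C; [intros; now rewrite Ec|].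
    apply BPol_plus.
    + apply BPol_scal; apply BPol_eq with (S k * 1)%nat (S k * 0)%nat; [lia|lia|]. apply BPol_pow, BPol_alpha.
    + apply (BPol_mult 1 0 k 0 beta (fun p => f1 (alpha p) (beta p))); [apply BPol_beta|now apply IH].
Qed.

(** * The icosahedral group *)

Lemma Form_I12 : Form 12 I12.
Proof.
  apply Form_ext with (fun a b => 1 * a ^ 11 * b ^ 1 + 11 * a ^ 6 * b ^ 6 + - (1) * a ^ 1 * b ^ 11)%C; [intros; unfold I12; ring|].
  repeat apply (Form_plus 12); [apply (Form_mono 11 1)|apply (Form_mono 6 6)|apply (Form_mono 1 11)].
Qed.
Lemma Form_I20 : Form 20 I20.
Proof.
  apply Form_ext with (fun a b => 1 * a ^ 20 * b ^ 0 + - (228) * a ^ 15 * b ^ 5 + 494 * a ^ 10 * b ^ 10 + 228 * a ^ 5 * b ^ 15 + 1 * a ^ 0 * b ^ 20)%C; [intros; unfold I20; ring|].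
  repeat apply (Form_plus 20); [apply (Form_mono 20 0)|apply (Form_mono 15 5)|apply (Form_mono 10 10)|apply (Form_mono 5 15)|apply (Form_mono 0 20)].
Qed.
Lemma Form_I30 : Form 30 I30.
Proof.
  apply Form_ext with (fun a b => 1 * a ^ 30 * b ^ 0 + 522 * a ^ 25 * b ^ 5 + - (10005) * a ^ 20 * b ^ 10 + - (10005) * a ^ 10 * b ^ 20 + - (522) * a ^ 5 * b ^ 25 + 1 * a ^ 0 * b ^ 30)%C; [intros; unfold I30; ring|].
  repeat apply (Form_plus 30); [apply (Form_mono 30 0)|apply (Form_mono 25 5)|apply (Form_mono 20 10)|apply (Form_mono 10 20)|apply (Form_mono 5 25)|apply (Form_mono 0 30)].
Qed.

Lemma syzygy (a b : CC) : (I30 a b ^ 2 = 1728 * I12 a b ^ 5 + I20 a b ^ 3)%C.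
Proof. unfold I30, I12, I20; ring. Qed.

(** In y = x^5 the coefficients are dominated by the leading terms as soon as y >= 243 = 3^5. *)
Lemma I_nonzero_points (n : nat) :
  I12 (INC (n + 3)) 1 <> 0%C /\ I20 (INC (n + 3)) 1 <> 0%C /\ I30 (INC (n + 3)) 1 <> 0%C.
Proof.
  set (x := INR (n + 3)).
  assert (Hx : 3 <= x) by (unfold x; rewrite plus_INR; cbn; pose proof (pos_INR n); lra).
  assert (Hy : 243 <= x ^ 5).
  { replace 243 with (3 ^ 5) by ring; apply pow_incr; lra. }
  unfold INC; fold x; set (y := x ^ 5) in *.
  assert (E12 : I12 (RtoC x) 1 = RtoC (x * (y * y + 11 * y - 1))).
  { unfold I12, y; rewrite RtoC_mult, RtoC_minus, RtoC_plus, !RtoC_mult, RtoC_pow; ring. }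
  assert (E20 : I20 (RtoC x) 1 = RtoC (y ^ 4 - 228 * y ^ 3 + 494 * y ^ 2 + 228 * y + 1)).
  { unfold I20, y; rewrite !RtoC_plus, RtoC_minus, !RtoC_mult, !RtoC_pow; ring. }
  assert (E30 : I30 (RtoC x) 1 = RtoC (y ^ 6 + 522 * y ^ 5 - 10005 * y ^ 4 - 10005 * y ^ 2 - 522 * y + 1)).
  { unfold I30, y; rewrite !RtoC_plus, !RtoC_minus, RtoC_plus, !RtoC_mult, !RtoC_pow; ring. }
  rewrite E12, E20, E30; clear E12 E20 E30; clearbody y.
  assert (P2 : 243 * y <= y ^ 2) by nra.
  assert (P3 : 243 * y ^ 2 <= y ^ 3) by nra.
  assert (P4 : 243 * y ^ 3 <= y ^ 4) by nra.
  assert (P5 : 243 * y ^ 4 <= y ^ 5) by nra.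
  assert (P6 : 243 * y ^ 5 <= y ^ 6) by nra.
  repeat split; apply RtoC_neq_0; apply Rgt_not_eq; nra.
Qed.

(** * Fifth roots of unity, the golden ratio and the twelve vertices *)

Definition eps : CC := (cos (2 * PI / 5), sin (2 * PI / 5)).

Lemma de_moivre (t : R) (n : nat) : (((cos t, sin t) : CC) ^ n)%C = (cos (INR n * t), sin (INR n * t)).
Proof.
  induction n as [|n IH]; [cbn; now rewrite Rmult_0_l, cos_0, sin_0|].
  rewrite Cpow_S, IH, S_INR, Rmult_plus_distr_r, Rmult_1_l, (Rplus_comm _ t), cos_plus, sin_plus.
  apply Ceq_ri; cbn; ring.
Qed.

Lemma eps5 : (eps ^ 5 = 1)%C.
Proof.
  unfold eps; rewrite de_moivre; replace (INR 5 * (2 * PI / 5)) with (2 * PI) by (cbn; field).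
  now rewrite cos_2PI, sin_2PI.
Qed.

Lemma eps_neq1 : eps <> 1%C.
Proof.
  intros E; apply (f_equal snd) in E; cbn in E.
  assert (0 < sin (2 * PI / 5)); [|lra]. apply sin_gt_0; pose proof PI_RGT_0; lra.
Qed.

Lemma eps_conj : (eps * Cconj eps = 1)%C.
Proof.
  apply Ceq_ri; cbn; [|ring]. assert (H := sin2_cos2 (2 * PI / 5)); unfold Rsqr in H; lra.
Qed.

Lemma C1_neq_0 : RtoC 1 <> 0%C.
Proof. apply RtoC_neq_0; lra. Qed.

Lemma eps_neq0 : eps <> 0%C.
Proof. intros E; assert (H := eps5); rewrite E in H; apply C1_neq_0; rewrite <- H; ring. Qed.

Lemma eps_pow_mod (n : nat) : (eps ^ n = 1)%C -> (n mod 5 = 0)%nat.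
Proof.
  intros H; rewrite (Nat.div_mod n 5) in H by lia.
  rewrite Cpow_add_r, Cpow_mult_r, eps5, Cpow_1_l, Cmult_1_l in H.
  assert (Hm := Nat.mod_upper_bound n 5 ltac:(lia)); assert (H5 := eps5).
  destruct (n mod 5) as [|[|[|[|[|m]]]]]; [reflexivity|..|lia]; exfalso; apply eps_neq1.
  - transitivity (eps ^ 1)%C; [ring|exact H].
  - transitivity (eps * (eps ^ 2) ^ 2)%C; [rewrite H; ring|rewrite <- H5; ring].
  - transitivity (eps * eps ^ 5)%C; [rewrite H5; ring|]. transitivity ((eps ^ 3) ^ 2)%C; [ring|rewrite H; ring].
  - transitivity (eps * eps ^ 4)%C; [rewrite H; ring|rewrite <- H5; ring].
Qed.

Lemma eps_pow_inj (i j : nat) : (i < 5)%nat -> (j < 5)%nat -> (eps ^ i = eps ^ j)%C -> i = j.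
Proof.
  assert (G : forall i j, (i <= j < 5)%nat -> (eps ^ i = eps ^ j)%C -> i = j).
  { intros m n Hmn E; replace n with (m + (n - m))%nat in E by lia; rewrite Cpow_add_r in E.
    assert (X : (eps ^ (n - m) = 1)%C).
    { assert (N := Cpow_nz eps m eps_neq0).
      transitivity (/ eps ^ m * (eps ^ m * eps ^ (n - m)))%C; [field; exact N|rewrite <- E; field; exact N]. }
    apply eps_pow_mod in X. rewrite Nat.mod_small in X by lia. lia. }
  intros Hi Hj E; destruct (Nat.le_ge_cases i j); [|symmetry]; apply G; auto; lia.
Qed.

Definition tau : R := (sqrt 5 - 1) / 2.
Definition taubar : R := - (1 + tau).

Lemma tau_eq : tau * tau = 1 - tau.
Proof. unfold tau; assert (H := sqrt_sqrt 5 ltac:(lra)); nra. Qed.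
Lemma tau_pos : 0 < tau.
Proof.
  unfold tau; assert (1 < sqrt 5); [|lra]. rewrite <- sqrt_1 at 1; apply sqrt_lt_1_alt; lra.
Qed.
Lemma taubar_eq : taubar * taubar = 1 - taubar.
Proof. unfold taubar; assert (H := tau_eq); nra. Qed.

Definition ico_roots : list CC :=
  map (fun j => eps ^ j * RtoC tau)%C (seq 0 5) ++ map (fun j => eps ^ j * RtoC taubar)%C (seq 0 5).

(** The roots t of t^2 + t - 1 have fifth powers 5 t - 3, which are the two roots of Y^2 + 11 Y - 1;
    this is how the golden ratio enters the ten finite nonzero vertices. *)
Lemma golden5 (t : R) : t * t = 1 - t -> (RtoC t ^ 5 = 5 * RtoC t - 3)%C.
Proof.
  intros H; assert (HC : (RtoC t ^ 2 = 1 - RtoC t)%C).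
  { rewrite <- RtoC_pow, <- RtoC_minus; f_equal; rewrite <- H; ring. }
  ring [HC].
Qed.

Lemma ico_root_eq (z : CC) : In z ico_roots -> (z ^ 10 + 11 * z ^ 5 - 1 = 0)%C.
Proof.
  assert (G : forall t j, t * t = 1 - t -> ((eps ^ j * RtoC t) ^ 10 + 11 * (eps ^ j * RtoC t) ^ 5 - 1 = 0)%C).
  { intros t j Ht; assert (E : ((eps ^ j * RtoC t) ^ 5 = 5 * RtoC t - 3)%C).
    { rewrite Cpow_mult_l, <- Cpow_mult_r, Nat.mul_comm, Cpow_mult_r, eps5, Cpow_1_l, golden5 by exact Ht; ring. }
    transitivity (((eps ^ j * RtoC t) ^ 5) ^ 2 + 11 * (eps ^ j * RtoC t) ^ 5 - 1)%C; [ring|rewrite E].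
    assert (HC : (RtoC t ^ 2 = 1 - RtoC t)%C).
    { rewrite <- RtoC_pow, <- RtoC_minus; f_equal; rewrite <- Ht; ring. }
    ring [HC]. }
  unfold ico_roots; rewrite in_app_iff, !in_map_iff; intros [(j & <- & _)|(j & <- & _)]; apply G.
  - apply tau_eq.
  - apply taubar_eq.
Qed.

Lemma taubar_neg : taubar < 0.
Proof. unfold taubar; pose proof tau_pos; lra. Qed.

Lemma ico_roots_nodup : NoDup (RtoC 0 :: ico_roots).
Proof.
  assert (Inj : forall t, t <> 0 -> NoDup (map (fun j => eps ^ j * RtoC t)%C (seq 0 5))).
  { intros t Ht; assert (HtC := RtoC_neq_0 t Ht).
    assert (X : forall i j, (i < 5)%nat -> (j < 5)%nat -> (eps ^ i * RtoC t = eps ^ j * RtoC t)%C -> i = j).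
    { intros i j Hi Hj E; apply eps_pow_inj; auto.
      transitivity (eps ^ i * RtoC t / RtoC t)%C; [field; exact HtC|rewrite E; field; exact HtC]. }
    apply NoDup_map_NoDup_ForallPairs; [|apply seq_NoDup].
    intros i j Hi Hj E; apply in_seq in Hi, Hj; apply X; auto; lia. }
  constructor.
  - intros H0; apply ico_root_eq in H0. apply C1_neq_0.
    transitivity (- (RtoC 0 ^ 10 + 11 * RtoC 0 ^ 5 - 1))%C; [ring|rewrite H0; ring].
  - apply NoDup_app; [apply Inj; pose proof tau_pos; lra|apply Inj; pose proof taubar_neg; lra|].
    intros z Hz Hz'; apply in_map_iff in Hz, Hz'; destruct Hz as (i & <- & _), Hz' as (j & E & _).
    apply (f_equal (fun z => z ^ 5)%C) in E.
    rewrite !Cpow_mult_l, <- !Cpow_mult_r, (Nat.mul_comm i), (Nat.mul_comm j), !Cpow_mult_r, eps5, !Cpow_1_l, !golden5 in E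
      by (apply tau_eq || apply taubar_eq).
    assert (X : RtoC taubar = RtoC tau).
    { assert (N5 : RtoC 5 <> 0%C) by (apply RtoC_neq_0; lra).
      transitivity ((1 * (5 * RtoC taubar - 3) + 3) / 5)%C; [field; exact N5|rewrite E; field; exact N5]. }
    assert (taubar = tau) by (now injection X). pose proof tau_pos; pose proof taubar_neg; lra.
Qed.

(** The vertex at infinity gives the factor b, the eleven finite ones give linear factors a - z
    b. *)
Lemma Form_vertices_aux (k : nat) (f : CC -> CC -> CC) : Form k f ->
  f 1%C 0%C = 0%C -> f 0%C 1%C = 0%C -> (forall z, In z ico_roots -> f z 1%C = 0%C) ->
  (forall a b, f a b = 0%C) \/
  exists m g, k = (12 + m)%nat /\ Form m g /\ forall a b, f a b = (b * linprod (RtoC 0 :: ico_roots) a b * g a b)%C.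
Proof.
  intros Hf Hinf H0 Hr; destruct k as [|k].
  - left; destruct Hf as [c Hc]; intros; rewrite Hc, <- (Hc 1%C 0%C); exact Hinf.
  - destruct Hf as (c & f1 & Hf1 & Ec).
    assert (Hc : c = 0%C).
    { rewrite Ec, Cpow_1_l in Hinf; rewrite <- Hinf; ring. }
    assert (E : forall a b, f a b = (b * f1 a b)%C) by (intros; rewrite Ec, Hc; ring).
    destruct (Form_roots (RtoC 0 :: ico_roots) k f1 ico_roots_nodup Hf1) as [Z|(m & g & Hm & Hg & Eg)].
    + intros z [<-|Hz].
      * rewrite E in H0; transitivity (1 * f1 0 1)%C; [ring|exact H0].
      * assert (X := Hr z Hz); rewrite E in X; transitivity (1 * f1 z 1)%C; [ring|exact X].
    + left; intros; rewrite E, Z; ring.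
    + right; exists m, g; repeat split; auto.
      * cbn in Hm; lia.
      * intros; rewrite E, Eg; ring.
Qed.

Lemma I12_vertices : I12 1 0 = 0%C /\ I12 0 1 = 0%C /\ forall z, In z ico_roots -> I12 z 1 = 0%C.
Proof.
  repeat split; [unfold I12; ring|unfold I12; ring|].
  intros z Hz; apply ico_root_eq in Hz; unfold I12.
  transitivity (z * (z ^ 10 + 11 * z ^ 5 - 1))%C; [ring|rewrite Hz; ring].
Qed.

Lemma I12_11 : I12 1 1 <> 0%C.
Proof. replace (I12 1 1) with (RtoC 11) by (unfold I12; ring). apply RtoC_neq_0; lra. Qed.

(** Applied to I12 itself the factorisation leaves a form of degree 0, so I12 is a nonzero constant
    times the product of the twelve linear factors; this replaces an explicit expansion. *)
Lemma Form_vertices (k : nat) (f : CC -> CC -> CC) : Form k f ->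
  f 1%C 0%C = 0%C -> f 0%C 1%C = 0%C -> (forall z, In z ico_roots -> f z 1%C = 0%C) ->
  (forall a b, f a b = 0%C) \/
  exists m g, k = (12 + m)%nat /\ Form m g /\ forall a b, f a b = (I12 a b * g a b)%C.
Proof.
  intros Hf Hinf H0 Hr.
  destruct (Form_vertices_aux k f Hf Hinf H0 Hr) as [Z|(m & g & Hm & Hg & Eg)]; [now left|right].
  destruct I12_vertices as (V1 & V2 & V3).
  destruct (Form_vertices_aux 12 I12 Form_I12 V1 V2 V3) as [Z|(m' & g' & Hm' & Hg' & Eg')].
  - now elim I12_11.
  - assert (m' = 0%nat) by lia; subst m'; destruct Hg' as [c Hc].
    assert (Hc0 : c <> 0%C).
    { intros E; apply I12_11; rewrite Eg', Hc, E; ring. }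
    exists m, (fun a b => / c * g a b)%C; repeat split; [exact Hm|now apply Form_scal|].
    intros a b; rewrite Eg, Eg', Hc; field; exact Hc0.
Qed.

Lemma C_integral (a b : CC) : (a * b = 0)%C -> a = 0%C \/ b = 0%C.
Proof. intros H; destruct (classic (a = 0%C)) as [E|E]; [now left|right]. now apply (Cmult_eq_0 a). Qed.

Lemma in_VI_I12 (z : CC) : in_VI (Some z) <-> I12 z 1 = 0%C.
Proof.
  replace (I12 z 1) with (z * (z ^ 10 + 11 * z ^ 5 - 1))%C by (unfold I12; ring); cbn [in_VI]; split.
  - intros [->|H]; [ring|rewrite H; ring].
  - intros H; now apply C_integral.
Qed.

Lemma I12_dehomog (u v : CC) : v <> 0%C -> I12 u v = (v ^ 12 * I12 (u / v) 1)%C.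
Proof.
  intros Hv; rewrite <- (Form_homog 12 I12 Form_I12); f_equal; field; exact Hv.
Qed.

(* [None] stands for the point at infinity, represented by the vector (1, 0). *)
Lemma mobius_I12 (a b c d z : CC) : in_VI (mobius (a, b, c, d) (Some z)) <-> I12 (a * z + b)%C (c * z + d)%C = 0%C.
Proof.
  cbn [mobius]; destruct (Defs.Ceq_dec (c * z + d)%C 0%C) as [E|E].
  - rewrite E; split; [intros _; unfold I12; ring|intros _; exact I].
  - rewrite in_VI_I12, (I12_dehomog (a * z + b)%C) by exact E; split; intros H; [rewrite H; ring|].
    now apply (Cmult_eq_0 _ _ H), Cpow_nz.
Qed.

Lemma mobius_I12_inf (a b c d : CC) : in_VI (mobius (a, b, c, d) None) <-> I12 a c = 0%C.
Proof.
  cbn [mobius]; destruct (Defs.Ceq_dec c 0%C) as [E|E].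
  - rewrite E; split; [intros _; unfold I12; ring|intros _; exact I].
  - rewrite in_VI_I12, (I12_dehomog a) by exact E; split; intros H; [rewrite H; ring|].
    now apply (Cmult_eq_0 _ _ H), Cpow_nz.
Qed.

Lemma Istar_of_I12 (a b c d : CC) : in_SU2 (a, b, c, d) ->
  (forall u v, I12 (a * u + b * v)%C (c * u + d * v)%C = I12 u v) -> in_Istar (a, b, c, d).
Proof.
  intros Hg H; split; [exact Hg|]; intros [z|].
  - rewrite mobius_I12, in_VI_I12, <- (H z 1%C), !Cmult_1_r; reflexivity.
  - rewrite mobius_I12_inf; split; [intros _|intros _; exact I].
    transitivity (I12 (a * 1 + b * 0)%C (c * 1 + d * 0)%C); [f_equal; ring|rewrite H; unfold I12; ring].
Qed.

(** z -> eps z, a turn by one fifth about the axis through 0 and infinity. *)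
Definition matS : mat2 := (eps ^ 3, RtoC 0, RtoC 0, eps ^ 2)%C.
Definition matU : mat2 := (RtoC 0, (- (1))%C, RtoC 1, RtoC 0).
Definition matN : mat2 := ((- (1))%C, RtoC 0, RtoC 0, (- (1))%C).
Definition tA : R := / sqrt (2 - tau).
(** The half-turn z -> (tau - z) / (tau z + 1), taking 0 to tau and infinity to -1 / tau. The scalar
    i [tA] makes the determinant 1, since 1 + tau^2 = 2 - tau. *)
Definition matT : mat2 := (- (Ci * RtoC tA), Ci * RtoC (tau * tA), Ci * RtoC (tau * tA), Ci * RtoC tA)%C.

Lemma Cconj_R (x : R) : Cconj (RtoC x) = RtoC x.
Proof. apply Ceq_ri; cbn; ring. Qed.
Lemma Cconj_Ci : Cconj Ci = (- Ci)%C.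
Proof. apply Ceq_ri; cbn; ring. Qed.
Lemma Ci2 : (Ci ^ 2 = - (1))%C.
Proof. apply Ceq_ri; cbn; ring. Qed.

Lemma Istar_S : in_Istar matS.
Proof.
  assert (E5 := eps5); assert (Ec := eps_conj).
  apply Istar_of_I12.
  - unfold in_SU2; rewrite !Cpow_conj, !Cconj_R; repeat split.
    + transitivity ((eps * Cconj eps) ^ 3)%C; [ring|rewrite Ec; ring].
    + transitivity ((eps * Cconj eps) ^ 2)%C; [ring|rewrite Ec; ring].
    + ring.
    + rewrite <- E5; ring.
  - intros u v; unfold I12.
    transitivity ((eps ^ 5) ^ 7 * (u ^ 11 * v) + 11 * (eps ^ 5) ^ 6 * u ^ 6 * v ^ 6 - (eps ^ 5) ^ 5 * (u * v ^ 11))%C; [ring|rewrite E5; ring].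
Qed.

Lemma Istar_U : in_Istar matU.
Proof.
  apply Istar_of_I12.
  - unfold in_SU2; rewrite !Copp_conj, !Cconj_R; repeat split; ring.
  - intros u v; unfold I12; ring.
Qed.

Lemma Istar_N : in_Istar matN.
Proof.
  apply Istar_of_I12.
  - unfold in_SU2; rewrite !Copp_conj, !Cconj_R; repeat split; ring.
  - intros u v; unfold I12; ring.
Qed.

Lemma tau_lt1 : tau < 1.
Proof. pose proof tau_eq; pose proof tau_pos; nra. Qed.

Lemma tA_sq : tA * tA * (2 - tau) = 1.
Proof.
  unfold tA; pose proof tau_lt1; rewrite <- Rinv_mult, sqrt_sqrt by lra; field; lra.
Qed.
Lemma tA_neq0 : tA <> 0.
Proof. intros E; pose proof tA_sq as H; rewrite E in H; lra. Qed.

Lemma Istar_T : in_Istar matT.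
Proof.
  assert (Ht := tau_eq); assert (Ha := tA_sq).
  assert (HtC : (RtoC tau ^ 2 = 1 - RtoC tau)%C).
  { rewrite <- RtoC_pow, <- RtoC_minus; f_equal; rewrite <- Ht; ring. }
  assert (HaC : (RtoC tA * RtoC tA * (2 - RtoC tau) = 1)%C) by (rewrite <- RtoC_minus, <- !RtoC_mult; now rewrite Ha).
  assert (Hi := Ci2).
  apply Istar_of_I12.
  - unfold in_SU2; rewrite !Copp_conj, !Cmult_conj, !Cconj_R, Cconj_Ci, RtoC_mult; repeat split.
    + transitivity (- Ci ^ 2 * (RtoC tA * RtoC tA * (1 + RtoC tau ^ 2)))%C; [ring|]. rewrite Hi, HtC; etransitivity; [|exact HaC]; ring.
    + transitivity (- Ci ^ 2 * (RtoC tA * RtoC tA * (1 + RtoC tau ^ 2)))%C; [ring|]. rewrite Hi, HtC; etransitivity; [|exact HaC]; ring.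
    + ring.
    + transitivity (- Ci ^ 2 * (RtoC tA * RtoC tA * (1 + RtoC tau ^ 2)))%C; [ring|]. rewrite Hi, HtC; etransitivity; [|exact HaC]; ring.
  - intros u v.
    transitivity (I12 ((Ci * RtoC tA) * (RtoC tau * v - u)) ((Ci * RtoC tA) * (RtoC tau * u + v)))%C.
    + rewrite RtoC_mult; f_equal; ring.
    + rewrite (Form_homog 12 I12 Form_I12).
      (* A polynomial identity modulo tau^2 = 1 - tau; the factor (2 - tau)^6 is cancelled by the
         twelfth power of i [tA]. *)
      assert (K : I12 (RtoC tau * v - u)%C (RtoC tau * u + v)%C = ((2 - RtoC tau) ^ 6 * I12 u v)%C).
      { unfold I12; ring [HtC]. }
      rewrite K.
      transitivity ((Ci ^ 2) ^ 6 * (RtoC tA * RtoC tA * (2 - RtoC tau)) ^ 6 * I12 u v)%C; [ring|rewrite Hi, HaC; ring].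
Qed.

(** * Invariance of I12, I20 and I30 *)

Definition onform (f : CC -> CC -> CC) : cfun := fun p => f (alpha p) (beta p).

(** Explicit partial derivatives of a form, so that Hessians and Jacobians become matters for
    [ring]. *)
Definition hasd (f fa fb : CC -> CC -> CC) : Prop :=
  Pol (onform f) /\ forall p, d_alpha (onform f) p = onform fa p /\ d_beta (onform f) p = onform fb p.

Lemma hasd_ext (f fa fb g ga gb : CC -> CC -> CC) : (forall a b, f a b = g a b) ->
  (forall a b, fa a b = ga a b) -> (forall a b, fb a b = gb a b) -> hasd f fa fb -> hasd g ga gb.
Proof.
  intros E Ea Eb [P H].
  assert (X : onform f = onform g) by (fext; apply E).
  split; [now rewrite <- X|]. intros p; rewrite <- X; destruct (H p) as [-> ->]; unfold onform; now rewrite Ea, Eb.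
Qed.

Lemma hasd_plus (f fa fb g ga gb : CC -> CC -> CC) : hasd f fa fb -> hasd g ga gb ->
  hasd (fun a b => f a b + g a b)%C (fun a b => fa a b + ga a b)%C (fun a b => fb a b + gb a b)%C.
Proof.
  intros [Pf Hf] [Pg Hg]; split; [now apply (Pol_plus (onform f) (onform g))|]. intros p.
  change (onform (fun a b => f a b + g a b)%C) with (fun q => onform f q + onform g q)%C.
  rewrite (der_plus d_alpha), (der_plus d_beta) by auto with pol.
  destruct (Hf p) as [-> ->], (Hg p) as [-> ->]; split; reflexivity.
Qed.

Lemma der_pow (D : cfun -> cfun) (F : cfun) (n : nat) (p : R4) : derivation D -> Pol F ->
  D (fun q => F q ^ n)%C p = (INC n * F p ^ (n - 1) * D F p)%C.
Proof.
  intros HD HF; induction n as [|n IH].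
  - change (fun q => F q ^ 0)%C with (fun _ : R4 => RtoC 1); rewrite (der_const D HD), INC_0; ring.
  - change (fun q => F q ^ S n)%C with (fun q => F q * F q ^ n)%C.
    rewrite (der_mult D HD F (fun q => F q ^ n)%C), IH by auto using Pol_pow.
    destruct n as [|n]; [rewrite INC_S, INC_0; cbn; ring|].
    replace (S n - 1)%nat with n by lia; replace (S (S n) - 1)%nat with (S n) by lia.
    rewrite (INC_S (S n)), !Cpow_S; ring.
Qed.

Lemma hasd_mono (c ca cb : CC) (m n : nat) : ca = (c * INC m)%C -> cb = (c * INC n)%C ->
  hasd (fun a b => c * a ^ m * b ^ n)%C (fun a b => ca * a ^ (m - 1) * b ^ n)%C (fun a b => cb * a ^ m * b ^ (n - 1))%C.
Proof.
  intros -> ->.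
  assert (P1 : Pol (fun q => c * alpha q ^ m)%C) by auto using Pol_scal, Pol_pow, Pol_alpha.
  assert (P2 : Pol (fun q => beta q ^ n)%C) by auto using Pol_pow, Pol_beta.
  split; [exact (Pol_mult _ _ P1 P2)|]. intros p; gens p.
  change (onform (fun a b => c * a ^ m * b ^ n)%C) with (fun q => (c * alpha q ^ m) * beta q ^ n)%C.
  rewrite (der_mult d_alpha derivation_d_alpha (fun q => c * alpha q ^ m)%C (fun q => beta q ^ n)%C),
    (der_mult d_beta derivation_d_beta (fun q => c * alpha q ^ m)%C (fun q => beta q ^ n)%C) by assumption.
  rewrite !der_scal, !der_pow, Gaa, Gab, Gba, Gbb by auto using Pol_pow with pol.
  unfold onform; split; ring.
Qed.

Ltac inc := unfold INC; rewrite INR_IZR_INZ; cbn; rewrite <- ?RtoC_opp, <- ?RtoC_mult; f_equal; ring.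

Definition I12a (a b : CC) : CC := (11 * a ^ 10 * b + 66 * a ^ 5 * b ^ 6 - b ^ 11)%C.
Definition I12b (a b : CC) : CC := (a ^ 11 + 66 * a ^ 6 * b ^ 5 - 11 * a * b ^ 10)%C.
Definition I12aa (a b : CC) : CC := (110 * a ^ 9 * b + 330 * a ^ 4 * b ^ 6)%C.
Definition I12ab (a b : CC) : CC := (11 * a ^ 10 + 396 * a ^ 5 * b ^ 5 - 11 * b ^ 10)%C.
Definition I12bb (a b : CC) : CC := (330 * a ^ 6 * b ^ 4 - 110 * a * b ^ 9)%C.
Definition I20a (a b : CC) : CC := (20 * a ^ 19 - 3420 * a ^ 14 * b ^ 5 + 4940 * a ^ 9 * b ^ 10 + 1140 * a ^ 4 * b ^ 15)%C.
Definition I20b (a b : CC) : CC := (- (1140) * a ^ 15 * b ^ 4 + 4940 * a ^ 10 * b ^ 9 + 3420 * a ^ 5 * b ^ 14 + 20 * b ^ 19)%C.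

Lemma hasd_I12 : hasd I12 I12a I12b.
Proof.
  eapply hasd_ext; [| | |exact (hasd_plus _ _ _ _ _ _ (hasd_plus _ _ _ _ _ _
    (hasd_mono 1 11 1 11 1 ltac:(inc) ltac:(inc)) (hasd_mono 11 66 66 6 6 ltac:(inc) ltac:(inc)))
    (hasd_mono (-1) (-1) (-11) 1 11 ltac:(inc) ltac:(inc)))];
  intros a b; unfold I12, I12a, I12b; cbn [Nat.sub]; ring.
Qed.

Lemma hasd_I12a : hasd I12a I12aa I12ab.
Proof.
  eapply hasd_ext; [| | |exact (hasd_plus _ _ _ _ _ _ (hasd_plus _ _ _ _ _ _
    (hasd_mono 11 110 11 10 1 ltac:(inc) ltac:(inc)) (hasd_mono 66 330 396 5 6 ltac:(inc) ltac:(inc)))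
    (hasd_mono (-1) 0 (-11) 0 11 ltac:(inc) ltac:(inc)))];
  intros a b; unfold I12a, I12aa, I12ab; cbn [Nat.sub]; ring.
Qed.

Lemma hasd_I12b : hasd I12b I12ab I12bb.
Proof.
  eapply hasd_ext; [| | |exact (hasd_plus _ _ _ _ _ _ (hasd_plus _ _ _ _ _ _
    (hasd_mono 1 11 0 11 0 ltac:(inc) ltac:(inc)) (hasd_mono 66 396 330 6 5 ltac:(inc) ltac:(inc)))
    (hasd_mono (-11) (-11) (-110) 1 10 ltac:(inc) ltac:(inc)))];
  intros a b; unfold I12b, I12bb, I12ab; cbn [Nat.sub]; ring.
Qed.

Lemma hasd_I20 : hasd I20 I20a I20b.
Proof.
  eapply hasd_ext; [| | |exact (hasd_plus _ _ _ _ _ _ (hasd_plus _ _ _ _ _ _ (hasd_plus _ _ _ _ _ _ (hasd_plus _ _ _ _ _ _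
    (hasd_mono 1 20 0 20 0 ltac:(inc) ltac:(inc)) (hasd_mono (-228) (-3420) (-1140) 15 5 ltac:(inc) ltac:(inc)))
    (hasd_mono 494 4940 4940 10 10 ltac:(inc) ltac:(inc))) (hasd_mono 228 1140 3420 5 15 ltac:(inc) ltac:(inc)))
    (hasd_mono 1 0 20 0 20 ltac:(inc) ltac:(inc)))];
  intros a b; unfold I20, I20a, I20b; cbn [Nat.sub]; ring.
Qed.

Lemma hasd_scal (x : CC) (f fa fb : CC -> CC -> CC) : hasd f fa fb ->
  hasd (fun a b => x * f a b)%C (fun a b => x * fa a b)%C (fun a b => x * fb a b)%C.
Proof.
  intros [P H]; split; [now apply (Pol_scal x (onform f))|]. intros p.
  change (onform (fun a b => x * f a b)%C) with (fun q => x * onform f q)%C.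
  rewrite !der_scal by auto with pol; destruct (H p) as [-> ->]; split; reflexivity.
Qed.

Lemma hasd_unique (f fa fb ga gb : CC -> CC -> CC) : hasd f fa fb -> hasd f ga gb ->
  (forall a b, fa a b = ga a b) /\ (forall a b, fb a b = gb a b).
Proof.
  intros [_ H] [_ H']; split; intros a b; destruct (H (pt a b)) as [E1 E2], (H' (pt a b)) as [E3 E4].
  - transitivity (onform fa (pt a b)); [unfold onform; now rewrite alpha_pt, beta_pt|].
    rewrite <- E1, E3; unfold onform; now rewrite alpha_pt, beta_pt.
  - transitivity (onform fb (pt a b)); [unfold onform; now rewrite alpha_pt, beta_pt|].
    rewrite <- E2, E4; unfold onform; now rewrite alpha_pt, beta_pt.
Qed.

Lemma hasd_subst (x y z w : CC) (f fa fb : CC -> CC -> CC) : hasd f fa fb ->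
  hasd (fun a b => f (x * a + y * b) (z * a + w * b))%C
    (fun a b => x * fa (x * a + y * b) (z * a + w * b) + z * fb (x * a + y * b) (z * a + w * b))%C
    (fun a b => y * fa (x * a + y * b) (z * a + w * b) + w * fb (x * a + y * b) (z * a + w * b))%C.
Proof.
  intros [P H].
  assert (E : onform (fun a b => f (x * a + y * b) (z * a + w * b))%C = (fun p => onform f (act (x, y, z, w) p))).
  { fext; unfold onform; now rewrite act_alpha, act_beta. }
  split; [rewrite E; now apply (Pol_act (x, y, z, w) (onform f))|].
  intros p; rewrite E; destruct (d_alpha_act x y z w (onform f) P p) as [-> ->].
  destruct (H (act (x, y, z, w) p)) as [-> ->]; unfold onform; rewrite act_alpha, act_beta; split; reflexivity.
Qed.

Lemma hasd_linear_relation (x y z w chi : CC) (f fa fb : CC -> CC -> CC) : hasd f fa fb ->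
  (forall a b, f (x * a + y * b) (z * a + w * b) = chi * f a b)%C ->
  (forall a b, x * fa (x * a + y * b) (z * a + w * b) + z * fb (x * a + y * b) (z * a + w * b) = chi * fa a b)%C /\
  (forall a b, y * fa (x * a + y * b) (z * a + w * b) + w * fb (x * a + y * b) (z * a + w * b) = chi * fb a b)%C.
Proof.
  intros Hf E; apply (hasd_unique (fun a b => f (x * a + y * b) (z * a + w * b))%C); [now apply hasd_subst|].
  eapply hasd_ext; [| | |exact (hasd_scal chi _ _ _ Hf)]; intros; cbv beta; auto.
Qed.

Lemma hasd_comb (s t : CC) (f fa fb g ga gb : CC -> CC -> CC) : hasd f fa fb -> hasd g ga gb ->
  hasd (fun a b => s * f a b + t * g a b)%C (fun a b => s * fa a b + t * ga a b)%C (fun a b => s * fb a b + t * gb a b)%C.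
Proof. intros Hf Hg; exact (hasd_plus _ _ _ _ _ _ (hasd_scal s _ _ _ Hf) (hasd_scal t _ _ _ Hg)). Qed.

Lemma hessian_I12 (a b : CC) : (I12aa a b * I12bb a b - I12ab a b ^ 2 = - (121) * I20 a b)%C.
Proof. unfold I12aa, I12bb, I12ab, I20; ring. Qed.
Lemma jacobian_I12_I20 (a b : CC) : (I12a a b * I20b a b - I12b a b * I20a a b = - (20) * I30 a b)%C.
Proof. unfold I12a, I12b, I20a, I20b, I30; ring. Qed.

(** Hessian and Jacobian are covariants: under a linear substitution they pick up the square and the
    first power of the determinant, here 1. Being quadratic in I12 the first scales by chi^2; the
    second scales by chi chi^2. *)
Lemma semi_invariant_I20_I30 (x y z w chi : CC) : (x * w - y * z = 1)%C ->
  (forall a b, I12 (x * a + y * b) (z * a + w * b) = chi * I12 a b)%C ->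
  (forall a b, I20 (x * a + y * b) (z * a + w * b) = chi ^ 2 * I20 a b)%C /\
  (forall a b, I30 (x * a + y * b) (z * a + w * b) = chi ^ 3 * I30 a b)%C.
Proof.
  intros Hdet H.
  destruct (hasd_linear_relation x y z w chi _ _ _ hasd_I12 H) as [Ha Hb].
  assert (Sa := hasd_subst x y z w _ _ _ hasd_I12a); assert (Sb := hasd_subst x y z w _ _ _ hasd_I12b).
  assert (Da := hasd_comb x z _ _ _ _ _ _ Sa Sb); assert (Db := hasd_comb y w _ _ _ _ _ _ Sa Sb).
  destruct (hasd_unique _ _ _ _ _ Da (hasd_ext _ _ _ _ _ _ (fun a b => eq_sym (Ha a b)) (fun a b => eq_refl) (fun a b => eq_refl) (hasd_scal chi _ _ _ hasd_I12a))) as [Haa Hab].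
  destruct (hasd_unique _ _ _ _ _ Db (hasd_ext _ _ _ _ _ _ (fun a b => eq_sym (Hb a b)) (fun a b => eq_refl) (fun a b => eq_refl) (hasd_scal chi _ _ _ hasd_I12b))) as [_ Hbb].
  assert (H20 : (forall a b, I20 (x * a + y * b) (z * a + w * b) = chi ^ 2 * I20 a b)%C).
  { intros a b; specialize (Haa a b); specialize (Hab a b); specialize (Hbb a b); cbv beta in *.
    assert (N : RtoC (-121) <> 0%C) by (apply RtoC_neq_0; lra).
    assert (E : (-121 * (I20 (x * a + y * b) (z * a + w * b) - chi ^ 2 * I20 a b) = 0)%C).
    { transitivity (- (121) * I20 (x * a + y * b) (z * a + w * b) - chi ^ 2 * (- (121) * I20 a b))%C; [ring|].
      rewrite <- !hessian_I12.
      transitivity ((x * w - y * z) ^ 2 * (I12aa (x * a + y * b) (z * a + w * b) * I12bb (x * a + y * b) (z * a + w * b) - I12ab (x * a + y * b) (z * a + w * b) ^ 2)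
         - ((chi * I12aa a b) * (chi * I12bb a b) - (chi * I12ab a b) ^ 2))%C; [rewrite Hdet; ring|].
      rewrite <- Haa, <- Hab, <- Hbb; ring. }
    apply Cmult_eq_0 in E; [|exact N].
    transitivity ((I20 (x * a + y * b) (z * a + w * b) - chi ^ 2 * I20 a b) + chi ^ 2 * I20 a b)%C; [ring|rewrite E; ring]. }
  split; [exact H20|].
  destruct (hasd_linear_relation x y z w (chi ^ 2)%C _ _ _ hasd_I20 H20) as [Ga Gb].
  intros a b; specialize (Ha a b); specialize (Hb a b); specialize (Ga a b); specialize (Gb a b); cbv beta in *.
  assert (N : RtoC (-20) <> 0%C) by (apply RtoC_neq_0; lra).
  assert (E : (-20 * (I30 (x * a + y * b) (z * a + w * b) - chi ^ 3 * I30 a b) = 0)%C).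
  { transitivity (- (20) * I30 (x * a + y * b) (z * a + w * b) - chi ^ 3 * (- (20) * I30 a b))%C; [ring|].
    rewrite <- !jacobian_I12_I20.
    transitivity ((x * w - y * z) * (I12a (x * a + y * b) (z * a + w * b) * I20b (x * a + y * b) (z * a + w * b) - I12b (x * a + y * b) (z * a + w * b) * I20a (x * a + y * b) (z * a + w * b))
       - ((chi * I12a a b) * (chi ^ 2 * I20b a b) - (chi * I12b a b) * (chi ^ 2 * I20a a b)))%C; [rewrite Hdet; ring|].
    rewrite <- Ha, <- Hb, <- Ga, <- Gb; ring. }
  apply Cmult_eq_0 in E; [|exact N].
  transitivity ((I30 (x * a + y * b) (z * a + w * b) - chi ^ 3 * I30 a b) + chi ^ 3 * I30 a b)%C; [ring|rewrite E; ring].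
Qed.

Definition invariant (f : CC -> CC -> CC) : Prop := forall x y z w, in_Istar (x, y, z, w) ->
  forall a b, f (x * a + y * b)%C (z * a + w * b)%C = f a b.

(* The syzygy forces the character by which I12 transforms to be trivial. *)
Lemma invariants_I : invariant I12 /\ invariant I20 /\ invariant I30.
Proof.
  assert (G : forall x y z w, in_Istar (x, y, z, w) ->
    (forall a b, I12 (x * a + y * b) (z * a + w * b) = I12 a b)%C /\
    (forall a b, I20 (x * a + y * b) (z * a + w * b) = I20 a b)%C /\
    (forall a b, I30 (x * a + y * b) (z * a + w * b) = I30 a b)%C).
  { intros x y z w [HSU HV]; destruct (HSU) as (_ & _ & _ & Hdet).
    (* The substituted I12 vanishes at all vertices because the Moebius map takes vertices to
       vertices; its degree 12 leaves only a constant as cofactor of I12. *)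
    set (f := fun a b => I12 (x * a + y * b)%C (z * a + w * b)%C).
    assert (Hf : Form 12 f) by (apply Form_subst, Form_I12).
    assert (V : forall u, in_VI (Some u) -> f u 1%C = 0%C).
    { intros u Hu; apply (proj1 (HV (Some u))), mobius_I12 in Hu; unfold f; now rewrite !Cmult_1_r. }
    destruct (Form_vertices 12 f Hf) as [Z|(m & g & Hm & Hg & Eg)].
    - assert (Hi : in_VI (mobius (x, y, z, w) None)) by (apply (proj1 (HV None)); exact I).
      apply mobius_I12_inf in Hi; unfold f; etransitivity; [|exact Hi]; f_equal; ring.
    - apply V; now left.
    - intros u Hu; apply V; right; now apply ico_root_eq.
    - exfalso; apply I12_11.
      (* (w - y, x - z) is the preimage of (1, 1), by determinant 1. *)
      specialize (Z (w - y) (x - z))%C; unfold f in Z.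
      replace (x * (w - y) + y * (x - z))%C with (x * w - y * z)%C in Z by ring.
      replace (z * (w - y) + w * (x - z))%C with (x * w - y * z)%C in Z by ring.
      now rewrite Hdet in Z.
    - assert (m = 0%nat) by lia; subst m; destruct Hg as [chi Hchi].
      assert (E12 : (forall a b, I12 (x * a + y * b) (z * a + w * b) = chi * I12 a b)%C).
      { intros a b; fold (f a b); rewrite Eg, Hchi; ring. }
      destruct (semi_invariant_I20_I30 x y z w chi Hdet E12) as [E20 E30].
      (* The syzygy at the image point has I30^2 and I20^3 scaled by chi^6 but I12^5 only by chi^5;
         compare with chi^6 times the syzygy at (1, 1). *)
      assert (X : (1728 * I12 1 1 ^ 5 * (chi ^ 5 * (chi - 1)) = 0)%C).
      { assert (Y := syzygy (x * 1 + y * 1)%C (z * 1 + w * 1)%C); rewrite E12, E20, E30 in Y.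
        transitivity (chi ^ 6 * (1728 * I12 1 1 ^ 5 + I20 1 1 ^ 3) - (1728 * (chi * I12 1 1) ^ 5 + (chi ^ 2 * I20 1 1) ^ 3))%C; [ring|].
        rewrite <- Y, <- syzygy; ring. }
      assert (Hchi0 : chi <> 0%C).
      { intros E; apply I12_11; assert (Y := E12 (w - y)%C (x - z)%C).
        replace (x * (w - y) + y * (x - z))%C with (x * w - y * z)%C in Y by ring.
        replace (z * (w - y) + w * (x - z))%C with (x * w - y * z)%C in Y by ring.
        rewrite Hdet, E in Y; rewrite Y; ring. }
      assert (Hchi1 : chi = 1%C).
      { apply Cmult_eq_0 in X.
        - apply Cmult_eq_0 in X; [|now apply Cpow_nz].
          transitivity ((chi - 1) + 1)%C; [ring|rewrite X; ring].
        - intros Y; apply C_integral in Y; destruct Y as [Y|Y].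
          + revert Y; apply RtoC_neq_0; lra.
          + revert Y; apply Cpow_nz, I12_11. }
      subst chi; repeat split; intros a b; [rewrite E12|rewrite E20|rewrite E30]; ring. }
  repeat split; intros x y z w H; apply (G x y z w H).
Qed.

(** * Invariant forms and the basis of modes *)

(** From here on [lia] also understands quotients and remainders, on which the degree counts
    rest. *)
Ltac Zify.zify_post_hook ::= Z.to_euclidean_division_equations.

Lemma invariant_mult (f g : CC -> CC -> CC) : invariant f -> invariant g -> invariant (fun a b => f a b * g a b)%C.
Proof. intros Hf Hg x y z w H a b; now rewrite Hf, Hg. Qed.
Lemma invariant_pow (f : CC -> CC -> CC) (n : nat) : invariant f -> invariant (fun a b => f a b ^ n)%C.
Proof. intros Hf x y z w H a b; now rewrite Hf. Qed.

(** Cancelling I12 is possible only where it is nonzero; the sample points suffice, since forms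
    agreeing there agree everywhere. *)
Lemma invariant_quotient (m : nat) (f g : CC -> CC -> CC) : invariant f -> Form m g ->
  (forall a b, f a b = I12 a b * g a b)%C -> invariant g.
Proof.
  intros Hf Hg E x y z w H.
  apply (Form_eq_points m (fun a b => g (x * a + y * b)%C (z * a + w * b)%C) g); [now apply Form_subst|exact Hg|].
  intros n; destruct (I_nonzero_points n) as (N & _).
  destruct invariants_I as (J & _).
  assert (X := Hf x y z w H (INC (n + 3)) 1%C); rewrite !E, (J x y z w H) in X.
  transitivity (/ I12 (INC (n + 3)) 1 * (I12 (INC (n + 3)) 1 * g (x * INC (n + 3) + y * 1) (z * INC (n + 3) + w * 1)))%C; [field; exact N|].
  rewrite X; field; exact N.
Qed.

Lemma Form_zero_scale (k : nat) (f : CC -> CC -> CC) (s a b : CC) : Form k f -> s <> 0%C ->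
  f (s * a)%C (s * b)%C = 0%C -> f a b = 0%C.
Proof.
  intros Hf Hs H; rewrite (Form_homog k f Hf) in H. now apply (Cmult_eq_0 _ _ H), Cpow_nz.
Qed.

Lemma Ci_neq_0 : Ci <> 0%C.
Proof. intros E; apply (f_equal snd) in E; cbn in E; lra. Qed.

(* The matrices S, T, U move the vertex 0 to all twelve vertices. *)
Lemma invariant_vertex (k : nat) (f : CC -> CC -> CC) : Form k f -> invariant f -> f 0%C 1%C = 0%C ->
  (forall a b, f a b = 0%C) \/
  exists m g, k = (12 + m)%nat /\ Form m g /\ invariant g /\ forall a b, f a b = (I12 a b * g a b)%C.
Proof.
  intros Hf Hinv H0.
  assert (HtA : RtoC tA <> 0%C) by (apply RtoC_neq_0, tA_neq0).
  assert (HiA : (Ci * RtoC tA)%C <> 0%C) by (intros E; apply HtA, (Cmult_eq_0 _ _ E), Ci_neq_0).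
  assert (Htau : RtoC tau <> 0%C) by (apply RtoC_neq_0; pose proof tau_pos; lra).
  (* [matU] takes (0, 1) to (-1, 0), a representative of infinity. *)
  assert (Hinf : f 1%C 0%C = 0%C).
  { apply (Form_zero_scale k f (- (1))%C); auto.
    - intros E; apply C1_neq_0; transitivity (- - (1))%C; [ring|rewrite E; ring].
    - etransitivity; [|exact H0]; etransitivity; [|exact (Hinv _ _ _ _ Istar_U 0%C 1%C)]; f_equal; ring. }
  (* [matT] takes (0, 1) to i [tA] (tau, 1). *)
  assert (Ht : f (RtoC tau) 1%C = 0%C).
  { apply (Form_zero_scale k f (Ci * RtoC tA)%C); auto.
    etransitivity; [|exact H0]; etransitivity; [|exact (Hinv _ _ _ _ Istar_T 0%C 1%C)]; rewrite RtoC_mult; f_equal; ring. }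
  (* [matT] takes (1, 0) to i [tA] (-1, tau), which is i [tA] tau (taubar, 1) because tau taubar =
     -1. *)
  assert (Hs : f (RtoC taubar) 1%C = 0%C).
  { apply (Form_zero_scale k f (Ci * RtoC tA * RtoC tau)%C); auto.
    - intros E; apply Htau, (Cmult_eq_0 _ _ E), HiA.
    - etransitivity; [|exact Hinf]; etransitivity; [|exact (Hinv _ _ _ _ Istar_T 1%C 0%C)]; rewrite RtoC_mult.
      assert (X : (RtoC tau * RtoC taubar = - (1))%C).
      { rewrite <- RtoC_mult, <- RtoC_opp; f_equal; unfold taubar; pose proof tau_eq; lra. }
      f_equal; [|ring].
      transitivity (Ci * RtoC tA * (RtoC tau * RtoC taubar))%C; [ring|rewrite X; ring]. }
  (* [matS] takes (z, 1) to eps^2 (eps z, 1), so zeros spread around each ring of five. *)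
  assert (He : forall z, f z 1%C = 0%C -> f (eps * z)%C 1%C = 0%C).
  { intros z Hz; apply (Form_zero_scale k f (eps ^ 2)%C); auto.
    - apply Cpow_nz, eps_neq0.
    - etransitivity; [|exact Hz]; etransitivity; [|exact (Hinv _ _ _ _ Istar_S z 1%C)]; f_equal; ring. }
  assert (Hej : forall z j, f z 1%C = 0%C -> f (eps ^ j * z)%C 1%C = 0%C).
  { intros z j Hz; induction j as [|j IH]; [replace (eps ^ 0 * z)%C with z by (cbn; ring); exact Hz|].
    replace (eps ^ S j * z)%C with (eps * (eps ^ j * z))%C by (rewrite Cpow_S; ring); auto. }
  destruct (Form_vertices k f Hf Hinf H0) as [Z|(m & g & Hm & Hg & Eg)].
  - unfold ico_roots; intros z; rewrite in_app_iff, !in_map_iff; intros [(j & <- & _)|(j & <- & _)]; auto.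
  - now left.
  - right; exists m, g; repeat split; auto. eapply invariant_quotient; eauto.
Qed.

(** [matS] fixes the vertex 0 but scales (0, 1) by eps^2, hence f there by eps^(4 h), which is 1
    only if 5 divides h. *)
Lemma invariant_vertex_zero (h : nat) (f : CC -> CC -> CC) : Form (2 * h) f -> invariant f ->
  (h mod 5 <> 0)%nat -> f 0%C 1%C = 0%C.
Proof.
  intros Hf Hinv Hh.
  assert (E := Hinv _ _ _ _ Istar_S 0%C 1%C).
  assert (E2 : f (eps ^ 3 * 0 + 0 * 1)%C (0 * 0 + eps ^ 2 * 1)%C = (eps ^ (4 * h) * f 0 1)%C).
  { replace (4 * h)%nat with (2 * (2 * h))%nat by lia; rewrite Cpow_mult_r.
    rewrite <- (Form_homog (2 * h) f Hf); f_equal; ring. }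
  rewrite E2 in E.
  assert (X : ((eps ^ (4 * h) - 1) * f 0 1 = 0)%C).
  { transitivity (eps ^ (4 * h) * f 0 1 - f 0 1)%C; [ring|rewrite E; ring]. }
  apply (Cmult_eq_0 _ _ X); intros Y.
  assert (Z : (eps ^ (4 * h) = 1)%C) by (transitivity ((eps ^ (4 * h) - 1) + 1)%C; [ring|rewrite Y; ring]).
  apply eps_pow_mod in Z; apply Hh. lia.
Qed.

(* [N] is the number of basis elements: k~ + 1 in the notation of the paper, with h = k / 2. *)
Definition ico_basis (h N i : nat) (a b : CC) : CC :=
  (I12 a b ^ (5 * i + h mod 5) * I20 a b ^ (3 * (N - 1 - i) + h mod 3) * I30 a b ^ (h mod 2))%C.

(** Thirty times the formula N = k~ + 1, each floor of h / p written as (h - h mod p) / p,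
    rearranged free of division and subtraction. It is also the degree count, I12, I20, I30 having
    half-degrees 6, 10, 15. *)
Definition ico_count (h N : nat) : Prop :=
  (h + 30 = 6 * (h mod 5) + 10 * (h mod 3) + 15 * (h mod 2) + 30 * N)%nat.

Lemma Form_ico_basis (h N i : nat) : ico_count h N -> (i < N)%nat -> Form (2 * h) (ico_basis h N i).
Proof.
  unfold ico_count; intros HN Hi.
  apply Form_deg with (((5 * i + h mod 5) * 12 + (3 * (N - 1 - i) + h mod 3) * 20) + (h mod 2) * 30)%nat; [lia|].
  apply (Form_mult _ _ (fun a b => I12 a b ^ (5 * i + h mod 5) * I20 a b ^ (3 * (N - 1 - i) + h mod 3))%C).
  - apply (Form_mult _ _ (fun a b => I12 a b ^ (5 * i + h mod 5))%C); apply Form_pow; [apply Form_I12|apply Form_I20].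
  - apply Form_pow, Form_I30.
Qed.

Lemma invariant_ico_basis (h N i : nat) : invariant (ico_basis h N i).
Proof.
  destruct invariants_I as (J12 & J20 & J30).
  apply (invariant_mult (fun a b => I12 a b ^ (5 * i + h mod 5) * I20 a b ^ (3 * (N - 1 - i) + h mod 3))%C);
    [apply (invariant_mult (fun a b => I12 a b ^ (5 * i + h mod 5))%C)|]; now apply invariant_pow.
Qed.

Lemma csum_shift (n : nat) (f : nat -> CC) : csum (S n) f = (f 0%nat + csum n (fun i => f (S i)))%C.
Proof.
  induction n as [|n IH]; [cbn; ring|]. change (csum (S (S n)) f) with (csum (S n) f + f (S n))%C.
  rewrite IH; cbn; ring.
Qed.

(** Dividing by I12 lowers h by 6, so the class mod 6 is kept throughout the descent and the
    exceptional value h = 5 is never met. *)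
Lemma invariant_span_good (h : nat) : forall N f, ico_count h N -> (h mod 6 <> 5)%nat ->
  Form (2 * h) f -> invariant f ->
  exists c : nat -> CC, forall a b, f a b = csum N (fun i => c i * ico_basis h N i a b)%C.
Proof.
  induction h as [h IH] using (well_founded_induction lt_wf).
  intros N f HN Hg Hf Hinv; unfold ico_count in HN.
  destruct (Nat.eq_dec (h mod 5) 0) as [H5|H5].
  (* With 5 dividing h, N = 0 would force h = 5, which is excluded mod 6. *)
  - destruct N as [|N]; [lia|].
    set (c0 := f 0%C 1%C).
    set (f' := fun a b => (f a b - c0 * ico_basis h (S N) 0 a b)%C).
    (* The basis form of index 0 has no factor I12 here, while I20 and I30 equal 1 at (0, 1). *)
    assert (B0 : ico_basis h (S N) 0 0 1 = 1%C).
    { unfold ico_basis; rewrite H5.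
      replace (I20 0 1) with (RtoC 1) by (unfold I20; ring); replace (I30 0 1) with (RtoC 1) by (unfold I30; ring).
      rewrite !Cpow_1_l; cbn; ring. }
    assert (Hf' : Form (2 * h) f').
    { apply Form_minus; [exact Hf|]. apply Form_scal, Form_ico_basis; [exact HN|lia]. }
    assert (Hi' : invariant f').
    { intros x y z w H a b; unfold f'; rewrite (Hinv x y z w H), (invariant_ico_basis h (S N) 0 x y z w H); reflexivity. }
    destruct (invariant_vertex (2 * h) f' Hf' Hi') as [Z|(m & g & Hm & Hfg & Hgi & Eg)].
    { unfold f'; rewrite B0; unfold c0; ring. }
    + exists (fun i => if Nat.eqb i 0 then c0 else 0%C); intros a b.
      rewrite csum_shift, csum_zero by (intros; cbn; ring). cbn [Nat.eqb].
      specialize (Z a b); unfold f' in Z.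
      transitivity ((f a b - c0 * ico_basis h (S N) 0 a b) + c0 * ico_basis h (S N) 0 a b)%C; [ring|rewrite Z; ring].
    + destruct (IH (h - 6)%nat ltac:(lia) N g) as [c Ec].
      * unfold ico_count; lia.
      * lia.
      * apply Form_deg with m; [lia|exact Hfg].
      * exact Hgi.
      * exists (fun i => match i with O => c0 | S i' => c i' end); intros a b.
        rewrite csum_shift.
        transitivity (c0 * ico_basis h (S N) 0 a b + f' a b)%C; [unfold f'; ring|].
        f_equal; rewrite Eg, Ec, <- csum_scal; apply csum_ext; intros i Hi.
        unfold ico_basis.
        (* The exponent of I12 goes from 5 i + 4 to 5 (i + 1): multiplication by I12 shifts the
           index by one, leaving index 0 to the subtracted form. *)
        replace ((h - 6) mod 5)%nat with 4%nat by lia. replace ((h - 6) mod 3)%nat with (h mod 3)%nat by lia.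
        replace ((h - 6) mod 2)%nat with (h mod 2)%nat by lia. rewrite H5.
        replace (S N - 1 - S i)%nat with (N - 1 - i)%nat by lia.
        replace (5 * S i + 0)%nat with (S (5 * i + 4)) by lia. rewrite (Cpow_S (I12 a b)); ring.
  - destruct (invariant_vertex (2 * h) f Hf Hinv (invariant_vertex_zero h f Hf Hinv H5)) as [Z|(m & g & Hm & Hfg & Hgi & Eg)].
    + exists (fun _ => 0%C); intros a b; rewrite Z, csum_zero; [reflexivity|intros; ring].
    + destruct (IH (h - 6)%nat ltac:(lia) N g) as [c Ec].
      * unfold ico_count; lia.
      * lia.
      * apply Form_deg with m; [lia|exact Hfg].
      * exact Hgi.
      (* Here (h - 6) mod 5 is h mod 5 minus 1, so multiplication by I12 keeps both index and
         count. *)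
      * exists c; intros a b. rewrite Eg, Ec, <- csum_scal; apply csum_ext; intros i Hi.
        unfold ico_basis.
        replace ((h - 6) mod 3)%nat with (h mod 3)%nat by lia.
        replace ((h - 6) mod 2)%nat with (h mod 2)%nat by lia.
        replace (5 * i + h mod 5)%nat with (S (5 * i + (h - 6) mod 5)) by lia. rewrite (Cpow_S (I12 a b)); ring.
Qed.

(* When h = 5 mod 6, the form f I30 falls under the previous case, and the syzygy
   I30^2 = 1728 I12^5 + I20^3 lets one divide by I30. *)
Lemma invariant_span (h N : nat) (f : CC -> CC -> CC) : ico_count h N ->
  Form (2 * h) f -> invariant f ->
  exists c : nat -> CC, forall a b, f a b = csum N (fun i => c i * ico_basis h N i a b)%C.
Proof.
  intros HN Hf Hinv; destruct (Nat.eq_dec (h mod 6) 5) as [H6|H6]; [|now apply invariant_span_good].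
  unfold ico_count in HN; destruct invariants_I as (J12 & J20 & J30).
  (* Adding 15 turns the class 5 mod 6 into 2 mod 6 and raises the count by one. *)
  destruct (invariant_span_good (h + 15) (S N) (fun a b => f a b * I30 a b)%C) as [c Ec].
  { unfold ico_count; lia. }
  { lia. }
  { apply Form_deg with (2 * h + 30)%nat; [lia|]. apply Form_mult; [exact Hf|apply Form_I30]. }
  { now apply invariant_mult. }
  (* Up to common powers f I30 is a binary form in X = I12^5 and Y = I20^3; dividing by I30 becomes
     a question about a root of it. *)
  set (Q := fun X Y => csum (S N) (fun i => c i * X ^ i * Y ^ (N - i))%C).
  assert (HQ : Form N Q).
  { apply Form_csum; intros i Hi; apply Form_deg with (i + (N - i))%nat; [lia|apply Form_mono]. }
  assert (E : forall a b, (f a b * I30 a b = I12 a b ^ (h mod 5) * I20 a b ^ 2 * Q (I12 a b ^ 5) (I20 a b ^ 3))%C).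
  { intros a b; rewrite Ec; unfold Q; rewrite <- csum_scal; apply csum_ext; intros i Hi.
    unfold ico_basis. replace ((h + 15) mod 5)%nat with (h mod 5)%nat by lia.
    replace ((h + 15) mod 3)%nat with 2%nat by lia. replace ((h + 15) mod 2)%nat with 0%nat by lia.
    replace (S N - 1 - i)%nat with (N - i)%nat by lia.
    rewrite !Cpow_add_r, !Cpow_mult_r; cbn [Cpow]; ring. }
  assert (Hci := Ci2).
  (* (i, 1) is a zero of I30 but not of I12 or I20. The syzygy there gives I12^5 / I20^3 = -1 /
     1728, which must therefore be a root of [Q]. *)
  assert (Z30 : I30 Ci 1 = 0%C) by (unfold I30; ring [Hci]).
  assert (N12 : I12 Ci 1 <> 0%C).
  { replace (I12 Ci 1) with (- (11) - 2 * Ci)%C by (unfold I12; ring [Hci]).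
    intros X; apply (f_equal snd) in X; cbn in X; lra. }
  assert (N20 : I20 Ci 1 <> 0%C).
  { replace (I20 Ci 1) with (- (492) + 456 * Ci)%C by (unfold I20; ring [Hci]).
    intros X; apply (f_equal snd) in X; cbn in X; lra. }
  set (r := (- / 1728)%C).
  assert (N1728 : RtoC 1728 <> 0%C) by (apply RtoC_neq_0; lra).
  assert (HQ0 : Q r 1%C = 0%C).
  { apply (Form_zero_scale N Q (I20 Ci 1 ^ 3)%C); [exact HQ|now apply Cpow_nz|].
    assert (X := E Ci 1%C); rewrite Z30 in X.
    assert (S := syzygy Ci 1%C); rewrite Z30 in S.
    replace (I20 Ci 1 ^ 3 * r)%C with (I12 Ci 1 ^ 5)%C.
    - replace (I20 Ci 1 ^ 3 * 1)%C with (I20 Ci 1 ^ 3)%C by ring.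
      apply (Cmult_eq_0 (I12 Ci 1 ^ (h mod 5) * I20 Ci 1 ^ 2)%C).
      + rewrite <- X; ring.
      + intros Y; apply C_integral in Y; destruct Y as [Y|Y]; revert Y; now apply Cpow_nz.
    - unfold r.
      transitivity ((1728 * I12 Ci 1 ^ 5 + I20 Ci 1 ^ 3) / 1728 - I20 Ci 1 ^ 3 / 1728)%C; [field; exact N1728|].
      rewrite <- S; field; exact N1728. }
  (* For N = 0 the form [Q] is constant, so its zero makes it, and with it f, vanish. *)
  destruct N as [|N].
  - exists (fun _ => 0%C). destruct HQ as [q Hq].
    apply (Form_eq_points (2 * h)); [exact Hf|apply Form_0|].
    intros n; destruct (I_nonzero_points n) as (_ & _ & N30).
    apply (Cmult_eq_0 (I30 (INC (n + 3)) 1)); [|exact N30].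
    transitivity (f (INC (n + 3)) 1%C * I30 (INC (n + 3)) 1)%C; [ring|].
    rewrite E, Hq, <- (Hq r 1%C), HQ0; ring.
  (* The linear factor X + Y / 1728 becomes I30^2 / 1728: one power of I30 cancels the one
     multiplied in, the other is the factor I30 of the basis forms for odd h. *)
  - destruct (Form_root N r Q HQ HQ0) as (R & HR & ER).
    destruct (Form_coeffs N R HR) as [e Ee].
    exists (fun i => / 1728 * e i)%C.
    apply (Form_eq_points (2 * h)); [exact Hf| |].
    { apply Form_csum; intros i Hi; apply Form_scal, Form_ico_basis; [exact HN|exact Hi]. }
    intros n; destruct (I_nonzero_points n) as (_ & _ & N30).
    set (a := INC (n + 3)) in *; set (b := RtoC 1) in *.
    assert (X := E a b); rewrite ER in X; unfold r in X.
    replace (I12 a b ^ 5 - - / 1728 * I20 a b ^ 3)%C with (/ 1728 * I30 a b ^ 2)%C in X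
      by (rewrite syzygy; field; exact N1728).
    transitivity (/ I30 a b * (f a b * I30 a b))%C; [field; exact N30|].
    rewrite X, Ee.
    transitivity (csum (S N) (fun i => / 1728 * I12 a b ^ (h mod 5) * I20 a b ^ 2 * I30 a b * (e i * (I12 a b ^ 5) ^ i * (I20 a b ^ 3) ^ (N - i)))%C).
    + rewrite csum_scal; field; auto.
    + apply csum_ext; intros i Hi; unfold ico_basis.
      replace (h mod 3)%nat with 2%nat by lia; replace (h mod 2)%nat with 1%nat by lia.
      replace (S N - 1 - i)%nat with (N - i)%nat by lia.
      rewrite !Cpow_add_r, !Cpow_mult_r; cbn [Cpow]; ring.
Qed.

(** At (0, 1), where I12 = 0 and I20 = 1, only the coefficient of index 0 is left; the remaining sum
    is divided by I12^5 at the sample points. *)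
Lemma ico_powers_independent (N : nat) : forall c : nat -> CC,
  (forall n, csum N (fun i => c i * (I12 (INC (n + 3)) 1 ^ 5) ^ i * (I20 (INC (n + 3)) 1 ^ 3) ^ (N - 1 - i))%C = 0%C) ->
  forall i, (i < N)%nat -> c i = 0%C.
Proof.
  induction N as [|N IH]; intros c H i Hi; [lia|].
  set (G := fun a b => csum (S N) (fun i => c i * (I12 a b ^ 5) ^ i * (I20 a b ^ 3) ^ (S N - 1 - i))%C).
  assert (HG : Form (60 * N) G).
  { apply Form_csum; intros j Hj.
    apply Form_ext with (fun a b => c j * ((I12 a b ^ 5) ^ j * (I20 a b ^ 3) ^ (S N - 1 - j)))%C; [intros; ring|].
    apply Form_scal, Form_deg with (j * (5 * 12) + (S N - 1 - j) * (3 * 20))%nat; [lia|].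
    apply (Form_mult _ _ (fun a b => (I12 a b ^ 5) ^ j)%C (fun a b => (I20 a b ^ 3) ^ (S N - 1 - j))%C).
    - apply (Form_pow (5 * 12) j (fun a b => I12 a b ^ 5)%C), Form_pow, Form_I12.
    - apply (Form_pow (3 * 20) _ (fun a b => I20 a b ^ 3)%C), Form_pow, Form_I20. }
  assert (Z := Form_many_roots _ G HG H).
  assert (C0 : c 0%nat = 0%C).
  { specialize (Z 0%C 1%C); unfold G in Z; rewrite csum_shift, csum_zero in Z.
    - replace (I20 0 1) with (RtoC 1) in Z by (unfold I20; ring); rewrite !Cpow_1_l in Z. rewrite <- Z; cbn; ring.
    - intros j Hj; replace (I12 0 1) with (RtoC 0) by (unfold I12; ring). cbn [Cpow]; ring. }
  destruct i as [|i]; [exact C0|].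
  apply (IH (fun i => c (S i))); [|lia].
  intros n; destruct (I_nonzero_points n) as (N12 & _).
  apply (Cmult_eq_0 (I12 (INC (n + 3)) 1 ^ 5)%C); [|now apply Cpow_nz].
  specialize (Z (INC (n + 3)) 1%C); unfold G in Z; rewrite csum_shift, C0 in Z.
  rewrite <- csum_scal; transitivity (0 * (I12 (INC (n + 3)) 1 ^ 5) ^ 0 * (I20 (INC (n + 3)) 1 ^ 3) ^ (S N - 1 - 0)
    + csum N (fun i => c (S i) * (I12 (INC (n + 3)) 1 ^ 5) ^ S i * (I20 (INC (n + 3)) 1 ^ 3) ^ (S N - 1 - S i)))%C; [|exact Z].
  transitivity (0 + csum N (fun i => c (S i) * (I12 (INC (n + 3)) 1 ^ 5) ^ S i * (I20 (INC (n + 3)) 1 ^ 3) ^ (S N - 1 - S i)))%C; [|ring].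
  rewrite Cplus_0_l; apply csum_ext; intros j Hj.
  replace (S N - 1 - S j)%nat with (N - 1 - j)%nat by lia. rewrite (Cpow_S _ j); ring.
Qed.

Lemma ico_basis_independent (h N : nat) (c : nat -> CC) :
  (forall a b, csum N (fun i => c i * ico_basis h N i a b)%C = 0%C) -> forall i, (i < N)%nat -> c i = 0%C.
Proof.
  intros H; apply (ico_powers_independent N); intros n.
  destruct (I_nonzero_points n) as (N12 & N20 & N30).
  set (x := I12 (INC (n + 3)) 1) in *; set (y := I20 (INC (n + 3)) 1) in *; set (t := I30 (INC (n + 3)) 1) in *.
  apply (Cmult_eq_0 (x ^ (h mod 5) * (y ^ (h mod 3) * t ^ (h mod 2)))%C).
  - rewrite <- csum_scal, <- (H (INC (n + 3)) 1%C); apply csum_ext; intros i Hi; unfold ico_basis; fold x y t.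
    rewrite !Cpow_add_r, !Cpow_mult_r; ring.
  - intros Y; apply C_integral in Y; destruct Y as [Y|Y]; [revert Y; now apply Cpow_nz|].
    apply C_integral in Y; destruct Y as [Y|Y]; revert Y; now apply Cpow_nz.
Qed.

Lemma csum_swap (m n : nat) (F : nat -> nat -> CC) :
  csum m (fun i => csum n (fun j => F i j)) = csum n (fun j => csum m (fun i => F i j)).
Proof.
  induction m as [|m IH]; cbn; [now rewrite csum_0|]. rewrite IH, <- csum_plus; reflexivity.
Qed.

Lemma sibling_csum (n : nat) (c : nat -> CC) (B : nat -> cfun) (j : nat) : (forall i, (i < n)%nat -> Pol (B i)) ->
  sibling (fun p => csum n (fun i => c i * B i p)%C) j = (fun p => csum n (fun i => c i * sibling (B i) j p)%C).
Proof.
  intros HB; unfold sibling.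
  rewrite (der_iter_csum twist_minus n (fun i p => c i * B i p)%C) by auto with pol.
  fext; apply csum_ext; intros i Hi. now rewrite der_iter_scal by auto with pol.
Qed.

Lemma sibling_mode (k : nat) (f : CC -> CC -> CC) (j : nat) : Form k f -> invariant f -> (j <= k)%nat ->
  is_mode in_Istar k (sibling (onform f) j).
Proof.
  intros Hf Hinv Hj.
  assert (HB : BPol k 0 (onform f)) by (now apply Form_BPol).
  assert (HS := sibling_BPol k (onform f) j HB Hj).
  assert (HP : HPol k (sibling (onform f) j)).
  { exists (fun b p => if Nat.eqb b j then sibling (onform f) j p else 0%C); split.
    - intros b Hb; destruct (Nat.eqb_spec b j) as [->|_]; [exact HS|apply BPol_0].
    - intros p; rewrite csum_single; destruct (Nat.ltb_spec j (S k)); [reflexivity|lia]. }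
  split; [now apply HPol_smooth with k|]. split.
  - intros p Hp; rewrite (HPol_lap k) by assumption.
    (* Siblings are harmonic: by the ladder relation [twist_minus] after [twist_plus] acts as - j (k
       - j + 1), the opposite of the term b (a + 1) for bidegree (k - j, j). *)
    assert (L : lapC (sibling (onform f) j) p = 0%C).
    { assert (E := BPol_lapC _ _ _ p HS); unfold onS3 in Hp; rewrite Hp in E.
      transitivity (1 * lapC (sibling (onform f) j) p)%C; [ring|rewrite E].
      destruct j as [|j].
      - rewrite (der_zero twist_minus); auto with pol.
        + rewrite Rmult_0_l; ring.
        + now apply (proj1 (BPol_twist_plus _ _ _ HS)).
      - assert (HS0 := sibling_BPol k (onform f) j HB ltac:(lia)).
        rewrite (sibling_raise k) by assumption. rewrite der_scal, <- sibling_S by eauto with pol.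
        replace (INC (k - j)) with (RtoC (INR (k - S j) + 1)).
        + unfold INC; rewrite RtoC_mult; ring.
        + unfold INC; rewrite <- S_INR; do 2 f_equal; lia. }
    rewrite L, RtoC_opp; ring.
  - intros g Hg p Hp.
    assert (HgS : in_SU2 g) by apply Hg.
    assert (HgI := in_SU2_inv2 g HgS).
    assert (Ef : (fun q => onform f (act g q)) = onform f).
    { fext; destruct g as [[[a b] c] d]; unfold onform; rewrite act_alpha, act_beta; now apply Hinv. }
    assert (E := sibling_act g (onform f) j HgS ltac:(eauto with pol)); rewrite Ef in E.
    apply (f_equal (fun F => F (act (inv2 g) p))) in E; cbv beta in E; rewrite E; f_equal.
    destruct g as [[[a b] c] d]; destruct HgS as (_ & _ & _ & Hdet); unfold inv2.
    apply R4_of_alpha_beta.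
    + rewrite act_alpha, act_alpha, act_beta.
      transitivity ((a * d - b * c) * alpha p)%C; [ring|rewrite Hdet; ring].
    + rewrite act_beta, act_alpha, act_beta.
      transitivity ((a * d - b * c) * beta p)%C; [ring|rewrite Hdet; ring].
Qed.

Lemma mode_decomposition (k : nat) (F : cfun) : is_mode in_Istar k F ->
  exists f : nat -> CC -> CC -> CC, (forall j, (j <= k)%nat -> Form k (f j) /\ invariant (f j)) /\
    forall p, onS3 p -> F p = csum (S k) (fun j => sibling (onform (f j)) j p).
Proof.
  intros (Hs & Hl & Hi); destruct (eigenfunction_siblings k F Hs Hl) as (f & Hf & Ef).
  assert (G : forall j, exists g, (j <= k)%nat -> Form k g /\ f j = onform g).
  { intros j; destruct (le_dec j k) as [Hj|Hj]; [|exists (fun _ _ => 0%C); lia].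
    destruct (BPol_Form k 0 (f j) (Hf j Hj) eq_refl) as (g & Hg & Eg).
    exists g; intros _; split; [exact Hg|]. fext; apply Eg. }
  apply choice_fun in G; destruct G as [g G].
  exists g; split.
  - intros j Hj; destruct (G j Hj) as [Hg Eg]; split; [exact Hg|].
    intros x y z w H a b.
    assert (X := components_invariant k F f (x, y, z, w) Hf Ef (proj1 H) (Hi (x, y, z, w) H) j (pt a b) Hj).
    rewrite Eg in X; unfold onform in X; rewrite act_alpha, act_beta, alpha_pt, beta_pt in X; exact X.
  - intros p Hp; rewrite Ef by exact Hp; apply csum_ext; intros j Hj.
    now rewrite <- (proj2 (G j ltac:(lia))).
Qed.

Theorem theorem10p5 (k : nat) :
  (Nat.odd k = true ->
     forall F : cfun, is_mode in_Istar k F -> forall p, onS3 p -> F p = 0%C) /\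
  (Nat.even k = true ->
     let N := Z.to_nat (ktilde k + 1) in
     (ktilde k >= -1)%Z /\
     (* each sibling of each B_i is a mode *)
     (forall i j, (i < N)%nat -> (j <= k)%nat ->
        is_mode in_Istar k (sibling (Bpoly k i) j)) /\
     (* linear independence on S^3 *)
     (forall c : nat -> nat -> CC,
        (forall p, onS3 p ->
           csum N (fun i => csum (S k) (fun j => (c i j * sibling (Bpoly k i) j p)%C)) = 0%C) ->
        forall i j, (i < N)%nat -> (j <= k)%nat -> c i j = 0%C) /\
     (* spanning *)
     (forall F : cfun, is_mode in_Istar k F ->
        exists c : nat -> nat -> CC, forall p, onS3 p ->
          F p = csum N (fun i => csum (S k) (fun j => (c i j * sibling (Bpoly k i) j p)%C)))).
Proof.
  split.
  - intros Hodd F HF p Hp.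
    destruct (mode_decomposition k F HF) as (f & Hf & Ef).
    rewrite Ef by exact Hp; apply csum_zero; intros j Hj.
    apply der_iter_zero; auto with pol. intros q; unfold onform.
    destruct (Hf j ltac:(lia)) as [Hform Hinv].
    (* -1 lies in the group and changes the sign of every form of odd degree. *)
    assert (E := Hinv _ _ _ _ Istar_N (alpha q) (beta q)).
    assert (E2 : f j (- (1) * alpha q + 0 * beta q)%C (0 * alpha q + - (1) * beta q)%C = (- f j (alpha q) (beta q))%C).
    { transitivity (f j (- (1) * alpha q)%C (- (1) * beta q)%C); [f_equal; ring|].
      rewrite (Form_homog k (f j) Hform). apply Nat.odd_spec in Hodd; destruct Hodd as [m ->].
      rewrite Cpow_add_r, Cpow_mult_r. replace ((- (1)) ^ 2)%C with (RtoC 1) by ring. rewrite Cpow_1_l; ring. }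
    rewrite E2 in E.
    apply (Cmult_eq_0 2%C); [|apply RtoC_neq_0; lra].
    transitivity (f j (alpha q) (beta q) - - f j (alpha q) (beta q))%C; [ring|rewrite E; ring].
  - intros Heven N.
    apply Nat.even_spec in Heven; destruct Heven as [h Hk].
    assert (Hh : (k / 2 = h)%nat) by (rewrite Hk, Nat.mul_comm; apply Nat.div_mul; lia).
    assert (Hkt : ktilde k = (Z.of_nat h / 2 + Z.of_nat h / 3 + Z.of_nat h / 5 - Z.of_nat h)%Z)
      by (unfold ktilde; now rewrite Hh).
    assert (Hge : (ktilde k >= -1)%Z) by (rewrite Hkt; lia).
    (* Since k~ is at least -1, the conversion of k~ + 1 to a natural number loses nothing. *)
    assert (HN : ico_count h N) by (unfold ico_count, N; rewrite Hkt in *; lia).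
    assert (HB : forall i, (i < N)%nat -> Bpoly k i = onform (ico_basis h N i)).
    { intros i Hi; fext; unfold Bpoly, onform, ico_basis; rewrite Hh.
      replace (Z.to_nat (ktilde k - Z.of_nat i)) with (N - 1 - i)%nat by (unfold N in *; lia). reflexivity. }
    assert (HF : forall i, (i < N)%nat -> Form k (ico_basis h N i)).
    { intros i Hi; apply Form_deg with (2 * h)%nat; [lia|now apply Form_ico_basis]. }
    assert (HP : forall i, (i < N)%nat -> BPol k 0 (onform (ico_basis h N i))).
    { intros i Hi; now apply Form_BPol, HF. }
    assert (HPP : forall i, (i < N)%nat -> Pol (onform (ico_basis h N i))).
    { intros i Hi; assert (X := HP i Hi); eauto with pol. }
    split; [exact Hge|]. split; [|split].
    + intros i j Hi Hj; rewrite HB by exact Hi.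
      apply sibling_mode; auto using invariant_ico_basis.
    + intros c H i j Hi Hj.
      (* Summing over i first collects, for each j, one form whose j-th sibling enters the relation;
         independence of siblings and then of the basis forms finishes. *)
      set (f := fun j p => csum N (fun i => c i j * onform (ico_basis h N i) p)%C).
      assert (Hf : forall j, (j <= k)%nat -> BPol k 0 (f j)).
      { intros j' _; apply BPol_csum; intros i' Hi'; apply BPol_scal, HP, Hi'. }
      assert (Z := siblings_independent_S3 k f Hf).
      apply (ico_basis_independent h N (fun i => c i j)); [|exact Hi].
      intros a b; transitivity (f j (pt a b)).
      * unfold f, onform; now rewrite alpha_pt, beta_pt.
      * apply Z; [|exact Hj]. intros p Hp; rewrite <- (H p Hp), csum_swap.
        apply csum_ext; intros j' Hj'; unfold f.
        rewrite (sibling_csum N (fun i => c i j') (fun i => onform (ico_basis h N i))) by exact HPP.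
        apply csum_ext; intros i' Hi'; now rewrite HB.
    + intros F HFm; destruct (mode_decomposition k F HFm) as (f & Hf & Ef).
      assert (G : forall j, exists c : nat -> CC, (j <= k)%nat ->
         onform (f j) = (fun p => csum N (fun i => c i * onform (ico_basis h N i) p)%C)).
      { intros j; destruct (le_dec j k) as [Hj|Hj]; [|exists (fun _ => 0%C); lia].
        destruct (Hf j Hj) as [Hform Hinv].
        destruct (invariant_span h N (f j) HN) as [c Ec]; [now apply Form_deg with k|exact Hinv|].
        exists c; intros _; fext; unfold onform; apply Ec. }
      apply choice_fun in G; destruct G as [c G].
      exists (fun i j => c j i); intros p Hp; rewrite csum_swap, Ef by exact Hp.
      apply csum_ext; intros j Hj; rewrite (G j) by lia.
      rewrite (sibling_csum N (c j) (fun i => onform (ico_basis h N i))) by exact HPP.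
      apply csum_ext; intros i Hi; now rewrite HB.
Qed.
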